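(* Let $\mathcal{Q}_c^{n+1}$ be a space form of constant sectional curvature $c$, and let $x:M^n\to\mathcal{Q}_c^{n+1}$ be a complete, noncompact, orientable, properly immersed hypersurface (isometric immersion). Assume that there is a nonnegative constant $\alpha$ such that $$(r+1)|S_{r+1}|\le (n-r)\,\alpha\, S_r \quad\text{on } M$$ for some integer $r$ with $0\le r\le n-1$. If $P_r$ is positive semi-definite (at every point of $M$), then for any $q\in M$ with $S_r(q)\ne 0$ and any $\mu_0>0$ there exists a positive constant $C$, depending on $\mu_0$, $q$ and $M$, such that $$\int_{\overline{B}_\mu(q)\cap M} S_r\,dM\ \ge\ \int_{\mu_0}^{\mu} C\, e^{-\alpha\tau}\,d\tau$$ for every $\mu>\mu_0$; in the case $c>0$, writing $c=\kappa^2$ with $\kappa>0$, this is asserted only for $\mu\le \frac{\pi}{2\kappa}$.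
   Context: A space form $\mathcal{Q}_c^{n+1}$ is a complete, simply connected Riemannian manifold of dimension $n+1$ with constant sectional curvature $c$. Fix a unit normal field $\eta$ along the immersion, let $A$ be the corresponding shape operator ($A(X)=-\overline{\nabla}_X\eta$, where $\overline\nabla$ is the ambient Levi-Civita connection), with eigenvalues (principal curvatures) $\lambda_1,\dots,\lambda_n$. Define $S_0=1$, $S_r=\sum_{i_1<\dots<i_r}\lambda_{i_1}\cdots\lambda_{i_r}$ for $1\le r\le n$, and $S_r=0$ for $r\ge n+1$. The Newton transformations $P_r:T_pM\to T_pM$ are defined inductively by $P_0=I$, $P_r=S_rI-A\circ P_{r-1}$ for $r\ge1$. $dM$ is the Riemannian volume element of $M$. $\overline{B}_\mu(q)$ is the closed geodesic ball of $\mathcal{Q}_c^{n+1}$ of radius $\mu$ centered at (the image $x(q)$ of) $q$, and $\overline{B}_\mu(q)\cap M$ means $x^{-1}(\overline{B}_\mu(q))\subset M$. *)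

(* Defs.v *)
From HB Require Import structures.
From mathcomp Require Export all_boot all_order all_algebra.
From mathcomp Require Export all_classical all_reals all_analysis.

Set Implicit Arguments.
Unset Strict Implicit.
Unset Printing Implicit Defensive.

Import Order.TTheory GRing.Theory Num.Theory.
Export numFieldNormedType.Exports.

Global Open Scope classical_set_scope.
Global Open Scope ring_scope.

(* Vectors are rows throughout: the matrix of a linear map acts on the right,
   so the matrix of a composite [A \o P] is [P *m A], and ['J f u] has as
   [i]-th row the partial derivative of [f] in the direction [ebase i]. *)

Section Calculus.
Variable R : realType.

Definition ebase m (i : 'I_m) : 'rV[R]_m := delta_mx 0 i.

Fixpoint Ck m (V : normedModType R) (k : nat) (U : set 'rV[R]_m)
    (f : 'rV[R]_m -> V) : Prop :=
  (forall u, U u -> {for u, continuous f}) /\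
  match k with
  | 0 => True
  | k'.+1 => forall i : 'I_m,
      (forall u, U u -> derivable f u (ebase i)) /\
      Ck k' U (fun u => 'D_(ebase i) f u)
  end.

(* Meaningful for open [U]. *)
Definition smooth_on m (V : normedModType R) (U : set 'rV[R]_m)
    (f : 'rV[R]_m -> V) : Prop := forall k, Ck k U f.

(* Iterated integral over R^m with respect to the Lebesgue measure of R; on
   nonnegative Borel functions it is the m-dimensional Lebesgue integral, by
   Tonelli. *)
Fixpoint iint (m : nat) : ('rV[R]_m -> \bar R) -> \bar R :=
  match m with
  | 0 => fun f => f 0
  | m'.+1 => fun f =>
      (\int[@lebesgue_measure R]_t
         iint (fun v : 'rV[R]_m' => f (row_mx (t%:M : 'M[R]_1) v)))%E
  end.

End Calculus.

Section Manifolds.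
Variable R : realType.

Record chart (T : topologicalType) (m : nat) := Chart {
  cdom : set T;
  ccod : set 'rV[R]_m;
  cmap : T -> 'rV[R]_m;
  cinv : 'rV[R]_m -> T;
  cdom_open : open cdom;
  ccod_open : open ccod;
  cmap_ccod : forall p, cdom p -> ccod (cmap p);
  cinv_cdom : forall u, ccod u -> cdom (cinv u);
  cmapK : forall p, cdom p -> cinv (cmap p) = p;
  cinvK : forall u, ccod u -> cmap (cinv u) = u;
  cmap_continuous : forall p, cdom p -> {for p, continuous cmap};
  cinv_continuous : forall u, ccod u -> {for u, continuous cinv}
}.

(* Coordinate expression of a map, and the open set on which it is defined. *)
Definition local (S T : topologicalType) m k (f : S -> T) (c : chart S m) (d : chart T k) :
  'rV[R]_m -> 'rV[R]_k := fun u => cmap d (f (cinv c u)).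

Definition local_dom (S T : topologicalType) m k (f : S -> T) (c : chart S m) (d : chart T k) :
  set 'rV[R]_m := [set u | ccod c u /\ cdom d (f (cinv c u))].

Definition smooth_transition (T : topologicalType) m (c d : chart T m) : Prop :=
  smooth_on (local_dom id c d) (local id c d).

(* Manifolds are not required to be connected. *)
Record manifold (m : nat) := Manifold {
  carrier :> ptopologicalType;
  atlas : set (chart carrier m);
  manifold_hausdorff : hausdorff_space carrier;
  manifold_second_countable : @second_countable carrier;
  atlas_cover : forall p, exists2 c, atlas c & cdom c p;
  atlas_smooth : forall c d, atlas c -> atlas d -> smooth_transition c d
}.

Definition orientable m (M : manifold m) : Prop :=
  exists O : set (chart M m),
  [/\ forall p, exists2 c, O c & cdom c p,
      forall c d, O c -> @atlas m M d ->
        smooth_transition c d /\ smooth_transition d c &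
      forall c d u, O c -> O d -> local_dom id c d u ->
        0 < \det ('J (local id c d) u)].

Definition smooth_map m k (M : manifold m) (N : manifold k) (f : M -> N) :=
  continuous f /\
  forall c d, @atlas m M c -> @atlas k N d ->
    smooth_on (local_dom f c d) (local f c d).

Definition proper_map (S T : topologicalType) (f : S -> T) : Prop :=
  forall K : set T, compact K -> compact (f @^-1` K).

Definition path_connected (T : topologicalType) : Prop :=
  forall p q : T, exists g : R -> T,
    [/\ {within `[0, 1], continuous g}, g 0 = p & g 1 = q].

Definition simply_connected (T : topologicalType) : Prop :=
  path_connected T /\
  forall g : R -> T, {within `[0, 1], continuous g} -> g 0 = g 1 ->
    exists H : R * R -> T,
      {within `[0, 1] `*` `[0, 1], continuous H} /\
      forall t, 0 <= t <= 1 ->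
        [/\ H (0, t) = g t, H (1, t) = g 0, H (t, 0) = g 0 & H (t, 1) = g 0].

End Manifolds.

Section MetricCoordinates.
Variables (R : realType) (m : nat).
(* Gram matrix of a Riemannian metric in a coordinate domain. *)
Variable g : 'rV[R]_m -> 'M[R]_m.

Definition inner (u v w : 'rV[R]_m) : R := (v *m g u *m w^T) 0 0.

(* [christoffel k i j] is Gamma^k_ij of the Levi-Civita connection. *)
Definition christoffel (k i j : 'I_m) (u : 'rV[R]_m) : R :=
  2^-1 * \sum_l invmx (g u) k l *
    ('D_(ebase R i) (fun w => g w j l) u + 'D_(ebase R j) (fun w => g w i l) u
     - 'D_(ebase R l) (fun w => g w i j) u).

(* [riemann l i j k] is the l-th component of R(e_i, e_j) e_k, where
   R(X, Y) Z = D_X D_Y Z - D_Y D_X Z - D_[X, Y] Z. *)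
Definition riemann (l i j k : 'I_m) (u : 'rV[R]_m) : R :=
  'D_(ebase R i) (christoffel l j k) u - 'D_(ebase R j) (christoffel l i k) u
  + \sum_s (christoffel l i s u * christoffel s j k u
            - christoffel l j s u * christoffel s i k u).

Definition curvature (u v w z : 'rV[R]_m) : 'rV[R]_m :=
  \row_l \sum_i \sum_j \sum_k v 0 i * w 0 j * z 0 k * riemann l i j k u.

Definition sectional (u v w : 'rV[R]_m) : R :=
  inner u (curvature u v w w) v
  / (inner u v v * inner u w w - inner u v w ^+ 2).

End MetricCoordinates.

Notation borel N := (g_sigma_algebraType (@open N)).

Section Riemannian.
Variable R : realType.

Record riemannian (m : nat) := Riemannian {
  rmanifold :> manifold R m;
  metric : chart R rmanifold m -> 'rV[R]_m -> 'M[R]_m;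
  metric_smooth : forall c, @atlas R m rmanifold c ->
    smooth_on (ccod c) (metric c);
  metric_sym : forall c u, @atlas R m rmanifold c -> ccod c u ->
    (metric c u)^T = metric c u;
  metric_pos : forall c u v, @atlas R m rmanifold c -> ccod c u -> v != 0 ->
    0 < inner (metric c) u v v;
  metric_change : forall c d u,
    @atlas R m rmanifold c -> @atlas R m rmanifold d -> local_dom id c d u ->
    metric c u = 'J (local id c d) u *m metric d (local id c d u)
                 *m ('J (local id c d) u)^T
}.

Section OneManifold.
Variables (m : nat) (N : riemannian m).

(* A C^1 arc, parametrized by [0, 1], inside the domain of a chart. *)
Definition arc (c : chart R N m) (g : R -> 'rV[R]_m) : Prop :=
  [/\ @atlas R m N c,
      forall t, 0 <= t <= 1 -> ccod c (g t),
      forall t, derivable g t 1 &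
      continuous (g^`()%classic : R -> 'rV[R]_m)].

Definition arc_length (c : chart R N m) (g : R -> 'rV[R]_m) : \bar R :=
  (\int[@lebesgue_measure R]_(t in `[0%R, 1%R])
     (Num.sqrt (inner (metric c) (g t) (g^`()%classic t) (g^`()%classic t)))%:E)%E.

(* [curve p q l]: a piecewise C^1 curve of length [l] joins [p] to [q]. *)
Inductive curve : N -> N -> \bar R -> Prop :=
| curve_nil p : curve p p 0%E
| curve_cons c g q l : arc c g -> curve (cinv c (g 1)) q l ->
    curve (cinv c (g 0)) q (arc_length c g + l)%E.

Definition rdist (p q : N) : \bar R := ereal_inf [set l | curve p q l].

Definition geodesic_ball (p : N) (mu : R) : set N :=
  [set q | (rdist p q <= mu%:E)%E].

Definition complete_riemannian : Prop :=
  forall a : nat -> N,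
    (forall e : R, 0 < e -> exists K, forall i j, (K <= i)%N -> (K <= j)%N ->
       (rdist (a i) (a j) < e%:E)%E) ->
    exists p : N, a @ \oo --> p.

Definition constant_curvature (k : R) : Prop :=
  forall (c : chart R N m) u v w, @atlas R m N c -> ccod c u ->
    row_free (col_mx v w) -> sectional (metric c) u v w = k.

Definition space_form (k : R) : Prop :=
  [/\ complete_riemannian, simply_connected R N & constant_curvature k].

End OneManifold.

Definition riemannian_volume m (N : riemannian m)
    (vol : set N -> \bar R) : Prop :=
  forall (c : chart R N m) (E : set 'rV[R]_m), @atlas R m N c ->
    <<s @open 'rV[R]_m >> E -> E `<=` ccod c ->
    vol (cinv c @` E) =
    iint (fun u => (\1_E u * Num.sqrt (\det (metric c u)))%:E).

End Riemannian.

Section Hypersurfaces.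
Variables (R : realType) (n : nat).
Variables (M : riemannian R n) (Q : riemannian R n.+1) (x : M -> Q).

Definition isometric_immersion : Prop :=
  smooth_map x /\
  forall c d u, @atlas R n M c -> @atlas R n.+1 Q d -> local_dom x c d u ->
    row_free ('J (local x c d) u) /\
    metric c u = 'J (local x c d) u *m metric d (local x c d u)
                 *m ('J (local x c d) u)^T.

(* A vector field along [x] is given by its components in each chart of [Q]. *)
Variable eta : chart R Q n.+1 -> M -> 'rV[R]_n.+1.

Record unit_normal : Prop := UnitNormal {
  normal_change : forall d e p, @atlas R n.+1 Q d -> @atlas R n.+1 Q e ->
    cdom d (x p) -> cdom e (x p) ->
    eta e p = eta d p *m 'J (local id d e) (cmap d (x p));
  normal_smooth : forall c d, @atlas R n M c -> @atlas R n.+1 Q d ->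
    smooth_on (local_dom x c d) (fun u => eta d (cinv c u));
  normal_orth : forall c d u (v : 'rV[R]_n), @atlas R n M c ->
    @atlas R n.+1 Q d -> local_dom x c d u ->
    inner (metric d) (local x c d u) (v *m 'J (local x c d) u)
      (eta d (cinv c u)) = 0;
  normal_unit : forall d p, @atlas R n.+1 Q d -> cdom d (x p) ->
    inner (metric d) (cmap d (x p)) (eta d p) (eta d p) = 1
}.

(* Row [i] holds the components, in the chart [d] of [Q], of the ambient
   covariant derivative of [eta] along the [i]-th coordinate vector field of
   the chart [c] of [M]. *)
Definition covariant_eta (c : chart R M n) (d : chart R Q n.+1)
    (u : 'rV[R]_n) : 'M[R]_(n, n.+1) :=
  \matrix_(i, a)
    ('D_(ebase R i) (fun w => eta d (cinv c w) 0 a) u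
     + \sum_b \sum_k christoffel (metric d) a b k (local x c d u)
         * 'J (local x c d) u i b * eta d (cinv c u) 0 k).

(* [A c u] is the matrix of the shape operator in the coordinates of [c]. *)
Definition shape_operator (A : chart R M n -> 'rV[R]_n -> 'M[R]_n) : Prop :=
  forall c d u, @atlas R n M c -> @atlas R n.+1 Q d -> local_dom x c d u ->
    A c u *m 'J (local x c d) u = - covariant_eta c d u.

End Hypersurfaces.

Section NewtonTransformations.
Variables (R : realType) (n : nat) (M : riemannian R n).
Variable A : chart R M n -> 'rV[R]_n -> 'M[R]_n.

(* Eigenvalues of [A], listed with multiplicity. *)
Definition principal_curvatures (lam : M -> 'I_n -> R) : Prop :=
  forall c u, @atlas R n M c -> ccod c u ->
    char_poly (A c u) = \prod_i ('X - (lam (cinv c u) i)%:P).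

Variable lam : M -> 'I_n -> R.

Definition Scurv (r : nat) (p : M) : R :=
  \sum_(I : {set 'I_n} | #|I| == r) \prod_(i in I) lam p i.

Fixpoint newton (r : nat) (c : chart R M n) (u : 'rV[R]_n) : 'M[R]_n :=
  match r with
  | 0 => 1%:M
  | r'.+1 => (Scurv r'.+1 (cinv c u))%:M - newton r' c u *m A c u
  end.

Definition newton_psd (r : nat) : Prop :=
  forall c u (v : 'rV[R]_n), @atlas R n M c -> ccod c u ->
    0 <= inner (metric c) u (v *m newton r c u) v.

End NewtonTransformations.

(* Main.v *)
(* If alpha > 0, or if c > 0, the right-hand side stays bounded, so it suffices that
   S_r >= 0 has positive integral near q. In the remaining case alpha = 0 and
   c <= 0, the hypothesis says that S_(r+1) = 0. By simple connectedness the ambient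
   space carries a function h with Hess h = - c h g, h(x(q)) = 0 and
   |grad h|^2 + c h^2 = 1. By the Codazzi equation P_r is divergence free, hence
   div (P_r grad (h o x)) = - c (h o x) (n-r) S_r + nu (r+1) S_(r+1)
   = - c (h o x) (n-r) S_r on M. With k = - c, the field
   Y = h / sqrt ((1 + h^2) (1 + k h^2)) P_r grad h therefore has nonnegative
   divergence e, positive at q when grad h is chosen well at x(q), and
   |Y| <= tr P_r = (n-r) S_r. Integrating div Y against a cutoff function of the
   distance to x(q), of slope 2 / (mu - mu0), gives
   0 < int_(B_mu0) e <= C (mu - mu0)^-1 int_(B_mu) S_r.
   The cutoff function is only Lipschitz, so the integration by parts is carried out
   with difference quotients and the translation invariance of Lebesgue measure. *)

(* The distance to x(q) is not smooth at its centre, whereas h is smooth everywhere. It solves an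
   overdetermined linear system for the pair (h, grad h) whose integrability condition is constant
   curvature; local solutions are continued by monodromy. The gradient at x(q) is dx(v) with v a
   unit vector such that <P_r v, v> > 0. Such a v exists because tr P_r = (n - r) S_r does not
   vanish at q, and this choice makes |grad h|^2 + c h^2 equal to 1. The weight h / sqrt ((1 + h^2)
   (1 + k h^2)) serves two ends: its square times 1 + k h^2 is h^2 / (1 + h^2) <= 1, so Y stays
   below tr P_r however fast h grows; and where its derivative is negative, the loss is absorbed by
   the term k h^2 tr P_r, since <P_r grad h, grad h> <= (1 + k h^2) tr P_r. The volume measure is
   known only on chart images, so the divergence theorem is proved for fields cut down by bump
   functions; finitely many suffice, because the cutoff has compact support by Hopf-Rinow in the
   ambient space and properness of x. *)
From HB Require Import structures.
From mathcomp Require Import perm ring lra zify.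
From mathcomp Require Import measurable_realfun.
Require Import Defs.
Import Order.TTheory GRing.Theory Num.Theory.
Set Implicit Arguments.
Unset Strict Implicit.
Unset Printing Implicit Defensive.
Set Bullet Behavior "Strict Subproofs".

(* A lock: matching on this opaque value keeps conversion from unfolding limits. *)
Fact seal : unit. Proof. exact: tt. Qed.

(** * Differential calculus in coordinates *)

Section Partials.
Variable R : realType.
Implicit Types (m n p q : nat).

Definition pd m : 'I_m -> ('rV[R]_m -> R) -> 'rV[R]_m -> R :=
  let: tt := seal in fun i f u => 'D_(ebase R i) f u.

Lemma pd_fun m (i : 'I_m) f : pd i f = 'D_(ebase R i) f.
Proof. by rewrite /pd; case: seal. Qed.

Lemma pdE m (i : 'I_m) f u : pd i f u = 'D_(ebase R i) f u.
Proof. by rewrite pd_fun. Qed.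

Definition pdm m p q : 'I_m -> ('rV[R]_m -> 'M[R]_(p, q)) -> 'rV[R]_m -> 'M[R]_(p, q) :=
  let: tt := seal in fun i F u => \matrix_(k, l) pd i (fun v => F v k l) u.

Lemma pdmE m p q i (F : 'rV[R]_m -> 'M[R]_(p, q)) u k l :
  pdm i F u k l = pd i (fun v => F v k l) u.
Proof. by rewrite /pdm; case: seal; rewrite mxE. Qed.

(** Regularity is asked of each entry, so that only real-valued functions are ever differentiated;
    [Ck_entry] passes from the matrix-valued notion to this one. *)
Definition Ckm m p q (k : nat) (U : set 'rV[R]_m)
    (F : 'rV[R]_m -> 'M[R]_(p, q)) : Prop :=
  forall i j, Ck k U (fun u => F u i j : R).

Lemma CkS m (V : normedModType R) k U (f : 'rV[R]_m -> V) :
  Ck k.+1 U f -> Ck k U f.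
Proof.
elim: k f => [|k IH] f [cf df]; first by split.
split=> // i; have [dfi cdf] := df i; split=> //; exact: IH.
Qed.

Lemma Ck_le m (V : normedModType R) k l U (f : 'rV[R]_m -> V) :
  (l <= k)%N -> Ck k U f -> Ck l U f.
Proof.
move=> /subnK <-; elim: (k - l)%N => // j IH; rewrite addSn => /CkS; exact: IH.
Qed.

Lemma Ck_cont m (V : normedModType R) k U (f : 'rV[R]_m -> V) u :
  Ck k U f -> U u -> {for u, continuous f}.
Proof. by case: k => [|k] [cf _] Uu; exact: cf. Qed.

Lemma Ck_sub m (V : normedModType R) k (U W : set 'rV[R]_m) (f : 'rV[R]_m -> V) :
  W `<=` U -> Ck k U f -> Ck k W f.
Proof.
move=> WU; elim: k f => [|k IH] f [cf df]; split; try by move=> u /WU /cf.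
  by [].
move=> i; have [dfi cdf] := df i; split; first by move=> u /WU /dfi.
exact: IH.
Qed.

Lemma open_near (T : topologicalType) (U : set T) u : open U -> U u -> \forall x \near u, U x.
Proof. by move=> oU Uu; exact: open_nbhs_nbhs. Qed.

Lemma near_cont (T S : topologicalType) (f g : T -> S) u :
  (\forall x \near u, f x = g x) -> {for u, continuous f} -> {for u, continuous g}.
Proof.
move=> fg cf; have e : f u = g u by exact: (nbhs_singleton fg).
by rewrite /prop_for /continuous_at -e; apply: cvg_trans cf; apply: near_eq_cvg.
Qed.

Lemma Ck_eq m (V : normedModType R) k (U : set 'rV[R]_m) (f g : 'rV[R]_m -> V) :
  open U -> (forall u, U u -> f u = g u) -> Ck k U f -> Ck k U g.
Proof.
move=> oU; have nr (f1 g1 : 'rV[R]_m -> V) u : (forall u, U u -> f1 u = g1 u) -> U u ->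
    \forall x \near u, f1 x = g1 x.
  by move=> fg /(open_near oU); apply: filterS => x /fg.
elim: k f g => [|k IH] f g fg [cf df]; split=> //.
- by move=> u Uu; apply: near_cont (cf u Uu); exact: nr.
- by move=> u Uu; apply: near_cont (cf u Uu); exact: nr.
- move=> i; have [dfi cdf] := df i; split.
    by move=> u Uu; apply: near_eq_derivable (dfi u Uu); exact: nr.
  apply: IH cdf => u Uu; apply: near_eq_derive; exact: nr.
Qed.

Lemma Ck_local m (V : normedModType R) k (U : set 'rV[R]_m) (f : 'rV[R]_m -> V) :
  (forall u, U u -> exists W, [/\ open W, W u & Ck k W f]) -> Ck k U f.
Proof.
elim: k f => [|k IH] f H; split=> //; try by move=> u /H[W [_ Wu /Ck_cont]]; exact.
move=> i; split; first by move=> u /H[W [_ Wu [_ /(_ i)[+ _]]]]; exact.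
by apply: IH => u /H[W [oW Wu [_ /(_ i)[_ ?]]]]; exists W.
Qed.

Lemma Ck_entry m p q k (U : set 'rV[R]_m) (F : 'rV[R]_m -> 'M[R]_(p, q)) :
  open U -> Ck k U F -> Ckm k U F.
Proof.
move=> oU; elim: k F => [|k IH] F [cF dF] i j.
  split=> // u /cF cu.
  exact: (@continuous_comp _ _ _ F (fun A : 'M[R]_(p, q) => A i j) u cu (@coord_continuous R p q i j _)).
split; first move=> u /cF cu.
  exact: (@continuous_comp _ _ _ F (fun A : 'M[R]_(p, q) => A i j) u cu (@coord_continuous R p q i j _)).
move=> a; have [dFa cdF] := dF a; split.
  by move=> u /dFa /derivable_mxP; exact.
apply: Ck_eq (IH _ cdF i j) => // u Uu; rewrite derive_mx ?mxE//; exact: dFa.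
Qed.

Lemma Ck_cst m k (U : set 'rV[R]_m) (a : R) : Ck k U (fun _ : 'rV[R]_m => a).
Proof.
elim: k U a => [|k IH] U a; split=> //; try by move=> u _; exact: cst_continuous.
move=> i; split; first by move=> u _; exact: derivable_cst.
rewrite [X in Ck _ _ X](_ : _ = (fun=> 0)) //; by apply/funext => u; rewrite derive_cst.
Qed.

Lemma Ck_coord m k (U : set 'rV[R]_m) (j : 'I_m) : Ck k U (fun u : 'rV[R]_m => u 0 j : R).
Proof.
have dc (i : 'I_m) (u : 'rV[R]_m) : is_derive u (ebase R i) (fun u : 'rV[R]_m => u 0 j : R) ((ebase R i) 0 j).
  have /diff_derivable d := @differentiable_coord R 1 m u 0 j.
  apply: DeriveDef; first exact: d.
  have /matrixP /(_ 0 j) := @derive_mx R _ 1 m id u (ebase R i) (@derivable_id _ _ u (ebase R i)).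
  by rewrite derive_id [X in _ = X -> _]mxE => <-.
case: k => [|k]; split=> //; try by move=> u _; exact: coord_continuous.
move=> i; split; first by move=> u _; case: (dc i u).
rewrite [X in Ck _ _ X](_ : _ = (fun=> (ebase R i) 0 j)); last by apply/funext => u; rewrite derive_val.
exact: Ck_cst.
Qed.

Section OnOpen.
Variables (m : nat) (U : set 'rV[R]_m).
Hypothesis oU : open U.
Implicit Types f g : 'rV[R]_m -> R.

Lemma CkD k f g : Ck k U f -> Ck k U g -> Ck k U (fun u => f u + g u).
Proof.
elim: k f g => [|k IH] f g [cf df] [cg dg]; split=> //.
- by move=> u Uu; exact: cvgD (cf u Uu) (cg u Uu).
- by move=> u Uu; exact: cvgD (cf u Uu) (cg u Uu).
- move=> i; have [dfi cdf] := df i; have [dgi cdg] := dg i; split.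
    by move=> u Uu; exact: derivableD (dfi u Uu) (dgi u Uu).
  apply: Ck_eq (IH _ _ cdf cdg) => // u Uu.
  exact: (esym (deriveD (dfi u Uu) (dgi u Uu))).
Qed.

Lemma CkM k f g : Ck k U f -> Ck k U g -> Ck k U (fun u => f u * g u).
Proof.
elim: k f g => [|k IH] f g cfk cgk.
  by split=> // u Uu; exact: cvgM (Ck_cont cfk Uu) (Ck_cont cgk Uu).
have [[cf df] [cg dg]] := (cfk, cgk); split; first by move=> u Uu; exact: cvgM (cf u Uu) (cg u Uu).
move=> i; have [dfi cdf] := df i; have [dgi cdg] := dg i; split.
  by move=> u Uu; exact: derivableM (dfi u Uu) (dgi u Uu).
apply: Ck_eq (CkD (IH _ _ (CkS cfk) cdg) (IH _ _ (CkS cgk) cdf)) => // u Uu.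
by rewrite -[RHS](_ : 'D_(ebase R i) (f * g) u = _)// (deriveM (dfi u Uu) (dgi u Uu)).
Qed.

Lemma CkN k f : Ck k U f -> Ck k U (fun u => - f u).
Proof.
move=> cf; apply: Ck_eq (CkM (Ck_cst k U (-1)) cf) => // u _; by rewrite mulN1r.
Qed.

Lemma CkB k f g : Ck k U f -> Ck k U g -> Ck k U (fun u => f u - g u).
Proof. by move=> cf cg; apply: CkD => //; exact: CkN. Qed.

Lemma Ck_sum k (I : Type) (r : seq I) (P : pred I) (f : I -> 'rV[R]_m -> R) :
  (forall i, P i -> Ck k U (f i)) -> Ck k U (fun u => \sum_(i <- r | P i) f i u).
Proof.
move=> cf; elim: r => [|x r IH].
  apply: Ck_eq (Ck_cst k U 0) => // u _; by rewrite big_nil.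
have [Px|nPx] := boolP (P x).
  by apply: Ck_eq (CkD (cf _ Px) IH) => // u _; rewrite big_cons Px.
by apply: Ck_eq IH => // u _; rewrite big_cons (negbTE nPx).
Qed.

Lemma Ck_prod k (I : Type) (r : seq I) (P : pred I) (f : I -> 'rV[R]_m -> R) :
  (forall i, P i -> Ck k U (f i)) -> Ck k U (fun u => \prod_(i <- r | P i) f i u).
Proof.
move=> cf; elim: r => [|x r IH].
  apply: Ck_eq (Ck_cst k U 1) => // u _; by rewrite big_nil.
have [Px|nPx] := boolP (P x).
  by apply: Ck_eq (CkM (cf _ Px) IH) => // u _; rewrite big_cons Px.
by apply: Ck_eq IH => // u _; rewrite big_cons (negbTE nPx).
Qed.

Lemma CkV k f : (forall u, U u -> f u != 0) -> Ck k U f -> Ck k U (fun u => (f u)^-1).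
Proof.
move=> f0; elim: k => [|k IH] cfk.
  by split=> // u Uu; exact: cvgV (f0 u Uu) (Ck_cont cfk Uu).
have [cf df] := cfk; have IHk := IH (CkS cfk).
split; first by move=> u Uu; exact: cvgV (f0 u Uu) (cf u Uu).
move=> i; have [dfi cdf] := df i; split.
  by move=> u Uu; exact: derivableV (f0 u Uu) (dfi u Uu).
apply: Ck_eq (CkN (CkM (CkM IHk IHk) cdf)) => // u Uu.
rewrite (deriveV (f0 u Uu) (dfi u Uu)).
by rewrite -exprVn expr2 /GRing.scale /= mulNr.
Qed.

Lemma Ck1P k f i u : Ck k.+1 U f -> U u -> derivable f u (ebase R i).
Proof. by move=> [_ /(_ i)[+ _]] Uu; exact. Qed.

Lemma Ck_pd k f i : Ck k.+1 U f -> Ck k U (pd i f).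
Proof. by move=> [_ /(_ i)[_]]; rewrite pd_fun. Qed.

Lemma pdD k f g i u : Ck k.+1 U f -> Ck k.+1 U g -> U u ->
  pd i (fun v => f v + g v) u = pd i f u + pd i g u.
Proof. by move=> cf cg Uu; rewrite !pdE; exact: deriveD (Ck1P (i:=i) cf Uu) (Ck1P (i:=i) cg Uu). Qed.

Lemma pdM k f g i u : Ck k.+1 U f -> Ck k.+1 U g -> U u ->
  pd i (fun v => f v * g v) u = pd i f u * g u + f u * pd i g u.
Proof.
move=> cf cg Uu; rewrite !pdE -[LHS](_ : 'D_(ebase R i) (f * g) u = _)//.
rewrite (deriveM (Ck1P (i:=i) cf Uu) (Ck1P (i:=i) cg Uu)).
by rewrite addrC /GRing.scale /= mulrC.
Qed.

Lemma pd_cst (a : R) (i : 'I_m) u : pd i (fun _ => a) u = 0.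
Proof. by rewrite pdE; exact: derive_cst. Qed.

Lemma pdN k f i u : Ck k.+1 U f -> U u -> pd i (fun v => - f v) u = - pd i f u.
Proof. by move=> cf Uu; rewrite !pdE; exact: deriveN (Ck1P (i:=i) cf Uu). Qed.

Lemma pdB k f g i u : Ck k.+1 U f -> Ck k.+1 U g -> U u ->
  pd i (fun v => f v - g v) u = pd i f u - pd i g u.
Proof. by move=> cf cg Uu; rewrite (pdD _ cf (CkN cg)) // (pdN _ cg). Qed.

Lemma pdV k f i u : (forall v, U v -> f v != 0) -> Ck k.+1 U f -> U u ->
  pd i (fun v => (f v)^-1) u = - pd i f u / (f u) ^+ 2.
Proof.
move=> f0 cf Uu; rewrite !pdE (deriveV (f0 u Uu) (Ck1P (i:=i) cf Uu)).
by rewrite /GRing.scale /= mulNr mulNr mulrC.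
Qed.

Lemma pd_sum k (I : Type) (r : seq I) (P : pred I) (f : I -> 'rV[R]_m -> R) i u :
  (forall i, P i -> Ck k.+1 U (f i)) -> U u ->
  pd i (fun v => \sum_(a <- r | P a) f a v) u = \sum_(a <- r | P a) pd i (f a) u.
Proof.
move=> cf Uu; elim: r => [|x r IH].
  rewrite big_nil (_ : (fun v => _) = fun=> 0) ?pd_cst //; by apply/funext => v; rewrite big_nil.
rewrite big_cons; case: ifP => Px.
  rewrite -IH -(pdD _ (cf _ Px) (Ck_sum r cf) Uu); congr (pd _ _ _).
  by apply/funext => v; rewrite big_cons Px.
by rewrite -IH; congr (pd _ _ _); apply/funext => v; rewrite big_cons Px.
Qed.

Lemma pd_eq f g i u : (forall v, U v -> f v = g v) -> U u -> pd i f u = pd i g u.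
Proof. by move=> fg Uu; rewrite !pdE; apply: near_eq_derive; apply: filterS (open_near oU Uu) => v /fg. Qed.

End OnOpen.

Lemma pd_coord m (i j : 'I_m) (u : 'rV[R]_m) : pd i (fun v : 'rV[R]_m => v 0 j : R) u = (i == j)%:R.
Proof.
have /matrixP /(_ 0 j) := @derive_mx R _ 1 m id u (ebase R i) (@derivable_id _ _ u (ebase R i)).
by rewrite pdE derive_id [X in X = _ -> _]mxE [X in _ = X -> _]mxE eqxx /= eq_sym => <-.
Qed.

End Partials.

Section MatrixContinuity.
Variable R : realType.

Lemma mx_entry_le p q (A : 'M[R]_(p, q)) i j : `|A i j| <= `|A|.
Proof. by rewrite [leRHS]/Num.Def.normr /= mx_normrE (le_bigmax _ (fun ij => `|A ij.1 ij.2|) (i, j)). Qed.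

Lemma mx_norm_le p q (A : 'M[R]_(p, q)) e : 0 <= e -> (forall i j, `|A i j| <= e) -> `|A| <= e.
Proof. by move=> e0 H; rewrite [leLHS]/Num.Def.normr /= mx_normrE bigmax_le. Qed.

Lemma mx_norm_lt p q (A : 'M[R]_(p, q)) e : 0 < e -> (forall i j, `|A i j| < e) -> `|A| < e.
Proof. by move=> e0 H; rewrite [ltLHS]/Num.Def.normr /= mx_normrE bigmax_lt. Qed.

Lemma mx_cont (T : topologicalType) p q (F : T -> 'M[R]_(p, q)) u :
  (forall i j, {for u, continuous (fun v => F v i j)}) -> {for u, continuous F}.
Proof.
move=> H; apply/cvgrPdist_le => /= e e0; near=> x.
apply: mx_norm_le (ltW e0) _ => i j; rewrite !mxE.
move: i j; near: x; apply: filter_forall => i; apply: filter_forall => j.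
exact: (cvgrPdist_le _ _).1 (H i j) e e0.
Unshelve. all: by end_near. Qed.

Lemma Ckm_cont m p q k U (F : 'rV[R]_m -> 'M[R]_(p, q)) u :
  Ckm k U F -> U u -> {for u, continuous F}.
Proof. by move=> cF Uu; apply: mx_cont => i j; exact: (Ck_cont (cF i j)). Qed.

Lemma is_derive_line m (f : 'rV[R]_m -> R) x v (t : R) :
  derivable f (x + t *: v) v ->
  is_derive t 1 (fun s : R => f (x + s *: v)) ('D_v f (x + t *: v)).
Proof.
have e : (fun h : R => h^-1 *: (((fun s : R => f (x + s *: v)) \o shift t) (h *: 1) - f (x + t *: v)))
  = (fun h => h^-1 *: ((f \o shift (x + t *: v)) (h *: v) - f (x + t *: v))).
  apply/funext => h; rewrite /= scaler1 scalerDl; congr (_ *: (f _ - _)).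
  by rewrite addrCA.
by move=> d; split; rewrite /derivable /derive e.
Qed.

Lemma MVT_line m (f : 'rV[R]_m -> R) x v (a : R) :
  (forall s : R, `|s| <= `|a| -> derivable f (x + s *: v) v) ->
  exists2 s, `|s| <= `|a| & f (x + a *: v) - f x = a * 'D_v f (x + s *: v).
Proof.
move=> d; pose g s := f (x + s *: v); pose dg s := 'D_v f (x + s *: v).
have dd (s : R) : `|s| <= `|a| -> is_derive s (1 : R) g (dg s : R) by move=> /d /is_derive_line.
have gc (lo hi : R) : (forall s, lo <= s <= hi -> `|s| <= `|a|) -> {within `[lo, hi], continuous g}.
  move=> H; apply: derivable_within_continuous => s; rewrite in_itv /= => /H /dd[+ _]; exact.
have g0 : g 0 = f x by rewrite /g scale0r addr0.
have [a0|a0] := leP 0 a.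
- have H s : 0 <= s <= a -> `|s| <= `|a| by move=> /andP[s0 sa]; rewrite !ger0_norm.
  have [s|s sI e] := @MVT_segment R g dg 0 a a0 _ (gc _ _ H).
    by rewrite in_itv /= => /andP[s0 sa]; apply: dd; apply: H; rewrite !ltW.
  exists s; first by apply: H; move: sI; rewrite in_itv.
  by rewrite -g0 -/(g a) e subr0 mulrC.
- have H s : a <= s <= 0 -> `|s| <= `|a|.
    by move=> /andP[s0 sa]; rewrite !ler0_norm ?lerN2 // ltW.
  have [s|s sI e] := @MVT_segment R g dg a 0 (ltW a0) _ (gc _ _ H).
    by rewrite in_itv /= => /andP[s0 sa]; apply: dd; apply: H; rewrite !ltW.
  exists s; first by apply: H; move: sI; rewrite in_itv.
  by apply: oppr_inj; rewrite opprB -g0 -/(g a) e sub0r mulrN mulrC.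
Qed.

Lemma row_sum_ebase m (v : 'rV[R]_m) : v = \sum_i v 0 i *: ebase R i.
Proof. exact: row_sum_delta. Qed.

(** The increment of [f] is telescoped along a path that changes one coordinate at a time. The mean
    value theorem on each leg turns it into a partial derivative at a nearby point, and continuity
    of the partial derivatives gives the linear approximation. *)
Lemma Ck1_differentiable m (U : set 'rV[R]_m) (f : 'rV[R]_m -> R) k u :
  open U -> Ck k.+1 U f -> U u ->
  differentiable f u /\ forall v, 'd f u v = \sum_i v 0 i * pd i f u.
Proof.
move=> oU /(@Ck_le _ _ _ _ 1) cf Uu; have {cf k}cf := cf isT.
pose l (v : 'rV[R]_m) := \sum_i v 0 i * pd i f u.
have ll : linear l.
  move=> a v w; rewrite /l scaler_sumr -big_split; apply: eq_bigr => i _.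
  by rewrite !mxE mulrDl; congr (_ + _); rewrite /GRing.scale /= mulrA.
pose lM := GRing.isLinear.Build _ _ _ _ _ ll.
pose L : {linear 'rV[R]_m -> R} := HB.pack l lM.
have cL : continuous L.
  move=> v; rewrite /continuous_at (_ : (L : _ -> _) = l) // /l.
  apply: (@Ck_cont R m _ 0 setT) => //; apply: Ck_sum => [|i _]; first exact: openT.
  by apply: CkM; [exact: openT|exact: Ck_coord|exact: Ck_cst].
suff E : forall e : R, 0 < e -> \forall v \near (0 : 'rV[R]_m), `|f (v + u) - (f u + l v)| <= e * `|v|.
  have dE : 'd f u = L :> (_ -> _).
    by apply: diff_unique cL _; apply/eqaddoP => e e0; near do exact: (near (E e e0)).
  split; last by move=> v; rewrite dE.
  by apply/diff_locallyP; rewrite dE; split=> //; apply/eqaddoP => e e0; near do exact: (near (E e e0)).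
move=> e e0.
(* There are [m] legs, each with error at most [e' * |v|]; dividing by [m.+1] rather than [m] also
   covers dimension 0. *)
pose e' := e / m.+1%:R; have e'0 : 0 < e' by rewrite divr_gt0.
have : \forall w \near u, U w /\ forall i, `|pd i f u - pd i f w| <= e'.
  have n2 : \forall w \near u, forall i, `|pd i f u - pd i f w| <= e'.
    have H i : \forall w \near u, `|pd i f u - pd i f w| <= e'.
      by have /cvgrPdist_le/(_ _ e'0) := Ck_cont (Ck_pd i cf) Uu.
    exact: filter_forall H.
  by apply: filterS2 (open_near oU Uu) n2 => w.
move=> /nbhs_ballP[d /= d0 dB].
apply/nbhs_ballP; exists d => //= v; rewrite -ball_normE /= sub0r normrN => vd.
(* The vector [v] cut after its first [k] coordinates; consecutive cuts differ in one coordinate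
   only. *)
pose tr k : 'rV[R]_m := \row_j (if (j < k)%N then v 0 j else 0).
have trS (k : 'I_m) : tr k.+1 = tr k + v 0 k *: ebase R k.
  apply/rowP => j; rewrite !mxE /= ltnS leq_eqVlt.
  have [->|jk] := eqVneq j k; first by rewrite eqxx ltnn /= mulr1 add0r.
  by rewrite (_ : (j == k :> nat) = false) ?mulr0 ?addr0 //; apply/negbTE.
have trm : tr m = v by apply/rowP => j; rewrite mxE ltn_ord.
have tr0 : tr 0%N = 0 by apply/rowP => j; rewrite !mxE.
have inB (k : 'I_m) (s : R) : `|s| <= `|v 0 k| -> ball u d ((u + tr k) + s *: ebase R k).
  move=> sv; rewrite -ball_normE /= -addrA opprD addNKr normrN; apply: le_lt_trans vd.
  apply: mx_norm_le => // a j; rewrite !mxE ord1 /= ; have [->|jk] := eqVneq j k.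
    by rewrite ltnn add0r mulr1 (le_trans sv) // mx_entry_le.
  by rewrite mulr0 addr0; case: ifP => _; rewrite ?normr0 // mx_entry_le.
have step (k : 'I_m) : `|f (u + tr k.+1) - f (u + tr k) - v 0 k * pd k f u| <= e' * `|v|.
  rewrite trS addrA.
  have [s s1 s2] : exists2 s, `|s| <= `|v 0 k| & f (u + tr k + v 0 k *: ebase R k) - f (u + tr k)
      = v 0 k * 'D_(ebase R k) f (u + tr k + s *: ebase R k).
    by apply: MVT_line => s sv; apply: (Ck1P cf); exact: (dB _ (inB k s sv)).1.
  rewrite s2 -mulrBr normrM mulrC; apply: ler_pM => //; last exact: mx_entry_le.
  by rewrite distrC -pdE; exact: (dB _ (inB k s s1)).2.
have -> : f (v + u) - (f u + l v) = \sum_(k < m) (f (u + tr k.+1) - f (u + tr k) - v 0 k * pd k f u).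
  rewrite sumrB -(big_mkord xpredT (fun k => f (u + tr k.+1) - f (u + tr k))) telescope_sumr //.
  rewrite trm tr0 addr0 /l.
  by rewrite [v + u]addrC opprD addrA.
apply: (le_trans (ler_norm_sum _ _ _)); apply: (@le_trans _ _ (\sum_(k < m) e' * `|v|)).
  by apply: ler_sum => k _; exact: step.
rewrite sumr_const card_ord -mulr_natr mulrAC ler_wpM2r // /e' -mulrA ler_piMr ?(ltW e0) //.
by rewrite ler_pdivrMl // mulr1 ler_nat.
Unshelve. all: by end_near. Qed.

End MatrixContinuity.

Section Chain.
Variable R : realType.

Lemma Ckm_differentiable m p (U : set 'rV[R]_m) (phi : 'rV[R]_m -> 'rV[R]_p) k u :
  open U -> Ckm k.+1 U phi -> U u -> differentiable phi u.
Proof.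
move=> oU cphi Uu.
rewrite (_ : phi = fun v => \sum_a (phi v 0 a *: ebase R a)); last first.
  by apply/funext => v; exact: row_sum_ebase.
rewrite (_ : (fun v => _) = \sum_a (fun v => phi v 0 a *: ebase R a)); last first.
  by apply/funext => v; rewrite fct_sumE.
apply: differentiable_sum => a.
by apply: differentiableZl; case: (Ck1_differentiable oU (cphi 0 a) Uu).
Qed.

Lemma derive_row_pd m p (U : set 'rV[R]_m) (phi : 'rV[R]_m -> 'rV[R]_p) k i u :
  open U -> Ckm k.+1 U phi -> U u ->
  'D_(ebase R i) phi u = \row_a pd i (fun v => phi v 0 a) u.
Proof.
move=> oU cphi Uu; rewrite derive_mx; last first.
  by apply: diff_derivable; apply: Ckm_differentiable Uu => //; exact: cphi.
by apply/rowP => a; rewrite !mxE pdE.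
Qed.

Lemma jacobianE m p (U : set 'rV[R]_m) (phi : 'rV[R]_m -> 'rV[R]_p) k u :
  open U -> Ckm k.+1 U phi -> U u ->
  'J phi u = \matrix_(i, a) pd i (fun v => phi v 0 a) u.
Proof.
move=> oU cphi Uu; apply/matrixP => i a; rewrite !mxE.
rewrite -[delta_mx 0 i]/(ebase R i) -deriveE; last exact: Ckm_differentiable Uu.
by rewrite (derive_row_pd _ oU cphi Uu) mxE.
Qed.

Lemma pd_comp m p (U : set 'rV[R]_m) (W : set 'rV[R]_p) (phi : 'rV[R]_m -> 'rV[R]_p)
    (f : 'rV[R]_p -> R) k l i u :
  open U -> open W -> Ckm k.+1 U phi -> Ck l.+1 W f -> U u -> W (phi u) ->
  pd i (fun v => f (phi v)) u = \sum_a pd i (fun v => phi v 0 a) u * pd a f (phi u).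
Proof.
move=> oU oW cphi cf Uu Wphi.
have dphi := Ckm_differentiable oU cphi Uu.
have [df dfE] := Ck1_differentiable oW cf Wphi.
rewrite pdE deriveE; last exact: (@differentiable_comp _ _ _ _ phi f).
rewrite (@diff_comp _ _ _ _ phi f u dphi df) /= dfE; apply: eq_bigr => a _; congr (_ * _).
by rewrite -deriveE // (derive_row_pd _ oU cphi Uu) mxE.
Qed.

Lemma Ck_comp m p (U : set 'rV[R]_m) (W : set 'rV[R]_p) (phi : 'rV[R]_m -> 'rV[R]_p)
    (f : 'rV[R]_p -> R) k :
  open U -> open W -> Ckm k U phi -> (forall u, U u -> W (phi u)) -> Ck k W f ->
  Ck k U (fun u => f (phi u)).
Proof.
move=> oU oW; have cc k' (f' : 'rV[R]_p -> R) : Ckm k' U phi -> (forall u, U u -> W (phi u)) ->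
    Ck k' W f' -> forall u, U u -> {for u, continuous (fun u => f' (phi u))}.
  move=> cphi UW cf u Uu.
  exact: (@continuous_comp _ _ _ phi f' u (Ckm_cont cphi Uu) (Ck_cont cf (UW u Uu))).
elim: k f => [|k IH] f cphi UW cf; split => //; try exact: cc.
move=> i; split.
  move=> u Uu; apply: diff_derivable; apply: (@differentiable_comp _ _ _ _ phi f).
    exact: Ckm_differentiable Uu.
  by case: (Ck1_differentiable oW cf (UW u Uu)).
apply: (@Ck_eq _ _ _ _ _ (fun u => \sum_a pd i (fun v => phi v 0 a) u * pd a f (phi u))) => //.
  by move=> u Uu; rewrite -(pd_comp i oU oW cphi cf Uu (UW _ Uu)) pdE.
apply: Ck_sum => // a _; apply: CkM => //; first exact: Ck_pd (cphi 0 a).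
apply: IH => //; last exact: Ck_pd.
by move=> x y; exact: CkS (cphi x y).
Qed.

Lemma pd_line m (U : set 'rV[R]_m) (f : 'rV[R]_m -> R) k (g : R -> 'rV[R]_m) t :
  open U -> Ck k.+1 U f -> U (g t) -> derivable g t 1 ->
  is_derive t (1 : R) (fun s => f (g s) : R) (\sum_a (g^`()%classic t) 0 a * pd a f (g t)).
Proof.
move=> oU cf Ug /derivable1_diffP dg; have [df dfE] := Ck1_differentiable oU cf Ug.
have d : differentiable (fun s => f (g s) : R) t by exact: (@differentiable_comp _ _ _ _ g f).
apply: DeriveDef; first exact: diff_derivable.
rewrite deriveE // (@diff_comp _ _ _ _ g f t dg df) /= dfE.
by apply: eq_bigr => a _; rewrite derive1E deriveE.
Qed.

(** Schwarz's theorem. The second difference of [f] over a square of side [h] is unchanged when the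
    two directions are exchanged, and two applications of the mean value theorem identify it with
    [h ^+ 2] times either mixed derivative, up to a small multiple of [h ^+ 2]. *)
Lemma pdC m (U : set 'rV[R]_m) (f : 'rV[R]_m -> R) k i j u :
  open U -> Ck k.+2 U f -> U u -> pd i (pd j f) u = pd j (pd i f) u.
Proof.
move=> oU cf Uu.
have key (i0 j0 : 'I_m) (e : R) : 0 < e -> \forall h \near (0 : R),
   `|f (u + h *: ebase R i0 + h *: ebase R j0) - f (u + h *: ebase R i0) - f (u + h *: ebase R j0) + f u
      - h ^+ 2 * pd j0 (pd i0 f) u| <= h ^+ 2 * e.
  move=> e0.
  have : \forall w \near u, U w /\ `|pd j0 (pd i0 f) u - pd j0 (pd i0 f) w| <= e.
    have n2 : \forall w \near u, `|pd j0 (pd i0 f) u - pd j0 (pd i0 f) w| <= e.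
      by have /cvgrPdist_le/(_ _ e0) := Ck_cont (Ck_pd j0 (Ck_pd i0 cf)) Uu.
    by apply: filterS2 (open_near oU Uu) n2 => w.
  move=> /nbhs_ballP[d /= d0 dB]; apply/nbhs_ballP; exists (d / 2) => /=; first by rewrite divr_gt0.
  move=> h; rewrite -ball_normE /= sub0r normrN => hd.
  have inB (s t : R) : `|s| <= `|h| -> `|t| <= `|h| -> ball u d (u + s *: ebase R i0 + t *: ebase R j0).
    move=> sh th; rewrite -ball_normE /= -addrA opprD addNKr normrN.
    rewrite (splitr d) (le_lt_trans (ler_normD _ _)) // ltrD // (le_lt_trans _ hd) //.
      rewrite (le_trans _ sh) // normrZ ler_piMr // mx_norm_le // => a b; rewrite mxE; case: (_ && _); by rewrite /= ?normr1 ?normr0.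
    rewrite normrZ (le_trans _ th) // ler_piMr // mx_norm_le // => a b; rewrite mxE; case: (_ && _); by rewrite /= ?normr1 ?normr0.
  have inB1 (s : R) : `|s| <= `|h| -> U (u + s *: ebase R i0).
    by move=> sh; have := (dB _ (inB s 0 sh _)).1; rewrite scale0r addr0 normr0; exact.
  pose g := fun w : 'rV[R]_m => f (w + h *: ebase R j0) - f w.
  have sh (w : 'rV[R]_m) v : derivable f (w + h *: ebase R j0) v ->
      derivable (fun w => f (w + h *: ebase R j0)) w v /\
      'D_v (fun w => f (w + h *: ebase R j0)) w = 'D_v f (w + h *: ebase R j0).
    have e' : (fun a : R => a^-1 *: (((fun w => f (w + h *: ebase R j0)) \o shift w) (a *: v) - f (w + h *: ebase R j0)))
       = (fun a => a^-1 *: ((f \o shift (w + h *: ebase R j0)) (a *: v) - f (w + h *: ebase R j0))).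
      by apply/funext => a; rewrite /= addrA.
    by move=> dd; split; rewrite /derivable /derive e'.
  have [s sh1 s2] : exists2 s, `|s| <= `|h| & g (u + h *: ebase R i0) - g u = h * 'D_(ebase R i0) g (u + s *: ebase R i0).
    apply: MVT_line => s hs; apply: derivableB; last by apply: (Ck1P cf); exact: inB1.
    by apply: (sh _ _ _).1; apply: (Ck1P cf); apply: (dB _ (inB s h hs _)).1.
  have s3 : 'D_(ebase R i0) g (u + s *: ebase R i0) = pd i0 f (u + s *: ebase R i0 + h *: ebase R j0) - pd i0 f (u + s *: ebase R i0).
    have [d1 d2] := sh (u + s *: ebase R i0) (ebase R i0) (Ck1P cf (dB _ (inB s h sh1 (lexx _))).1).
    by rewrite !pdE -d2; exact: deriveB d1 (Ck1P cf (inB1 _ sh1)).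
  have [t th1 t2] : exists2 t, `|t| <= `|h| & pd i0 f (u + s *: ebase R i0 + h *: ebase R j0) - pd i0 f (u + s *: ebase R i0)
      = h * 'D_(ebase R j0) (pd i0 f) (u + s *: ebase R i0 + t *: ebase R j0).
    apply: MVT_line => t ht; apply: (Ck1P (Ck_pd i0 cf)); exact: (dB _ (inB s t sh1 ht)).1.
  rewrite (_ : _ + f u = g (u + h *: ebase R i0) - g u); last first.
    by rewrite /g; ring.
  rewrite s2 s3 t2 mulrA -expr2 -mulrBr normrM ger0_norm ?sqr_ge0 // ler_wpM2l ?sqr_ge0 //.
  by rewrite distrC -pdE; exact: (dB _ (inB s t sh1 th1)).2.
apply/eqP; rewrite -subr_eq0 -normr_eq0; apply/eqP/le_anti; rewrite normr_ge0 andbT.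
apply/ler_addgt0Pl => e e0; rewrite addr0.
have e20 : 0 < e / 2 by rewrite divr_gt0.
have /nbhs_ballP[r1 /= r10 B1] := key i j _ e20.
have /nbhs_ballP[r2 /= r20 B2] := key j i _ e20.
pose d := Num.min r1 r2; have d0 : 0 < d by rewrite lt_min r10.
have d2 : 0 < d / 2 by rewrite divr_gt0.
have db : d / 2 < d by rewrite ltr_pdivrMr // ltr_pMr // ltr1n.
have H1 : ball (0 : R) r1 (d / 2).
  by rewrite -ball_normE /= sub0r normrN ger0_norm ?ltW // (lt_le_trans db) // /d ge_min lexx.
have H2 : ball (0 : R) r2 (d / 2).
  by rewrite -ball_normE /= sub0r normrN ger0_norm ?ltW // (lt_le_trans db) // /d ge_min lexx orbT.
move: (B1 _ H1) (B2 _ H2) => {H1 H2}; set h := d / 2 in d2 *.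
rewrite [u + h *: ebase R j + h *: ebase R i]addrAC.
set A := f _; set B := f _; set C := f _; set D := f _; set X := pd j _ u; set Y := pd i _ u.
have h2 : 0 < h ^+ 2 by rewrite exprn_gt0.
move=> H1 H2; rewrite -(ler_pM2l h2).
have -> : h ^+ 2 * `|Y - X| = `|(A - B - C + D - h ^+ 2 * X) - (A - C - B + D - h ^+ 2 * Y)|.
  rewrite -{1}(ger0_norm (ltW h2)) -normrM; congr (`|_|); ring.
rewrite (splitr e) mulrDr; exact: (le_trans (ler_normB _ _) (lerD H1 H2)).
Qed.

End Chain.

Lemma cont_le (R : realType) (T : topologicalType) (f : T -> R) u :
  (forall e : R, 0 < e -> \forall v \near u, `|f u - f v| <= e) -> {for u, continuous f}.
Proof. by move=> H; apply/cvgrPdist_le => e /H. Qed.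

Lemma near_ball2 (R : realType) (V : normedModType R) (P Q : V -> Prop) u :
  (\forall v \near u, P v) -> (\forall v \near u, Q v) ->
  exists2 d : R, 0 < d & forall v, ball u d v -> P v /\ Q v.
Proof.
move=> hP hQ; have : \forall v \near u, P v /\ Q v by apply: filterS2 hP hQ.
by move=> /nbhs_ballP[d /= d0 dB]; exists d.
Qed.

(** * Integrals over [0, 1] and geometric convergence *)

Section Int01.
Variable R : realType.
Notation mu := (@lebesgue_measure R).

Definition cont01 (f : R -> R) := {within `[0, 1], continuous f}.
Definition int01 (f : R -> R) : R := \int[mu]_(t in `[0%R, 1%R]) f t.

Lemma cont01_integrable f : cont01 f -> mu.-integrable `[0%R, 1%R] (EFin \o f).
Proof. by move=> cf; apply: continuous_compact_integrable => //; exact: segment_compact. Qed.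

Lemma int01B f g : cont01 f -> cont01 g -> int01 (fun t => f t - g t) = int01 f - int01 g.
Proof. by move=> cf cg; apply: RintegralB => //; exact: cont01_integrable. Qed.

Lemma int01Z a f : cont01 f -> int01 (fun t => a * f t) = a * int01 f.
Proof. by move=> cf; apply: RintegralZl => //; exact: cont01_integrable. Qed.

Lemma eq_int01 f g : (forall t, 0 <= t <= 1 -> f t = g t) -> int01 f = int01 g.
Proof. by move=> fg; apply: eq_Rintegral => t; rewrite inE /= in_itv /= => /fg. Qed.

Lemma le_int01 f g : cont01 f -> cont01 g -> (forall t, 0 <= t <= 1 -> f t <= g t) -> int01 f <= int01 g.
Proof.
move=> cf cg fg; apply: le_Rintegral => //; try exact: cont01_integrable.
Qed.

Lemma int01_cst (a : R) : int01 (fun _ => a) = a.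
Proof.
rewrite /int01 Rintegral_cst //= (_ : mu _ = 1%E) /= ?mulr1 //.
by rewrite (lebesgue_measure_itv `[0%R, 1%R]) /= lte_fin ltr01 oppr0 adde0.
Qed.

Lemma cont01_cst (a : R) : cont01 (fun _ => a).
Proof. by apply: continuous_subspaceT => t; exact: cst_continuous. Qed.

Lemma cont01P (f : R -> R) : (forall t : R, 0 <= t <= 1 -> {for t, continuous f}) -> cont01 f.
Proof.
move=> H; apply/continuous_in_subspaceT => t; rewrite inE /= in_itv /= => /H; exact.
Qed.

Lemma int01_norm f e : cont01 f -> (forall t, 0 <= t <= 1 -> `|f t| <= e) -> `|int01 f| <= e.
Proof.
move=> cf fe; rewrite ler_norml -{1}(int01_cst e) -{2}(int01_cst e) -mulN1r -int01Z; last exact: cont01_cst.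
have fe' t : 0 <= t <= 1 -> - e <= f t <= e by move=> /fe; rewrite ler_norml.
apply/andP; split; apply: le_int01 => //; try exact: cont01_cst.
  by move=> t /fe' /andP[]; rewrite mulN1r.
by move=> t /fe' /andP[].
Qed.

Lemma int01_FTC (F f : R -> R) : (forall t : R, 0 <= t <= 1 -> {for t, continuous f}) ->
  (forall t : R, 0 <= t <= 1 -> is_derive t (1 : R) F (f t)) -> int01 f = F 1 - F 0.
Proof.
move=> cf dF; have c (t : R) : 0 <= t <= 1 -> {for t, continuous F}.
  by move=> /dF[d _]; apply: differentiable_continuous; apply/derivable1_diffP.
rewrite /int01 /Rintegral (@continuous_FTC2 _ f F) //; first exact: cont01P.
  split; first by move=> t; rewrite in_itv /= => /andP[t0 t1]; have [|//] := dF t; rewrite !ltW.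
    by apply: cvg_at_right_filter; apply: c; rewrite lexx ler01.
  by apply: cvg_at_left_filter; apply: c; rewrite lexx ler01.
move=> t; rewrite in_itv /= => /andP[t0 t1]; rewrite derive1E.
by have [|_ ->//] := dF t; rewrite !ltW.
Qed.

(** Subtracting or adding the tail [2 * c / 2 ^+ k] of the geometric series makes [x] increasing or
    decreasing; the limit is the supremum of the increasing sequence and lies between the two. *)
Lemma dyadic_limit (x : nat -> R) (c : R) : 0 <= c ->
  (forall k, `|x k.+1 - x k| <= c / 2 ^+ k) ->
  exists l, forall k, `|l - x k| <= 2 * c / 2 ^+ k.
Proof.
move=> c0 H; pose y k := x k - 2 * c / 2 ^+ k; pose z k := x k + 2 * c / 2 ^+ k.
have e k : 2 * c / 2 ^+ k = 2 * c / 2 ^+ k.+1 + c / 2 ^+ k.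
  by rewrite exprS invfM; field; rewrite expf_neq0.
have yS k : y k <= y k.+1.
  by move: (H k); rewrite /y e ler_norml => /andP[h _]; lra.
have zS k : z k.+1 <= z k.
  by move: (H k); rewrite /z (e k) ler_norml => /andP[_ h]; lra.
have ym k j : y k <= y (k + j)%N by elim: j => [|j IH]; rewrite ?addn0 // addnS (le_trans IH).
have zm k j : z (k + j)%N <= z k by elim: j => [|j IH]; rewrite ?addn0 // addnS (le_trans _ IH).
have yz k : y k <= z k.
  have q : 0 <= 2 * c / 2 ^+ k by rewrite divr_ge0 ?exprn_ge0 // mulr_ge0.
  by rewrite /y /z; lra.
have ylez k j : y k <= z j.
  by rewrite (le_trans (ym k j)) // (le_trans (yz _)) // addnC zm.
have hs : has_sup (range y).
  by split; [exists (y 0%N); exists 0%N|exists (z 0%N) => _ [k _ <-]; exact: ylez].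
exists (sup (range y)) => k; rewrite ler_norml; apply/andP; split.
  have : y k <= sup (range y) by apply: (sup_upper_bound hs); exists k.
  by rewrite /y; lra.
have : sup (range y) <= z k by apply: ge_sup; [exists (y 0%N); exists 0%N|move=> _ [j _ <-]; exact: ylez].
by rewrite /z; lra.
Qed.

End Int01.

(** * A Poincaré lemma with an error bound *)

Section Poincare.
Variables (R : realType) (m : nat) (p : 'rV[R]_m) (rho : R).
Hypothesis rho0 : 0 < rho.
Let O : set 'rV[R]_m := ball p rho.

Definition rad (t : R) (u : 'rV[R]_m) := p + t *: (u - p).

Lemma rad_in t u : 0 <= t <= 1 -> O u -> O (rad t u).
Proof.
move=> /andP[t0 t1]; rewrite /O -ball_normE /= => uO.
rewrite opprD addNKr normrN normrZ ger0_norm // distrC.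
by rewrite (le_lt_trans _ uO) // ler_piMl.
Qed.

Lemma rad_cont (g : 'rV[R]_m -> R) u t : Ck 0 O g -> O u -> 0 <= t <= 1 ->
  {for t, continuous (fun s => g (rad s u))}.
Proof.
move=> cg Ou t01; apply: (@continuous_comp _ _ _ (fun s => rad s u) g).
  apply: cvgD; first exact: cvg_cst.
  by apply: cvgZl; exact: cvg_id.
exact: (Ck_cont cg (rad_in t01 Ou)).
Qed.

(* Joint continuity on the compact fibres [0, 1]; it gives uniformity in [t]. *)
Definition jcont (H : 'rV[R]_m -> R -> R) := forall (u : 'rV[R]_m) (t : R), O u -> 0 <= t <= 1 ->
  {for (u, t), continuous (fun z : 'rV[R]_m * R => H z.1 z.2)}.

(** The tube lemma: compactness of [0, 1], in its near-covering form, makes the estimate uniform in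
    [t]. *)
Lemma jcont_tube (H : 'rV[R]_m -> R -> R) u (e : R) : jcont H -> O u -> 0 < e ->
  \forall v \near u, forall t, 0 <= t <= 1 -> `|H v t - H u t| <= e.
Proof.
move=> cH Ou e0; have e20 : 0 < e / 2 by rewrite divr_gt0.
have NC := (near_covering_withinP _).2 ((compact_near_coveringP _).1 (@segment_compact R 0 1)).
have K : \forall v \near u, `[0%R, 1%R]%classic `<=` (fun t : R => `|H v t - H u t| <= e).
  apply: (NC 'rV[R]_m (nbhs u) (fun v t => `|H v t - H u t| <= e)).
  move=> t; rewrite /= in_itv /= => t01.
  have [[A B] /= [nA nB] AB] := (cvgrPdist_le _ _).1 (cH u t Ou t01) _ e20.
  have uA := nbhs_singleton nA.
  exists (B, A) => //= -[s v] /= [Bs Av] _.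
  have h1 := AB (v, s) (conj Av Bs); have h2 := AB (u, s) (conj uA Bs).
  rewrite (splitr e) -(subrKA (H u t)) (le_trans (ler_normD _ _)) // lerD //.
  by rewrite distrC.
by apply: filterS K => v Hv t t01; apply: Hv; rewrite /= in_itv.
Qed.

Lemma jcont_cont01 H u : jcont H -> O u -> forall t : R, 0 <= t <= 1 -> {for t, continuous (H u)}.
Proof.
move=> cH Ou t t01.
apply: (@continuous_comp _ _ _ (fun s : R => (u, s)) (fun z : 'rV[R]_m * R => H z.1 z.2) t); last exact: cH.
exact: (cvg_pair (cvg_cst u) (@cvg_id _ (nbhs t))).
Qed.

Lemma jcont_int01 H u : jcont H -> O u -> {for u, continuous (fun v : 'rV[R]_m => int01 (H v))}.
Proof.
move=> cH Ou; apply: cont_le => e e0.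
apply: filterS2 (jcont_tube cH Ou e0) (open_near (@ball_open _ _ p rho) Ou) => v vt Ov.
have c01 w : O w -> cont01 (H w) by move=> Ow; apply: cont01P; exact: jcont_cont01.
rewrite -int01B; [|exact: c01|exact: c01].
apply: int01_norm; last by move=> t /vt; rewrite distrC.
by apply: cont01P => t t01; apply: cvgB; apply: jcont_cont01.
Qed.

Lemma jcontD H K : jcont H -> jcont K -> jcont (fun u t => H u t + K u t).
Proof. by move=> cH cK u t Ou t01; exact: cvgD (cH u t Ou t01) (cK u t Ou t01). Qed.

Lemma jcontM H K : jcont H -> jcont K -> jcont (fun u t => H u t * K u t).
Proof. by move=> cH cK u t Ou t01; exact: cvgM (cH u t Ou t01) (cK u t Ou t01). Qed.

Lemma jcont_sum (J : Type) (r : seq J) (H : J -> 'rV[R]_m -> R -> R) :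
  (forall j, jcont (H j)) -> jcont (fun u t => \sum_(j <- r) H j u t).
Proof.
move=> cH; elim: r => [|j r IH].
  have -> : (fun u t => \sum_(j <- [::]) H j u t) = (fun _ _ => 0).
    by apply/funext => u; apply/funext => t; rewrite big_nil.
  by move=> u t _ _; exact: cst_continuous.
have -> : (fun u t => \sum_(j <- j :: r) H j u t) = (fun u t => H j u t + \sum_(j <- r) H j u t).
  by apply/funext => u; apply/funext => t; rewrite big_cons.
exact: jcontD.
Qed.

Lemma jcont_rad g : Ck 0 O g -> jcont (fun u t => g (rad t u)).
Proof.
move=> cg u t Ou t01.
apply: (@continuous_comp _ _ _ (fun z : 'rV[R]_m * R => rad z.2 z.1) g (u, t)); last first.
  exact: (Ck_cont cg (rad_in t01 Ou)).
apply: cvgD; first exact: cvg_cst.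
apply: cvgZ; first exact: cvg_snd.
by apply: cvgB; [exact: cvg_fst|exact: cvg_cst].
Qed.

Lemma jcont_coord j : jcont (fun u _ => (u - p) 0 j).
Proof.
move=> u t Ou t01.
apply: (@continuous_comp _ _ _ (fun z : 'rV[R]_m * R => z.1 - p) (fun v : 'rV[R]_m => v 0 j) (u, t)).
  by apply: cvgB; [exact: cvg_fst|exact: cvg_cst].
exact: coord_continuous.
Qed.

Lemma jcont_time : jcont (fun _ t => t).
Proof. by move=> u t _ _; exact: cvg_snd. Qed.

Lemma rad_derive (f : 'rV[R]_m -> R) u (t : R) k : Ck k.+1 O f -> O u -> 0 <= t <= 1 ->
  is_derive t (1 : R) (fun s => f (rad s u) : R) (\sum_j (u - p) 0 j * pd j f (rad t u)).
Proof.
move=> cf Ou t01.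
have d : is_derive t (1 : R) (fun s => rad s u) (u - p).
  have e : (fun h : R => h^-1 *: (((fun s => rad s u) \o shift t) (h *: (1 : R)) - rad t u)) @ 0^' --> u - p.
    apply: cvg_near_cst; near=> h.
    have h0 : h != 0 by near: h; exact: nbhs_dnbhs_neq.
    rewrite /rad /= scaler1; set w := u - p.
    by rewrite scalerDl opprD addrACA subrr add0r addrK scalerA mulVf // scale1r.
  by apply: DeriveDef; [apply/cvg_ex; exists (u - p)|exact/cvg_lim].
have [dr de] := d.
have := pd_line (@ball_open _ _ p rho) cf (rad_in t01 Ou) dr.
by rewrite derive1E de.
Unshelve. all: by end_near. Qed.


Lemma pd_affine (a b t : R) (i j : 'I_m) u : pd i (fun v : 'rV[R]_m => a + t * (v 0 j - b)) u = t * (i == j)%:R.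
Proof.
have cb : Ck 1 setT (fun v : 'rV[R]_m => v 0 j - b).
  by apply: CkB; [exact: openT|exact: Ck_coord|exact: Ck_cst].
rewrite (pdD _ (Ck_cst 1 setT a) (CkM openT (Ck_cst 1 setT t) cb)) // pd_cst add0r.
rewrite (pdM _ (Ck_cst 1 setT t) cb) // pd_cst mul0r add0r.
by rewrite (pdB openT _ (Ck_coord 1 setT j) (Ck_cst 1 setT b)) // pd_cst pd_coord subr0.
Qed.

(** [I] is the integral of the form [al] along the radial segment from [p]. Differentiating under
    the integral and subtracting the derivative in [t] of [t * al i (rad t u)] leaves only the
    antisymmetric differences of the partial derivatives, so a form that is closed up to [e] has a
    primitive up to a multiple of [e]. Approximate closedness is what the iteration in
    [parallel_step] provides. *)
Lemma poincare (al : 'I_m -> 'rV[R]_m -> R) : (forall j, Ck 1 O (al j)) ->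
  exists I : 'rV[R]_m -> R, [/\ Ck 1 O I, I p = 0 &
    forall e u, (forall i j v, O v -> `|pd i (al j) v - pd j (al i) v| <= e) -> O u ->
      forall i, `|pd i I u - al i u| <= m%:R * rho * e].
Proof.
move=> cal; have oO : open O by exact: ball_open.
pose G u (t : R) := \sum_j (u - p) 0 j * al j (rad t u).
pose dG i u (t : R) := al i (rad t u) + \sum_j (u - p) 0 j * (t * pd i (al j) (rad t u)).
have jG : jcont G.
  apply: jcont_sum => j; apply: jcontM; first exact: jcont_coord.
  by apply: jcont_rad; exact: CkS.
have jdG i : jcont (dG i).
  apply: jcontD; first by apply: jcont_rad; exact: CkS.
  apply: jcont_sum => j; apply: jcontM; first exact: jcont_coord.
  apply: jcontM; first exact: jcont_time.
  by apply: jcont_rad; exact: Ck_pd.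
have c01 H u : jcont H -> O u -> cont01 (H u) by move=> cH Ou; apply: cont01P; exact: jcont_cont01.
have crad k t : Ckm k O (rad t).
  move=> a b; apply: (@Ck_eq _ _ _ _ _ (fun u : 'rV[R]_m => p 0 b + t * (u 0 b - p 0 b))) => //.
    by move=> u _; rewrite !mxE ord1.
  apply: CkD => //; first exact: Ck_cst.
  apply: CkM => //; first exact: Ck_cst.
  by apply: CkB => //; [exact: Ck_coord|exact: Ck_cst].
have crd j : Ck 1 O (fun u : 'rV[R]_m => (u - p) 0 j).
  apply: (@Ck_eq _ _ _ _ _ (fun u : 'rV[R]_m => u 0 j - p 0 j)) => //.
    by move=> u _; rewrite !mxE.
  by apply: CkB => //; [exact: Ck_coord|exact: Ck_cst].
have calr j t : 0 <= t <= 1 -> Ck 1 O (fun u => al j (rad t u)).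
  by move=> t01; apply: (Ck_comp oO oO (crad 1%N t) _ (cal j)) => u; exact: rad_in.
have cG t : 0 <= t <= 1 -> Ck 1 O (fun u => G u t).
  by move=> t01; apply: Ck_sum => // j _; apply: CkM => //; exact: calr.
have pdrad i t u j : 0 <= t <= 1 -> O u -> pd i (fun v => al j (rad t v)) u = t * pd i (al j) (rad t u).
  move=> t01 Ou; rewrite (pd_comp i oO oO (crad 1%N t) (cal j) Ou (rad_in t01 Ou)).
  rewrite (bigD1 i) //= big1 ?addr0 => [|a ai]; last first.
    rewrite (_ : (fun v => _) = (fun v : 'rV[R]_m => p 0 a + t * (v 0 a - p 0 a))); last first.
      by apply/funext => v; rewrite !mxE.
    by rewrite pd_affine eq_sym (negbTE ai) mulr0 mul0r.
  congr (_ * _).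
  rewrite (_ : (fun v => _) = (fun v : 'rV[R]_m => p 0 i + t * (v 0 i - p 0 i))); last first.
    by apply/funext => v; rewrite !mxE.
  by rewrite pd_affine eqxx mulr1.
have pdG i t u : 0 <= t <= 1 -> O u -> pd i (fun v => G v t) u = dG i u t.
  move=> t01 Ou; rewrite (pd_sum oO _ _ (fun j _ => CkM oO (crd j) (calr j t t01)) Ou).
  under eq_bigr => j _.
    rewrite (pdM i (crd j) (calr j t t01) Ou) pdrad //.
    rewrite (_ : (fun v : 'rV[R]_m => (v - p) 0 j) = (fun v : 'rV[R]_m => v 0 j - p 0 j)); last first.
      by apply/funext => v; rewrite !mxE.
    rewrite (pdB oO i (Ck_coord 1 O j) (Ck_cst 1 O (p 0 j))) // pd_cst pd_coord subr0.
    over.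
  rewrite big_split /=; congr (_ + _).
  rewrite (bigD1 i) //= eqxx mul1r big1 ?addr0 // => j ji.
  by rewrite eq_sym (negbTE ji) mul0r.
pose I u := int01 (G u).
have dI i u : O u -> is_derive u (ebase R i) I (int01 (dG i u)).
  move=> Ou.
  suff cI : (fun h : R => h^-1 *: ((I \o shift u) (h *: ebase R i) - I u)) h @[h --> 0^'] --> int01 (dG i u).
    by apply: DeriveDef; [apply/cvg_ex; exists (int01 (dG i u))|exact/cvg_lim].
  apply/cvgrPdist_le => e e0.
  have [d d0 dB] := near_ball2 (jcont_tube (jdG i) Ou e0) (open_near oO Ou).
  near=> h.
  have h0 : h != 0 by near: h; exact: nbhs_dnbhs_neq.
  have hd : `|h| < d by near: h; exact: dnbhs0_lt.
  have inB (s : R) : `|s| <= `|h| -> ball u d (u + s *: ebase R i).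
    move=> sh; rewrite -ball_normE /= opprD addNKr normrN (le_lt_trans _ hd) // (le_trans _ sh) //.
    rewrite normrZ ler_piMr // mx_norm_le // => a b; rewrite mxE; case: (_ && _); by rewrite /= ?normr1 ?normr0.
  have Oh := (dB _ (inB h (lexx _))).2.
  rewrite -[(I \o shift u) (h *: ebase R i)]/(I (h *: ebase R i + u)) [h *: _ + u]addrC /I -int01B;
    [|exact: c01|exact: c01].
  rewrite [_ *: _](_ : _ = int01 (fun t => h^-1 * (G (u + h *: ebase R i) t - G u t))); last first.
    rewrite /GRing.scale /= -int01Z //; apply: cont01P => t t01.
    by apply: cvgB; apply: jcont_cont01.
  have cq : forall t : R, 0 <= t <= 1 -> {for t, continuous (fun t => h^-1 * (G (u + h *: ebase R i) t - G u t))}.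
    move=> t t01; apply: cvgM; first exact: cvg_cst.
    by apply: cvgB; apply: jcont_cont01.
  rewrite -int01B; [|exact: c01|exact: cont01P].
  apply: int01_norm.
    by apply: cont01P => t t01; apply: cvgB; [exact: jcont_cont01|exact: cq].
  move=> t t01.
  have [s sh ->] : exists2 s, `|s| <= `|h| & G (u + h *: ebase R i) t - G u t = h * 'D_(ebase R i) (fun v => G v t) (u + s *: ebase R i).
    apply: MVT_line => s sh; apply: (Ck1P (cG t t01)); exact: (dB _ (inB s sh)).2.
  rewrite mulKf // -pdE pdG //; last exact: (dB _ (inB s sh)).2.
  by rewrite distrC; exact: (dB _ (inB s sh)).1.
exists I; split.
- split; first by move=> u Ou; exact: jcont_int01.
  move=> i; split; first by move=> u /(dI i)[].
  split=> // u Ou; apply: near_cont (jcont_int01 (jdG i) Ou).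
  by apply: filterS (open_near oO Ou) => v /(dI i)[_ ->].
- rewrite /I -(int01_cst 0); apply: eq_int01 => t _; rewrite /G big1 // => j _.
  by rewrite subrr mxE mul0r.
- move=> e u He Ou i; rewrite pdE; have [_ ->] := dI i u Ou.
  (* [al i u] is the increment of [F] over [0, 1], hence the integral of [f]; it can then be
     compared with the derivative of [I] under one integral sign. *)
  pose F (t : R) := t * al i (rad t u).
  pose f (t : R) := al i (rad t u) + t * \sum_j (u - p) 0 j * pd j (al i) (rad t u).
  have jf : jcont (fun u t => al i (rad t u) + t * \sum_j (u - p) 0 j * pd j (al i) (rad t u)).
    apply: jcontD; first by apply: jcont_rad; exact: CkS.
    apply: jcontM; first exact: jcont_time.
    apply: jcont_sum => j; apply: jcontM; first exact: jcont_coord.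
    by apply: jcont_rad; exact: Ck_pd.
  have -> : al i u = int01 f.
    transitivity (F 1 - F 0); first by rewrite /F mul0r subr0 mul1r /rad scale1r addrC subrK.
    apply/esym/int01_FTC.
      by move=> t t01; exact: (jcont_cont01 jf Ou t01).
    move=> t t01; have [d1 d2] := rad_derive (cal i) Ou t01.
      have [d3 d4] := @is_derive_id R R t 1.
      apply: DeriveDef; first exact: (derivableM d3 d1).
      rewrite (deriveM d3 d1) d2 d4 /f addrC; congr (_ + _); exact: mulr1.
  rewrite -int01B; [|exact: c01|exact: (c01 _ u jf)].
  apply: int01_norm.
    by apply: cont01P => t t01; apply: cvgB; [exact: jcont_cont01|exact: (jcont_cont01 jf Ou)].
  move=> t t01.
  have -> : dG i u t - f t = t * \sum_j (u - p) 0 j * (pd i (al j) (rad t u) - pd j (al i) (rad t u)).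
    rewrite /dG /f opprD addrACA subrr add0r !mulr_sumr -sumrB; apply: eq_bigr => j _; ring.
  rewrite normrM -[leRHS]mul1r; apply: ler_pM => //.
    by rewrite ger0_norm; case/andP: t01.
  apply: (le_trans (ler_norm_sum _ _ _)); apply: (@le_trans _ _ (\sum_(j < m) rho * e)).
    apply: ler_sum => j _; rewrite normrM; apply: ler_pM => //; last first.
      by apply: He; exact: rad_in.
    rewrite (le_trans (mx_entry_le _ _ _)) // distrC.
    by move: Ou; rewrite /O -ball_normE /= => /ltW.
  by rewrite sumr_const card_ord -[leLHS]mulr_natl mulrA.
Unshelve. all: by end_near. Qed.

End Poincare.

Lemma mx_subE (R : realType) p q (A B : 'M[R]_(p, q)) i j : (A - B) i j = A i j - B i j.
Proof. by rewrite mxE [in LHS]mxE. Qed.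

(** * Parallel sections of flat systems *)

Section MatrixCalculus.
Variables (R : realType) (m : nat) (U : set 'rV[R]_m).
Hypothesis oU : open U.

Lemma CkmD p q k (F G : 'rV[R]_m -> 'M[R]_(p, q)) :
  Ckm k U F -> Ckm k U G -> Ckm k U (fun u => F u + G u).
Proof.
move=> cF cG i j; apply: (Ck_eq oU _ (CkD oU (cF i j) (cG i j))) => u _; by rewrite mxE.
Qed.

Lemma CkmN p q k (F : 'rV[R]_m -> 'M[R]_(p, q)) : Ckm k U F -> Ckm k U (fun u => - F u).
Proof. move=> cF i j; apply: (Ck_eq oU _ (CkN oU (cF i j))) => u _; by rewrite mxE. Qed.

Lemma CkmB p q k (F G : 'rV[R]_m -> 'M[R]_(p, q)) :
  Ckm k U F -> Ckm k U G -> Ckm k U (fun u => F u - G u).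
Proof. by move=> cF cG; apply: CkmD => //; exact: CkmN. Qed.

Lemma Ckm_cst p q k (A : 'M[R]_(p, q)) : Ckm k U (fun _ => A).
Proof. by move=> i j; exact: Ck_cst. Qed.

Lemma Ckm_tr p q k (F : 'rV[R]_m -> 'M[R]_(p, q)) : Ckm k U F -> Ckm k U (fun u => (F u)^T).
Proof. by move=> cF i j; apply: (Ck_eq oU _ (cF j i)) => u _; rewrite mxE. Qed.

Lemma CkmM p q r k (F : 'rV[R]_m -> 'M[R]_(p, q)) (G : 'rV[R]_m -> 'M[R]_(q, r)) :
  Ckm k U F -> Ckm k U G -> Ckm k U (fun u => F u *m G u).
Proof.
move=> cF cG i j; apply: (@Ck_eq _ _ _ _ _ (fun u => \sum_a F u i a * G u a j)) => //.
  by move=> u _; rewrite mxE.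
by apply: Ck_sum => // a _; exact: CkM.
Qed.

Lemma CkmZ p q k (f : 'rV[R]_m -> R) (F : 'rV[R]_m -> 'M[R]_(p, q)) :
  Ck k U f -> Ckm k U F -> Ckm k U (fun u => f u *: F u).
Proof.
move=> cf cF i j; apply: (Ck_eq oU _ (CkM oU cf (cF i j))) => u _; by rewrite mxE.
Qed.

Lemma CkmS p q k (F : 'rV[R]_m -> 'M[R]_(p, q)) : Ckm k.+1 U F -> Ckm k U F.
Proof. by move=> cF i j; exact: CkS. Qed.

Lemma Ckm_eq p q k (F G : 'rV[R]_m -> 'M[R]_(p, q)) :
  (forall u, U u -> F u = G u) -> Ckm k U F -> Ckm k U G.
Proof. by move=> FG cF i j; apply: (Ck_eq oU _ (cF i j)) => u /FG ->. Qed.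

Lemma Ckm_pdm p q k i (F : 'rV[R]_m -> 'M[R]_(p, q)) : Ckm k.+1 U F -> Ckm k U (pdm i F).
Proof.
move=> cF a b; apply: (Ck_eq oU _ (Ck_pd i (cF a b))) => u _; by rewrite pdmE.
Qed.

Lemma pdmD p q k i u (F G : 'rV[R]_m -> 'M[R]_(p, q)) :
  Ckm k.+1 U F -> Ckm k.+1 U G -> U u -> pdm i (fun v => F v + G v) u = pdm i F u + pdm i G u.
Proof.
move=> cF cG Uu; apply/matrixP => a b; rewrite [RHS]mxE !pdmE -(pdD i (cF a b) (cG a b) Uu).
by apply: (pd_eq oU) => // v _; rewrite mxE.
Qed.

Lemma pdmN p q k i u (F : 'rV[R]_m -> 'M[R]_(p, q)) :
  Ckm k.+1 U F -> U u -> pdm i (fun v => - F v) u = - pdm i F u.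
Proof.
move=> cF Uu; apply/matrixP => a b; rewrite [RHS]mxE !pdmE -(pdN i (cF a b) Uu).
by apply: (pd_eq oU) => // v _; rewrite mxE.
Qed.

Lemma pdmB p q k i u (F G : 'rV[R]_m -> 'M[R]_(p, q)) :
  Ckm k.+1 U F -> Ckm k.+1 U G -> U u -> pdm i (fun v => F v - G v) u = pdm i F u - pdm i G u.
Proof. by move=> cF cG Uu; rewrite (pdmD i cF (CkmN cG) Uu) (pdmN i cG Uu). Qed.

Lemma pdm_tr p q i u (F : 'rV[R]_m -> 'M[R]_(p, q)) : pdm i (fun v => (F v)^T) u = (pdm i F u)^T.
Proof. by apply/matrixP => a b; rewrite [RHS]mxE !pdmE; congr (pd _ _ _); apply/funext => v; rewrite mxE. Qed.

Lemma pdm_cst p q i u (A : 'M[R]_(p, q)) : pdm i (fun _ : 'rV[R]_m => A) u = 0.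
Proof. by apply/matrixP => a b; rewrite pdmE mxE pd_cst. Qed.

Lemma pdmM p q r k i u (F : 'rV[R]_m -> 'M[R]_(p, q)) (G : 'rV[R]_m -> 'M[R]_(q, r)) :
  Ckm k.+1 U F -> Ckm k.+1 U G -> U u ->
  pdm i (fun v => F v *m G v) u = pdm i F u *m G u + F u *m pdm i G u.
Proof.
move=> cF cG Uu; apply/matrixP => a b; rewrite pdmE [RHS]mxE [X in X + _]mxE [X in _ + X]mxE -big_split /=.
rewrite (@pd_eq _ _ _ oU _ (fun v => \sum_j F v a j * G v j b)) //; last by move=> v _; rewrite mxE.
rewrite (pd_sum oU _ _ (fun j _ => CkM oU (cF a j) (cG j b)) Uu).
by apply: eq_bigr => j _; rewrite !pdmE (pdM i (cF a j) (cG j b) Uu).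
Qed.

Lemma pdmZ p q k i u (f : 'rV[R]_m -> R) (F : 'rV[R]_m -> 'M[R]_(p, q)) :
  Ck k.+1 U f -> Ckm k.+1 U F -> U u ->
  pdm i (fun v => f v *: F v) u = pd i f u *: F u + f u *: pdm i F u.
Proof.
move=> cf cF Uu; apply/matrixP => a b; rewrite [RHS]mxE [X in X + _]mxE [X in _ + X]mxE !pdmE -(pdM i cf (cF a b) Uu).
by apply: (pd_eq oU) => // v _; rewrite mxE.
Qed.

Lemma pdm_eq p q i u (F G : 'rV[R]_m -> 'M[R]_(p, q)) :
  (forall v, U v -> F v = G v) -> U u -> pdm i F u = pdm i G u.
Proof.
by move=> FG Uu; apply/matrixP => a b; rewrite !pdmE; apply: (pd_eq oU) => // v /FG ->.
Qed.

Lemma pdm_pdmC p q k i j u (F : 'rV[R]_m -> 'M[R]_(p, q)) :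
  Ckm k.+2 U F -> U u -> pdm i (pdm j F) u = pdm j (pdm i F) u.
Proof.
move=> cF Uu; apply/matrixP => a b.
have pE (c : 'I_m) : (fun v => pdm c F v a b) = pd c (fun v => F v a b) by apply/funext => v; exact: pdmE.
apply: (etrans (pdmE i (pdm j F) u a b)); rewrite pE (pdC i j oU (cF a b) Uu) -pE.
exact: esym (pdmE j (pdm i F) u a b).
Qed.

End MatrixCalculus.

Section Frobenius.
Variables (R : realType) (m N : nat) (p : 'rV[R]_m) (rho K : R).
Hypotheses (rho0 : 0 < rho) (K0 : 0 <= K).
Let O : set 'rV[R]_m := ball p rho.
Variable B : 'I_m -> 'rV[R]_m -> 'M[R]_N.
Hypothesis cB : forall j, Ckm 1 O (B j).
Hypothesis bB : forall j u, O u -> forall a b, `|B j u a b| <= K.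
Hypothesis flat : forall i j u, O u ->
  pdm i (B j) u - pdm j (B i) u + B i u *m B j u - B j u *m B i u = 0.
(** The factor 8 makes one correction in [parallel_step] halve the error and leaves the contraction
    factor 1/4 in [parallel_unique]. *)
Hypothesis small : 8 * (m%:R * rho * (N%:R * K)) <= 1.

Definition parallel (s : 'rV[R]_m -> 'rV[R]_N) : Prop :=
  Ckm 1 O s /\ forall j u, O u -> pdm j s u = s u *m B j u.

Let oO : open O. Proof. exact: ball_open. Qed.

Lemma mulB_le (v : 'rV[R]_N) (e : R) j u : 0 <= e -> (forall a, `|v 0 a| <= e) -> O u ->
  forall a, `|(v *m B j u) 0 a| <= N%:R * K * e.
Proof.
move=> e0 ve Ou a; rewrite mxE (le_trans (ler_norm_sum _ _ _)) //.
apply: (@le_trans _ _ (\sum_(b < N) e * K)).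
  by apply: ler_sum => b _; rewrite normrM ler_pM // bB.
by rewrite sumr_const card_ord -mulr_natl; lra.
Qed.

Lemma segment_in q u (t : R) : O q -> O u -> 0 <= t <= 1 -> O (q + t *: (u - q)).
Proof.
rewrite /O -ball_normE /= => Oq Ou /andP[t0 t1].
have -> : p - (q + t *: (u - q)) = (1 - t) *: (p - q) + t *: (p - u).
  by apply/matrixP => a b; rewrite !mxE; ring.
rewrite (le_lt_trans (ler_normD _ _)) // !normrZ (ger0_norm t0) ger0_norm ?subr_ge0 //.
have [->|tn0] := eqVneq t 0; first by rewrite subr0 mul1r mul0r addr0.
have t0' : 0 < t by rewrite lt_def tn0.
have : (1 - t) * `|p - q| <= (1 - t) * rho by rewrite ler_wpM2l ?subr_ge0 // ltW.
have : t * `|p - u| < t * rho by rewrite ltr_pM2l.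
move: `|p - q| `|p - u| => x y h1 h2.
by lra.
Qed.

Lemma rad_bound (f : 'rV[R]_m -> R) (e : R) : Ck 1 O f -> (forall j u, O u -> `|pd j f u| <= e) ->
  forall u, O u -> `|f u - f p| <= m%:R * rho * e.
Proof.
move=> cf fe u Ou.
have [t| |t tI E] := @MVT_segment R (fun t => f (rad p t u)) (fun t => \sum_j (u - p) 0 j * pd j f (rad p t u)) 0 1 ler01.
- rewrite in_itv /= => /andP[t0 t1]; apply: (rad_derive cf Ou).
  by rewrite !ltW.
- apply: cont01P => t t01; exact: (rad_cont (CkS cf) Ou t01).
- have r1 : rad p 1 u = u by rewrite /rad scale1r addrC subrK.
  have r0 : rad p 0 u = p by rewrite /rad scale0r addr0.
  move: E; rewrite r1 r0 subr0 mulr1 => ->.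
  rewrite (le_trans (ler_norm_sum _ _ _)) //; apply: (@le_trans _ _ (\sum_(j < m) rho * e)).
    apply: ler_sum => j _; rewrite normrM; apply: ler_pM => //.
    by rewrite (le_trans (mx_entry_le _ _ _)) // distrC; move: Ou; rewrite /O -ball_normE /= => /ltW.
    by apply: fe; apply: rad_in => //; move: tI; rewrite in_itv.
  by rewrite sumr_const card_ord -[leLHS]mulr_natl mulrA.
Qed.

(** The new section starts from [s p] and adds the radial integral of the forms [s *m B j]. By
    flatness the exterior derivative of these forms is the present error multiplied by [B], so
    [poincare] bounds the new error by [e / 4]; replacing [s] by [s'] in the product with [B] costs
    another [e / 4]. *)
Lemma parallel_step (s : 'rV[R]_m -> 'rV[R]_N) (e : R) : 0 <= e -> Ckm 1 O s ->
  (forall i u, O u -> forall a, `|(pdm i s u - s u *m B i u) 0 a| <= e) ->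
  exists s' : 'rV[R]_m -> 'rV[R]_N, [/\ Ckm 1 O s', s' p = s p,
    (forall u a, O u -> `|s' u 0 a - s u 0 a| <= 2 * m%:R * rho * e) &
    (forall i u, O u -> forall a, `|(pdm i s' u - s' u *m B i u) 0 a| <= e / 2)].
Proof.
move=> e0 cs sE.
have cal j a : Ck 1 O (fun u => (s u *m B j u) 0 a) by exact: CkmM.
have /choice[I HI] a := poincare (fun j => cal j a).
pose s' u := \row_a (s p 0 a + I a u).
have dal i j u : O u -> forall a,
    `|pd i (fun u => (s u *m B j u) 0 a) u - pd j (fun u => (s u *m B i u) 0 a) u| <= 2 * (N%:R * K * e).
  move=> Ou a.
  have -> : pd i (fun u => (s u *m B j u) 0 a) u - pd j (fun u => (s u *m B i u) 0 a) u =
      ((pdm i s u - s u *m B i u) *m B j u) 0 a - ((pdm j s u - s u *m B j u) *m B i u) 0 a.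
    transitivity ((pdm i (fun u => s u *m B j u) u - pdm j (fun u => s u *m B i u) u) 0 a).
      by rewrite mx_subE !pdmE.
    rewrite (pdmM oO i cs (cB j) Ou) (pdmM oO j cs (cB i) Ou).
    transitivity (((pdm i s u - s u *m B i u) *m B j u - (pdm j s u - s u *m B j u) *m B i u
       + s u *m (pdm i (B j) u - pdm j (B i) u + B i u *m B j u - B j u *m B i u)) 0 a).
      congr (fun_of_matrix _ 0 a); rewrite !mulmxBl !mulmxBr !mulmxDr !mulmxA !mulmxN.
      set x1 := pdm i s u *m _; set x2 := s u *m pdm i _ u; set x3 := pdm j s u *m _; set x4 := s u *m pdm j _ u.
      set x5 := s u *m B i u *m B j u; set x6 := s u *m B j u *m B i u.
      by apply/matrixP => b d; rewrite !mxE; ring.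
    by rewrite flat // mulmx0 addr0 mx_subE.
  rewrite (le_trans (ler_normB _ _)) // mulr2n mulrDl mul1r lerD //; apply: mulB_le => //; exact: sE.
have I1 a : Ck 1 O (I a) by case: (HI a).
have cs' : Ckm 1 O s'.
  move=> b a; apply: (Ck_eq oO _ (CkD oO (Ck_cst 1 O (s p 0 a)) (I1 a))) => u _; by rewrite mxE.
have pds' i a u : O u -> pd i (fun u => s' u 0 a) u = pd i (I a) u.
  move=> Ou; rewrite (@pd_eq _ _ _ oO _ (fun v => s p 0 a + I a v)) //; last by move=> v _; rewrite mxE.
  by rewrite (pdD i (Ck_cst 1 O (s p 0 a)) (I1 a) Ou) pd_cst add0r.
have est i a u : O u -> `|pd i (I a) u - (s u *m B i u) 0 a| <= m%:R * rho * (2 * (N%:R * K * e)).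
  move=> Ou; have [_ _ H] := HI a; apply: (H _ u _ Ou i) => i' j' v Ov; exact: dal.
have small' : m%:R * rho * (2 * (N%:R * K * e)) <= e / 4.
  have -> : m%:R * rho * (2 * (N%:R * K * e)) = (8 * (m%:R * rho * (N%:R * K))) * (e / 4) by field.
  by rewrite ler_piMl // divr_ge0.
have close u a : O u -> `|s' u 0 a - s u 0 a| <= 2 * m%:R * rho * e.
  move=> Ou; pose w u := s' u 0 a - s u 0 a.
  have cw : Ck 1 O w by apply: CkB.
  have -> : s' u 0 a - s u 0 a = w u - w p.
    by rewrite /w /s' !mxE; have [_ -> _] := HI a; rewrite addr0 subrr subr0.
  have -> : 2 * m%:R * rho * e = m%:R * rho * (2 * e) by ring.
  apply: rad_bound => // i v Ov.
  rewrite /w (pdB oO i (cs' 0 a) (cs 0 a) Ov) pds' //.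
  have := sE i v Ov a; rewrite mx_subE pdmE => h1.
  have h2 := le_trans (est i a v Ov) small'.
  move: h1 h2; move: (pd i (I a) v) (pd i _ v) ((s v *m B i v) 0 a) => x y z h1 h2.
  have -> : x - y = (x - z) - (y - z) by ring.
  by rewrite (le_trans (ler_normB _ _)) //; lra.
exists s'; split => //.
  by apply/rowP => a; rewrite mxE; have [_ -> _] := HI a; rewrite addr0.
move=> i u Ou a.
have -> : (pdm i s' u - s' u *m B i u) 0 a
   = (pd i (I a) u - (s u *m B i u) 0 a) - ((s' u - s u) *m B i u) 0 a.
  rewrite mulmxBl mx_subE pdmE pds' //.
  by rewrite mx_subE opprB addrA subrK.
have h1 := le_trans (est i a u Ou) small'.
have h2 : `|((s' u - s u) *m B i u) 0 a| <= e / 4.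
  have c0 : 0 <= 2 * m%:R * rho * e by rewrite !mulr_ge0 // ltW.
  have := @mulB_le (s' u - s u) _ i u c0 _ Ou a; move=> H; apply: (le_trans (H _)).
    by move=> b; rewrite mx_subE; exact: close.
  have -> : N%:R * K * (2 * m%:R * rho * e) = (8 * (m%:R * rho * (N%:R * K))) * (e / 4) by field.
  by rewrite ler_piMl // divr_ge0.
rewrite (le_trans (ler_normB _ _)) //; move: h1 h2; set x := `|_|; set y := `|_|; lra.
Qed.

(** Along the segment from the zero [q] to [u], the equation and the mean value theorem bound the
    maximum of the norm of [s] by a quarter of itself. *)
Lemma parallel_unique (s : 'rV[R]_m -> 'rV[R]_N) q u : parallel s -> O q -> s q = 0 -> O u -> s u = 0.
Proof.
move=> [cs ps] Oq sq Ou.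
pose g (t : R) := q + t *: (u - q).
have gO t : 0 <= t <= 1 -> O (g t) by exact: segment_in.
have dg (t : R) : is_derive t (1 : R) g (u - q).
  have e : (fun h : R => h^-1 *: ((g \o shift t) (h *: (1 : R)) - g t)) @ 0^' --> u - q.
    apply: cvg_near_cst; near=> h.
    have h0 : h != 0 by near: h; exact: nbhs_dnbhs_neq.
    rewrite /g /= scaler1; set w := u - q.
    by rewrite scalerDl opprD addrACA subrr add0r addrK scalerA mulVf // scale1r.
  by apply: DeriveDef; [apply/cvg_ex; exists (u - q)|exact/cvg_lim].
have cg (t : R) : {for t, continuous g}.
  by apply: differentiable_continuous; apply/derivable1_diffP; case: (dg t).
have cn : {within `[0, 1], continuous (fun t : R => `|s (g t)|)}.
  apply: cont01P => t t01; apply: (@continuous_comp _ _ _ (fun t => s (g t)) (fun v : 'rV[R]_N => `|v|)); last exact: norm_continuous.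
  apply: (@continuous_comp _ _ _ g s t (cg t)); exact: (Ckm_cont cs (gO t t01)).
have [c] := EVT_max ler01 cn; rewrite in_itv /= => c01 cmax.
set Mx := `|s (g c)| in cmax.
have sM t : 0 <= t <= 1 -> `|s (g t)| <= Mx by move=> t01; apply: cmax; rewrite in_itv.
have M0 : 0 <= Mx by rewrite /Mx.
have dphi a (t : R) : 0 <= t <= 1 ->
    is_derive t (1 : R) (fun t => s (g t) 0 a : R) (\sum_b (u - q) 0 b * (s (g t) *m B b (g t)) 0 a).
  move=> t01; have [d1 d2] := dg t; have := pd_line oO (cs 0 a) (gO t t01) d1.
  rewrite derive1E d2; set x := \sum_b _; set y := \sum_b _; suff -> : x = y by [].
  by apply: eq_bigr => b _; rewrite -ps ?pdmE //; exact: gO.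
have uq j : `|(u - q) 0 j| <= 2 * rho.
  rewrite (le_trans (mx_entry_le _ _ _)) // (_ : u - q = (p - q) - (p - u)); last first.
    by apply/matrixP => a b; rewrite !mxE; ring.
  rewrite (le_trans (ler_normB _ _)) // mulr2n mulrDl mul1r lerD //.
    by move: Oq; rewrite /O -ball_normE => /ltW.
  by move: Ou; rewrite /O -ball_normE => /ltW.
have Mx4 : Mx <= Mx / 4.
  apply: mx_norm_le; first by rewrite divr_ge0.
  move=> i a; rewrite ord1.
  have [t| |t tI E] := @MVT_segment R (fun t => s (g t) 0 a) (fun t => \sum_b (u - q) 0 b * (s (g t) *m B b (g t)) 0 a) 0 c (proj1 (andP c01)).
    rewrite in_itv /= => /andP[t0 tc]; apply: dphi.
    by rewrite ltW //= (le_trans (ltW tc)) //; case/andP: c01.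
    apply: derivable_within_continuous => t; rewrite in_itv /= => /andP[t0 tc].
    by case: (dphi a t _) => //; rewrite t0 (le_trans tc) //; case/andP: c01.
  have t01 : 0 <= t <= 1.
      by move: tI; rewrite in_itv /= => /andP[-> tc]; rewrite (le_trans tc) //; case/andP: c01.
    move: E; rewrite {2}/g scale0r addr0 sq mxE subr0 subr0 => ->.
    rewrite normrM -[leRHS]mulr1; apply: ler_pM => //; last first.
      by case/andP: c01 => c0 c1; rewrite ger0_norm.
    rewrite (le_trans (ler_norm_sum _ _ _)) //; apply: (@le_trans _ _ (\sum_(j < m) 2 * rho * (N%:R * K * Mx))).
      apply: ler_sum => j _; rewrite normrM; apply: ler_pM => //.
      apply: mulB_le => //; last exact: gO.
      by move=> b; rewrite (le_trans (mx_entry_le _ _ _)) // sM.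
    rewrite sumr_const card_ord -[leLHS]mulr_natl.
    have -> : m%:R * (2 * rho * (N%:R * K * Mx)) = (8 * (m%:R * rho * (N%:R * K))) * (Mx / 4) by field.
    by rewrite ler_piMl // divr_ge0.
have Mx0 : Mx <= 0 by lra.
have := sM 1; rewrite ler01 lexx => /(_ isT) h.
rewrite /g scale1r addrC subrK in h.
by apply/eqP; rewrite -normr_le0 (le_trans h).
Unshelve. all: by end_near. Qed.

Lemma pow2_small (C e : R) : 0 < e -> exists k, C / 2 ^+ k <= e.
Proof.
move=> e0; exists (Num.bound (C / e)); rewrite ler_pdivrMr ?exprn_gt0 // -ler_pdivrMl // mulrC.
by apply: ltW; apply: upper_nthrootP.
Qed.

(** [parallel_step] is iterated from the constant section [s0]. The errors and the successive
    distances decay like [2 ^- k], so the iterates converge uniformly, and the equation passes to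
    the limit through difference quotients. *)
Lemma parallel_exists (s0 : 'rV[R]_N) : exists s, parallel s /\ s p = s0.
Proof.
pose e0 : R := N%:R * K * `|s0|.
have e00 : 0 <= e0 by rewrite !mulr_ge0.
pose P k (s : 'rV[R]_m -> 'rV[R]_N) := [/\ Ckm 1 O s, s p = s0 &
  forall i u, O u -> forall a, `|(pdm i s u - s u *m B i u) 0 a| <= e0 / 2 ^+ k].
have P0 : P 0%N (fun _ => s0).
  split=> [|//|i u Ou a]; first exact: Ckm_cst.
  rewrite pdm_cst sub0r mxE normrN expr0 divr1; apply: mulB_le => // b; exact: mx_entry_le.
(* The index travels with the section, and a section outside the invariant [P] is left alone: this
   makes the step a total function to which choice applies. *)
have stepx (ks : nat * ('rV[R]_m -> 'rV[R]_N)) : exists s', P ks.1 ks.2 ->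
    P ks.1.+1 s' /\ forall u a, O u -> `|s' u 0 a - ks.2 u 0 a| <= 2 * m%:R * rho * e0 / 2 ^+ ks.1.
  case: ks => k s /=; have [[cs sp sE]|nP] := pselect (P k s); last by exists s => /nP.
  have ek : 0 <= e0 / 2 ^+ k by rewrite divr_ge0 // exprn_ge0.
  have [s' [h1 h2 h3 h4]] := parallel_step ek cs sE.
  exists s' => _; split; last by move=> u a Ou; rewrite -[leRHS]mulrA; exact: h3.
  split=> //; first by rewrite h2.
  by move=> i u Ou a; rewrite exprSr invfM mulrA; exact: h4.
have [F HF] := choice stepx.
pose S := fix S k := match k with 0%N => (fun _ => s0) | k'.+1 => F (k', S k') end.
have PS k : P k (S k) by elim: k => [|k IH] //=; exact: (HF (k, S k) IH).1.
pose c := 2 * m%:R * rho * e0.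
have c0 : 0 <= c by rewrite !mulr_ge0 // ltW.
have dS k u a : O u -> `|S k.+1 u 0 a - S k u 0 a| <= c / 2 ^+ k.
  by move=> Ou; exact: (HF (k, S k) (PS k)).2.
have limx (ua : 'rV[R]_m * 'I_N) : exists l, O ua.1 -> forall k, `|l - S k ua.1 0 ua.2| <= 2 * c / 2 ^+ k.
  case: ua => u a /=; have [Ou|nO] := pselect (O u); last by exists 0 => /nO.
  have [l Hl] := dyadic_limit c0 (fun k => dS k u a Ou).
  by exists l.
have [l Hl] := choice limx.
pose s (u : 'rV[R]_m) := \row_a l (u, a).
have sS k u a : O u -> `|s u 0 a - S k u 0 a| <= 2 * c / 2 ^+ k.
  by move=> Ou; rewrite mxE; exact: (Hl (u, a) Ou).
have sc a u : O u -> {for u, continuous (fun v : 'rV[R]_m => s v 0 a)}.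
  move=> Ou; apply: cont_le => e e1.
  have e3 : 0 < e / 3 by rewrite divr_gt0.
  have [k hk] := pow2_small (2 * c) e3.
  have [cSk _ _] := PS k.
  have nS : \forall v \near u, `|S k u 0 a - S k v 0 a| <= e / 3.
    by have /cvgrPdist_le/(_ _ e3) := Ck_cont (cSk 0 a) Ou.
  apply: filterS2 nS (open_near oO Ou) => v hv Ov.
  have h1 := le_trans (sS k u a Ou) hk; have h2 := le_trans (sS k v a Ov) hk.
  rewrite (_ : s u 0 a - s v 0 a = (s u 0 a - S k u 0 a) + (S k u 0 a - S k v 0 a) - (s v 0 a - S k v 0 a)); last by ring.
  rewrite (le_trans (ler_normB _ _)) // (_ : e = (e / 3 + e / 3) + e / 3); last by field.
  by rewrite lerD // (le_trans (ler_normD _ _)) // lerD.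
pose D i a u := (s u *m B i u) 0 a.
have Dc i a u : O u -> {for u, continuous (D i a)}.
  have cs0 : Ckm 0 O s.
    move=> b b'; split=> // v Ov; apply: near_cont (sc b' v Ov); near=> w; by rewrite ord1.
  by move=> Ou; exact: (Ck_cont (CkmM oO cs0 (CkmS (cB i)) 0 a) Ou).
pose C := e0 + N%:R * K * (2 * c).
have SD k i a u : O u -> `|pd i (fun v => S k v 0 a) u - D i a u| <= C / 2 ^+ k.
  move=> Ou; have [_ _ /(_ i u Ou a)] := PS k.
  rewrite mx_subE pdmE => h1.
  have h2 : `|((S k u - s u) *m B i u) 0 a| <= N%:R * K * (2 * c / 2 ^+ k).
    have q : 0 <= 2 * c / 2 ^+ k by rewrite divr_ge0 // ?exprn_ge0 // mulr_ge0.
    by apply: mulB_le => // b; rewrite mx_subE distrC; exact: sS.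
  move: h2; rewrite mulmxBl mx_subE => h2.
  rewrite -(subrKA ((S k u *m B i u) 0 a)) (le_trans (ler_normD _ _)) // /C mulrDl lerD //.
  by rewrite -mulrA.
have ds i a u : O u -> is_derive u (ebase R i) (fun v : 'rV[R]_m => s v 0 a : R) (D i a u).
  move=> Ou.
  suff cI : (fun h : R => h^-1 *: (((fun v : 'rV[R]_m => s v 0 a) \o shift u) (h *: ebase R i) - s u 0 a)) h @[h --> 0^'] --> D i a u.
    by apply: DeriveDef; [apply/cvg_ex; exists (D i a u)|exact/cvg_lim].
  apply/cvgrPdist_le => e e1; have e2 : 0 < e / 2 by rewrite divr_gt0.
  have nD : \forall v \near u, `|D i a u - D i a v| <= e / 2.
    by have /cvgrPdist_le/(_ _ e2) := Dc i a u Ou.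
  have [d d0 dB] := near_ball2 nD (open_near oO Ou).
  near=> h.
  have h0 : h != 0 by near: h; exact: nbhs_dnbhs_neq.
  have hd : `|h| < d by near: h; exact: dnbhs0_lt.
  have inB (t : R) : `|t| <= `|h| -> ball u d (u + t *: ebase R i).
    move=> sh; rewrite -ball_normE /= opprD addNKr normrN (le_lt_trans _ hd) // (le_trans _ sh) //.
    rewrite normrZ ler_piMr // mx_norm_le // => x y; rewrite mxE; case: (_ && _); by rewrite /= ?normr1 ?normr0.
  have Oh := (dB _ (inB h (lexx _))).2.
  have ah : 0 < `|h| by rewrite normr_gt0.
  (* The index depends on [h]: replacing the limit by the iterate in the difference quotient costs a
     multiple of [c / 2 ^+ k] divided by the norm of [h]. *)
  have [k hk] := pow2_small (C + 4 * c / `|h|) e2.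
  rewrite /= [h *: _ + u]addrC -(ler_pM2l ah) -normrM mulrBr -[h^-1 *: (s _ 0 a - _)]/(h^-1 * (s (u + h *: ebase R i) 0 a - s u 0 a)) mulVKf //.
  have [cSk _ _] := PS k.
  have [t th Et] : exists2 t, `|t| <= `|h| & S k (u + h *: ebase R i) 0 a - S k u 0 a
      = h * 'D_(ebase R i) (fun v => S k v 0 a) (u + t *: ebase R i).
    by apply: MVT_line => t th; apply: (Ck1P (cSk 0 a)); exact: (dB _ (inB t th)).2.
  have [hD Ot] := dB _ (inB t th).
  have h1 := SD k i a _ Ot; rewrite pdE in h1.
  have h2 := sS k u a Ou; have h3 := sS k _ a Oh.
  move: hk Et hD h1 h2 h3; rewrite mulrDl.
  move: ('D_(ebase R i) _ _) (D i a _) (D i a u) (s u 0 a) (S k u 0 a) (s (u + h *: ebase R i) 0 a) (S k (u + h *: ebase R i) 0 a).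
  move=> x y z su Su sh Sh hk Et hD h1 h2 h3.
  have -> : h * z - (sh - su) = h * (z - y) - h * (x - y) - (sh - Sh) + (su - Su) by rewrite !mulrBr -Et; ring.
  have q1 : `|h * (z - y)| <= `|h| * (e / 2) by rewrite normrM ler_wpM2l.
  have q2 : `|h * (x - y)| <= `|h| * (C / 2 ^+ k) by rewrite normrM ler_wpM2l.
  have q3 : `|h| * (C / 2 ^+ k) + 2 * (2 * c / 2 ^+ k) <= `|h| * (e / 2).
    rewrite (le_trans _ (ler_wpM2l (ltW ah) hk)) // mulrDr lerD2l.
    have -> : `|h| * (4 * c / `|h| / 2 ^+ k) = 2 * (2 * c / 2 ^+ k); last exact: lexx.
    have a0 : `|h| != 0 by rewrite gt_eqF.
    have p0 : (2 : R) ^+ k != 0 by rewrite expf_neq0.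
    by move: ((2 : R) ^+ k) p0 => P2 p0; field; rewrite a0 p0.
  rewrite (le_trans (ler_normD _ _)) //; rewrite -lerBrDr (le_trans (ler_normB _ _)) //.
  rewrite -lerBrDr (le_trans (ler_normB _ _)) //.
  move: q1 q2 q3 h2 h3; set x1 := `|_|; set x2 := `|_|; set x3 := _ / 2 ^+ k; set x4 := `|_|.
  set x5 := _ / 2 ^+ k; set x6 := `|_|; lra.
exists s; split; last first.
  apply/rowP => a; have Op : O p by exact: ballxx.
  apply/eqP; rewrite -subr_eq0 -normr_le0; apply/ler_addgt0Pl => e e1; rewrite addr0.
  have [k hk] := pow2_small (2 * c) e1.
  by have := sS k p a Op; have [_ -> _] := PS k => h; exact: le_trans h hk.
have cs : Ckm 1 O s.
  move=> b a; rewrite ord1; split; first exact: sc.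
  move=> i; split; first by move=> u /(ds i a)[].
  split=> // u Ou; apply: near_cont (Dc i a u Ou).
  by apply: filterS (open_near oO Ou) => v /(ds i a)[_ ->].
split=> // j u Ou; apply/rowP => a; rewrite pdmE pdE.
by have [_ ->] := ds j a u Ou.
Unshelve. all: by end_near. Qed.

End Frobenius.

Section Clamp.
Variables (R : realType) (a b : R).
Hypothesis ab : a <= b.

(** The retraction of the line onto [a, b]; composing with it turns continuity within the interval
    into continuity on the whole line. *)
Definition clamp (t : R) : R := if t <= a then a else if b <= t then b else t.

Lemma clamp_in t : a <= clamp t <= b.
Proof. rewrite /clamp; case: (leP t a) => ta; first by rewrite lexx.
by case: (leP b t) => tb; rewrite ?lexx ?ab ?(ltW ta) ?(ltW tb). Qed.

Lemma clamp_id t : a <= t <= b -> clamp t = t.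
Proof.
rewrite /clamp => /andP[at_ tb]; case: leP => [ta|_]; first by apply/le_anti; rewrite at_ ta.
by case: leP => // bt; apply/le_anti; rewrite tb bt.
Qed.

Lemma clamp_lip s t : `|clamp s - clamp t| <= `|s - t|.
Proof.
have := ler_norm (s - t); have := ler_norm (t - s); rewrite (distrC t s).
rewrite ler_norml /clamp; move: `|s - t| (ab) => x ab'.
case: (leP s a) => ?; case: (leP b s) => ?; case: (leP t a) => ?; case: (leP b t) => ?;
  move=> ? ?; apply/andP; split; lra.
Qed.

Lemma clamp_cont : continuous clamp.
Proof.
move=> t; apply/cvgrPdist_le => e e0.
have H : \forall s \near (t : R), ball (t : R) e s := nbhsx_ballx (t : R) e e0.
by apply: filterS H => s; rewrite -ball_normE /= => /ltW; exact: le_trans (clamp_lip _ _).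
Qed.

Lemma within_cvg (X Y : topologicalType) (A : set X) (f : X -> Y) x :
  {within A, continuous f} -> A x -> f @ within A (nbhs x) --> f x.
Proof. by move=> cf Ax; have := cf x; rewrite /prop_for /continuous_at nbhs_subspace_in. Qed.

Lemma clamp_path (T : topologicalType) (g : R -> T) :
  {within `[a, b], continuous g} -> continuous (fun t => g (clamp t)).
Proof.
move=> cg t; have ct : `[a, b]%classic (clamp t) by rewrite /= in_itv; exact: clamp_in.
apply: cvg_trans (within_cvg cg ct); move=> A; rewrite /= /within => /= hA.
have : \forall s \near t, `[a, b]%classic (clamp s) -> A (g (clamp s)) by exact: (clamp_cont hA).
by apply: filterS => s; apply; rewrite /= in_itv; exact: clamp_in.
Qed.

End Clamp.

(** * Continuation of germs *)

Section Monodromy.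
Variables (R : realType) (T : topologicalType).
Implicit Types (p q r : T) (h k : T -> R).

Lemma clamp_square (H : R * R -> T) : {within `[0%R, 1%R]%classic `*` `[0%R, 1%R]%classic, continuous H} ->
  continuous (fun z : R * R => H (clamp 0 1 z.1, clamp 0 1 z.2)).
Proof.
move=> cH z; pose c (z : R * R) := (clamp 0 1 z.1, clamp 0 1 z.2).
have ct y : (`[0%R, 1%R]%classic `*` `[0%R, 1%R]%classic) (c y).
  by split; rewrite /= in_itv; exact: clamp_in.
have cc : continuous c.
  move=> y.
  have c1 := @continuous_comp _ _ _ (@fst R R) (clamp 0 1) y cvg_fst (@clamp_cont R 0 1 ler01 _).
  have c2 := @continuous_comp _ _ _ (@snd R R) (clamp 0 1) y cvg_snd (@clamp_cont R 0 1 ler01 _).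
  exact: (cvg_pair (c1 _) (c2 _)).
apply: cvg_trans (within_cvg cH (ct z)); move=> A; rewrite /= /within => /= hA.
have : \forall s \near z, (`[0%R, 1%R]%classic `*` `[0%R, 1%R]%classic) (c s) -> A (H (c s)) by exact: (cc _ _ hA).
by apply: filterS => s; apply; exact: ct.
Qed.

(** Connectedness of [a, b]: the indicator function of [P], made total by [clamp], is continuous, so
    the intermediate value theorem forbids a jump from 1 to 0. *)
Lemma locally_constant (P : R -> Prop) (a b : R) : a <= b ->
  (forall t : R, a <= t <= b -> \forall s \near t, a <= s <= b -> (P s <-> P t)) -> P a -> P b.
Proof.
move=> ab HP Pa; apply: contrapT => nPb.
pose f t : R := if pselect (P (clamp a b t)) then 1 else 0.
have cf : continuous f.
  move=> t; apply: cvg_near_cst.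
  have H : \forall s \near t, a <= clamp a b s <= b -> (P (clamp a b s) <-> P (clamp a b t)).
    exact: (@clamp_cont R a b ab t _ (HP _ (clamp_in ab t))).
  near=> s; have E : P (clamp a b s) <-> P (clamp a b t) by apply: (near H s) => //; exact: clamp_in.
  by rewrite /f; case: pselect => h1; case: pselect => h2 //; [case: h2; apply/E|case: h1; apply/E].
have fa : f a = 1.
  by rewrite /f; case: pselect => // -[]; rewrite clamp_id // lexx.
have fb : f b = 0.
  by rewrite /f; case: pselect => // h; case: nPb; move: h; rewrite clamp_id // lexx ab.
have [||c _ fc] := @IVT R f a b 2^-1 ab.
- exact: continuous_subspaceT.
- rewrite fa fb; apply/andP; split; rewrite /Num.min /Num.max; case: ltP; lra.
- by move: fc; rewrite /f; case: (pselect (P (clamp a b c))) => [h|h] /= e; lra.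
Unshelve. all: by end_near. Qed.

(** Equality of the germs of [h] and [k] at [p]. *)
Definition geq p h k := \forall q \near p, h q = k q.

Lemma geq_refl p h : geq p h h. Proof. exact: nearW. Qed.
Lemma geq_sym p h k : geq p h k -> geq p k h. Proof. by apply: filterS => q ->. Qed.
Lemma geq_trans p h k l : geq p h k -> geq p k l -> geq p h l.
Proof. by move=> H1 H2; apply: filterS2 H1 H2 => q -> ->. Qed.
Lemma near_near (P : T -> Prop) p : (\forall q \near p, P q) -> \forall q \near p, \forall r \near q, P r.
Proof. by move=> /nbhs_interior. Qed.

(** [L p h] reads: [h] is a solution near [p]. The equation itself stays abstract; the argument uses
    only that being a solution is local and open, and that simply covered sets exist. *)
Variable L : T -> (T -> R) -> Prop.
Hypothesis L_geq : forall p h k, geq p h k -> L p h -> L p k.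
Hypothesis L_near : forall p h, L p h -> \forall q \near p, L q h.

(* [U] is simply covered: germs of solutions on [U] extend uniquely to [U]. *)
Definition nice (U : set T) : Prop :=
  [/\ open U,
   forall q h, U q -> L q h -> exists k, (forall r, U r -> L r k) /\ geq q k h,
   forall k k' q, (forall r, U r -> L r k) -> (forall r, U r -> L r k') ->
     U q -> geq q k k' -> forall r, U r -> k r = k' r &
   forall q r, U q -> U r -> exists g : R -> T,
     [/\ continuous g, g 0 = q, g 1 = r & forall t, U (g t)]].

Hypothesis nice_cover : forall p, exists2 U, nice U & U p.

(** Continuation of a germ along [g], that is, a lift of the path to the space of germs of
    solutions: [K t] is the germ at [g t], and it is locally represented by one function. *)
Definition germ_lift (g : R -> T) (K : R -> T -> R) (a b : R) : Prop :=
  forall t : R, a <= t <= b -> L (g t) (K t) /\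
    \forall s \near t, a <= s <= b -> geq (g s) (K s) (K t).

Lemma lift_nice (g : R -> T) K a b (t : R) U : continuous g -> germ_lift g K a b -> a <= t <= b -> nice U -> U (g t) ->
  exists k, (forall r, U r -> L r k) /\
    \forall s \near t, a <= s <= b -> U (g s) /\ geq (g s) (K s) k.
Proof.
move=> cg lK tab [oU U1 U2 _] Ug; have [Lt Kt] := lK t tab.
have [k [Lk kE]] := U1 _ _ Ug Lt; exists k; split=> //.
have nU : \forall s \near t, U (g s) := cg t _ (open_near oU Ug).
have nk : \forall s \near t, geq (g s) k (K t) := cg t _ (near_near kE).
apply: filterS3 nU nk Kt => s Us ks Ks sab; split=> //.
by apply: geq_trans (Ks sab) _; exact: geq_sym.
Qed.

(** Over a nice set each lift is the germ of a single solution on that set, and two such solutions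
    agree at one point's germ exactly when they agree throughout. Equality of the lifts is therefore
    locally constant in time. *)
Lemma lift_unique g K K' a b : a <= b -> continuous g -> germ_lift g K a b -> germ_lift g K' a b ->
  geq (g a) (K a) (K' a) -> geq (g b) (K b) (K' b).
Proof.
move=> ab cg lK lK' H; apply: (@locally_constant (fun t => geq (g t) (K t) (K' t)) a b ab) => // t tab.
have [U nU Ut] := nice_cover (g t).
have [k [Lk nk]] := lift_nice cg lK tab nU Ut; have [k' [Lk' nk']] := lift_nice cg lK' tab nU Ut.
have [oU _ U2 _] := nU.
have key (s : R) : U (g s) -> geq (g s) (K s) k -> geq (g s) (K' s) k' ->
   (geq (g s) (K s) (K' s) <-> forall r, U r -> k r = k' r).
  move=> Us Kk Kk'; split=> E.
    apply: (U2 k k' (g s)) => //; apply: geq_trans (geq_sym Kk) _; exact: geq_trans E Kk'.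
  apply: geq_trans Kk _; apply: geq_trans (geq_sym Kk').
  by apply: filterS (open_near oU Us) => r /E.
have [Ut1 Kt] := nbhs_singleton nk tab; have [_ Kt'] := nbhs_singleton nk' tab.
apply: filterS2 nk nk' => s hs hs' sab.
have [Us Ks] := hs sab; have [_ Ks'] := hs' sab.
exact: iff_trans (key _ Us Ks Ks') (iff_sym (key _ Ut Kt Kt')).
Qed.

Lemma lift_sub g K a b a' b' : a <= a' -> b' <= b -> germ_lift g K a b -> germ_lift g K a' b'.
Proof.
move=> aa bb lK t /andP[t1 t2]; have tab : a <= t <= b by rewrite (le_trans aa t1) (le_trans t2 bb).
have [Lt Kt] := lK t tab; split=> //; apply: filterS Kt => s H /andP[s1 s2].
by apply: H; rewrite (le_trans aa s1) (le_trans s2 bb).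
Qed.

Lemma lift_const (g : R -> T) h (a b : R) : (forall t : R, a <= t <= b -> L (g t) h) -> germ_lift g (fun _ => h) a b.
Proof. by move=> Lh t /Lh; split=> //; apply: (@nearW _ (nbhs t)) => s _; exact: geq_refl. Qed.

(** Being liftable up to time [t] is locally constant in [t]: inside a nice set the lift is
    prolonged by the constant solution [k] that represents its last germ. *)
Lemma lift_exists g h : continuous g -> L (g 0) h -> exists K, germ_lift g K 0 1 /\ geq (g 0) (K 0) h.
Proof.
move=> cg Lh; apply: (@locally_constant (fun t => exists K, germ_lift g K 0 t /\ geq (g 0) (K 0) h) 0 1 ler01).
  move=> t t01; have [U nU Ut] := nice_cover (g t); have [oU U1 _ _] := nU.
  have nUg : \forall s \near t, U (g s) := cg t _ (open_near oU Ut).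
  have /nbhs_ballP[d /= d0 dB] := nUg.
  have ext (s1 s2 : R) : ball t d s1 -> ball t d s2 -> 0 <= s1 -> s1 <= s2 ->
     (exists K, germ_lift g K 0 s1 /\ geq (g 0) (K 0) h) -> exists K, germ_lift g K 0 s2 /\ geq (g 0) (K 0) h.
    move=> B1 B2 s10 s12 [K [lK K0]].
    have s1I : 0 <= s1 <= s1 by rewrite s10 lexx.
    have [k [Lk nk]] := lift_nice cg lK s1I nU (dB _ B1).
    have [_ Kk] := nbhs_singleton nk s1I.
    exists (fun s => if s <= s1 then K s else k); split; last by rewrite s10.
    have inU s : s1 <= s <= s2 -> U (g s).
      move=> /andP[h1 h2]; apply: dB; move: B1 B2; rewrite -ball_normE /= !ltr_distl.
      by move=> /andP[a1 a2] /andP[a3 a4]; apply/andP; split; lra.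
    move=> s /andP[s0 s2']; case: leP => ss1.
      have sI : 0 <= s <= s1 by rewrite s0.
      have [Ls Ks] := lK s sI; split=> //.
      have [es|ns] := eqVneq s s1.
        rewrite es in Ks *.
        have nK : \forall r \near s1, geq (g r) (K s1) k := cg s1 _ (near_near Kk).
        apply: filterS2 Ks nK => r h1 h2 /andP[r0 r2].
        case: leP => rs1; first by apply: h1; rewrite r0.
        exact: geq_sym.
      have lt : s < s1 by rewrite lt_neqAle ns.
      apply: filterS2 Ks (lt_nbhsl lt) => r h1 h2 /andP[r0 r2].
      by rewrite (ltW h2); apply: h1; rewrite r0 ltW.
    split; first by apply: Lk; apply: inU; rewrite (ltW ss1).
    by apply: filterS (lt_nbhsr ss1) => r rs1 _; rewrite leNgt rs1 /=; exact: geq_refl.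
  have res (s1 s2 : R) : s1 <= s2 -> (exists K, germ_lift g K 0 s2 /\ geq (g 0) (K 0) h) ->
     exists K, germ_lift g K 0 s1 /\ geq (g 0) (K 0) h.
    by move=> s12 [K [lK K0]]; exists K; split=> //; exact: lift_sub lK.
  have nB : \forall s \near t, ball t d s by exact: nbhsx_ballx.
  have Bt : ball t d t by exact: ballxx.
  apply: filterS nB => s Bs /andP[s0 s1].
  have [st|/ltW ts] := leP s t; first by split; [exact: ext|exact: res].
  by split; [exact: res|apply: ext => //; case/andP: t01].
exists (fun _ => h); split; last exact: geq_refl.
by apply: lift_const => t /andP[t0 t1]; rewrite (_ : t = 0) //; apply/le_anti; rewrite t1.
Qed.

Lemma lift_affine g K (a b c d : R) : 0 <= c -> germ_lift g K a b ->
  forall a' b', a <= c * a' + d -> c * b' + d <= b -> germ_lift (fun t => g (c * t + d)) (fun t => K (c * t + d)) a' b'.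
Proof.
move=> c0 lK a' b' ha hb t /andP[t1 t2].
have tab (s : R) : a' <= s <= b' -> a <= c * s + d <= b.
  move=> /andP[s1 s2]; apply/andP; split.
    by rewrite (le_trans ha) // lerD2r ler_wpM2l.
  by rewrite (le_trans _ hb) // lerD2r ler_wpM2l.
have [Lt Kt] := lK _ (tab t (introT andP (conj t1 t2))); split=> //.
have cc : {for t, continuous (fun s : R => c * s + d)}.
  by apply: cvgD; [apply: cvgM; [exact: cvg_cst|exact: cvg_id]|exact: cvg_cst].
have H : \forall s \near t, a <= c * s + d <= b -> geq (g (c * s + d)) (K (c * s + d)) (K (c * t + d)) := cc _ Kt.
by apply: filterS H => s hs /tab /hs.
Qed.

Lemma lift_rev g K : germ_lift g K 0 1 -> germ_lift (fun t => g (1 - t)) (fun t => K (1 - t)) 0 1.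
Proof.
move=> lK t t01.
have r01 (s : R) : 0 <= s <= 1 -> 0 <= 1 - s <= 1 by move=> /andP[? ?]; apply/andP; split; lra.
have [Lt Kt] := lK _ (r01 _ t01); split=> //.
have cc : {for t, continuous (fun s : R => 1 - s)} by apply: cvgB; [exact: cvg_cst|exact: cvg_id].
have H : \forall s \near t, 0 <= 1 - s <= 1 -> geq (g (1 - s)) (K (1 - s)) (K (1 - t)) := cc _ Kt.
by apply: filterS H => s hs /r01 /hs.
Qed.

Lemma lift_eq g g' K a b : (forall t, a <= t <= b -> g t = g' t) -> germ_lift g K a b -> germ_lift g' K a b.
Proof.
move=> gg lK t tab; have [Lt Kt] := lK t tab; rewrite -gg //; split=> //.
by apply: filterS Kt => s hs sab; rewrite -gg //; exact: hs.
Qed.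

(** The lifts [K s] are not assumed to vary continuously with [s]. The comparison with nearby
    parameters is transported from [t = 0] to [t = 1]: around each point of the square one solution
    on a nice set represents all the lifts concerned, and the neighbourhood of [s] may shrink at
    each stage. *)
Lemma square_transport (H : R * R -> T) (K : R -> R -> T -> R) :
  continuous H -> (forall s : R, 0 <= s <= 1 -> germ_lift (fun t => H (s, t)) (K s) 0 1) ->
  (forall s s' : R, 0 <= s <= 1 -> 0 <= s' <= 1 -> geq (H (s', 0)) (K s' 0) (K s 0)) ->
  forall s : R, 0 <= s <= 1 -> \forall s' \near s, 0 <= s' <= 1 -> geq (H (s', 1)) (K s' 1) (K s 1).
Proof.
move=> cH lK K0 s s01.
have cHs (s' : R) : continuous (fun t => H (s', t)).
  move=> t; apply: (@continuous_comp _ _ _ (fun t : R => (s', t)) H t); last exact: cH.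
  exact: (cvg_pair (cvg_cst s') (@cvg_id _ (nbhs t))).
apply: (@locally_constant (fun t => \forall s' \near s, 0 <= s' <= 1 -> geq (H (s', t)) (K s' t) (K s t)) 0 1 ler01); last first.
  by apply: (@nearW _ (nbhs s)) => s' s'01; exact: K0.
move=> t t01; have [U nU Ut] := nice_cover (H (s, t)); have [oU _ U2 _] := nU.
have [k [Lk nk]] := lift_nice (cHs s) (lK s s01) t01 nU Ut.
have [[A B] /= [nA nB] AB] : \forall z \near (s, t), U (H z) := cH (s, t) _ (open_near oU Ut).
have /nbhs_ballP[d /= d0 dB] : \forall t' \near t, B t' /\ (0 <= t' <= 1 -> geq (H (s, t')) (K s t') k).
  by apply: filterS2 nB nk => t' Bt' h; split=> // /h[].
have nd : \forall t' \near t, ball t d t' by exact: nbhsx_ballx.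
have cHt (t' : R) : {for s, continuous (fun s' => H (s', t'))}.
  apply: (@continuous_comp _ _ _ (fun s' : R => (s', t')) H s); last exact: cH.
  exact: (cvg_pair (@cvg_id _ (nbhs s)) (cvg_cst t')).
have key (t1 t2 : R) : ball t d t1 -> ball t d t2 -> 0 <= t1 <= 1 -> 0 <= t2 <= 1 ->
   (\forall s' \near s, 0 <= s' <= 1 -> geq (H (s', t1)) (K s' t1) (K s t1)) ->
   (\forall s' \near s, 0 <= s' <= 1 -> geq (H (s', t2)) (K s' t2) (K s t2)).
  move=> B1 B2 I1 I2 P1.
  have n1 : \forall s' \near s, geq (H (s', t1)) (K s t1) k := cHt t1 _ (near_near ((dB _ B1).2 I1)).
  have n2 : \forall s' \near s, geq (H (s', t2)) (K s t2) k := cHt t2 _ (near_near ((dB _ B2).2 I2)).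
  have n3 : \forall s' \near s, geq (H (s', t1)) (K s t1) k /\ geq (H (s', t2)) (K s t2) k.
    by apply: filterS2 n1 n2.
  apply: filterS3 P1 n3 nA => s' P1s [n1s n2s] As' s'01.
  have e1 : geq (H (s', t1)) (K s' t1) k by exact: geq_trans (P1s s'01) n1s.
  apply: geq_trans (geq_sym n2s).
  have inU (t' : R) : ball t d t' -> U (H (s', t')).
    by move=> /dB[Bt' _]; exact: (AB (s', t') (conj As' Bt')).
  have between (x y z : R) : ball t d x -> ball t d y -> x <= z <= y -> ball t d z.
    rewrite -ball_normE /= !ltr_distl => /andP[a1 a2] /andP[a3 a4] /andP[a5 a6].
    by apply/andP; split; lra.
  have [t12|/ltW t21] := leP t1 t2.
    apply: (@lift_unique (fun t => H (s', t)) (K s') (fun _ => k) t1 t2) => //.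
      by apply: lift_sub (lK s' s'01); [case/andP: I1|case/andP: I2].
    by apply: lift_const => z zI; apply: Lk; apply: inU; exact: between zI.
  (* [lift_unique] only moves forward in time, so for [t2] before [t1] the path is run backwards. *)
  have lr : germ_lift (fun x => H (s', 1 - x)) (fun x => K s' (1 - x)) 0 1 := lift_rev (lK s' s'01).
  have := @lift_unique (fun x => H (s', 1 - x)) (fun x => K s' (1 - x)) (fun _ => k) (1 - t1) (1 - t2).
  rewrite !subKr; apply => //.
    by rewrite lerD2l lerN2.
    move=> x; apply: (@continuous_comp _ _ _ (fun x : R => 1 - x) (fun t => H (s', t)) x); last exact: cHs.
    by apply: cvgB; [exact: cvg_cst|exact: cvg_id].
    by apply: lift_sub lr; case/andP: I1 => *; case/andP: I2 => *; lra.
    apply: lift_const => z /andP[z1 z2]; apply: Lk; apply: inU; apply: (between t2 t1) => //.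
    by apply/andP; split; lra.
apply: filterS nd => t' Bt' t'01.
by split; apply: key => //; exact: ballxx.
Qed.

(** Lift every curve of a null homotopy with the same initial germ. The final germ is locally
    constant in the homotopy parameter; it is [K 1] on the loop itself and [K 0] on the constant
    curve. *)
Lemma loop_transport (g : R -> T) K : simply_connected R T -> continuous g -> g 0 = g 1 ->
  germ_lift g K 0 1 -> geq (g 0) (K 1) (K 0).
Proof.
move=> [_ sc] cg g01 lK.
have [H [cH HE]] := sc g (continuous_subspaceT cg) g01.
pose H' (z : R * R) := H (clamp 0 1 z.1, clamp 0 1 z.2).
have cH' : continuous H' := clamp_square cH.
have c0 : clamp 0 1 0 = 0 :> R by rewrite clamp_id // lexx ler01.
have c1 : clamp 0 1 1 = 1 :> R by rewrite clamp_id // lexx ler01.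
have z01 : 0 <= (0 : R) <= 1 by rewrite lexx ler01.
have o01 : 0 <= (1 : R) <= 1 by rewrite lexx ler01.
have H'E (t : R) : 0 <= t <= 1 -> [/\ H' (0, t) = g t, H' (1, t) = g 0, H' (t, 0) = g 0 & H' (t, 1) = g 0].
  by move=> t01; rewrite /H' /= c0 c1 clamp_id //; exact: HE.
have cHs (s' : R) : continuous (fun t => H' (s', t)).
  move=> t; apply: (@continuous_comp _ _ _ (fun t : R => (s', t)) H' t); last exact: cH'.
  exact: (cvg_pair (cvg_cst s') (@cvg_id _ (nbhs t))).
have LK0 : L (g 0) (K 0) by case: (lK 0 z01).
have ex (s : R) : exists Ks, 0 <= s <= 1 -> germ_lift (fun t => H' (s, t)) Ks 0 1 /\ geq (g 0) (Ks 0) (K 0).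
  have [s01|ns] := boolP (0 <= s <= 1); last by exists K.
  have Hs0 : H' (s, 0) = g 0 by case: (H'E s s01).
  have [|Ks [l1 l2]] := @lift_exists (fun t => H' (s, t)) (K 0) (cHs s); first by rewrite Hs0.
  by exists Ks => _; rewrite Hs0 in l2.
have [Ks HKs] := choice ex.
have ST := @square_transport H' Ks cH' (fun s s01 => (HKs s s01).1).
have {}ST (s : R) : 0 <= s <= 1 -> \forall s' \near s, 0 <= s' <= 1 -> geq (g 0) (Ks s' 1) (Ks s 1).
  move=> s01; have : \forall s' \near s, 0 <= s' <= 1 -> geq (H' (s', 1)) (Ks s' 1) (Ks s 1).
    apply: ST => // a a' a01 a'01.
    have [_ _ -> _] := H'E a' a'01.
    exact: geq_trans (HKs a' a'01).2 (geq_sym (HKs a a01).2).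
  by apply: filterS => s' hs s'01; have [_ _ _ <-] := H'E s' s'01; exact: hs.
have e1 : geq (g 0) (Ks 1 1) (Ks 0 1).
  apply: (@locally_constant (fun s => geq (g 0) (Ks s 1) (Ks 0 1)) 0 1 ler01); last exact: geq_refl.
  move=> s s01; apply: filterS (ST s s01) => s' hs s'01; split=> h.
    exact: geq_trans (geq_sym (hs s'01)) h.
  exact: geq_trans (hs s'01) h.
have e2 : geq (g 0) (Ks 0 1) (K 1).
  rewrite g01; apply: (@lift_unique g (Ks 0) K 0 1) => //; last exact: (HKs 0 z01).2.
  by apply: lift_eq (HKs 0 z01).1 => t t01; case: (H'E t t01).
have e3 : geq (g 0) (Ks 1 1) (K 0).
  apply: (@lift_unique (fun _ => g 0) (Ks 1) (fun _ => K 0) 0 1) => //.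
    by move=> t; exact: cvg_cst.
    by apply: lift_eq (HKs 1 o01).1 => t t01; case: (H'E t t01).
    by apply: lift_const.
    exact: (HKs 1 o01).2.
exact: geq_trans (geq_sym e2) (geq_trans (geq_sym e1) e3).
Qed.

Lemma half_lt1 : ((1 : R) <= 2^-1) = false.
Proof. by apply/negbTE; rewrite -ltNge; lra. Qed.

Definition pcat (g1 g2 : R -> T) (t : R) := if t <= 2^-1 then g1 (2 * t) else g2 (2 * t - 1).

Lemma pcat_cont (g1 g2 : R -> T) : continuous g1 -> continuous g2 -> g1 1 = g2 0 -> continuous (pcat g1 g2).
Proof.
move=> c1 c2 g12 t.
have d1 : {for t, continuous (fun t : R => g1 (2 * t))}.
  apply: (@continuous_comp _ _ _ (fun t : R => 2 * t) g1 t); last exact: c1.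
  by apply: cvgM; [exact: cvg_cst|exact: cvg_id].
have d2 : {for t, continuous (fun t : R => g2 (2 * t - 1))}.
  apply: (@continuous_comp _ _ _ (fun t : R => 2 * t - 1) g2 t); last exact: c2.
  by apply: cvgB; [apply: cvgM; [exact: cvg_cst|exact: cvg_id]|exact: cvg_cst].
have [lt|gt|e] := ltgtP t 2^-1.
- apply: near_cont d1; apply: filterS (lt_nbhsl lt) => s hs; by rewrite /pcat (ltW hs).
- apply: near_cont d2; apply: filterS (lt_nbhsr gt) => s hs; by rewrite /pcat leNgt hs.
- have h2 : 2 * 2^-1 = 1 :> R by rewrite divff.
  rewrite e in d1 d2 *; move=> A; rewrite /pcat lexx h2 => nA.
  have n1 : \forall s \near (2^-1 : R), A (g1 (2 * s)) by apply: d1; rewrite h2.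
  have n2 : \forall s \near (2^-1 : R), A (g2 (2 * s - 1)) by apply: d2; rewrite h2 subrr -g12.
  suff : \forall s \near (2^-1 : R), A (pcat g1 g2 s) by [].
  by apply: filterS2 n1 n2 => s; rewrite /pcat; case: ifP.
Qed.

Lemma lift_left g1 g2 K : germ_lift (pcat g1 g2) K 0 1 -> germ_lift g1 (fun t => K (2^-1 * t + 0)) 0 1.
Proof.
have h : 0 <= (2^-1 : R) by rewrite invr_ge0.
move=> lK; have H := @lift_affine _ K 0 1 _ 0 h lK 0 1; apply: lift_eq (H _ _); last 2 first.
- by rewrite mulr0 addr0.
- by rewrite mulr1 addr0; lra.
- move=> t /andP[t0 t1]; rewrite /pcat addr0 mulVKf //.
  by have -> : 2^-1 * t <= 2^-1 by lra.
Qed.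

Lemma lift_right g1 g2 K : g1 1 = g2 0 -> germ_lift (pcat g1 g2) K 0 1 -> germ_lift g2 (fun t => K (2^-1 * t + 2^-1)) 0 1.
Proof.
move=> g12; have h : 0 <= (2^-1 : R) by rewrite invr_ge0.
move=> lK; have H := @lift_affine _ K 0 1 _ 2^-1 h lK 0 1; apply: lift_eq (H _ _); last 2 first.
- by rewrite mulr0 add0r.
- by rewrite mulr1; lra.
- move=> t /andP[t0 t1]; rewrite /pcat mulrDr mulVKf // divff //.
  case: leP => [tl|_]; last by rewrite addrK.
  have -> : t = 0 by move: tl; rewrite gerDr pmulr_rle0 ?invr_gt0 // => tl; apply/le_anti; rewrite t0 tl.
  by rewrite add0r -g12.
Qed.

(** The path [a] followed by the reverse of [b] is a loop; its lift is compared with [Ka] on the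
    first half and with the reverse of [Kb] on the second. *)
Lemma path_independent (a b : R -> T) Ka Kb : simply_connected R T -> continuous a -> continuous b ->
  a 0 = b 0 -> a 1 = b 1 -> germ_lift a Ka 0 1 -> germ_lift b Kb 0 1 -> geq (a 0) (Ka 0) (Kb 0) ->
  geq (a 1) (Ka 1) (Kb 1).
Proof.
move=> sc ca cb ab0 ab1 la lb K0.
pose br (t : R) := b (1 - t).
have cbr : continuous br.
  move=> x; apply: (@continuous_comp _ _ _ (fun x : R => 1 - x) b x); last exact: cb.
  by apply: cvgB; [exact: cvg_cst|exact: cvg_id].
have abr : a 1 = br 0 by rewrite /br subr0.
have cg := pcat_cont ca cbr abr; set g := pcat a br in cg.
have h2 : 2 * 2^-1 = 1 :> R by rewrite divff.
have g0 : g 0 = a 0 by rewrite /g /pcat mulr0; case: leP => //; rewrite invr_lt0 ltNge ler0n.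
have g1 : g 1 = a 0.
  by rewrite /g /pcat half_lt1 /br mulr1 (_ : 1 - (2 - 1) = 0) //; ring.
have [|K [lK KE]] := @lift_exists g (Ka 0) cg.
  by rewrite g0; case: (la 0) => //; rewrite lexx ler01.
have := loop_transport sc cg _ lK; rewrite g0 g1 => /(_ erefl) E.
rewrite g0 in KE.
have z01 : 0 <= (1 : R) by [].
have lL := lift_left lK; have lR := lift_right abr lK.
have e1 : geq (a 1) (Ka 1) (K (2^-1 * 1 + 0)).
  apply: (@lift_unique a Ka (fun t => K (2^-1 * t + 0)) 0 1 z01 ca la lL).
  by rewrite mulr0 add0r; exact: geq_sym.
have lR' : germ_lift b (fun t => K (2^-1 * (1 - t) + 2^-1)) 0 1.
  by apply: lift_eq (lift_rev lR) => t _; rewrite /br subKr.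
have e2 : geq (b 1) (K (2^-1 * (1 - 1) + 2^-1)) (Kb 1).
  apply: (@lift_unique b _ Kb 0 1 z01 cb lR' lb).
  rewrite subr0 mulr1 (_ : 2^-1 + 2^-1 = 1); last by rewrite -[RHS]h2; ring.
  by rewrite -ab0; exact: geq_trans E (geq_trans KE K0).
rewrite -ab1 subrr mulr0 add0r in e2; rewrite mulr1 addr0 in e1.
exact: geq_trans e1 e2.
Qed.

(** The value of [F] at [p] is that of the germ continued along a path chosen for [p]. What has to
    be shown is that neighbouring points, whose chosen paths are unrelated, give values of one and
    the same local solution. *)
Theorem monodromy p0 h0 : simply_connected R T -> L p0 h0 ->
  exists F, (forall p, L p F) /\ geq p0 F h0.
Proof.
move=> sc L0; have [pc _] := sc.
have ex p : exists gK : (R -> T) * (R -> T -> R), [/\ continuous gK.1, gK.1 0 = p0, gK.1 1 = p,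
    germ_lift gK.1 gK.2 0 1 & geq p0 (gK.2 0) h0].
  have [g [cg g0 g1]] := pc p0 p.
  have cg' := clamp_path (@ler01 R) cg.
  have g0' : g (clamp 0 1 0) = p0 by rewrite clamp_id // lexx ler01.
  have g1' : g (clamp 0 1 1) = p by rewrite clamp_id // lexx ler01.
  have [|K [lK KE]] := @lift_exists (fun t => g (clamp 0 1 t)) h0 cg'; first by rewrite g0'.
  by exists ((fun t => g (clamp 0 1 t)), K); split=> //=; rewrite -g0'.
have [gK HgK] := choice ex.
pose F p := (gK p).2 1 p.
have z01 : 0 <= (1 : R) <= 1 by rewrite lexx ler01.
have z00 : 0 <= (0 : R) <= 1 by rewrite lexx ler01.
have key p U : nice U -> U p -> exists k, (forall r, U r -> L r k) /\ geq p k ((gK p).2 1) /\ forall r, U r -> F r = k r.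
  move=> nU Up; have [cg g0 g1 lK K0] := HgK p; have [oU U1 U2 U3] := nU.
  have Lp : L p ((gK p).2 1) by rewrite -{1}g1; case: (lK 1 z01).
  have [k [Lk kE]] := U1 p _ Up Lp; exists k; split=> //; split=> // r Ur.
  (* The path chosen for [p], prolonged inside [U] to [r], ends with the germ of [k];
     [path_independent] then equates it with the path chosen for [r]. *)
  have [de [cd d0 d1 dU]] := U3 p r Up Ur.
  have gd : (gK p).1 1 = de 0 by rewrite g1.
  have cc := pcat_cont cg cd gd; set a := pcat (gK p).1 de in cc.
  have h2 : 2 * 2^-1 = 1 :> R by rewrite divff.
  have a0 : a 0 = p0 by rewrite /a /pcat mulr0; case: leP => //; rewrite invr_lt0 ltNge ler0n.
  have a1 : a 1 = r.
    by rewrite /a /pcat half_lt1 mulr1 (_ : 2 - 1 = 1) //; ring.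
  have [|K [la Ka]] := @lift_exists a h0 cc; first by rewrite a0.
  have lL := lift_left la; have lR := lift_right gd la.
  have z1 : 0 <= (1 : R) by [].
  rewrite a0 in Ka.
  have e1 : geq p (K (2^-1)) ((gK p).2 1).
    have := @lift_unique _ _ _ 0 1 z1 cg lL lK; rewrite g0 g1 mulr0 mulr1 !addr0; apply.
    exact: geq_trans Ka (geq_sym K0).
  have e2 : geq r (K 1) k.
    have lk : germ_lift de (fun _ => k) 0 1 by apply: lift_const => t _; exact: Lk.
    have := @lift_unique _ _ _ 0 1 z1 cd lR lk; rewrite d0 d1 mulr0 mulr1 add0r.
    rewrite (_ : 2^-1 + 2^-1 = 1); last by rewrite -[RHS]h2; ring.
    by apply; exact: geq_trans e1 (geq_sym kE).
  have [cg' g0' g1' lK' K0'] := HgK r.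
  have e3 : geq r (K 1) ((gK r).2 1).
    have := @path_independent a (gK r).1 K (gK r).2 sc cc cg'; rewrite a0 a1 g0' g1'; apply=> //.
    exact: geq_trans Ka (geq_sym K0').
  rewrite /F -(nbhs_singleton e3) (nbhs_singleton e2) //.
exists F; split.
  move=> p; have [U nU Up] := nice_cover p; have [oU _ _ _] := nU.
  have [k [Lk [_ Fk]]] := key p U nU Up.
  apply: L_geq (Lk p Up); apply: filterS (open_near oU Up) => r /Fk ->//.
have [U nU Up] := nice_cover p0; have [oU _ _ _] := nU.
have [k [Lk [kE Fk]]] := key p0 U nU Up.
have [cg g0 g1 lK K0] := HgK p0.
(* The path chosen for [p0] may be any loop, so its final germ has to be brought back to the initial
   one. *)
have E := loop_transport sc cg (etrans g0 (esym g1)) lK; rewrite g0 in E.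
apply: geq_trans (geq_trans kE (geq_trans E K0)).
by apply: filterS (open_near oU Up) => r /Fk.
Qed.

End Monodromy.

Lemma mx_addE (R : realType) p q (A B : 'M[R]_(p, q)) i j : (A + B) i j = A i j + B i j.
Proof. by rewrite mxE. Qed.
Lemma mx_oppE (R : realType) p q (A : 'M[R]_(p, q)) i j : (- A) i j = - A i j.
Proof. by rewrite mxE. Qed.

(** For identities that are additive in the matrix products: products and derivatives become
    variables, and [ring] closes each entry. *)
Ltac mxabel :=
  repeat match goal with
  | |- context [@mulmx ?R ?m ?n ?p ?A ?B] => move: (A *m B) => ?
  end;
  repeat match goal with |- context [@pdm ?R ?m ?p ?q ?i ?F ?u] => generalize (@pdm R m p q i F u); intro end;
  let a := fresh in let b := fresh in apply/matrixP => a b;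
  rewrite !mxE; ring.

(** The algebra behind exchanging two derivatives of the metric: with [P] and [Q] the two connection
    matrices, the left side is the commutator of second derivatives of [g] expanded by metric
    compatibility. *)
Lemma ricci_alg (R : realType) n (A B P Q g : 'M[R]_n) :
  (A *m g + P *m (Q *m g + g *m Q^T) + ((Q *m g + g *m Q^T) *m P^T + g *m A^T))
  - (B *m g + Q *m (P *m g + g *m P^T) + ((P *m g + g *m P^T) *m Q^T + g *m B^T))
  = (A - B + P *m Q - Q *m P) *m g + g *m (A - B + P *m Q - Q *m P)^T.
Proof.
have tE (A' B' C D : 'M[R]_n) : (A' - B' + C - D)^T = A'^T - B'^T + C^T - D^T by apply/matrixP => a b; rewrite !mxE.
rewrite tE !trmx_mul !(mulmxBl, mulmxBr, mulmxDl, mulmxDr, mulmxA).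
mxabel.
Qed.

Section MatrixInverse.
Variables (R : realType) (m : nat) (U : set 'rV[R]_m).
Hypothesis oU : open U.

Lemma Ck_det n k (F : 'rV[R]_m -> 'M[R]_n) : Ckm k U F -> Ck k U (fun u => \det (F u)).
Proof.
move=> cF; rewrite /determinant; apply: Ck_sum => // s _; apply: CkM => //; first exact: Ck_cst.
by apply: Ck_prod => // i _; exact: cF.
Qed.

Lemma Ckm_adj n k (F : 'rV[R]_m -> 'M[R]_n) : Ckm k U F -> Ckm k U (fun u => \adj (F u)).
Proof.
move=> cF i j; apply: (@Ck_eq _ _ _ _ _ (fun u => cofactor (F u) j i)) => //.
  by move=> u _; rewrite mxE.
rewrite /cofactor; apply: CkM => //; first exact: Ck_cst.
apply: Ck_det => a b; apply: (Ck_eq oU _ (cF (lift j a) (lift i b))) => u _; by rewrite !mxE.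
Qed.

Lemma Ckm_inv n k (F : 'rV[R]_m -> 'M[R]_n) : (forall u, U u -> F u \in unitmx) ->
  Ckm k U F -> Ckm k U (fun u => invmx (F u)).
Proof.
move=> uF cF; apply: (@Ckm_eq _ _ _ oU _ _ _ (fun u => (\det (F u))^-1 *: \adj (F u))).
  by move=> u Uu; rewrite /invmx uF.
apply: CkmZ => //; last exact: Ckm_adj.
apply: CkV => //; last exact: Ck_det.
by move=> u /uF; rewrite unitmxE unitfE.
Qed.

End MatrixInverse.

(** * Curvature and the Hessian equation *)

Section LeviCivita.
Variables (R : realType) (m : nat) (U : set 'rV[R]_m).
Hypothesis oU : open U.
Variable g : 'rV[R]_m -> 'M[R]_m.
Hypothesis cg : forall k, Ckm k U g.
Hypothesis gT : forall u, U u -> (g u)^T = g u.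
Hypothesis gpos : forall u v, U u -> v != 0 -> 0 < inner g u v v.

(** Row [k] of [Gam i] holds the components of the covariant derivative of the [k]-th coordinate
    field in direction [i]. *)
Definition Gam : 'I_m -> 'rV[R]_m -> 'M[R]_m :=
  let: tt := seal in fun i u => \matrix_(k, l) christoffel g l i k u.
(** The Koszul combination, twice the Christoffel symbol of the first kind. *)
Definition Kos : 'I_m -> 'rV[R]_m -> 'M[R]_m := let: tt := seal in fun i u => \matrix_(k, l)
  (pd i (fun v => g v k l) u + pd k (fun v => g v i l) u - pd l (fun v => g v i k) u).

Lemma Gam_entry i u k l : Gam i u k l = christoffel g l i k u.
Proof. by rewrite /Gam; case: seal; rewrite mxE. Qed.

Lemma Kos_entry i u k l : Kos i u k l =
  pd i (fun v => g v k l) u + pd k (fun v => g v i l) u - pd l (fun v => g v i k) u.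
Proof. by rewrite /Kos; case: seal; rewrite mxE. Qed.

Lemma metric_unit u : U u -> g u \in unitmx.
Proof.
move=> Uu; rewrite -row_free_unit -kermx_eq0; apply/eqP/row_matrixP => i; rewrite row0.
apply/eqP; apply/negPn/negP => /(gpos Uu); rewrite /inner.
have : row i (kermx (g u)) *m g u = 0 by apply/sub_kermxP; exact: row_sub.
by move=> ->; rewrite mul0mx mxE ltxx.
Qed.

Lemma inner_sym u v w : U u -> inner g u v w = inner g u w v.
Proof.
move=> Uu; rewrite /inner; set X := v *m _ *m _.
by rewrite -[X]trmxK mxE /X !trmx_mul trmxK gT // mulmxA.
Qed.

Lemma g_sym u i j : U u -> g u i j = g u j i.
Proof. by move=> Uu; rewrite -{1}gT // mxE. Qed.

Lemma pdg_sym i j k u : U u -> pd i (fun v => g v j k) u = pd i (fun v => g v k j) u.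
Proof. by move=> Uu; apply: (pd_eq oU) => // v Uv; rewrite g_sym. Qed.

Lemma GamE i u : U u -> Gam i u = 2^-1 *: (Kos i u *m invmx (g u)).
Proof.
move=> Uu; have iT : (invmx (g u))^T = invmx (g u) by rewrite trmx_inv gT.
apply/matrixP => k l; rewrite Gam_entry /christoffel [RHS]mxE; congr (_ * _).
rewrite [RHS]mxE; apply: eq_bigr => s _.
by rewrite Kos_entry mulrC -{1}iT mxE !pdE.
Qed.

Lemma Gam_metric i u : U u -> Gam i u *m g u = 2^-1 *: Kos i u.
Proof. by move=> Uu; rewrite GamE // -scalemxAl mulmxKV // metric_unit. Qed.

Lemma compat i u : U u -> pdm i g u = Gam i u *m g u + g u *m (Gam i u)^T.
Proof.
move=> Uu; rewrite -{2}(gT Uu) -trmx_mul Gam_metric //; apply/matrixP => k l.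
rewrite pdmE; transitivity (2^-1 * Kos i u k l + 2^-1 * Kos i u l k); last first.
  by move: (Kos i u) => K; rewrite !mxE.
rewrite (Kos_entry i u k l) (Kos_entry i u l k).
rewrite (pdg_sym i l k) // (pdg_sym k i l) // (pdg_sym l i k) //.
by rewrite (pdg_sym k l i) // (pdg_sym l k i) //; field.
Qed.

Lemma Gam_sym i k l u : U u -> Gam i u k l = Gam k u i l.
Proof.
move=> Uu; rewrite !Gam_entry /christoffel; congr (_ * _); apply: eq_bigr => s _; congr (_ * _).
rewrite -!pdE (pdg_sym s i k) //; ring.
Qed.

Lemma Ckm_Gam k i : Ckm k U (Gam i).
Proof.
apply: (@Ckm_eq _ _ _ oU _ _ _ (fun u => 2^-1 *: (Kos i u *m invmx (g u)))).
  by move=> u Uu; rewrite GamE.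
apply: CkmZ => //; first exact: Ck_cst.
apply: CkmM => //; last by apply: Ckm_inv => //; exact: metric_unit.
move=> a b; apply: (@Ck_eq _ _ _ _ _ (fun u =>
  pd i (fun v => g v a b) u + pd a (fun v => g v i b) u - pd b (fun v => g v i a) u)) => //.
  by move=> u _; rewrite Kos_entry.
have c (x y z : 'I_m) : Ck k U (pd x (fun v => g v y z)) by exact: (Ck_pd x (cg k.+1 y z)).
exact: (CkB oU (CkD oU (c _ _ _) (c _ _ _)) (c _ _ _)).
Qed.

(** The curvature operator of the coordinate fields [i] and [j]; the products stand in reversed
    order because matrices act on the right. *)
Definition Om : 'I_m -> 'I_m -> 'rV[R]_m -> 'M[R]_m := let: tt := seal in fun i j u =>
  pdm i (Gam j) u - pdm j (Gam i) u + Gam j u *m Gam i u - Gam i u *m Gam j u.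

Lemma Om_def i j u : Om i j u =
  pdm i (Gam j) u - pdm j (Gam i) u + Gam j u *m Gam i u - Gam i u *m Gam j u.
Proof. by rewrite /Om; case: seal. Qed.

Lemma OmC i j u : Om j i u = - Om i j u.
Proof. rewrite !Om_def; mxabel. Qed.

(** Second derivatives of [g] commute; expanding both orders by [compat] leaves exactly the skewness
    of the curvature. *)
Lemma Om_skew i j u : U u -> Om i j u *m g u + g u *m (Om i j u)^T = 0.
Proof.
move=> Uu.
have d2 (a b : 'I_m) : pdm a (pdm b g) u = (pdm a (Gam b) u *m g u + Gam b u *m (Gam a u *m g u + g u *m (Gam a u)^T))
    + ((Gam a u *m g u + g u *m (Gam a u)^T) *m (Gam b u)^T + g u *m (pdm a (Gam b) u)^T).
  have e v : U v -> pdm b g v = Gam b v *m g v + g v *m (Gam b v)^T by move=> Uv; exact: compat.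
  have cG : Ckm 1 U (Gam b) by exact: Ckm_Gam.
  rewrite (pdm_eq oU a e Uu) (pdmD oU a (CkmM oU cG (cg 1)) (CkmM oU (cg 1) (Ckm_tr oU cG)) Uu).
  by rewrite (pdmM oU a cG (cg 1) Uu) (pdmM oU a (cg 1) (Ckm_tr oU cG) Uu) pdm_tr -compat.
have sch : pdm i (pdm j g) u = pdm j (pdm i g) u := pdm_pdmC oU i j (cg 2) Uu.
have := ricci_alg (pdm i (Gam j) u) (pdm j (Gam i) u) (Gam j u) (Gam i u) (g u).
rewrite -(d2 i j) -(d2 j i) sch subrr -Om_def => E; exact: esym E.
Qed.

Lemma OmE i j u k l : Om i j u k l = pd i (fun v => Gam j v k l) u - pd j (fun v => Gam i v k l) u
  + (Gam j u *m Gam i u) k l - (Gam i u *m Gam j u) k l.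
Proof.
rewrite -!pdmE Om_def; move: (Gam j u *m Gam i u) (Gam i u *m Gam j u) (pdm i _ u) (pdm j _ u) => X Y Z W.
by rewrite !mxE.
Qed.

Lemma Om_riemann i j k l u : Om i j u k l = riemann g l i j k u.
Proof.
apply: (etrans (OmE i j u k l)); rewrite /riemann.
have pE (a b : 'I_m) : pd a (fun v => Gam b v k l) u = 'D_(ebase R a) (christoffel g l b k) u.
  by rewrite pdE; have -> : (fun v => Gam b v k l) = christoffel g l b k by apply/funext => v; exact: Gam_entry.
rewrite (pE i j) (pE j i) -addrA; congr (_ + _).
rewrite mxE [X in _ - X]mxE -sumrB; apply: eq_bigr => s _.
have E := fun a b c => Gam_entry a u b c.
by rewrite (E j k s) (E i s l) (E i k s) (E j s l); ring.
Qed.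

(** Since the connection is torsion free ([Gam_sym]), the six derivative terms and the six products
    cancel in pairs. *)
Lemma Om_bianchi i j k l u : U u -> Om i j u k l + Om j k u i l + Om k i u j l = 0.
Proof.
move=> Uu.
have alg (o1 o2 o3 p1 p2 p3 p4 p5 p6 q1 q2 q3 q4 q5 q6 : R) :
   o1 = p1 - p2 + q1 - q2 -> o2 = p3 - p4 + q3 - q4 -> o3 = p5 - p6 + q5 - q6 ->
   p1 = p6 -> p2 = p3 -> p4 = p5 -> q1 = q6 -> q2 = q3 -> q4 = q5 -> o1 + o2 + o3 = 0.
  by move=> -> -> -> -> -> -> -> -> ->; ring.
have s (a b c d : 'I_m) : pd a (fun v => Gam b v c d) u = pd a (fun v => Gam c v b d) u.
  by apply: (pd_eq oU) => // v Uv; exact: Gam_sym.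
have t (a b c d : 'I_m) : (Gam a u *m Gam b u) c d = (Gam c u *m Gam b u) a d.
  rewrite [LHS]mxE [RHS]mxE; apply: eq_bigr => x _; congr (_ * _); exact: Gam_sym.
exact: (alg _ _ _ _ _ _ _ _ _ _ _ _ _ _ _ (OmE i j u k l) (OmE j k u i l) (OmE k i u j l)
  (s i j k l) (s j i k l) (s k j i l) (t j i k l) (t i j k l) (t j k i l)).
Qed.

End LeviCivita.

Section Polarization.
Variables (R : realFieldType) (V : lmodType R) (F : V -> V -> V -> V -> R).
Hypothesis F1 : forall X X' Y Z W, F (X + X') Y Z W = F X Y Z W + F X' Y Z W.
Hypothesis F2 : forall X Y Z W, F Y X Z W = - F X Y Z W.
Hypothesis F3 : forall X Y Z W, F X Y W Z = - F X Y Z W.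
Hypothesis F4 : forall X Y Z W, F X Y Z W + F Y Z X W + F Z X Y W = 0.
Hypothesis F5 : forall X Y Z W W', F X Y Z (W + W') = F X Y Z W + F X Y Z W'.
Hypothesis F0 : forall X Y, F X Y Y X = 0.

(** A linear combination of the four Bianchi identities obtained by rotating the arguments. *)
Lemma pair_sym X Y Z W : F Z W X Y = F X Y Z W.
Proof.
have e1 := F4 X Y Z W; have e2 := F4 Y Z W X; have e3 := F4 Z W X Y; have e4 := F4 W X Y Z.
have q1 : F Z X Y W = - F X Z Y W by rewrite F2.
have q2 : F Y Z W X = - F Y Z X W by rewrite F3.
have q3 : F Z W Y X = - F Z W X Y by rewrite F3.
have q4 : F W Y Z X = F Y W X Z by rewrite F2 F3 opprK.
have q5 : F W X Z Y = F X W Y Z by rewrite F2 F3 opprK.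
have q6 : F X Z W Y = - F X Z Y W by rewrite F3.
have q7 : F W X Y Z = - F X W Y Z by rewrite F2.
have q8 : F X Y W Z = - F X Y Z W by rewrite F3.
rewrite q1 in e1; rewrite q2 q3 q4 in e2; rewrite q5 q6 in e3; rewrite q7 q8 in e4.
lra.
Qed.

(** A curvature-like tensor with vanishing sectional values is zero: polarizing in the outer and
    then in the inner arguments makes [F] antisymmetric in its two middle arguments, and the Bianchi
    identity becomes [3 F = 0]. *)
Lemma polarization X Y Z W : F X Y Z W = 0.
Proof.
have G1 A B C : F A B B C = 0.
  have := F0 (A + C) B; rewrite F1 !F5 !F0 add0r addr0 => e.
  have e' : F C B B A = F A B B C by rewrite -pair_sym F2 F3 opprK.
  by move: e; rewrite e'; lra.
have G2 A B C D : F A C B D = - F A B C D.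
  have Fm : F A (B + C) (B + C) D = F A B B D + F A B C D + (F A C B D + F A C C D).
    have F1' P P' Q S T : F P (Q + S) P' T = F P Q P' T + F P S P' T.
      by rewrite F2 F1 opprD -!F2.
    have F3' P Q S S' T : F P Q (S + S') T = F P Q S T + F P Q S' T.
      by rewrite F3 F5 opprD -!F3.
    by rewrite F1' !F3'.
  by move: Fm; rewrite !G1; lra.
have := F4 X Y Z W.
have -> : F Y Z X W = F X Y Z W by rewrite G2 F2 opprK.
have -> : F Z X Y W = F X Y Z W by rewrite F2 G2 opprK.
lra.
Qed.
End Polarization.

Section ConstantCurvature.
Variables (R : realType) (m : nat) (U : set 'rV[R]_m).
Hypothesis oU : open U.
Variable g : 'rV[R]_m -> 'M[R]_m.
Hypothesis cg : forall k, Ckm k U g.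
Hypothesis gT : forall u, U u -> (g u)^T = g u.
Hypothesis gpos : forall u v, U u -> v != 0 -> 0 < inner g u v v.
Variable c : R.
Hypothesis gsec : forall u v w, U u -> row_free (col_mx v w) -> sectional g u v w = c.
Variable u : 'rV[R]_m.
Hypothesis Uu : U u.

(* [curvop X Y] is the matrix of the curvature operator [R(X, Y)]. *)
Definition curvop (X Y : 'rV[R]_m) : 'M[R]_m := \sum_i \sum_j (X 0 i * Y 0 j) *: Om g i j u.

(** The curvature tensor minus that of the model of constant curvature [c]. *)
Definition curvF (X Y Z W : 'rV[R]_m) : R := (Z *m curvop X Y *m g u *m W^T) 0 0
  - c * (inner g u Y Z * inner g u X W - inner g u X Z * inner g u Y W).

Lemma innerDl X Y Z : inner g u (X + Y) Z = inner g u X Z + inner g u Y Z.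
Proof. by rewrite /inner !mulmxDl mxE. Qed.
Lemma innerDr X Y Z : inner g u Z (X + Y) = inner g u Z X + inner g u Z Y.
Proof. by rewrite /inner linearD mulmxDr mxE. Qed.
Lemma innerZl a X Z : inner g u (a *: X) Z = a * inner g u X Z.
Proof. by rewrite /inner -!scalemxAl mxE. Qed.
Lemma innerZr a X Z : inner g u Z (a *: X) = a * inner g u Z X.
Proof. by rewrite /inner linearZ /= -scalemxAr mxE. Qed.

Lemma curvopD X X' Y : curvop (X + X') Y = curvop X Y + curvop X' Y.
Proof.
rewrite /curvop -big_split; apply: eq_bigr => i _; rewrite -big_split; apply: eq_bigr => j _.
by rewrite mxE mulrDl scalerDl.
Qed.

Lemma curvopZ a X Y : curvop (a *: X) Y = a *: curvop X Y.
Proof.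
rewrite /curvop scaler_sumr; apply: eq_bigr => i _; rewrite scaler_sumr; apply: eq_bigr => j _.
by rewrite mxE scalerA mulrA.
Qed.

Lemma curvopC X Y : curvop Y X = - curvop X Y.
Proof.
rewrite /curvop exchange_big -sumrN; apply: eq_bigr => i _; rewrite -sumrN; apply: eq_bigr => j _.
by rewrite (OmC g i j u) scalerN mulrC.
Qed.

Lemma curvop_skew X Y : curvop X Y *m g u + g u *m (curvop X Y)^T = 0.
Proof.
rewrite /curvop mulmx_suml; have -> : (\sum_i \sum_j (X 0 i * Y 0 j) *: Om g i j u)^T =
   \sum_i \sum_j (X 0 i * Y 0 j) *: (Om g i j u)^T.
  rewrite linear_sum; apply: eq_bigr => i _; rewrite linear_sum; apply: eq_bigr => j _; by rewrite linearZ.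
rewrite mulmx_sumr -big_split big1 // => i _; rewrite mulmx_suml mulmx_sumr -big_split big1 // => j _.
rewrite -[LHS]/(((X 0 i * Y 0 j) *: Om g i j u) *m g u + g u *m ((X 0 i * Y 0 j) *: (Om g i j u)^T)).
by rewrite -scalemxAl -scalemxAr -scalerDr (Om_skew oU cg gT gpos) // scaler0.
Qed.

Lemma curvop_bianchi X Y Z : Z *m curvop X Y + X *m curvop Y Z + Y *m curvop Z X = 0.
Proof.
have e (A B C : 'rV[R]_m) l : (A *m curvop B C) 0 l = \sum_i \sum_j \sum_k B 0 i * C 0 j * A 0 k * Om g i j u k l.
  rewrite mxE.
  under eq_bigr => k _ do rewrite /curvop summxE mulr_sumr.
  rewrite exchange_big; apply: eq_bigr => i _.
  under eq_bigr => k _ do rewrite summxE mulr_sumr.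
  rewrite exchange_big; apply: eq_bigr => j _; apply: eq_bigr => k _.
  by rewrite mxE; ring.
have ad (A B C : 'rV[R]_m) l : (A + B + C) 0 l = A 0 l + B 0 l + C 0 l by rewrite !mxE.
apply/rowP => l; rewrite ad !e [RHS]mxE.
have -> : \sum_i \sum_j \sum_k Y 0 i * Z 0 j * X 0 k * Om g i j u k l
   = \sum_i \sum_j \sum_k Y 0 j * Z 0 k * X 0 i * Om g j k u i l.
  by rewrite [RHS]exchange_big; apply: eq_bigr => i _; rewrite [RHS]exchange_big.
have -> : \sum_i \sum_j \sum_k Z 0 i * X 0 j * Y 0 k * Om g i j u k l
   = \sum_i \sum_j \sum_k Z 0 k * X 0 i * Y 0 j * Om g k i u j l.
  rewrite exchange_big; apply: eq_bigr => i _; rewrite exchange_big; by [].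
rewrite -!big_split big1 // => i _; rewrite -!big_split big1 // => j _; rewrite -!big_split big1 // => k _.
have B := Om_bianchi oU gT i j k l Uu.
move: B; set o1 := Om g i j u k l; set o2 := Om g j k u i l; set o3 := Om g k i u j l => B.
transitivity (X 0 i * Y 0 j * Z 0 k * (o1 + o2 + o3)); last by rewrite B mulr0.
by rewrite /=; ring.
Qed.

(** For independent vectors this is the hypothesis on sectional curvature. For dependent ones, about
    which that hypothesis is silent, both terms vanish by antisymmetry. *)
Lemma curvF0 X Y : curvF X Y Y X = 0.
Proof.
pose D := inner g u X X * inner g u Y Y - inner g u X Y ^+ 2.
have sec : inner g u (curvature g u X Y Y) X = (Y *m curvop X Y *m g u *m X^T) 0 0.
  rewrite /inner; congr ((_ *m _ *m _) 0 0); apply/rowP => l; rewrite !mxE.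
  under [RHS]eq_bigr => k _ do rewrite /curvop summxE mulr_sumr.
  rewrite [RHS]exchange_big; apply: eq_bigr => i _.
  under [RHS]eq_bigr => k _ do rewrite summxE mulr_sumr.
  rewrite [RHS]exchange_big; apply: eq_bigr => j _; apply: eq_bigr => k _.
  by rewrite mxE -(Om_riemann g i j k l u); ring.
rewrite /curvF (inner_sym gT Y X) //.
have [fr|nfr] := boolP (row_free (col_mx X Y)).
  have := gsec Uu fr; rewrite /sectional sec -/D => H.
  (* [D] is the Gram determinant: if it were zero, [z] would have length zero, giving a linear
     relation between [X] and [Y]. *)
  have D0 : D != 0.
    apply/eqP => D0; pose z := inner g u Y Y *: X - inner g u X Y *: Y.
    have zz : inner g u z z = inner g u Y Y * D.
      by rewrite /z -!scaleNr innerDl !innerDr !innerZl !innerZr (inner_sym gT Y X Uu) /D; ring.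
    have z0 : z = 0.
      by apply/eqP/negPn/negP => /(gpos Uu); rewrite zz D0 mulr0 ltxx.
    have : row_mx (inner g u Y Y)%:M (- inner g u X Y)%:M *m col_mx X Y = 0.
      by rewrite mul_row_col !mul_scalar_mx scaleNr.
    rewrite -[RHS](mul0mx _ (col_mx X Y)) => /(row_free_inj fr) /eqP.
    rewrite -row_mx0 => /eqP /eq_row_mx [/matrixP /(_ 0 0) y0 _].
    have Y0 : Y = 0.
      apply/eqP/negPn/negP => /(gpos Uu); move: y0; rewrite !mxE eqxx mulr1n => ->; by rewrite ltxx.
    have : row_mx (0 : 'M[R]_1) 1%:M *m col_mx X Y = 0.
      by rewrite mul_row_col mul0mx mul1mx add0r.
    rewrite -[RHS](mul0mx _ (col_mx X Y)) => /(row_free_inj fr) /eqP.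
    rewrite -row_mx0 => /eqP /eq_row_mx [_ /matrixP /(_ 0 0)]; rewrite !mxE => /eqP.
    by rewrite oner_eq0.
  have -> : inner g u Y Y * inner g u X X - inner g u X Y * inner g u X Y = D by rewrite /D expr2 mulrC.
  by rewrite -H divfK // subrr.
have C0 Z : curvop Z Z = 0.
  have := curvopC Z Z; move: (curvop Z Z) => A e; apply/matrixP => i j.
  by move/matrixP: e => /(_ i j); rewrite !mxE; lra.
have dep t Z : curvF (t *: Z) Z Z (t *: Z) = 0 /\ curvF Z (t *: Z) (t *: Z) Z = 0.
  rewrite /curvF curvopZ (curvopC (t *: Z) Z) curvopZ C0 scaler0 oppr0 !mulmx0 !mul0mx mxE !innerZl !innerZr.
  by split; ring.
rewrite -[LHS](_ : curvF X Y Y X = _); last by rewrite /curvF (inner_sym gT Y X Uu).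
have [ab abn abX] : exists2 ab : 'rV[R]_(1 + 1), ab != 0 & ab *m col_mx X Y = 0.
  move: nfr; rewrite -kermx_eq0 => /rowV0Pn[ab /sub_kermxP h1 h2]; by exists ab.
pose a : R := lsubmx ab 0 0; pose b : R := rsubmx ab 0 0.
have E : a *: X + b *: Y = 0.
  have /(congr1 (fun x => x *m col_mx X Y)) := hsubmxK ab; rewrite mul_row_col abX => <-.
  by rewrite (mx11_scalar (lsubmx ab)) (mx11_scalar (rsubmx ab)) !mul_scalar_mx.
have [a0|a0] := eqVneq a 0; last first.
  have -> : X = (- (b / a)) *: Y.
    apply: (scalerI a0); rewrite scalerA mulrN mulrCA divff // mulr1 scaleNr.
    by apply/eqP; rewrite -addr_eq0 E.
  exact: (dep _ _).1.
have b0 : b != 0.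
  apply: contra_neq abn => b0; rewrite -[ab]hsubmxK (mx11_scalar (lsubmx ab)) (mx11_scalar (rsubmx ab)) -/a -/b a0 b0.
  have z1 : (0%:M : 'M[R]_1) = 0 by apply/matrixP => i j; rewrite !mxE mul0rn.
  by rewrite z1 row_mx0.
have Y0 : Y = 0.
  by move/eqP: E; rewrite a0 scale0r add0r scaler_eq0 (negbTE b0) => /eqP.
have := (dep 0 X).2; by rewrite Y0 scale0r.
Qed.

Lemma curvF_eq0 X Y Z W : curvF X Y Z W = 0.
Proof.
apply: (@polarization R 'rV[R]_m curvF) => {X Y Z W}.
- move=> X X' Y Z W; rewrite /curvF curvopD mulmxDr !mulmxDl mx_addE !innerDl; ring.
- move=> X Y Z W; rewrite /curvF curvopC mulmxN !mulNmx mx_oppE; ring.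
- move=> X Y Z W; rewrite /curvF.
  have sk : (W *m curvop X Y *m g u *m Z^T) 0 0 = - (Z *m curvop X Y *m g u *m W^T) 0 0.
    have -> : (W *m curvop X Y *m g u *m Z^T) 0 0 = (Z *m (g u *m (curvop X Y)^T) *m W^T) 0 0.
      set A := W *m _ *m _ *m _; rewrite -[A]trmxK mxE /A !trmx_mul trmxK gT //.
      by rewrite !mulmxA.
    have /eqP := curvop_skew X Y; rewrite addrC addr_eq0 => /eqP ->.
    by rewrite mulmxN mulNmx mxE !mulmxA.
  by rewrite sk; ring.
- move=> X Y Z W; rewrite /curvF (inner_sym gT Z X Uu) (inner_sym gT Y X Uu) (inner_sym gT Z Y Uu).
  have := congr1 (fun A : 'rV[R]_m => (A *m g u *m W^T) 0 0) (curvop_bianchi X Y Z).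
  rewrite /= !mulmxDl !mul0mx !mx_addE [X in _ = X -> _]mxE.
  move: ((Z *m _ *m _ *m _) 0 0) ((X *m _ *m _ *m _) 0 0) ((Y *m _ *m _ *m _) 0 0) => x y z e.
  have -> : z = - (x + y) by lra.
  ring.
- move=> X Y Z W W'; rewrite /curvF linearD mulmxDr mx_addE !innerDr; ring.
- exact: curvF0.
Qed.

(** Testing [curvF_eq0] against the difference of the two sides shows, row by row, that this
    difference has length zero. *)
Lemma Om_const i j : Om g i j u = c *: ((row j (g u))^T *m ebase R i - (row i (g u))^T *m ebase R j).
Proof.
have coE : curvop (ebase R i) (ebase R j) = Om g i j u.
  rewrite /curvop (bigD1 i) //= [X in _ + X]big1 ?addr0 => [|a ai]; last first.
    by rewrite big1 // => b _; rewrite /ebase mxE (negbTE ai) andbF mul0r scale0r.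
  rewrite (bigD1 j) //= big1 ?addr0 => [|b bj]; last first.
    by rewrite /ebase [X in _ * X]mxE (negbTE bj) andbF mulr0 scale0r.
  by rewrite /ebase !mxE !eqxx mulr1 scale1r.
apply/row_matrixP => k.
set v := row k (Om g i j u); set w := row k _.
suff : v - w = 0 by move/eqP; rewrite subr_eq0 => /eqP.
apply/eqP/negPn/negP => /(gpos Uu).
suff -> : inner g u (v - w) (v - w) = 0 by rewrite ltxx.
have := curvF_eq0 (ebase R i) (ebase R j) (ebase R k) (v - w).
rewrite /curvF coE -rowE -/v.
have ie a W : inner g u (ebase R a) W = (row a (g u) *m W^T) 0 0 by rewrite /inner -rowE.
have ik a : inner g u (ebase R a) (ebase R k) = g u a k.
  rewrite ie /ebase trmx_delta -colE !mxE //.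
have -> : w = c *: (g u j k *: ebase R i - g u i k *: ebase R j).
  rewrite /w linearZ /= linearB /=; congr (_ *: (_ - _)); rewrite row_mul;
  by apply/rowP => l; rewrite !mxE big_ord1 !mxE.
rewrite !ik !ie => e.
rewrite {1}/inner mulmxBl mulmxBl mx_subE -[RHS]e; congr (_ - _).
have sE (a : R) (B : 'M[R]_1) : (a *: B) 0 0 = a * B 0 0 by rewrite mxE.
rewrite -!scalemxAl sE mulmxBl mulmxBl mx_subE -!scalemxAl !sE.
by rewrite -!rowE.
Qed.

End ConstantCurvature.

Lemma mx_scaleE (R : pzRingType) p q (a : R) (A : 'M[R]_(p, q)) i j : (a *: A) i j = a * A i j.
Proof. by rewrite mxE. Qed.
Lemma mx_trE (R : Type) p q (A : 'M[R]_(p, q)) i j : A^T i j = A j i.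
Proof. by rewrite mxE. Qed.

(** The uniqueness half of the Levi-Civita theorem: a tensor symmetric in its first two indices and
    skew in its last two vanishes. *)
Lemma koszul_unique (R : realType) m (S T : 'I_m -> 'M[R]_m) :
  (forall i k l, S i k l = S k i l) -> (forall i k l, T i k l = T k i l) ->
  (forall i, S i + (S i)^T = T i + (T i)^T) -> forall i, S i = T i.
Proof.
move=> sS sT ST i; apply/matrixP => k l.
have e a b c : S a b c + S a c b = T a b c + T a c b.
  have := congr1 (fun A : 'M[R]_m => A b c) (ST a).
  by rewrite !mx_addE !mx_trE.
have := e i k l; have := e k l i; have := e l i k.
rewrite (sS k l i) (sS l k i) (sS l i k) (sS k i l) (sT k l i) (sT l k i) (sT l i k) (sT k i l).
rewrite (sS i k l) (sS i l k) (sT i k l) (sT i l k).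
lra.
Qed.

Section Jacobian.
Variables (R : realType) (n m : nat).
Implicit Types (tau : 'rV[R]_n -> 'rV[R]_m).

Definition jac : ('rV[R]_n -> 'rV[R]_m) -> 'rV[R]_n -> 'M[R]_(n, m) :=
  let: tt := seal in fun tau u => \matrix_(i, a) pd i (fun v => tau v 0 a) u.

Lemma jac_entry tau u i a : jac tau u i a = pd i (fun v => tau v 0 a) u.
Proof. by rewrite /jac; case: seal; rewrite mxE. Qed.

Definition grd k : ('rV[R]_k -> R) -> 'rV[R]_k -> 'rV[R]_k :=
  let: tt := seal in fun f u => \row_b pd b f u.

Lemma grd_entry k (f : 'rV[R]_k -> R) u i b : grd f u i b = pd b f u.
Proof. by rewrite /grd; case: seal; rewrite mxE. Qed.

Variables (U : set 'rV[R]_n) (V : set 'rV[R]_m).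
Hypotheses (oU : open U) (oV : open V).
Variable tau : 'rV[R]_n -> 'rV[R]_m.
Hypothesis ctau : forall k, Ckm k U tau.
Hypothesis tauV : forall u, U u -> V (tau u).

Lemma jacE u : U u -> 'J tau u = jac tau u.
Proof.
by move=> Uu; apply/matrixP => i a; rewrite (jacobianE oU (ctau 1) Uu) jac_entry mxE.
Qed.

Lemma Ckm_jac k : Ckm k U (jac tau).
Proof.
move=> i a; apply: (Ck_eq oU _ (Ck_pd i (ctau k.+1 0 a))) => u _; by rewrite jac_entry.
Qed.

Lemma Ckm_grd k l (W : set 'rV[R]_k) (f : 'rV[R]_k -> R) : open W -> Ck l.+1 W f -> Ckm l W (grd f).
Proof. by move=> oW cf i b; apply: (Ck_eq oW _ (Ck_pd b cf)) => u _; rewrite grd_entry. Qed.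

Lemma Ckm_comp p q k (F : 'rV[R]_m -> 'M[R]_(p, q)) : Ckm k V F -> Ckm k U (fun u => F (tau u)).
Proof. by move=> cF a b; exact: (Ck_comp oU oV (ctau k) tauV (cF a b)). Qed.

Lemma pdm_comp p q k i u (F : 'rV[R]_m -> 'M[R]_(p, q)) : Ckm k.+1 V F -> U u ->
  pdm i (fun v => F (tau v)) u = \sum_a jac tau u i a *: pdm a F (tau u).
Proof.
move=> cF Uu; apply/matrixP => x y; rewrite pdmE (pd_comp i oU oV (ctau 1) (cF x y) Uu (tauV Uu)).
rewrite summxE; apply: eq_bigr => a _; by rewrite mx_scaleE jac_entry pdmE.
Qed.

Lemma grd_comp k (f : 'rV[R]_m -> R) u : Ck k.+1 V f -> U u ->
  grd (fun v => f (tau v)) u = grd f (tau u) *m (jac tau u)^T.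
Proof.
move=> cf Uu; apply/rowP => b; rewrite grd_entry (pd_comp b oU oV (ctau 1) cf Uu (tauV Uu)).
by rewrite mxE; apply: eq_bigr => a _; rewrite grd_entry mxE jac_entry mulrC.
Qed.
End Jacobian.

Section HessianEquation.
Variables (R : realType) (m : nat).
(** The equation Hess f = - c f g in coordinates. Its solutions are the affine functions on flat
    space and the restrictions of linear functions on the sphere and the hyperboloid. *)
Definition hesseq (g : 'rV[R]_m -> 'M[R]_m) (c : R) (U : set 'rV[R]_m) (f : 'rV[R]_m -> R) : Prop :=
  (forall k, Ck k U f) /\ forall j u, U u ->
    pdm j (grd f) u = (- (c * f u)) *: row j (g u) + grd f u *m (Gam g j u)^T.
End HessianEquation.

Section Pullback.
Variables (R : realType) (n m : nat) (U : set 'rV[R]_n) (V : set 'rV[R]_m).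
Hypotheses (oU : open U) (oV : open V).
Variable tau : 'rV[R]_n -> 'rV[R]_m.
Hypothesis ctau : forall k, Ckm k U tau.
Hypothesis tauV : forall u, U u -> V (tau u).
Variables (g : 'rV[R]_n -> 'M[R]_n) (h : 'rV[R]_m -> 'M[R]_m).
Hypotheses (cg : forall k, Ckm k U g) (ch : forall k, Ckm k V h).
Hypotheses (gT : forall u, U u -> (g u)^T = g u) (hT : forall u, V u -> (h u)^T = h u).
Hypothesis gpos : forall u v, U u -> v != 0 -> 0 < inner g u v v.
Hypothesis hpos : forall u v, V u -> v != 0 -> 0 < inner h u v v.
Let J := jac tau.
Hypothesis gE : forall u, U u -> g u = J u *m h (tau u) *m (J u)^T.

(* Christoffel matrices of the pulled back ambient connection, and the
   covariant derivative of the coordinate fields. *)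
Definition Gt : 'I_n -> 'rV[R]_n -> 'M[R]_m := let: tt := seal in
  fun i u => \sum_a J u i a *: Gam h a (tau u).
Definition DJ : 'I_n -> 'rV[R]_n -> 'M[R]_(n, m) := let: tt := seal in
  fun i u => pdm i J u + J u *m Gt i u.

Lemma Gt_def i u : Gt i u = \sum_a J u i a *: Gam h a (tau u).
Proof. by rewrite /Gt; case: seal. Qed.
Lemma DJ_def i u : DJ i u = pdm i J u + J u *m Gt i u.
Proof. by rewrite /DJ; case: seal. Qed.

Let cJ k : Ckm k U J. Proof. exact: Ckm_jac. Qed.
Let cGam k a : Ckm k V (Gam h a). Proof. exact: Ckm_Gam. Qed.
Let cht k : Ckm k U (fun u => h (tau u)). Proof. exact: (Ckm_comp oU oV ctau tauV (ch k)). Qed.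

Lemma pdm_jac_sym i k a u : U u -> pdm i J u k a = pdm k J u i a.
Proof.
move=> Uu; rewrite !pdmE.
have E (l : 'I_n) : (fun v => J v l a) = pd l (fun v => tau v 0 a) by apply/funext => v; exact: jac_entry.
by rewrite !E (pdC i k oU (ctau 2 0 a) Uu).
Qed.

Lemma JGt i k a u : (J u *m Gt i u) k a = \sum_b \sum_c J u k b * J u i c * Gam h c (tau u) b a.
Proof.
rewrite mxE; apply: eq_bigr => b _; rewrite Gt_def summxE mulr_sumr; apply: eq_bigr => c _.
by rewrite [in LHS]mxE mulrA.
Qed.

Lemma DJ_sym i k a u : U u -> DJ i u k a = DJ k u i a.
Proof.
move=> Uu; rewrite !DJ_def !mx_addE (pdm_jac_sym i k a Uu) !JGt; congr (_ + _).
rewrite exchange_big; apply: eq_bigr => b _; apply: eq_bigr => c _.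
by rewrite (Gam_sym oV hT _ _ _ (tauV Uu)); congr (_ * _); rewrite mulrC.
Qed.

Lemma pdm_metric_comp i u : U u ->
  pdm i (fun v => h (tau v)) u = Gt i u *m h (tau u) + h (tau u) *m (Gt i u)^T.
Proof.
move=> Uu; rewrite (pdm_comp oU oV ctau tauV i (ch 1) Uu) Gt_def.
have -> : (\sum_a J u i a *: Gam h a (tau u))^T = \sum_a J u i a *: (Gam h a (tau u))^T.
  by rewrite linear_sum; apply: eq_bigr => a _; rewrite linearZ.
rewrite mulmx_suml mulmx_sumr -big_split; apply: eq_bigr => a _.
by rewrite (compat oV hT hpos a (tauV Uu)) scalerDr -scalemxAl -scalemxAr.
Qed.

(** The tangential part of the ambient derivative is torsion free and compatible with the induced
    metric, so by [koszul_unique] it is the Levi-Civita connection of [g]. *)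
Lemma DJ_metric i u : U u -> DJ i u *m h (tau u) *m (J u)^T = Gam g i u *m g u.
Proof.
move=> Uu.
have hTu := hT (tauV Uu).
move: i; apply: koszul_unique.
- move=> i k l; rewrite !mxE; apply: eq_bigr => a _; congr (_ * _); rewrite !mxE.
  by apply: eq_bigr => b _; rewrite (DJ_sym i k b Uu).
- move=> i k l; rewrite !mxE; apply: eq_bigr => a _; congr (_ * _).
  exact: (Gam_sym oU gT).
- move=> i; rewrite !trmx_mul trmxK hTu (gT Uu) -(compat oU gT gpos i Uu) (pdm_eq oU i gE Uu).
  have cJh := CkmM oU (cJ 1) (cht 1).
  rewrite (pdmM oU i cJh (Ckm_tr oU (cJ 1)) Uu) (pdmM oU i (cJ 1) (cht 1) Uu) pdm_tr.
  rewrite (pdm_metric_comp i Uu) DJ_def [in LHS]linearD /= trmx_mul.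
  rewrite !mulmxDl !mulmxDr !mulmxDl !mulmxA -!addrA; congr (_ + (_ + _)).
  exact: addrC.
Qed.

(** [DJ] contains the tangential connection as well as the second fundamental form, so the same
    chain rule serves for changes of charts and for hypersurfaces. *)
Lemma hess_comp c f : hesseq h c V f -> forall j u, U u ->
  pdm j (grd (fun v => f (tau v))) u = (- (c * f (tau u))) *: row j (g u) + grd f (tau u) *m (DJ j u)^T.
Proof.
move=> [cf Hf] j u Uu.
have cgr k : Ckm k V (grd f) by exact: Ckm_grd.
rewrite (pdm_eq oU j (fun v Uv => grd_comp oU oV ctau tauV (cf 1) Uv) Uu).
rewrite (pdmM oU j (Ckm_comp oU oV ctau tauV (cgr 1)) (Ckm_tr oU (cJ 1)) Uu).
rewrite pdm_tr (pdm_comp oU oV ctau tauV j (cgr 1) Uu).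
have -> : \sum_a jac tau u j a *: pdm a (grd f) (tau u) =
   (- (c * f (tau u))) *: (row j (J u) *m h (tau u)) + grd f (tau u) *m (Gt j u)^T.
  have -> : (Gt j u)^T = \sum_a J u j a *: (Gam h a (tau u))^T.
    by rewrite Gt_def linear_sum; apply: eq_bigr => a _; rewrite linearZ.
  have -> : row j (J u) *m h (tau u) = \sum_a J u j a *: row a (h (tau u)).
    by rewrite mulmx_sum_row; apply: eq_bigr => a _; rewrite mxE.
  rewrite scaler_sumr mulmx_sumr -big_split; apply: eq_bigr => a _.
  by rewrite (Hf a _ (tauV Uu)) scalerDr !scalerA mulrC -scalemxAr.
rewrite (gE Uu) !row_mul mulmxDl -scalemxAl DJ_def [in RHS]linearD /= trmx_mul mulmxDr.
by rewrite -[(Gt j u)^T *m _]/((Gt j u)^T *m (J u)^T) mulmxA -addrA [X in _ + X]addrC.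
Qed.

Lemma pdm_Gt i j u : U u -> pdm i (Gt j) u =
  \sum_a pdm i J u j a *: Gam h a (tau u) + \sum_a \sum_b (J u j a * J u i b) *: pdm b (Gam h a) (tau u).
Proof.
move=> Uu; rewrite -big_split /=; apply/matrixP => x y; rewrite pdmE.
rewrite (@pd_eq _ _ _ oU _ (fun v => \sum_a J v j a * Gam h a (tau v) x y)) //; last first.
  move=> v _; rewrite Gt_def summxE; apply: eq_bigr => a _; by rewrite mxE.
have cG a : Ck 1 U (fun v => Gam h a (tau v) x y) by exact: (Ckm_comp oU oV ctau tauV (cGam 1 a)).
rewrite (pd_sum oU _ i (fun a _ => CkM oU (cJ 1 j a) (cG a)) Uu) summxE; apply: eq_bigr => a _.
rewrite (pdM i (cJ 1 j a) (cG a) Uu) mx_addE mx_scaleE -pdmE; congr (_ + _).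
rewrite -pdmE (pdm_comp oU oV ctau tauV i (cGam 1 a) Uu) !summxE mulr_sumr.
apply: eq_bigr => b _; by rewrite !mx_scaleE mulrA.
Qed.

(** The curvature of the pulled back connection is the pulled back curvature: the second derivatives
    of [tau] are symmetric and cancel. *)
Lemma Gt_curvature i j u : U u ->
  pdm i (Gt j) u - pdm j (Gt i) u + Gt j u *m Gt i u - Gt i u *m Gt j u =
  \sum_a \sum_b (J u i a * J u j b) *: Om h a b (tau u).
Proof.
move=> Uu.
have GG k l : Gt k u *m Gt l u = \sum_a \sum_b (J u l a * J u k b) *: (Gam h b (tau u) *m Gam h a (tau u)).
  rewrite (Gt_def k) (Gt_def l) mulmx_sumr; apply: eq_bigr => a _; rewrite mulmx_suml; apply: eq_bigr => b _.
  by rewrite -scalemxAl -scalemxAr scalerA mulrC.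
have GG' k l : Gt k u *m Gt l u = \sum_a \sum_b (J u k a * J u l b) *: (Gam h a (tau u) *m Gam h b (tau u)).
  by rewrite GG exchange_big; apply: eq_bigr => a _; apply: eq_bigr => b _; rewrite mulrC.
rewrite (GG j i) (GG' i j) !pdm_Gt //.
have -> : \sum_a pdm i J u j a *: Gam h a (tau u) = \sum_a pdm j J u i a *: Gam h a (tau u).
  by apply: eq_bigr => a _; rewrite pdm_jac_sym.
have -> : \sum_a \sum_b (J u j a * J u i b) *: pdm b (Gam h a) (tau u) =
   \sum_a \sum_b (J u i a * J u j b) *: pdm a (Gam h b) (tau u).
  by rewrite exchange_big; apply: eq_bigr => a _; apply: eq_bigr => b _; rewrite mulrC.
move: (\sum_a _ *: Gam h a (tau u)) => X.
have ab (x y z w : 'M[R]_m) : (X + x) - (X + y) + z - w = x - y + z - w.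
  by rewrite opprD addrACA subrr add0r.
rewrite {}ab -!sumrB -!big_split -!sumrB; apply: eq_bigr => a _.
rewrite -!sumrB -!big_split -!sumrB; apply: eq_bigr => b _.
by rewrite /= -!scalerBr -scalerDr -scalerBr Om_def.
Qed.

End Pullback.

Section HessianLocal.
Variables (R : realType) (m : nat) (U : set 'rV[R]_m).
Hypothesis oU : open U.
Variable g : 'rV[R]_m -> 'M[R]_m.
Hypothesis cg : forall k, Ckm k U g.
Hypothesis gT : forall u, U u -> (g u)^T = g u.
Hypothesis gpos : forall u v, U u -> v != 0 -> 0 < inner g u v v.
Variable c : R.
Hypothesis gsec : forall u v w, U u -> row_free (col_mx v w) -> sectional g u v w = c.

(* First order form of the Hessian equation for the row [(f, grad f)]. *)
Definition Hs : 'I_m -> 'rV[R]_m -> 'M[R]_(1 + m) := let: tt := seal in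
  fun j u => block_mx 0 (- c *: row j (g u)) (ebase R j)^T (Gam g j u)^T.

Lemma Hs_def j u : Hs j u = block_mx 0 (- c *: row j (g u)) (ebase R j)^T (Gam g j u)^T.
Proof. by rewrite /Hs; case: seal. Qed.

Lemma Ckm_Hs k j : Ckm k U (Hs j).
Proof.
have cG : Ckm k U (Gam g j) by exact: Ckm_Gam.
move=> a b; case: (splitP a) => a' ea; case: (splitP b) => b' eb.
- have -> : a = lshift m a' by apply/val_inj. have -> : b = lshift m b' by apply/val_inj.
  by apply: (Ck_eq oU _ (Ck_cst k U (0 : R))) => u _; rewrite Hs_def block_mxEul mxE.
- have -> : a = lshift m a' by apply/val_inj. have -> : b = rshift 1 b' by apply/val_inj.
  apply: (Ck_eq oU _ (CkM oU (Ck_cst k U (- c)) (cg k j b'))) => u _; by rewrite Hs_def block_mxEur !mxE.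
- have -> : a = rshift 1 a' by apply/val_inj. have -> : b = lshift m b' by apply/val_inj.
  by apply: (Ck_eq oU _ (Ck_cst k U ((ebase R j)^T a' b'))) => u _; rewrite Hs_def block_mxEdl.
- have -> : a = rshift 1 a' by apply/val_inj. have -> : b = rshift 1 b' by apply/val_inj.
  by apply: (Ck_eq oU _ (cG b' a')) => u _; rewrite Hs_def block_mxEdr mxE.
Qed.

Lemma pdm_Hs i j u : U u ->
  pdm i (Hs j) u = block_mx 0 (- c *: row j (pdm i g u)) 0 (pdm i (Gam g j) u)^T.
Proof.
move=> Uu.
have cG : Ckm 1 U (Gam g j) by exact: Ckm_Gam.
apply/matrixP => a b; rewrite pdmE; case: (splitP a) => a' ea; case: (splitP b) => b' eb.
- have -> : a = lshift m a' by apply/val_inj. have -> : b = lshift m b' by apply/val_inj.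
  rewrite block_mxEul mxE -[RHS](pd_cst (0 : R) i u); apply: (pd_eq oU) => // v _.
  by rewrite Hs_def block_mxEul mxE.
- have -> : a = lshift m a' by apply/val_inj. have -> : b = rshift 1 b' by apply/val_inj.
  rewrite block_mxEur mx_scaleE [X in _ * X]mxE pdmE.
  rewrite (@pd_eq _ _ _ oU _ (fun v => - c * g v j b')) //; last first.
    by move=> v _; rewrite Hs_def block_mxEur !mxE.
  by rewrite (pdM i (Ck_cst 1 U (- c)) (cg 1 j b') Uu) pd_cst mul0r add0r.
- have -> : a = rshift 1 a' by apply/val_inj. have -> : b = lshift m b' by apply/val_inj.
  rewrite block_mxEdl [RHS]mxE -[RHS](pd_cst ((ebase R j)^T a' b') i u); apply: (pd_eq oU) => // v _.
  by rewrite Hs_def block_mxEdl.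
- have -> : a = rshift 1 a' by apply/val_inj. have -> : b = rshift 1 b' by apply/val_inj.
  rewrite block_mxEdr mx_trE pdmE; apply: (pd_eq oU) => // v _.
  by rewrite Hs_def block_mxEdr mxE.
Qed.

Lemma block_mxB (p1 p2 q1 q2 : nat) (A A' : 'M[R]_(p1, q1)) (B B' : 'M[R]_(p1, q2)) (C C' : 'M[R]_(p2, q1)) (D D' : 'M[R]_(p2, q2)) :
  block_mx A B C D - block_mx A' B' C' D' = block_mx (A - A') (B - B') (C - C') (D - D').
Proof. by rewrite opp_block_mx add_block_mx. Qed.

(** Torsion freeness and metric compatibility dispose of three blocks; constant curvature is what
    makes the lower right block vanish, through [Om_const]. *)
Lemma Hs_flat i j u : U u ->
  pdm i (Hs j) u - pdm j (Hs i) u + Hs i u *m Hs j u - Hs j u *m Hs i u = 0.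
Proof.
move=> Uu; rewrite (pdm_Hs i j Uu) (pdm_Hs j i Uu) (Hs_def i) (Hs_def j) !mulmx_block.
rewrite block_mxB add_block_mx block_mxB !mul0mx !mulmx0 !add0r !oppr0 !add0r.
have ts : row j (Gam g i u) = row i (Gam g j u).
  by apply/rowP => l; rewrite !mxE (Gam_sym oU gT i j l Uu).
rewrite -[RHS]block_mx0; congr block_mx.
- rewrite -!scalemxAl /ebase !trmx_delta -!colE; have -> : col j (row i (g u)) = col i (row j (g u)).
    by apply/matrixP => a b; rewrite !mxE (g_sym gT i j Uu).
  by rewrite subrr.
- rewrite -!scalemxAl -!scalerBr -scalerDr -scalerBr !(compat oU gT gpos) //.
  have rD k (A B : 'M[R]_m) : row k (A + B) = row k A + row k B by apply/rowP => l; rewrite !mxE.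
  rewrite !rD !row_mul ts; set X := row i _ *m g u.
  move: (row j (g u) *m _) (row i (g u) *m _) => Y Z.
  have -> : X + Y - (X + Z) + Z - Y = 0 by rewrite opprD addrACA subrr add0r subrK subrr.
  by rewrite scaler0.
- by rewrite -!trmx_mul /ebase -!rowE ts subrr.
- rewrite -!scalemxAr; have O := Om_const oU cg gT gpos gsec Uu i j.
  have OT : (Om g i j u)^T = (pdm i (Gam g j) u)^T - (pdm j (Gam g i) u)^T
     + (Gam g i u)^T *m (Gam g j u)^T - (Gam g j u)^T *m (Gam g i u)^T.
    rewrite Om_def -!trmx_mul; move: (pdm i _ u) (pdm j _ u) (_ *m Gam g i u) (Gam g i u *m _) => a b x y.
    by apply/matrixP => k l; rewrite !mxE.
  move: OT; rewrite O linearZ linearB /= !trmx_mul !trmxK.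
  move: (pdm i _ u)^T (pdm j _ u)^T (_ *m (Gam g j u)^T) ((Gam g j u)^T *m _) => a b x y.
  move: (_ *m row j (g u)) (_ *m row i (g u)) => z w e.
  have -> : a - b + (- c *: z + x) - (- c *: w + y) = (a - b + x - y) - c *: (z - w).
    by apply/matrixP => k l; rewrite !mxE; ring.
  by rewrite -e subrr.
Qed.

Definition hrow (f : 'rV[R]_m -> R) (u : 'rV[R]_m) : 'rV[R]_(1 + m) := row_mx (f u)%:M (grd f u).

Lemma parallel_hesseq p rho (s : 'rV[R]_m -> 'rV[R]_(1 + m)) : ball p rho `<=` U ->
  parallel p rho Hs s -> hesseq g c (ball p rho) (fun u => s u 0 (lshift m 0)) /\
  forall u, ball p rho u -> grd (fun u => s u 0 (lshift m 0)) u = rsubmx (s u).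
Proof.
move=> pU [cs ps]; have oB : open (ball p rho) by exact: ball_open.
(* Bootstrap: the derivative of [s] is the product of [s] with the smooth matrices [Hs], so each
   order of regularity gives the next. *)
have cs' k : Ckm k (ball p rho) s.
  elim: k => [|k IH]; first exact: CkmS.
  move=> a b; have [c1 d1] := cs a b; split=> // i; split; first by have [] := d1 i.
  have cH : Ckm k (ball p rho) (Hs i) by move=> x y; apply: Ck_sub (Ckm_Hs k i x y).
  apply: (Ck_eq oB _ (CkmM oB IH cH a b)) => u Bu.
  by rewrite -pdE -(ps i u Bu) pdmE.
have e u : ball p rho u -> grd (fun u => s u 0 (lshift m 0)) u = rsubmx (s u).
  move=> Bu; apply/rowP => j; rewrite grd_entry -pdmE (ps j u Bu) -{1}[s u]hsubmxK Hs_def mul_row_block.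
  by rewrite row_mxEl mulmx0 add0r /ebase trmx_delta -colE mxE.
split=> //; split=> [k|j u Bu]; first exact: (cs' k 0 (lshift m 0)).
rewrite (pdm_eq oB j e Bu); apply/rowP => l.
have -> : pdm j (fun v => rsubmx (s v)) u 0 l = pdm j s u 0 (rshift 1 l).
  rewrite !pdmE; apply: (pd_eq oB) => // v _; by rewrite mxE.
rewrite (ps j u Bu) -{1}[s u]hsubmxK Hs_def mul_row_block row_mxEr e //.
rewrite (mx11_scalar (lsubmx (s u))) mul_scalar_mx scalerA mulrN mulrC [lsubmx (s u) 0 0]mxE.
by [].
Qed.

Lemma hesseq_parallel p rho f : ball p rho `<=` U -> hesseq g c (ball p rho) f -> parallel p rho Hs (hrow f).
Proof.
move=> pU [cf Hf]; have oB : open (ball p rho) by exact: ball_open.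
have cgr k := Ckm_grd oB (cf k.+1).
split=> [a b|j u Bu].
- rewrite ord1; case: (splitP b) => b' eb.
  + have -> : b = lshift m b' by apply/val_inj. rewrite ord1.
    by apply: (Ck_eq oB _ (cf 1%N)) => u _; rewrite row_mxEl mxE eqxx mulr1n.
  + have -> : b = rshift 1 b' by apply/val_inj.
    by apply: (Ck_eq oB _ (cgr 1%N 0 b')) => u _; rewrite row_mxEr.
- rewrite /hrow Hs_def mul_row_block mulmx0 add0r mul_scalar_mx scalerA.
  apply/rowP => b; rewrite pdmE; case: (splitP b) => b' eb.
  + have -> : b = lshift m b' by apply/val_inj. rewrite ord1.
    rewrite (@pd_eq _ _ _ oB _ f) //; last by move=> v _; rewrite row_mxEl mxE eqxx mulr1n.
    by rewrite row_mxEl /ebase trmx_delta -colE mxE grd_entry.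
  + have -> : b = rshift 1 b' by apply/val_inj.
    rewrite (@pd_eq _ _ _ oB _ (fun v => grd f v 0 b')) //; last by move=> v _; rewrite row_mxEr.
    by rewrite row_mxEr -pdmE (Hf j u Bu) mulrN mulrC.
Qed.

End HessianLocal.

Lemma hesseq_sub (R : realType) m (g : 'rV[R]_m -> 'M[R]_m) c (U W : set 'rV[R]_m) f :
  W `<=` U -> hesseq g c U f -> hesseq g c W f.
Proof. by move=> WU [cf Hf]; split=> [k|j u /WU]; [exact: Ck_sub (cf k)|exact: Hf]. Qed.

Lemma grd_eq (R : realType) m (U : set 'rV[R]_m) (f f' : 'rV[R]_m -> R) u : open U ->
  (forall v, U v -> f v = f' v) -> U u -> grd f u = grd f' u.
Proof. by move=> oU ff Uu; apply/rowP => b; rewrite !grd_entry (pd_eq oU b ff Uu). Qed.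

Lemma hesseq_eq (R : realType) m (g : 'rV[R]_m -> 'M[R]_m) c (U : set 'rV[R]_m) f f' : open U ->
  (forall v, U v -> f v = f' v) -> hesseq g c U f -> hesseq g c U f'.
Proof.
move=> oU ff [cf Hf]; split=> [k|j u Uu]; first exact: Ck_eq (cf k).
rewrite -(ff u Uu) -(grd_eq oU ff Uu) -(Hf j u Uu); apply: (pdm_eq oU) => // v Uv.
by rewrite (grd_eq oU ff Uv).
Qed.

Lemma hesseq_local (R : realType) m (g : 'rV[R]_m -> 'M[R]_m) c (U : set 'rV[R]_m) f :
  (forall u, U u -> exists W, [/\ open W, W u & hesseq g c W f]) -> hesseq g c U f.
Proof.
move=> H; split=> [k|j u /H[W [_ Wu [_]]]]; last exact.
apply: Ck_local => u /H[W [oW Wu [cf _]]]; by exists W; split.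
Qed.

Lemma le_trans_mul (R : realFieldType) (a b : R) : 0 <= a -> 0 <= b -> b <= (16 * (a + 1))^-1 -> 8 * (2 * b * a) <= 1.
Proof.
move=> a0 b0 h; have h1 : 16 * (a + 1) * b <= 1.
  have p : 0 < 16 * (a + 1) by lra.
  by rewrite mulrC -ler_pdivlMr // div1r.
have : 8 * (2 * b * a) = 16 * (a + 1) * b - 16 * b by ring.
lra.
Qed.

(** Initial data may be prescribed at any point [q] of the ball while the solution must live on the
    whole ball. Hence the flat system is solved on the larger ball of radius [2 * rho] centred at
    [q]. *)
Lemma local_hess (R : realType) m (U : set 'rV[R]_m) (oU : open U) (g : 'rV[R]_m -> 'M[R]_m)
  (cg : forall k, Ckm k U g) (gT : forall u, U u -> (g u)^T = g u)
  (gpos : forall u v, U u -> v != 0 -> 0 < inner g u v v) c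
  (gsec : forall u v w, U u -> row_free (col_mx v w) -> sectional g u v w = c) p e :
  U p -> 0 < e -> exists rho, [/\ 0 < rho, rho <= e, ball p rho `<=` U,
   (forall q a w, ball p rho q -> exists f, [/\ hesseq g c (ball p rho) f, f q = a & grd f q = w]) &
   forall f f' q, hesseq g c (ball p rho) f -> hesseq g c (ball p rho) f' -> ball p rho q ->
     f q = f' q -> grd f q = grd f' q -> forall u, ball p rho u -> f u = f' u].
Proof.
move=> Up e0.
have cH k j := Ckm_Hs oU cg gT gpos c k j.
pose K : R := 1 + \sum_j `|Hs g c j p|.
have K0 : 0 <= K by rewrite addr_ge0 // sumr_ge0.
have nK : \forall u \near p, forall j, `|Hs g c j u| <= K.
  apply: (@filter_forall _ _ (fun j u => `|Hs g c j u| <= K) (nbhs p)) => j.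
  have := Ckm_cont (cH 0 j) Up; move=> /cvgrPdist_le /(_ 1 ltr01); apply: filterS => u h.
  rewrite /K (bigD1 j) //= addrA; apply: (@le_trans _ _ (1 + `|Hs g c j p|)).
    rewrite -lerBlDr -[leLHS]/(`|Hs g c j u| - `|Hs g c j p|).
    by apply: le_trans h; rewrite distrC; exact: lerB_dist.
  by rewrite lerDl sumr_ge0.
have [d d0 dP] := near_ball2 (open_near oU Up) nK.
(* The bound [d / 3] keeps the ball of radius [2 * rho] about any point of the small ball inside the
   region where [Hs] is bounded by [K]; the last term is the smallness condition for radius
   [2 * rho]. *)
pose rho := Num.min e (Num.min (d / 3) (16 * (m%:R * ((1 + m)%:R * K) + 1))^-1).
have P0 : 0 <= m%:R * ((1 + m)%:R * K) by rewrite !mulr_ge0.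
have rho0 : 0 < rho by rewrite !lt_min e0 divr_gt0 // invr_gt0 mulr_gt0 // ltr_wpDl.
have rd : rho <= d / 3 by rewrite /rho !ge_min lexx orbT.
have rs : rho <= (16 * (m%:R * ((1 + m)%:R * K) + 1))^-1 by rewrite /rho !ge_min lexx !orbT.
have small : 8 * (m%:R * (2 * rho) * ((1 + m)%:R * K)) <= 1.
  have -> : m%:R * (2 * rho) * ((1 + m)%:R * K) = 2 * rho * (m%:R * ((1 + m)%:R * K)) by ring.
  by apply: le_trans_mul => //; exact: ltW.
have small1 : 8 * (m%:R * rho * ((1 + m)%:R * K)) <= 1.
  apply: le_trans small; rewrite ler_pM2l // ler_wpM2r ?mulr_ge0 // ler_wpM2l //; move: (ltW rho0); lra.
have bd : ball p rho `<=` ball p d by apply: le_ball; move: rd; lra.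
have bU : ball p rho `<=` U by move=> u /bd /dP[].
have bK u j a b : ball p d u -> `|Hs g c j u a b| <= K.
  by move=> /dP[_ /(_ j)]; apply: le_trans; exact: mx_entry_le.
exists rho; split=> //; first by rewrite /rho ge_min lexx.
- move=> q a w Bq.
  have qd : ball q (2 * rho) `<=` ball p d.
    move=> u qu; have : ball p (rho + 2 * rho) u by exact: (ball_triangle Bq qu).
    by apply: le_ball; move: rd; lra.
  have pq : ball p rho `<=` ball q (2 * rho).
    move=> u pu; have -> : 2 * rho = rho + rho by ring.
    exact: (ball_triangle (ball_sym Bq) pu).
  have qU : ball q (2 * rho) `<=` U by move=> u /qd /dP[].
  have r20 : 0 < 2 * rho by rewrite mulr_gt0.
  have cq j : Ckm 1 (ball q (2 * rho)) (Hs g c j) by move=> x y; exact: Ck_sub (cH 1 j x y).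
  have fl i j u (qu : ball q (2 * rho) u) := Hs_flat oU cg gT gpos gsec i j (qU _ qu).
  have bq j u (qu : ball q (2 * rho) u) x y := bK u j x y (qd _ qu).
  have [s [ps sq]] := parallel_exists r20 K0 cq bq fl small (row_mx a%:M w).
  have [h1 h2] := parallel_hesseq oU cg gT gpos qU ps.
  exists (fun u => s u 0 (lshift m 0)); split; first exact: hesseq_sub h1.
    by rewrite sq row_mxEl mxE eqxx mulr1n.
  by rewrite h2 ?sq ?row_mxKr //; exact: ballxx.
- move=> f f' q Hf Hf' Bq e1 e2 u Bu.
  have [ct pt] := hesseq_parallel bU Hf; have [ct' pt'] := hesseq_parallel bU Hf'.
  have oB : open (ball p rho) by exact: ball_open.
  have pp : parallel p rho (Hs g c) (fun u => hrow f u - hrow f' u).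
    split; first exact: CkmB.
    by move=> j v Bv; rewrite (pdmB oB j ct ct' Bv) pt // pt' // mulmxBl.
  have z : hrow f q - hrow f' q = 0 by rewrite /hrow e1 e2 subrr.
  have := parallel_unique (fun j v Bv a b => bK v j a b (bd v Bv)) small1 pp Bq z Bu.
  move=> /rowP /(_ (lshift m 0)); rewrite mx_subE !row_mxEl !mxE eqxx !mulr1n => /eqP.
  by rewrite subr_eq0 => /eqP.
Qed.

Section Energy.
Variables (R : realType) (m : nat) (U : set 'rV[R]_m).
Hypothesis oU : open U.
Variable g : 'rV[R]_m -> 'M[R]_m.
Hypothesis cg : forall k, Ckm k U g.
Hypothesis gT : forall u, U u -> (g u)^T = g u.
Hypothesis gpos : forall u v, U u -> v != 0 -> 0 < inner g u v v.
Variable c : R.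

Lemma Ckm_ginv k : Ckm k U (fun v => invmx (g v)).
Proof. by apply: Ckm_inv => //; exact: metric_unit. Qed.

Lemma pdm_ginv j u : U u -> pdm j (fun v => invmx (g v)) u =
  - (invmx (g u) *m Gam g j u + (Gam g j u)^T *m invmx (g u)).
Proof.
move=> Uu; have un := metric_unit gpos.
have : pdm j (fun v => invmx (g v) *m g v) u = 0.
  rewrite (@pdm_eq _ _ _ oU _ _ _ _ _ (fun _ => 1%:M)) ?pdm_cst // => v Uv.
  by rewrite mulVmx // un.
rewrite (pdmM oU j (Ckm_ginv 1) (cg 1) Uu) (compat oU gT gpos j Uu) mulmxDr mulKmx ?un //.
move=> /(congr1 (fun A => A *m invmx (g u))).
rewrite !mulmxDl mul0mx !mulmxK ?un // !mulmxA => /eqP.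
by rewrite mulmxK ?un // addr_eq0 => /eqP.
Qed.

(** The first integral c f^2 + |grad f|^2 of the Hessian equation. *)
Definition energy f u : R := c * f u ^+ 2 + (grd f u *m invmx (g u) *m (grd f u)^T) 0 0.

Lemma Ck_energy f k : hesseq g c U f -> Ck k U (energy f).
Proof.
move=> [cf Hf]; rewrite /energy; apply: CkD => //.
  apply: CkM => //; first exact: Ck_cst.
  by apply: CkM.
have cgr : Ckm k U (grd f) by exact: Ckm_grd (cf k.+1).
exact: (CkmM oU (CkmM oU cgr (Ckm_ginv k)) (Ckm_tr oU cgr) 0 0).
Qed.

Lemma pd_energy f j u : hesseq g c U f -> U u -> pd j (energy f) u = 0.
Proof.
move=> [cf Hf] Uu; have un := metric_unit gpos Uu.
have cgr : Ckm 1 U (grd f) by exact: Ckm_grd (cf 2%N).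
have cff := CkM oU (cf 1%N) (cf 1%N).
have cA := CkmM oU cgr (Ckm_ginv 1); have cB := CkmM oU cA (Ckm_tr oU cgr).
rewrite /energy (pdD j (CkM oU (Ck_cst 1 U c) cff) (cB 0 0) Uu).
rewrite (pdM j (Ck_cst 1 U c) cff Uu) (pdM j (cf 1%N) (cf 1%N) Uu) pd_cst mul0r add0r.
rewrite -pdmE (pdmM oU j cA (Ckm_tr oU cgr) Uu) (pdmM oU j cgr (Ckm_ginv 1) Uu) pdm_tr.
rewrite (pdm_ginv j Uu) (Hf j u Uu).
have E : grd f u *m invmx (g u) *m (row j (g u))^T = (pd j f u)%:M.
  rewrite tr_row (gT Uu) colE -mulmxA mulKmx // -colE; apply/matrixP => a b.
  by rewrite !ord1 !mxE eqxx mulr1n grd_entry.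
have E' : row j (g u) *m invmx (g u) *m (grd f u)^T = (pd j f u)%:M.
  rewrite -row_mul mulmxV // row1 -rowE; apply/matrixP => a b.
  by rewrite !ord1 !mxE eqxx mulr1n grd_entry.
rewrite (mulmxDl _ _ (grd f u)^T).
have -> : ((- (c * f u)) *: row j (g u) + grd f u *m (Gam g j u)^T) *m invmx (g u) *m (grd f u)^T =
   (- (c * f u)) *: (pd j f u)%:M + grd f u *m ((Gam g j u)^T *m invmx (g u)) *m (grd f u)^T.
  by rewrite !mulmxDl -!scalemxAl E' !mulmxA.
have -> : ((- (c * f u)) *: row j (g u) + grd f u *m (Gam g j u)^T)^T =
    (- (c * f u)) *: (row j (g u))^T + Gam g j u *m (grd f u)^T.
  by rewrite linearD /= linearZ /= trmx_mul trmxK.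
rewrite mulmxDr -scalemxAr E mulmxN mulmxDr mulNmx mulmxDl !mulmxA.
move: (_ *m Gam g j u *m _) (_ *m invmx (g u) *m (grd f u)^T) => X Y.
by rewrite !mxE !eqxx !mulr1n; ring.
Qed.

End Energy.

Lemma open_preim (T S : topologicalType) (U : set T) (W : set S) (f : T -> S) : open U -> open W ->
  (forall u, U u -> {for u, continuous f}) -> open (U `&` f @^-1` W).
Proof.
move=> oU oW cf; rewrite openE => u [Uu Wu].
by apply: filterI; [exact: open_nbhs_nbhs|apply: (cf u Uu); exact: open_nbhs_nbhs].
Qed.

Lemma near_open (T : topologicalType) (P : T -> Prop) p : (\forall q \near p, P q) ->
  exists Z : set T, [/\ open Z, Z p & forall q, Z q -> P q].
Proof. by move=> Pp; exists (interior [set q | P q]); split; [exact: open_interior|exact: Pp|exact: interior_subset]. Qed.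

Lemma local_dom_open (R : realType) (S T : topologicalType) m k (f : S -> T) (c : chart R S m) (d : chart R T k) :
  continuous f -> open (local_dom f c d).
Proof.
move=> cf; rewrite [X in open X](_ : _ = ccod c `&` (f \o cinv c) @^-1` cdom d); last by [].
apply: open_preim; [exact: ccod_open|exact: cdom_open|move=> u Uu].
by apply: continuous_comp; [exact: cinv_continuous|exact: cf].
Qed.

(** * Global solutions of the Hessian equation *)

Section ChartFacts.
Variables (R : realType) (m : nat) (N : riemannian R m).
Implicit Types (c d : chart R N m).
Local Notation tr c d := (local id c d).
Local Notation trd c d := (local_dom id c d).

Lemma metricC c k : @atlas R m N c -> Ckm k (ccod c) (metric c).
Proof. by move=> ac; exact: (Ck_entry (@ccod_open _ _ _ c) (metric_smooth ac k)). Qed.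

Lemma trd_open c d : open (trd c d).
Proof. by apply: local_dom_open => x; exact: cvg_id. Qed.

Lemma transC c d k : @atlas R m N c -> @atlas R m N d -> Ckm k (trd c d) (tr c d).
Proof. by move=> ac ad; apply: Ck_entry; [exact: trd_open|exact: (atlas_smooth ac ad k)]. Qed.

Lemma trans_cod c d u : trd c d u -> ccod d (tr c d u).
Proof. by move=> [_ h]; exact: cmap_ccod. Qed.

Lemma transK c d u : trd c d u -> cinv d (tr c d u) = cinv c u.
Proof. by move=> [_ h]; rewrite /local cmapK. Qed.

Lemma cinv_cvg c p : cdom c p -> cinv c @ nbhs (cmap c p) --> p.
Proof. by move=> cp; have := cinv_continuous (cmap_ccod cp); rewrite /prop_for /continuous_at cmapK. Qed.

Lemma trd_cmap c d p : cdom c p -> cdom d p -> trd c d (cmap c p).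
Proof. by move=> cp dp; split; [exact: cmap_ccod|rewrite cmapK]. Qed.

Lemma tr_cmap c d p : cdom c p -> tr c d (cmap c p) = cmap d p.
Proof. by move=> cp; rewrite /local cmapK. Qed.

Lemma metric_trans c d u : @atlas R m N c -> @atlas R m N d -> trd c d u ->
  metric c u = jac (tr c d) u *m metric d (tr c d u) *m (jac (tr c d) u)^T.
Proof.
move=> ac ad Uu; rewrite (metric_change ac ad Uu).
by rewrite (jacE (@trd_open c d) (fun k => transC k ac ad) Uu).
Qed.

Lemma metric_unitC c u : @atlas R m N c -> ccod c u -> metric c u \in unitmx.
Proof. by move=> ac; apply: metric_unit => v w; exact: metric_pos. Qed.

Lemma jac_trans_unit c d u : @atlas R m N c -> @atlas R m N d -> trd c d u -> jac (tr c d) u \in unitmx.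
Proof.
move=> ac ad Uu; have := metric_unitC ac Uu.1.
by rewrite (metric_trans ac ad Uu) !unitmx_mul => /andP[/andP[]].
Qed.

Lemma DJ_trans c d i u : @atlas R m N c -> @atlas R m N d -> trd c d u ->
  DJ (tr c d) (metric d) i u = Gam (metric c) i u *m jac (tr c d) u.
Proof.
move=> ac ad Uu; have Ju := jac_trans_unit ac ad Uu; have hu := metric_unitC ad (trans_cod Uu).
have E := DJ_metric (@trd_open c d) (@ccod_open _ _ _ d) (fun k => transC k ac ad) (@trans_cod c d)
  (fun k => metricC k ad)
  (fun u (h : trd c d u) => metric_sym ac h.1) (fun u => @metric_sym _ _ _ d u ad)
  (fun u v (h : trd c d u) => @metric_pos _ _ _ c u v ac h.1) (fun u v => @metric_pos _ _ _ d u v ad)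
  (fun u h => metric_trans ac ad h) i Uu.
move: E; rewrite (metric_trans ac ad Uu) !mulmxA => E.
have JT : (jac (tr c d) u)^T \in unitmx by rewrite unitmx_tr.
by move: E => /(congr1 (fun A => A *m invmx (jac (tr c d) u)^T *m invmx (metric d (tr c d u)))); rewrite !mulmxK.
Qed.

Lemma hesseq_trans c d k (W : set 'rV[R]_m) f : @atlas R m N c -> @atlas R m N d -> open W -> W `<=` ccod d ->
  hesseq (metric d) k W f ->
  open (trd c d `&` tr c d @^-1` W) /\ hesseq (metric c) k (trd c d `&` tr c d @^-1` W) (f \o tr c d).
Proof.
move=> ac ad oW Wd Hf; set U := _ `&` _.
have oU : open U.
  apply: open_preim => //; first exact: trd_open.
  by move=> u Uu; exact: (Ckm_cont (transC 0 ac ad) Uu).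
have US : U `<=` trd c d by move=> u [].
have ct l : Ckm l U (tr c d) by move=> i j; exact: Ck_sub (transC l ac ad i j).
have tW u : U u -> W (tr c d u) by case.
have [cf _] := Hf.
split=> //; split=> [l|j u Uu].
  exact: (Ck_comp oU oW (ct l) tW (cf l)).
have := @hess_comp R m m U W oU oW (tr c d) ct tW (metric c) (metric d) _ k f Hf j u Uu; rewrite /= => -> //; last first.
  by move=> v Uv; exact: (metric_trans ac ad (US v Uv)).
rewrite (DJ_trans j ac ad (US u Uu)) trmx_mul mulmxA; congr (_ + _ *m _).
by rewrite -(grd_comp oU oW ct tW (cf 1%N) Uu).
Qed.

Definition hess_sol (k : R) (p : N) (h : N -> R) : Prop := exists c W,
  [/\ @atlas R m N c, cdom c p, open W /\ W (cmap c p), W `<=` ccod c &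
      hesseq (metric c) k W (h \o cinv c)].

Lemma hess_sol_chart k p h d : hess_sol k p h -> @atlas R m N d -> cdom d p ->
  exists W, [/\ open W, W (cmap d p), W `<=` ccod d & hesseq (metric d) k W (h \o cinv d)].
Proof.
move=> [c [W [ac cp [oW Wp] Wc H]]] ad dp.
have [oU H'] := hesseq_trans ad ac oW Wc H.
exists (trd d c `&` tr d c @^-1` W); split=> //.
- by split; [exact: trd_cmap|rewrite /= tr_cmap].
- by move=> u [[]].
- by apply: hesseq_eq H' => // u [Uu _] /=; rewrite transK.
Qed.

Lemma hess_sol_geq k p h h' : geq p h h' -> hess_sol k p h -> hess_sol k p h'.
Proof.
move=> hh [c [W [ac cp [oW Wp] Wc H]]].
have [Z [oZ Zp Oh]] := near_open hh.
exists c, (W `&` cinv c @^-1` Z).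
have oV : open (W `&` cinv c @^-1` Z).
  by apply: open_preim => // u /Wc; exact: cinv_continuous.
split=> //.
- by split=> //; split=> //=; rewrite cmapK.
- by move=> u [/Wc].
- by apply: (hesseq_eq oV _ (hesseq_sub (@subIsetl _ _ _) H)) => u [_ /Oh].
Qed.

Lemma hess_sol_on k c (W : set 'rV[R]_m) h : @atlas R m N c -> open W -> W `<=` ccod c ->
  (forall u, W u -> hess_sol k (cinv c u) h) -> hesseq (metric c) k W (h \o cinv c).
Proof.
move=> ac oW Wc H; apply: hesseq_local => u Wu.
have [W' [oW' W'u W'c H']] := hess_sol_chart (H u Wu) ac (cinv_cdom (Wc u Wu)).
rewrite cinvK in W'u; last exact: Wc.
by exists W'.
Qed.

(** The nice sets are preimages under a chart of the balls of [local_hess]; a solution germ is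
    extended by the solution with the same value and gradient. *)
Lemma hess_nice_cover k p : constant_curvature N k -> exists2 U, nice (hess_sol k) U & U p.
Proof.
move=> curv; have [c ac cp] := atlas_cover p.
have oc := @ccod_open _ _ _ c.
have gsec u v w : ccod c u -> row_free (col_mx v w) -> sectional (metric c) u v w = k by exact: curv.
have LH := local_hess oc (fun k => metricC k ac) (fun u => @metric_sym _ _ _ c u ac)
  (fun u v => @metric_pos _ _ _ c u v ac) gsec.
have [rho [rho0 _ Bc ex uq]] := LH (cmap c p) 1 (cmap_ccod cp) ltr01.
set B := ball (cmap c p) rho in Bc ex uq.
have oB : open B by exact: ball_open.
have cmapC q : cdom c q -> {for q, continuous (cmap c)} by exact: cmap_continuous.
exists (cdom c `&` cmap c @^-1` B); last by split=> //; exact: ballxx.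
split.
- by apply: open_preim => //; exact: cdom_open.
- move=> q h [cq Bq] Lq.
  have [W [oW Wq Wc H]] := hess_sol_chart Lq ac cq.
  have [f [Hf f1 f2]] := ex (cmap c q) (h (cinv c (cmap c q))) (grd (h \o cinv c) (cmap c q)) Bq.
  have oWB : open (W `&` B) by exact: openI.
  have [e e0 eP] := near_ball2 (open_near oWB (conj Wq Bq)) (open_near oWB (conj Wq Bq)).
  (* The germ [h] is a solution on [W] only, so its equality with [f] is derived on a smaller ball
     about [q], from uniqueness there. *)
  have [s [s0 se _ _ uqs]] := LH (cmap c q) e (cmap_ccod cq) e0.
  have sub : ball (cmap c q) s `<=` W `&` B by move=> u us; case: (eP u) => //; exact: le_ball us.
  have agree := uqs f (h \o cinv c) (cmap c q) (hesseq_sub (fun u us => (sub u us).2) Hf)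
    (hesseq_sub (fun u us => (sub u us).1) H) (ballxx _ s0) f1 f2.
  exists (f \o cmap c); split.
    move=> r [cr Br]; exists c, B; split=> //.
    by apply: (hesseq_eq oB _ Hf) => u Bu /=; rewrite cinvK //; exact: Bc.
  have h1 : \forall r \near q, cdom c r by apply: open_near => //; exact: cdom_open.
  have h2 : \forall r \near q, ball (cmap c q) s (cmap c r) by apply: (cmapC q cq); exact: nbhsx_ballx.
  by apply: filterS2 h1 h2 => r cr /agree /= ->; rewrite cmapK.
- move=> h h' q Lh Lh' [cq Bq] hh r [cr Br].
  have onB l : (forall r, (cdom c `&` cmap c @^-1` B) r -> hess_sol k r l) -> hesseq (metric c) k B (l \o cinv c).
    move=> Ll; apply: hess_sol_on => // u Bu; apply: Ll; split; first exact: cinv_cdom (Bc _ Bu).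
    by rewrite /= cinvK //; exact: Bc.
  have hq : \forall u \near cmap c q, h (cinv c u) = h' (cinv c u).
    exact: (cinv_cvg cq hh).
  have eg : grd (h \o cinv c) (cmap c q) = grd (h' \o cinv c) (cmap c q).
    have [Z [oZ Zq Oh]] := near_open hq; exact: (grd_eq oZ Oh Zq).
  have := uq _ _ _ (onB h Lh) (onB h' Lh') Bq (nbhs_singleton hq) eg _ Br.
  by rewrite /= cmapK.
- move=> q r [cq Bq] [cr Br]; pose g (t : R) := cmap c q + clamp 0 1 t *: (cmap c r - cmap c q).
  have gB t : B (g t) by apply: segment_in => //; exact: clamp_in.
  exists (cinv c \o g); split.
  + move=> t; apply: continuous_comp; last exact: cinv_continuous (Bc _ (gB t)).
    apply: cvgD; first exact: cvg_cst.
    by apply: cvgZl; exact: clamp_cont.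
  + by rewrite /g /= clamp_id ?lexx ?ler01 // scale0r addr0 cmapK.
  + by rewrite /g /= clamp_id ?lexx ?ler01 // scale1r addrC subrK cmapK.
  + by move=> t; split; [exact: cinv_cdom (Bc _ (gB t))|rewrite /= cinvK; [exact: gB|exact: Bc]].
Qed.

Theorem hess_global k d q0 (w : 'rV[R]_m) : space_form N k -> @atlas R m N d -> cdom d q0 ->
  exists F : N -> R, [/\ forall c, @atlas R m N c -> hesseq (metric c) k (ccod c) (F \o cinv c),
     F q0 = 0 & grd (F \o cinv d) (cmap d q0) = w].
Proof.
move=> [_ sc curv] ad dq.
have oc := @ccod_open _ _ _ d.
have gsec u v v' : ccod d u -> row_free (col_mx v v') -> sectional (metric d) u v v' = k by exact: curv.
have [rho [rho0 _ Bc ex _]] := local_hess oc (fun k => metricC k ad) (fun u => @metric_sym _ _ _ d u ad)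
  (fun u v => @metric_pos _ _ _ d u v ad) gsec (cmap_ccod dq) ltr01.
have [f [Hf f0 f1]] := ex (cmap d q0) 0 w (ballxx _ rho0).
have oB : open (ball (cmap d q0) rho) by exact: ball_open.
have L0 : hess_sol k q0 (f \o cmap d).
  exists d, (ball (cmap d q0) rho); split=> //; first by split=> //; exact: ballxx.
  by apply: (hesseq_eq oB _ Hf) => u /Bc Bu /=; rewrite cinvK.
have [F [LF gF]] := monodromy (@hess_sol_geq k) (fun p => hess_nice_cover p curv) sc L0.
exists F; split.
- move=> c ac; apply: hess_sol_on => //; exact: ccod_open.
- by rewrite (nbhs_singleton gF).
- rewrite -f1.
  have hq : \forall u \near cmap d q0, F (cinv d u) = f (cmap d (cinv d u)).
    exact: (cinv_cvg dq gF).
  have hc : \forall u \near cmap d q0, ccod d u by apply: open_near => //; exact: cmap_ccod.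
  have hf : \forall u \near cmap d q0, (F \o cinv d) u = f u.
    by apply: filterS2 hq hc => u /= -> cu; rewrite cinvK.
  have [Z [oZ Zq Oh]] := near_open hf; exact: (grd_eq oZ Oh Zq).
Qed.

(** A function with zero derivatives, diminished by its value at [q], is a parallel section of the
    zero connection that vanishes at [q]. *)
Lemma pd0_ball_const p rho (f : 'rV[R]_m -> R) q u : Ck 1 (ball p rho) f ->
  (forall j v, ball p rho v -> pd j f v = 0) -> ball p rho q -> ball p rho u -> f u = f q.
Proof.
move=> cf f0 Bq Bu; have oB : open (ball p rho) by exact: ball_open.
pose B (j : 'I_m) (v : 'rV[R]_m) : 'M[R]_1 := 0.
have B0 j v : ball p rho v -> forall a b, `|B j v a b| <= 0 by move=> _ a b; rewrite mxE normr0.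
pose s (v : 'rV[R]_m) : 'rV[R]_1 := (f v - f q)%:M.
have sE v a b : s v a b = f v - f q by rewrite !ord1 mxE eqxx mulr1n.
have cs : Ck 1 (ball p rho) (fun v => f v - f q) by exact: (CkB oB cf (Ck_cst 1 _ (f q))).
have ps : parallel p rho B s.
  split=> [a b|j v Bv]; first by apply: (Ck_eq oB _ cs) => v _; rewrite sE.
  rewrite mulmx0; apply/matrixP => a b; rewrite pdmE mxE.
  rewrite (@pd_eq _ _ _ oB _ (fun v => f v - f q)) //.
  by rewrite (pdB oB j cf (Ck_cst 1 _ (f q)) Bv) f0 // pd_cst subr0.
have sm : 8 * (m%:R * rho * (1%:R * 0)) <= (1 : R) by rewrite !mulr0 ler01.
have := parallel_unique B0 sm ps Bq (_ : s q = 0) Bu.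
have -> : s q = 0 by apply/matrixP => a b; rewrite sE subrr mxE.
by move=> /(_ erefl) /matrixP /(_ 0 0); rewrite sE mxE => /eqP; rewrite subr_eq0 => /eqP.
Qed.

Lemma energy_trans k F c d u : (forall c, @atlas R m N c -> hesseq (metric c) k (ccod c) (F \o cinv c)) ->
  @atlas R m N c -> @atlas R m N d -> trd c d u ->
  energy (metric c) k (F \o cinv c) u = energy (metric d) k (F \o cinv d) (tr c d u).
Proof.
move=> HF ac ad Uu; rewrite /energy /= transK //; congr (_ + _).
have Ju := jac_trans_unit ac ad Uu; have hu := metric_unitC ad (trans_cod Uu).
have -> : grd (F \o cinv c) u = grd (F \o cinv d) (tr c d u) *m (jac (tr c d) u)^T.
  rewrite -(grd_comp (@trd_open c d) (@ccod_open _ _ _ d) (fun k => transC k ac ad) (@trans_cod c d) ((HF d ad).1 1%N) Uu).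
  by apply: (grd_eq (@trd_open c d)) => // v Uv /=; rewrite transK.
rewrite (metric_trans ac ad Uu) trmx_mul trmxK.
set J := jac _ _; set H := metric d _; set v := grd _ _.
have JT : J^T \in unitmx by rewrite unitmx_tr.
have -> : invmx (J *m H *m J^T) = invmx J^T *m invmx H *m invmx J.
  have U3 : J *m H *m J^T \in unitmx by rewrite !unitmx_mul Ju hu JT.
  apply: (can_inj (mulKmx U3)); rewrite mulmxV //.
  by rewrite !mulmxA mulmxK // mulmxK // mulmxV.
by rewrite !mulmxA mulmxK // mulmxKV.
Qed.

(** The energy is independent of the chart and locally constant, and a path joins the two points. *)
Theorem energy_const k F : path_connected R N ->
  (forall c, @atlas R m N c -> hesseq (metric c) k (ccod c) (F \o cinv c)) ->
  forall c d p q, @atlas R m N c -> @atlas R m N d -> cdom c p -> cdom d q ->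
  energy (metric c) k (F \o cinv c) (cmap c p) = energy (metric d) k (F \o cinv d) (cmap d q).
Proof.
move=> pc HF c d p q ac ad cp dq; have [g [cg g0 g1]] := pc p q.
have cg' := clamp_path (@ler01 R) cg.
set e := LHS.
pose P t := forall d, @atlas R m N d -> cdom d (g (clamp 0 1 t)) ->
   energy (metric d) k (F \o cinv d) (cmap d (g (clamp 0 1 t))) = e.
suff : P 1.
  move=> /(_ d ad); rewrite clamp_id ?lexx ?ler01 // g1 => /(_ dq) ->; by [].
have indep d1 d2 r : @atlas R m N d1 -> @atlas R m N d2 -> cdom d1 r -> cdom d2 r ->
   energy (metric d1) k (F \o cinv d1) (cmap d1 r) = energy (metric d2) k (F \o cinv d2) (cmap d2 r).
  by move=> a1 a2 r1 r2; rewrite (energy_trans HF a1 a2 (trd_cmap r1 r2)) tr_cmap.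
have P0 : P 0.
  move=> d' ad'; rewrite clamp_id ?lexx ?ler01 // g0 => dp; exact: indep.
apply: (@locally_constant R P 0 1 ler01 _ P0) => t t01.
have [d' ad' dt] := atlas_cover (g (clamp 0 1 t)).
set r := g (clamp 0 1 t) in dt.
have od := @ccod_open _ _ _ d'.
have near_d : \forall u \near cmap d' r, ccod d' u by apply: open_near => //; exact: cmap_ccod.
have [e1 e10 eP] := near_ball2 near_d near_d.
have bd : ball (cmap d' r) e1 `<=` ccod d' by move=> u /eP[].
have h1 : \forall s \near t, cdom d' (g (clamp 0 1 s)).
  by apply: (cg' t); apply: open_near => //; exact: cdom_open.
have h2 : \forall s \near t, ball (cmap d' r) e1 (cmap d' (g (clamp 0 1 s))).
  have hb : \forall z \near r, ball (cmap d' r) e1 (cmap d' z) by exact: (cmap_continuous dt (nbhsx_ballx (cmap d' r) e1 e10)).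
  exact: (cg' t _ hb).
have gm := fun u => @metric_sym _ _ _ d' u ad'; have gp := fun u v => @metric_pos _ _ _ d' u v ad'.
have cE : Ck 1 (ccod d') (energy (metric d') k (F \o cinv d')).
  exact: (Ck_energy od (fun k => metricC k ad') gp 1 (HF d' ad')).
have pE j v : ccod d' v -> pd j (energy (metric d') k (F \o cinv d')) v = 0.
  exact: (pd_energy od (fun k => metricC k ad') gm gp (f := F \o cinv d')  _ (HF d' ad')).
apply: filterS2 h1 h2 => s cs Bs _.
have E : energy (metric d') k (F \o cinv d') (cmap d' (g (clamp 0 1 s))) =
   energy (metric d') k (F \o cinv d') (cmap d' r).
  apply: (pd0_ball_const (Ck_sub bd cE) _ (ballxx _ e10) Bs) => j v /bd; exact: pE.
split=> H d2 ad2 c2.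
  by rewrite (indep d2 d' _ ad2 ad' c2 dt) -E; exact: H.
by rewrite (indep d2 d' _ ad2 ad' c2 cs) E; exact: H.
Qed.

End ChartFacts.

Section TrmxLinear.
Variables (R : pzRingType) (p q : nat).
Implicit Types A B : 'M[R]_(p, q).
Lemma trmx_add A B : (A + B)^T = A^T + B^T. Proof. exact: linearD. Qed.
Lemma trmx_sub A B : (A - B)^T = A^T - B^T. Proof. exact: linearB. Qed.
Lemma trmx_opp A : (- A)^T = - A^T. Proof. exact: linearN. Qed.
Lemma trmx_scale (a : R) A : (a *: A)^T = a *: A^T. Proof. exact: linearZ. Qed.
End TrmxLinear.

Section Leibniz.
Variable K : comPzRingType.

(** Stated for an abstract functional [D] on sequences, so that it applies both to derivatives of
    polynomials and to partial derivatives. *)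
Lemma prod_leibniz (I : eqType) (s : seq I) (f df : I -> K) (D : seq I -> K) : uniq s ->
  D [::] = 0 -> (forall i s, D (i :: s) = df i * \prod_(j <- s) f j + f i * D s) ->
  D s = \sum_(i <- s) df i * \prod_(j <- s | j != i) f j.
Proof.
move=> + D0 DS; elim: s => [_|i s IH /=]; first by rewrite big_nil.
move=> /andP[is_ us]; rewrite DS big_cons IH //; congr (_ + _).
  rewrite big_cons eqxx /=; congr (_ * _); rewrite big_seq [RHS]big_seq_cond; apply: eq_bigl => j.
  by case js: (j \in s) => //=; apply/esym/eqP => ji; rewrite ji (negbTE is_) in js.
rewrite mulr_sumr; apply: eq_big_seq => j js.
have ij : i != j by apply/eqP => ij; rewrite -ij (negbTE is_) in js.
by rewrite big_cons ij mulrCA.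
Qed.

(** Each summand over [k] is the determinant of [M] with row [k] replaced by that of [N], expanded
    along this row. *)
Lemma det_leibniz n (M N : 'M[K]_n) :
  \sum_(s : 'S_n) (-1) ^+ s * \sum_k N k (s k) * \prod_(l | l != k) M l (s l) =
  \sum_k \sum_l N k l * cofactor M k l.
Proof.
under eq_bigr => s _ do rewrite mulr_sumr.
rewrite exchange_big; apply: eq_bigr => k _ /=.
pose M' := \matrix_(i, j) if i == k then N k j else M i j.
transitivity (\det M').
  apply: eq_bigr => s _; rewrite [in RHS](bigD1 k) //= mxE eqxx; congr (_ * (_ * _)).
  by apply: eq_bigr => l lk; rewrite mxE (negbTE lk).
rewrite (expand_det_row M' k); apply: eq_bigr => l _; rewrite mxE eqxx; congr (_ * _).
rewrite /cofactor; congr (_ * \det _); apply/matrixP => a b.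
by rewrite !mxE eq_sym (negbTE (neq_lift _ _)).
Qed.
End Leibniz.

Lemma deriv_det (R : comNzRingType) n (M : 'M[{poly R}]_n) :
  (\det M)^`() = \sum_k \sum_l (M k l)^`() * cofactor M k l.
Proof.
have -> : \sum_k \sum_l (M k l)^`() * cofactor M k l = \sum_k \sum_l (\matrix_(k, l) (M k l)^`()) k l * cofactor M k l.
  by apply: eq_bigr => k _; apply: eq_bigr => l _; rewrite mxE.
rewrite -det_leibniz.
rewrite /determinant linear_sum; apply: eq_bigr => s _.
rewrite -[LHS]/(((-1) ^+ s * \prod_i M i (s i))^`()).
have -> : ((-1) ^+ s * \prod_i M i (s i))^`() = (-1) ^+ s * (\prod_i M i (s i))^`().
  by case: (odd_perm s); rewrite ?expr1 ?expr0 ?mul1r // !mulN1r derivN.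
congr (_ * _).
rewrite (@prod_leibniz _ _ (index_enum 'I_n) (fun i => M i (s i)) (fun i => (M i (s i))^`())
  (fun s' => (\prod_(i <- s') M i (s i))^`())).
- by apply: eq_bigr => k _; rewrite mxE.
- exact: index_enum_uniq.
- by rewrite big_nil derivC.
- by move=> i s'; rewrite big_cons derivM.
Qed.

Lemma pd_det (R : realType) m (U : set 'rV[R]_m) n (F : 'rV[R]_m -> 'M[R]_n) i u : open U ->
  Ckm 1 U F -> U u ->
  pd i (fun v => \det (F v)) u = \tr (pdm i F u *m \adj (F u)).
Proof.
move=> oU cF Uu; transitivity (\sum_k \sum_l pdm i F u k l * cofactor (F u) k l); last first.
  rewrite /mxtrace; apply: eq_bigr => k _; rewrite mxE; apply: eq_bigr => l _.
  by rewrite mxE.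
rewrite -det_leibniz /determinant.
have cP (s : 'S_n) (r : seq 'I_n) : Ck 1 U (fun v => \prod_(i <- r) F v i (s i)).
  by apply: Ck_prod => // j _; exact: cF.
rewrite (pd_sum oU _ i (fun (s : 'S_n) _ => CkM oU (Ck_cst 1 U ((-1) ^+ s)) (cP s _)) Uu).
apply: eq_bigr => s _; rewrite (pdM i (Ck_cst 1 U ((-1) ^+ s)) (cP s _) Uu) pd_cst mul0r add0r; congr (_ * _).
rewrite (@prod_leibniz _ _ (index_enum 'I_n) (fun k => F u k (s k)) (fun k => pdm i F u k (s k))
  (fun r => pd i (fun v => \prod_(k <- r) F v k (s k)) u)) //.
- exact: index_enum_uniq.
- rewrite -[RHS](pd_cst (1 : R) i u); apply: (pd_eq oU) => // v _; by rewrite big_nil.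
- move=> j r; rewrite pdmE -(pdM i (cF j (s j)) (cP s r) Uu).
  by apply: (pd_eq oU) => // v _; rewrite big_cons.
Qed.

(** * Newton transformations *)

Section NewtonAlgebra.
Variable R : realFieldType.

Definition esym n (l : 'I_n -> R) (r : nat) : R :=
  \sum_(I : {set 'I_n} | #|I| == r) \prod_(i in I) l i.

(** The coefficients [s] are kept apart from [A]: a change of charts conjugates [A] and leaves the
    symmetric functions alone. *)
Fixpoint nwt n (s : nat -> R) (A : 'M[R]_n) (r : nat) : 'M[R]_n :=
  match r with 0 => 1%:M | r'.+1 => (s r'.+1)%:M - nwt s A r' *m A end.

Lemma esym0 n (l : 'I_n -> R) : esym l 0 = 1.
Proof.
rewrite /esym (bigD1 finset.set0) ?cards0 //= big_set0 big1 ?addr0 // => I /andP[].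
by rewrite cards_eq0 => /eqP -> /eqP.
Qed.

Lemma prod_esym n (l : 'I_n -> R) :
  \prod_i ('X - (l i)%:P) = \sum_(k < n.+1) ((-1) ^+ k * esym l k) *: 'X^(n - k).
Proof.
under eq_bigr => i _ do rewrite addrC.
rewrite bigA_distr (partition_big (fun J : {set 'I_n} => inord #|J| : 'I_n.+1) xpredT) //=.
have cN (J : {set 'I_n}) : (#|J| < n.+1)%N by rewrite ltnS -[leqRHS](card_ord n) max_card.
apply: eq_bigr => k _; rewrite /esym mulr_sumr scaler_suml; apply: eq_big => [J|J /eqP Jk].
  by rewrite -val_eqE /= inordK.
have {}Jk : #|J| = k :> nat.
  by rewrite -Jk inordK.
rewrite (bigID (mem J)) /= (eq_bigr (fun i => (- l i)%:P)); last by move=> i ->; rewrite polyCN.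
rewrite [X in _ * X](eq_bigr (fun _ => 'X)); last by move=> i /negbTE ->.
rewrite prodr_const -rmorph_prod prodrN Jk mul_polyC.
have <- // : #|[predC J]| = (n - k)%N by have := cardC J; rewrite card_ord Jk; lia.
Qed.

Lemma nwtE n (s : nat -> R) (A : 'M[R]_n.+1) r : s 0 = 1 ->
  nwt s A r = \sum_(k < r.+1) ((-1) ^+ k * s (r - k)%N) *: A ^+ k.
Proof.
move=> s0; elim: r => [|r IH] /=.
  by rewrite big_ord_recl big_ord0 expr0 mul1r s0 scale1r addr0.
rewrite big_ord_recl /= expr0 mul1r expr0 subn0 -scalemx1 IH; congr (_ + _).
rewrite mulmx_suml -sumrN; apply: eq_bigr => k _.
by rewrite /bump /= add1n subSS exprS mulN1r mulNr scaleNr -scalemxAl -[_ *m A]/(_ * A) -exprSr.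
Qed.

Variables (n : nat) (A : 'M[R]_n) (l : 'I_n -> R).
Hypothesis lA : char_poly A = \prod_i ('X - (l i)%:P).
Local Notation e := (esym l).
Local Notation P := (nwt e A).

(** Up to sign this is the characteristic polynomial evaluated at [A], so it vanishes by
    Cayley-Hamilton. *)
Lemma nwt_top : P n = 0.
Proof.
case: n A l lA => [|n'] B l' lB; first by apply/matrixP => -[].
rewrite nwtE ?esym0 //; have := Cayley_Hamilton B; rewrite lB prod_esym rmorph_sum /= => H.
have {}H : \sum_(k < n'.+2) ((-1) ^+ k * esym l' k) *: B ^+ (n'.+1 - k) = 0.
  rewrite -[RHS]H; apply: eq_bigr => k _.
  by rewrite linearZ /= rmorphXn /= horner_mx_X.
have sg : (-1 : R) ^+ n'.+1 != 0 by rewrite signr_eq0.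
apply: (scalerI sg); rewrite scaler0 -[RHS]H scaler_sumr (reindex_inj rev_ord_inj) /=.
apply: eq_bigr => k _; have kn : (k <= n'.+1)%N by rewrite -ltnS.
rewrite subSS (subKn kn) scalerA mulrA -exprD.
have -> // : (-1 : R) ^+ (n'.+1 + (n'.+1 - k)) = (-1) ^+ k.
by rewrite -[LHS]signr_odd oddD oddB // addbA addbb addFb signr_odd.
Qed.

Local Notation Q k := ((-1) ^+ k *: P k).
(** The Faddeev-LeVerrier formula for the adjugate of [X - A], whose coefficients are the Newton
    transformations up to sign. *)
Definition adjW : 'M[{poly R}]_n := \sum_(k < n) 'X^(n - k.+1) *: map_mx polyC (Q k).

(** The recursion of the Newton transformations makes the product telescope, and the end term is
    zero by [nwt_top]. *)
Lemma adjW_mul : adjW *m char_poly_mx A = (char_poly A)%:M.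
Proof.
pose f k : 'M[{poly R}]_n := 'X^(n - k) *: map_mx polyC (Q k).
pose c k : {poly R} := ((-1) ^+ k * e k)%:P.
have QA k : Q k *m A = Q k.+1 - ((-1) ^+ k.+1 * e k.+1)%:M.
  rewrite /= scalerBr scale_scalar_mx exprS mulN1r !mulNr scaleNr -scalemxAl.
  by rewrite [RHS]addrC addrA addNr add0r opprK.
have -> : adjW *m char_poly_mx A =
   \sum_(k < n) (f k - f k.+1) + \sum_(k < n) ('X^(n - k.+1) * c k.+1)%:M.
  rewrite /adjW mulmx_suml -big_split; apply: eq_bigr => k _.
  have E1 : 'X^(n - k.+1) *: (map_mx polyC (Q k) *m 'X%:M) = f k.
    by rewrite mul_mx_scalar scalerA -exprSr subnSK.
  rewrite /char_poly_mx -scalemxAl mulmxBr scalerBr E1 -map_mxM QA map_mxB map_scalar_mx /=.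
  by rewrite -scale_scalar_mx scalerBr /f /= opprB addrA addrAC.
have -> : \sum_(k < n) (f k - f k.+1) = f 0%N - f n.
  rewrite -(big_mkord xpredT (fun k => f k - f k.+1)) -opprB -(telescope_sumr f (leq0n n)) -sumrN.
  by apply: eq_bigr => k _; rewrite opprB.
have -> : f n = 0 by rewrite /f nwt_top scaler0 map_mx0 scaler0.
rewrite subr0 lA prod_esym big_ord_recl raddfD /=; congr (_ + _).
  by rewrite /f subn0 expr0 mul1r esym0 map_mxZ map_scalar_mx /= !scale1r scale_scalar_mx mulr1.
rewrite raddf_sum; apply: eq_bigr => k _; congr (_%:M).
by rewrite /bump /= add1n /c mulrC mul_polyC.
Qed.

Lemma adj_char_poly_mx : \adj (char_poly_mx A) = adjW.
Proof.
have d0 : char_poly A != 0 by rewrite monic_neq0 // char_poly_monic.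
set M := char_poly_mx A in d0 *; have : (\adj M - adjW) *m M = 0.
  by rewrite mulmxBl mul_adj_mx adjW_mul subrr.
move=> /(congr1 (mulmx^~ (\adj M))); rewrite -mulmxA mul_mx_adj mul0mx mul_mx_scalar.
move=> /matrixP E; apply/matrixP => i j; have := E i j; rewrite !mxE => /eqP.
by rewrite mulf_eq0 (negbTE d0) subr_eq0 => /eqP.
Qed.

Lemma coef_adjW i j r : (r < n)%N -> (adjW i j)`_(n - r.+1) = (-1) ^+ r * P r i j.
Proof.
move=> rn; rewrite /adjW summxE coef_sum (bigD1 (Ordinal rn)) //= big1 ?addr0 => [|k kr].
  by rewrite mxE [X in _ * X]mxE coefMC coefXn eqxx mul1r mxE.
rewrite mxE [X in _ * X]mxE coefMC coefXn; case: eqP => [/eqP|_]; last by rewrite mul0r.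
move=> h; case/eqP: kr; apply/val_inj => /=; move: h (ltn_ord k); lia.
Qed.

(** By Jacobi's formula the derivative of the characteristic polynomial is the trace of the adjugate
    of [X - A]; the claim compares coefficients. No diagonalization of [A] is involved. *)
Lemma trace_nwt r : (r <= n)%N -> \tr (P r) = (n - r)%:R * e r.
Proof.
rewrite leq_eqVlt => /orP[/eqP ->|rn]; first by rewrite nwt_top linear0 subnn mul0r.
have D : \sum_k \sum_l (char_poly_mx A k l)^`() * cofactor (char_poly_mx A) k l = \tr adjW.
  rewrite -adj_char_poly_mx /mxtrace; apply: eq_bigr => k _; rewrite (bigD1 k) //= big1 => [|j lk].
    by rewrite addr0 !mxE eqxx mulr1n derivB derivX derivC subr0 mul1r.
  by rewrite !mxE eq_sym (negbTE lk) mulr0n sub0r derivN derivC oppr0 mul0r.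
have := congr1 (fun p : {poly R} => p`_(n - r.+1)) (deriv_det (char_poly_mx A)).
rewrite /= D -/(char_poly A) lA prod_esym coef_deriv subnSK // coef_sum.
have rn1 : (r < n.+1)%N by rewrite ltnS ltnW.
rewrite (bigD1 (Ordinal rn1)) //= big1 ?addr0 => [|k kr]; last first.
  rewrite coefZ coefXn; case: eqP => [h|_]; last by rewrite mulr0.
  case/eqP: kr; apply/val_inj => /=; move: h (ltn_ord k); lia.
rewrite coefZ coefXn eqxx mulr1 /mxtrace coef_sum => E.
have sg : (-1 : R) ^+ r != 0 by rewrite signr_eq0.
apply: (mulfI sg); rewrite mulr_sumr mulrCA mulr_natl E.
by apply: eq_bigr => k _; rewrite coef_adjW.
Qed.


Lemma esym_gt r : (n < r)%N -> e r = 0.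
Proof.
move=> nr; rewrite /esym big_pred0 // => I; apply/negbTE/negP => /eqP Ir.
by move: nr; rewrite -Ir ltnNge -[X in (_ <= X)%N](card_ord n) max_card.
Qed.

(** Take the trace of the recursion that defines [P r.+1] and insert [trace_nwt] at the indices
    [r.+1] and, through that recursion, [r]. *)
Lemma esym_trace r : (r < n)%N -> r.+1%:R * e r.+1 = \tr (P r *m A).
Proof.
move=> rn; have := trace_nwt rn; rewrite /= linearB /= mxtrace_scalar => /eqP.
rewrite subr_eq => /eqP E; have h : n%:R = (n - r.+1)%:R + r.+1%:R :> R by rewrite -natrD subnK.
have {}E : n%:R * e r.+1 = (n - r.+1)%:R * e r.+1 + \tr (P r *m A) by rewrite mulr_natl.
move: E; rewrite h; move: (\tr _) (e r.+1) => x y; lra.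
Qed.

End NewtonAlgebra.

Lemma horner_eq0 (R : realType) (p : {poly R}) : (forall x, p.[x] = 0) -> p = 0.
Proof.
move=> p0; apply: (@roots_geq_poly_eq0 _ _ [seq i%:R | i <- iota 0 (size p)]).
- by apply/allP => x _; apply/rootP.
- rewrite map_inj_uniq ?iota_uniq // => i j /eqP; by rewrite eqr_nat => /eqP.
- by rewrite size_map size_iota.
Qed.

Lemma char_poly_horner (R : comNzRingType) n (A : 'M[R]_n) x : (char_poly A).[x] = \det (x%:M - A).
Proof.
rewrite /char_poly -horner_evalE -det_map_mx; congr (\det _); apply/matrixP => i j.
by rewrite [LHS]mxE -[LHS]/((char_poly_mx A i j).[x]) /char_poly_mx !mxE hornerD hornerN hornerC hornerMn hornerX.
Qed.

Lemma adj_horner (R : comNzRingType) n (A : 'M[R]_n) x i j :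
  (\adj (char_poly_mx A) i j).[x] = \adj (x%:M - A) i j.
Proof.
rewrite -horner_evalE; have := map_mx_adj (horner_eval x) (char_poly_mx A).
move=> /matrixP /(_ i j); rewrite [LHS]mxE => ->; congr (\adj _ i j); apply/matrixP => a b.
by rewrite [LHS]mxE -[LHS]/((char_poly_mx A a b).[x]) /char_poly_mx !mxE hornerD hornerN hornerC hornerMn hornerX.
Qed.

Section NewtonCalculus.
Variables (R : realType) (m n : nat) (U : set 'rV[R]_m).
Hypothesis oU : open U.
Variables (A : 'rV[R]_m -> 'M[R]_n) (l : 'rV[R]_m -> 'I_n -> R).
Hypothesis cA : forall k, Ckm k U A.
Hypothesis lA : forall u, U u -> char_poly (A u) = \prod_i ('X - (l u i)%:P).
Local Notation e r := (fun u => esym (l u) r).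
Local Notation P r := (fun u => nwt (esym (l u)) (A u) r).

(** The functions [l u i] only list eigenvalues and need not be continuous in [u]. Smoothness of
    their symmetric functions comes from that of [A], by a joint induction through the identity
    [esym_trace]. *)
Lemma Ck_esym_nwt r : (forall k, Ck k U (e r)) /\ (forall k, Ckm k U (P r)).
Proof.
elim: r => [|r [IHe IHP]].
  split=> k; last exact: Ckm_cst.
  by apply: (Ck_eq oU _ (Ck_cst k U (1 : R))) => u _; rewrite esym0.
have ce k : Ck k U (e r.+1).
  have [rn|nr] := ltnP r n; last first.
    by apply: (Ck_eq oU _ (Ck_cst k U (0 : R))) => u _; rewrite esym_gt.
  have ct : Ck k U (fun u => \tr (P r u *m A u)).
    by apply: Ck_sum => // i _; exact: (CkmM oU (IHP k) (cA k) i i).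
  apply: (Ck_eq oU _ (CkM oU (Ck_cst k U (r.+1%:R^-1 : R)) ct)) => u Uu.
  by rewrite -(esym_trace (lA Uu) rn) mulKf // pnatr_eq0.
split=> // k i j.
have cs : Ck k U (fun u => (esym (l u) r.+1)%:M i j).
  have [ij|ij] := eqVneq i j.
    by apply: (Ck_eq oU _ (ce k)) => u _; rewrite ij mxE eqxx mulr1n.
  by apply: (Ck_eq oU _ (Ck_cst k U (0 : R))) => u _; rewrite mxE (negbTE ij).
by apply: (Ck_eq oU _ (CkB oU cs (CkmM oU (IHP k) (cA k) i j))) => u _; rewrite /= mx_subE.
Qed.

Lemma Ck_esym r k : Ck k U (e r). Proof. exact: (Ck_esym_nwt r).1. Qed.
Lemma Ckm_nwt r k : Ckm k U (P r). Proof. exact: (Ck_esym_nwt r).2. Qed.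

(** Differentiate the determinant of [x - A] by Jacobi's formula for every real [x], read the result
    as an identity of polynomials in [x], and compare coefficients. *)
Lemma pd_esym r i u : (r < n)%N -> U u -> pd i (e r.+1) u = \tr (P r u *m pdm i A u).
Proof.
move=> rn Uu.
pose p := \sum_(k < n.+1) ((-1) ^+ k * pd i (e k) u) *: 'X^(n - k) +
  \sum_a \sum_b pdm i A u a b *: adjW (A u) (l u) b a.
have p0 : p = 0.
  apply: horner_eq0 => x.
  have cx : Ckm 1 U (fun v => x%:M - A v) by apply: CkmB => //; exact: Ckm_cst.
  have := pd_det i oU cx Uu.
  rewrite (pdmB oU i (Ckm_cst U 1 x%:M) (cA 1) Uu) pdm_cst sub0r mulNmx linearN /=.
  rewrite (@pd_eq _ _ _ oU _ (fun v => \sum_(k < n.+1) ((-1) ^+ k * esym (l v) k) * x ^+ (n - k))) //; last first.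
    move=> v Uv; rewrite -char_poly_horner (lA Uv) prod_esym horner_sum.
    by apply: eq_bigr => k _; rewrite hornerZ hornerXn.
  have ck (k : 'I_n.+1) : Ck 1 U (fun v => (-1) ^+ k * esym (l v) k) := CkM oU (Ck_cst 1 U ((-1) ^+ k)) (Ck_esym k 1).
  rewrite (pd_sum oU _ i (fun (k : 'I_n.+1) _ => CkM oU (ck k) (Ck_cst 1 U (x ^+ (n - k)))) Uu) => E.
  rewrite /p hornerD [X in X + _](_ : _ = - \tr (pdm i A u *m \adj (x%:M - A u))); last first.
    rewrite -E horner_sum; apply: eq_bigr => k _; rewrite hornerZ hornerXn.
    rewrite (pdM i (ck k) (Ck_cst 1 U (x ^+ (n - k))) Uu) pd_cst mulr0 addr0.
    by rewrite (pdM i (Ck_cst 1 U ((-1) ^+ k)) (Ck_esym k 1) Uu) pd_cst mul0r add0r.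
  rewrite [X in _ + X](_ : _ = \tr (pdm i A u *m \adj (x%:M - A u))) ?addNr //.
  rewrite horner_sum /mxtrace; apply: eq_bigr => a _; rewrite horner_sum mxE; apply: eq_bigr => b _.
  by rewrite hornerZ -(adj_char_poly_mx (lA Uu)) adj_horner.
have := congr1 (fun q : {poly R} => q`_(n - r.+1)) p0; rewrite coef0 /p coefD.
have rn1 : (r.+1 < n.+1)%N by [].
rewrite coef_sum (bigD1 (Ordinal rn1)) //= big1 ?addr0 => [|k kr]; last first.
  rewrite coefZ coefXn; case: eqP => [h|_]; last by rewrite mulr0.
  case/eqP: kr; apply/val_inj => /=; move: h (ltn_ord k); lia.
rewrite coefZ coefXn eqxx mulr1 coef_sum.
have -> : \sum_a (\sum_b pdm i A u a b *: adjW (A u) (l u) b a)`_(n - r.+1) = (-1) ^+ r * \tr (P r u *m pdm i A u).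
  rewrite mxtrace_mulC /mxtrace mulr_sumr; apply: eq_bigr => a _; rewrite coef_sum mxE mulr_sumr.
  apply: eq_bigr => b _; by rewrite coefZ coef_adjW // mulrCA.
rewrite exprS mulN1r mulNr addrC => /eqP; rewrite subr_eq0 => /eqP /(mulfI _) -> //.
by rewrite signr_eq0.
Qed.
End NewtonCalculus.

(** * Semidefinite forms and orthonormal frames *)

Section Psd.
Variable R : realType.
Implicit Types n : nat.

Lemma quad11 n (B : 'M[R]_n) (v w : 'rV[R]_n) : (v *m B *m w^T) 0 0 = \sum_i \sum_j v 0 i * w 0 j * B i j.
Proof.
rewrite mxE exchange_big; apply: eq_bigr => j _; rewrite mxE mulr_suml; apply: eq_bigr => i _.
by rewrite [w^T _ _]mxE mulrAC.
Qed.

Lemma bilinC n (S : 'M[R]_n) (v w : 'rV[R]_n) : S^T = S -> (v *m S *m w^T) 0 0 = (w *m S *m v^T) 0 0.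
Proof. by move=> ST; rewrite -[in LHS](trmxK (v *m S *m w^T)) mxE !trmx_mul trmxK ST mulmxA. Qed.

Lemma psd_bilin n (S : 'M[R]_n) (v w : 'rV[R]_n) : S^T = S -> (forall v : 'rV[R]_n, 0 <= (v *m S *m v^T) 0 0) ->
  2 * `|(v *m S *m w^T) 0 0| <= (v *m S *m v^T) 0 0 + (w *m S *m w^T) 0 0.
Proof.
move=> ST S0; have e := bilinC v w ST.
have exp (a b : 'rV[R]_n) : ((a + b) *m S *m (a + b)^T) 0 0 =
   (a *m S *m a^T) 0 0 + (a *m S *m b^T) 0 0 + ((b *m S *m a^T) 0 0 + (b *m S *m b^T) 0 0).
  by rewrite linearD /= !mulmxDl !mulmxDr !mx_addE addrACA.
have p1 := S0 (v + w); have p2 := S0 (v - w).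
rewrite !exp e in p1 p2; rewrite trmx_opp !mulNmx !mulmxN opprK !mx_oppE e in p2.
case: (lerP 0 ((v *m S *m w^T) 0 0)) => h; rewrite ?(ger0_norm h) ?(ltr0_norm h) e; lra.
Qed.

(** Twice the difference of the two sides is the sum, over all pairs of indices, of the form [T]
    evaluated at [y 0 j *: ebase R i - y 0 i *: ebase R j]. *)
Lemma psd_le_tr n (T : 'M[R]_n) (y : 'rV[R]_n) : T^T = T -> (forall v : 'rV[R]_n, 0 <= (v *m T *m v^T) 0 0) ->
  (y *m T *m y^T) 0 0 <= \tr T * (y *m y^T) 0 0.
Proof.
move=> TT T0; have Tsym i j : T i j = T j i by rewrite -{1}TT mxE.
have key : 2 * (\tr T * (y *m y^T) 0 0 - (y *m T *m y^T) 0 0) =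
   \sum_i \sum_j ((y 0 j *: ebase R i - y 0 i *: ebase R j) *m T *m (y 0 j *: ebase R i - y 0 i *: ebase R j)^T) 0 0.
  have eT i j : (ebase R i *m T *m (ebase R j)^T) 0 0 = T i j.
    by rewrite /ebase -rowE trmx_delta -colE !mxE.
  have ex (a b : R) (x z : 'rV[R]_n) : ((a *: x - b *: z) *m T *m (a *: x - b *: z)^T) 0 0 =
    a * a * (x *m T *m x^T) 0 0 - a * b * (x *m T *m z^T) 0 0 - (a * b * (z *m T *m x^T) 0 0 - b * b * (z *m T *m z^T) 0 0).
    rewrite trmx_sub !trmx_scale !mulmxBl !mulmxBr -!scalemxAl -!scalemxAr.
    by rewrite !mx_subE !mx_scaleE !mulrA (mulrC b a).
  transitivity (\sum_i \sum_j (y 0 j * y 0 j * T i i - y 0 j * y 0 i * T i j - (y 0 j * y 0 i * T j i - y 0 i * y 0 i * T j j))); last first.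
    by apply: eq_bigr => i _; apply: eq_bigr => j _; rewrite ex !eT.
  have -> : \tr T * (y *m y^T) 0 0 = \sum_i \sum_j y 0 j * y 0 j * T i i.
    rewrite /mxtrace mulr_suml; apply: eq_bigr => i _; rewrite mxE mulr_sumr; apply: eq_bigr => j _.
    by rewrite [y^T _ _]mxE mulrC.
  rewrite quad11.
  have -> : \sum_i \sum_j (y 0 j * y 0 j * T i i - y 0 j * y 0 i * T i j - (y 0 j * y 0 i * T j i - y 0 i * y 0 i * T j j)) =
     (\sum_i \sum_j y 0 j * y 0 j * T i i - \sum_i \sum_j y 0 i * y 0 j * T i j) -
     (\sum_i \sum_j y 0 i * y 0 j * T i j - \sum_i \sum_j y 0 i * y 0 i * T j j).
    rewrite -!sumrB; apply: eq_bigr => i _; rewrite -!sumrB; apply: eq_bigr => j _.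
    by rewrite (Tsym j i) (mulrC (y 0 j) (y 0 i)).
  have -> : \sum_i \sum_j y 0 i * y 0 i * T j j = \sum_i \sum_j y 0 j * y 0 j * T i i by rewrite exchange_big.
  ring.
have : 0 <= 2 * (\tr T * (y *m y^T) 0 0 - (y *m T *m y^T) 0 0).
  by rewrite key; apply: sumr_ge0 => i _; apply: sumr_ge0 => j _.
by rewrite pmulr_rge0 // subr_ge0.
Qed.

(** Cholesky decomposition: the corner entry is positive and its Schur complement [S] is again
    positive definite, so induction on the dimension applies. *)
Lemma frame_exists n (g : 'M[R]_n) : g^T = g -> (forall v : 'rV[R]_n, v != 0 -> 0 < (v *m g *m v^T) 0 0) ->
  exists E : 'M[R]_n, E *m g *m E^T = 1%:M.
Proof.
elim: n g => [|n IH] g gT g0; first by exists 1%:M; apply/matrixP => -[].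
rewrite -[n.+1]/(1 + n)%N in g gT g0 *.
pose a := ulsubmx g 0 0; pose b := ursubmx g; pose d := drsubmx g.
have gE : g = block_mx a%:M b b^T d.
  rewrite -[LHS]submxK; congr block_mx; first by rewrite [LHS]mx11_scalar.
  by rewrite -[LHS]trmxK trmx_dlsub gT.
have a0 : 0 < a.
  have := g0 (row_mx 1%:M 0); rewrite gE mul_row_block !mul0mx !addr0 tr_row_mx mul_row_col trmx0 mulmx0 addr0.
  rewrite trmx1 mulmx1 mul1mx mxE eqxx mulr1n; apply.
  by apply/eqP => /matrixP /(_ 0 (lshift n 0)); rewrite row_mxEl !mxE => /eqP; rewrite oner_eq0.
have dT : d^T = d by rewrite /d trmx_drsub gT.
pose S := d - a^-1 *: (b^T *m b).
have ST : S^T = S by rewrite /S trmx_sub trmx_scale trmx_mul trmxK dT.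
have S0 (w : 'rV[R]_n) : w != 0 -> 0 < (w *m S *m w^T) 0 0.
  move=> w0; have := g0 (row_mx (- a^-1 *: (w *m b^T)) w); rewrite gE mul_row_block tr_row_mx mul_row_col.
  have -> : - a^-1 *: (w *m b^T) *m a%:M + w *m b^T = 0.
    by rewrite mul_mx_scalar scalerA mulrN divff ?gt_eqF // scaleN1r addNr.
  have -> : - a^-1 *: (w *m b^T) *m b + w *m d = w *m S.
    by rewrite /S mulmxBr -scalemxAr -scalemxAl mulmxA scaleNr addrC.
  rewrite mul0mx add0r; apply.
  apply/eqP => /matrixP E; case/eqP: w0; apply/matrixP => i j.
  by have := E i (rshift 1 j); rewrite row_mxEr !mxE.
have [E' HE'] := IH S ST S0.
pose s := (Num.sqrt a)^-1.
have ss : s * a * s = 1.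
  have q : Num.sqrt a != 0 by rewrite sqrtr_eq0 -ltNge.
  rewrite /s -{2}(sqr_sqrtr (ltW a0)) expr2; field; exact: q.
exists (block_mx s%:M 0 (- a^-1 *: (E' *m b^T)) E').
rewrite gE mulmx_block tr_block_mx mulmx_block.
have z : - a^-1 *: (E' *m b^T) *m a%:M + E' *m b^T = 0.
  by rewrite mul_mx_scalar scalerA mulrN divff ?gt_eqF // scaleN1r addNr.
rewrite z !mul0mx !addr0 !trmx0 !mulmx0 !addr0 !add0r -scalar_mxM.
have -> : - a^-1 *: (E' *m b^T) *m b + E' *m d = E' *m S.
  by rewrite /S mulmxBr -scalemxAr -scalemxAl mulmxA scaleNr addrC.
rewrite HE' tr_scalar_mx -scalar_mxM ss trmx_scale trmx_mul trmxK [RHS]scalar_mx_block.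
have -> // : (s * a)%:M *m (- a^-1 *: (b *m E'^T)) + s%:M *m b *m E'^T = 0.
by rewrite !mul_scalar_mx scalerA mulrN mulfK ?gt_eqF // scaleNr -scalemxAl addNr.
Qed.

(** In a frame orthonormal for [g] the claim becomes [psd_le_tr], and the trace of the transformed
    form is that of [S *m invmx g]. *)
Lemma psd_le_trace n (g S : 'M[R]_n) (v : 'rV[R]_n) : g^T = g -> S^T = S ->
  (forall v : 'rV[R]_n, v != 0 -> 0 < (v *m g *m v^T) 0 0) ->
  (forall v : 'rV[R]_n, 0 <= (v *m S *m v^T) 0 0) ->
  (v *m S *m v^T) 0 0 <= \tr (S *m invmx g) * (v *m g *m v^T) 0 0.
Proof.
move=> gT ST g0 S0; have [E HE] := frame_exists gT g0.
have uE : E \in unitmx by have := mulmx1_unit HE => -[]; rewrite unitmx_mul => /andP[].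
have uT : E^T \in unitmx by rewrite unitmx_tr.
have giE : invmx g = E^T *m E.
  have ug : g \in unitmx by have := mulmx1_unit HE => -[]; rewrite unitmx_mul => /andP[].
  apply: (can_inj (mulKmx ug)); rewrite mulmxV // mulmxA.
  by apply: (can_inj (mulKmx uE)); rewrite !mulmxA HE mul1mx mulmx1.
pose T := E *m S *m E^T.
have [y vE] : exists y, v = y *m E by exists (v *m invmx E); rewrite mulmxKV.
have T0 (w : 'rV[R]_n) : 0 <= (w *m T *m w^T) 0 0.
  by have := S0 (w *m E); rewrite trmx_mul /T !mulmxA.
have TT : T^T = T by rewrite /T !trmx_mul trmxK ST mulmxA.
have := psd_le_tr y TT T0.
have -> : \tr T = \tr (S *m invmx g) by rewrite giE mulmxA [RHS]mxtrace_mulC mulmxA.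
have -> : (y *m T *m y^T) 0 0 = (v *m S *m v^T) 0 0 by rewrite vE trmx_mul /T !mulmxA.
suff -> : (y *m y^T) 0 0 = (v *m g *m v^T) 0 0 by [].
by rewrite vE trmx_mul !mulmxA -(mulmxA y) -(mulmxA y) HE mulmx1.
Qed.
End Psd.

Section Sqrt.
Variables (R : realType) (m : nat) (U : set 'rV[R]_m).
Hypothesis oU : open U.
Variable f : 'rV[R]_m -> R.
Hypothesis f0 : forall u, U u -> 0 < f u.

Lemma derive_sqrt i u k : Ck k.+1 U f -> U u ->
  derivable (fun v => Num.sqrt (f v)) u (ebase R i) /\
  pd i (fun v => Num.sqrt (f v)) u = pd i f u / (2 * Num.sqrt (f u)).
Proof.
move=> cf Uu; have [df Df] := Ck1_differentiable oU cf Uu.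
have s0 : is_derive (f u) 1 (@Num.sqrt R) (2 * Num.sqrt (f u))^-1 := is_derive1_sqrt (f0 Uu).
have ds : differentiable (@Num.sqrt R) (f u) by apply/derivable1_diffP; case: s0.
have dc : differentiable ((@Num.sqrt R) \o f) u := differentiable_comp df ds.
split; first exact: diff_derivable.
rewrite pdE (deriveE _ dc) (diff_comp df ds) /= diff1E //= derive1E derive_val.
by rewrite -(deriveE _ df) -pdE.
Qed.

Lemma pd_sqrt i u k : Ck k.+1 U f -> U u ->
  pd i (fun v => Num.sqrt (f v)) u = pd i f u / (2 * Num.sqrt (f u)).
Proof. by move=> cf Uu; exact: (derive_sqrt i cf Uu).2. Qed.

Lemma Ck_sqrt k : Ck k U f -> Ck k U (fun v => Num.sqrt (f v)).
Proof.
elim: k => [|k IH] cf.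
  split=> // u Uu; apply: (@continuous_comp _ _ _ f (@Num.sqrt R)); first exact: (Ck_cont cf).
  exact: sqrt_continuous.
have IHk := IH (CkS cf); split=> [u Uu|i]; first exact: (Ck_cont IHk).
split=> [u Uu|]; first exact: (derive_sqrt i cf Uu).1.
apply: (Ck_eq oU (f := fun u => pd i f u * (2 * Num.sqrt (f u))^-1)).
  by move=> u Uu; rewrite -(pd_sqrt i cf Uu) pdE.
apply: CkM => //; first exact: Ck_pd.
apply: CkV => //; last by apply: CkM => //; exact: Ck_cst.
by move=> u Uu; rewrite mulf_neq0 ?pnatr_eq0 // sqrtr_eq0 -ltNge f0.
Qed.
End Sqrt.

(** * The flux field of a hypersurface *)

Section Immersion.
Variables (R : realType) (n : nat).
Variables (U : set 'rV[R]_n) (V : set 'rV[R]_n.+1).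
Hypotheses (oU : open U) (oV : open V).
Variable tau : 'rV[R]_n -> 'rV[R]_n.+1.
Hypothesis ctau : forall k, Ckm k U tau.
Hypothesis tauV : forall u, U u -> V (tau u).
Variables (g : 'rV[R]_n -> 'M[R]_n) (h : 'rV[R]_n.+1 -> 'M[R]_n.+1).
Hypotheses (cg : forall k, Ckm k U g) (ch : forall k, Ckm k V h).
Hypotheses (gT : forall u, U u -> (g u)^T = g u) (hT : forall u, V u -> (h u)^T = h u).
Hypothesis gpos : forall u v, U u -> v != 0 -> 0 < inner g u v v.
Hypothesis hpos : forall u v, V u -> v != 0 -> 0 < inner h u v v.
Let J := jac tau.
Hypothesis gE : forall u, U u -> g u = J u *m h (tau u) *m (J u)^T.
Variable c : R.
Hypothesis hsec : forall u v w, V u -> row_free (col_mx v w) -> sectional h u v w = c.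
Variable eta : 'rV[R]_n -> 'rV[R]_n.+1.
Hypothesis ceta : forall k, Ckm k U eta.
Hypothesis eta_orth : forall u, U u -> J u *m h (tau u) *m (eta u)^T = 0.
Hypothesis eta_unit : forall u, U u -> eta u *m h (tau u) *m (eta u)^T = 1%:M.
Variable A : 'rV[R]_n -> 'M[R]_n.
Local Notation Gt := (Gt tau h).
Local Notation DJ := (DJ tau h).
Hypothesis weingarten : forall i u, U u -> pdm i eta u + eta u *m Gt i u = - (row i (A u) *m J u).

Let cJ k : Ckm k U J. Proof. exact: Ckm_jac. Qed.
Let cht k : Ckm k U (fun u => h (tau u)). Proof. exact: (Ckm_comp oU oV ctau tauV (ch k)). Qed.
Let ug u : U u -> g u \in unitmx. Proof. exact: metric_unit. Qed.
Let DJm i u (Uu : U u) := DJ_metric oU oV ctau tauV ch gT hT gpos hpos gE i Uu.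

Let orthT u : U u -> eta u *m h (tau u) *m (J u)^T = 0.
Proof.
move=> Uu; have := eta_orth Uu; move/(congr1 trmx).
by rewrite !trmx_mul trmxK (hT (tauV Uu)) mulmxA trmx0.
Qed.

(** The normal together with the coordinate fields is a basis of the ambient tangent space, since
    its Gram matrix is block diagonal with the invertible blocks 1 and [g]. *)
Lemma tangent_zero p u (X : 'M[R]_(p, n.+1)) : U u ->
  X *m h (tau u) *m (J u)^T = 0 -> X *m h (tau u) *m (eta u)^T = 0 -> X = 0.
Proof.
move=> Uu h1 h2; pose F : 'M[R]_(1 + n) := col_mx (eta u) (J u).
have FF : F *m h (tau u) *m F^T = block_mx 1%:M 0 0 (g u).
  rewrite /F mul_col_mx tr_col_mx mul_col_row eta_unit // eta_orth //.
  by rewrite orthT // -gE.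
have uF : F *m h (tau u) *m F^T \in unitmx.
  by rewrite FF unitmxE det_ublock det1 mul1r -unitmxE ug.
have [uh uFT] : F *m h (tau u) \in unitmx /\ F^T \in unitmx by move: uF; rewrite unitmx_mul => /andP.
have uh' : h (tau u) \in unitmx by exact: (metric_unit hpos (tauV Uu)).
have : X *m h (tau u) *m F^T = 0 by rewrite /F tr_col_mx mul_mx_row h1 h2 row_mx0.
move=> /(congr1 (mulmx^~ (invmx F^T))); rewrite mul0mx mulmxK //.
by move=> /(congr1 (mulmx^~ (invmx (h (tau u))))); rewrite mul0mx mulmxK.
Qed.

(** Differentiating the orthogonality of [J] and [eta] moves the derivative from [J] to [eta], where
    the Weingarten equation applies. *)
Lemma sff i u : U u -> DJ i u *m h (tau u) *m (eta u)^T = (row i (A u *m g u))^T.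
Proof.
move=> Uu; have cJh := CkmM oU (cJ 1) (cht 1); have ceT := Ckm_tr oU (ceta 1).
have : pdm i (fun v => J v *m h (tau v) *m (eta v)^T) u = 0.
  by rewrite (pdm_eq oU i (fun v Uv => eta_orth Uv) Uu) pdm_cst.
rewrite (pdmM oU i cJh ceT Uu) (pdmM oU i (cJ 1) (cht 1) Uu) pdm_tr.
rewrite (pdm_metric_comp oU oV ctau tauV ch hT hpos i Uu).
have -> : pdm i eta u = - (row i (A u) *m J u) - eta u *m Gt i u by rewrite -weingarten // addrK.
rewrite trmx_sub trmx_opp !trmx_mul mulmxBr mulmxN DJ_def.
have -> : J u *m h (tau u) *m ((J u)^T *m (row i (A u))^T) = (row i (A u *m g u))^T.
  by rewrite mulmxA -(gE Uu) row_mul trmx_mul (gT Uu).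
rewrite mulmxDr !mulmxDl !mulmxA.
move: (_ *m h (tau u) *m (eta u)^T) (_ *m Gt i u *m _ *m _) (_ *m (Gt i u)^T *m _) (row i _)^T => x y z w.
have -> : x + (y + z) + (- w - z) = x + y - w by rewrite [- w - z]addrC addrA addrA addrK.
by move=> /eqP; rewrite subr_eq0 => /eqP.
Qed.

(** The Gauss formula: by [tangent_zero] it suffices to compare tangential parts, given by
    [DJ_metric], and normal parts, given by [sff]. *)
Lemma gauss i u : U u -> DJ i u = Gam g i u *m J u + (row i (A u *m g u))^T *m eta u.
Proof.
move=> Uu; set b := (row i _)^T.
have e1 : Gam g i u *m J u *m h (tau u) *m (J u)^T = Gam g i u *m g u by rewrite (gE Uu) !mulmxA.
have e2 : b *m eta u *m h (tau u) *m (J u)^T = 0 by rewrite -!mulmxA (mulmxA (eta u)) orthT // mulmx0.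
have e3 : Gam g i u *m J u *m h (tau u) *m (eta u)^T = 0 by rewrite -!mulmxA (mulmxA (J u)) eta_orth // mulmx0.
have e4 : b *m eta u *m h (tau u) *m (eta u)^T = b by rewrite -!mulmxA (mulmxA (eta u)) eta_unit // mulmx1.
apply/eqP; rewrite -subr_eq0 opprD addrA; apply/eqP; apply: (tangent_zero Uu); rewrite !mulmxDl !mulNmx.
  by rewrite (DJm i Uu) e1 e2 subrr subr0.
by rewrite (sff i Uu) e3 e4 subr0 subrr.
Qed.

Lemma sff_sym u : U u -> (A u *m g u)^T = A u *m g u.
Proof.
move=> Uu; apply/matrixP => i k.
have e (a b : 'I_n) : (A u *m g u) a b = (DJ a u *m h (tau u) *m (eta u)^T) b 0 by rewrite (sff a Uu) !mxE.
rewrite mxE !e -!mulmxA [LHS]mxE [RHS]mxE; apply: eq_bigr => j _; congr (_ * _).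
exact: (DJ_sym oU oV ctau tauV hT).
Qed.

Hypothesis cA : forall k, Ckm k U A.

(** In constant curvature the operator on two tangent vectors sends the normal to a combination of
    them whose coefficients are their products with the normal, hence zero. *)
Lemma curv_normal i j u : U u -> eta u *m
  (pdm i (Gt j) u - pdm j (Gt i) u + Gt j u *m Gt i u - Gt i u *m Gt j u) = 0.
Proof.
move=> Uu; rewrite (Gt_curvature oU oV ctau tauV ch hT hpos i j Uu).
pose y b := (eta u *m (row b (h (tau u)))^T) 0 0.
have yE a b : eta u *m Om h a b (tau u) = c *: (y b *: ebase R a - y a *: ebase R b).
  have yM k : eta u *m (row k (h (tau u)))^T = (y k)%:M by rewrite [LHS]mx11_scalar.
  rewrite (Om_const oV ch hT hpos hsec (tauV Uu)) -scalemxAr mulmxBr !mulmxA !yM.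
  by rewrite !mul_scalar_mx.
have y0 k : \sum_b J u k b * y b = 0.
  transitivity ((J u *m h (tau u) *m (eta u)^T) k 0); last by rewrite eta_orth // mxE.
  rewrite -mulmxA mxE; apply: eq_bigr => b _; congr (_ * _).
  by rewrite /y -[LHS](mx_trE _ 0 0) trmx_mul trmxK -row_mul mxE.
rewrite mulmx_sumr -[RHS](scaler0 _ c).
have -> : \sum_a eta u *m \sum_b (jac tau u i a * jac tau u j b) *: Om h a b (tau u) =
  c *: (\sum_a (J u i a * \sum_b J u j b * y b) *: ebase R a - \sum_b (J u j b * \sum_a J u i a * y a) *: ebase R b).
  have -> : \sum_b (J u j b * \sum_a J u i a * y a) *: ebase R b = \sum_a \sum_b (J u j b * (J u i a * y a)) *: ebase R b.
    rewrite [RHS]exchange_big; apply: eq_bigr => b _; by rewrite mulr_sumr scaler_suml.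
  rewrite -sumrB scaler_sumr; apply: eq_bigr => a _.
  rewrite mulmx_sumr mulr_sumr scaler_suml -sumrB scaler_sumr; apply: eq_bigr => b _.
  rewrite -scalemxAr yE !scalerBr !scalerA; congr (_ *: _ - _ *: _); ring.
rewrite !y0; congr (_ *: _).
by rewrite !big1 ?subrr // => a _; rewrite mulr0 scale0r.
Qed.

(** Second derivatives of [eta] commute. Expanding them by the Weingarten equation leaves the
    curvature applied to [eta], which is zero by [curv_normal], and the projection on the tangent
    space replaces [DJ] by [Gam]. *)
Lemma codazzi i j u : U u ->
  row j (pdm i A u) + row j (A u) *m Gam g i u = row i (pdm j A u) + row i (A u) *m Gam g j u.
Proof.
move=> Uu.
have cGt k l : Ckm l U (Gt k).
  apply: (@Ckm_eq _ _ _ oU _ _ _ (fun v => \sum_a J v k a *: Gam h a (tau v))).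
    by move=> v Uv; rewrite Gt_def.
  move=> a b; apply: (@Ck_eq _ _ _ _ _ (fun v => \sum_x J v k x * Gam h x (tau v) a b)) => //.
    by move=> v _; rewrite summxE; apply: eq_bigr => x _; rewrite mxE.
  apply: Ck_sum => // x _; apply: CkM => //; first exact: cJ.
  exact: (Ckm_comp oU oV ctau tauV (Ckm_Gam oV ch hT hpos l x) a b).
have cR k l : Ckm l U (fun v => row k (A v)).
  by move=> a b; apply: (Ck_eq oU _ (cA l k b)) => v _; rewrite mxE.
have pR k l v : U v -> pdm l (fun v => row k (A v)) v = row k (pdm l A v).
  move=> Uv; apply/matrixP => a b; rewrite pdmE [RHS]mxE pdmE; apply: (pd_eq oU) => // w _.
  by rewrite mxE.
have d2 k l : pdm k (pdm l eta) u = - (row l (pdm k A u) *m J u + row l (A u) *m DJ k u)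
    + (row l (A u) *m (J u *m Gt k u) + row k (A u) *m (J u *m Gt l u))
    + eta u *m (Gt k u *m Gt l u) - eta u *m pdm k (Gt l) u.
  have e v : U v -> pdm l eta v = - (row l (A v) *m J v) - eta v *m Gt l v.
    by move=> Uv; rewrite -weingarten // addrK.
  have c1 := CkmM oU (cR l 1) (cJ 1); have c2 := CkmM oU (ceta 1) (cGt l 1).
  rewrite (pdm_eq oU k e Uu) (pdmB oU k (CkmN oU c1) c2 Uu) (pdmN oU k c1 Uu).
  rewrite (pdmM oU k (cR l 1) (cJ 1) Uu) (pdmM oU k (ceta 1) (cGt l 1) Uu) (pR l k u Uu).
  have -> : pdm k eta u = - (row k (A u) *m J u) - eta u *m Gt k u by rewrite -weingarten // addrK.
  rewrite DJ_def mulmxDr mulmxBl mulNmx !mulmxA.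
  move: (row l (pdm k A u) *m _) (row l (A u) *m pdm k _ u) (row l (A u) *m _ *m _) => x y z.
  move: (row k (A u) *m J u *m Gt l u) (eta u *m Gt k u *m Gt l u) (eta u *m pdm k (Gt l) u) => a b d.
  by apply/matrixP => p q; rewrite !mxE; ring.
have := pdm_pdmC oU i j (ceta 2) Uu; rewrite !d2 => /eqP; rewrite -subr_eq0 => /eqP E.
have K := curv_normal i j Uu; rewrite mulmxBr mulmxDr mulmxBr in K.
have {}E : row j (pdm i A u) *m J u + row j (A u) *m DJ i u = row i (pdm j A u) *m J u + row i (A u) *m DJ j u.
  move: E K; move: (row j (pdm i A u) *m _ + _) (row i (pdm j A u) *m _ + _) => x y.
  move: (row j (A u) *m _) (row i (A u) *m _) (_ *m (Gt i u *m _)) (_ *m (Gt j u *m _)) (_ *m pdm i _ u) (_ *m pdm j _ u) => a b d e k l E K.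
  apply/eqP; rewrite -subr_eq0; apply/eqP.
  have -> : x - y = - (- x + (a + b) + d - k - (- y + (b + a) + e - l)) - (k - l + e - d).
    by apply/matrixP => p q; rewrite !mxE; ring.
  by rewrite E K oppr0 addr0.
have := congr1 (fun B => B *m (h (tau u) *m (J u)^T)) E.
rewrite /= !mulmxDl -!mulmxA (mulmxA (J u)) -(gE Uu) (mulmxA (DJ i u)) (mulmxA (DJ j u)) (DJm i Uu) (DJm j Uu).
rewrite !mulmxA -!mulmxDl => /(congr1 (mulmx^~ (invmx (g u)))).
by rewrite !mulmxK ?ug.
Qed.
End Immersion.

(** * Divergence and the Newton transformations *)

Section Divergence.
Variables (R : realType) (n : nat) (U : set 'rV[R]_n).
Hypothesis oU : open U.
Variable g : 'rV[R]_n -> 'M[R]_n.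
Hypothesis cg : forall k, Ckm k U g.
Hypothesis gT : forall u, U u -> (g u)^T = g u.
Hypothesis gpos : forall u v, U u -> v != 0 -> 0 < inner g u v v.

Lemma det_metric_pos u : U u -> 0 < \det (g u).
Proof.
move=> Uu; have [E HE] := frame_exists (gT Uu) (fun v v0 => gpos Uu v0).
have := congr1 determinant HE; rewrite !det_mulmx det1 det_tr => h.
have e0 : \det E != 0 by apply/eqP => e; move: h; rewrite e !mul0r => /eqP; rewrite eq_sym oner_eq0.
have -> : \det (g u) = (\det E ^- 2) by move: h => /(canRL (mulfK e0)) /(canRL (mulKf e0)) ->; rewrite mul1r -invfM expr2.
by rewrite invr_gt0 exprn_even_gt0.
Qed.

Definition vol u := Num.sqrt (\det (g u)).

Lemma vol_pos u : U u -> 0 < vol u.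
Proof. by move=> Uu; rewrite sqrtr_gt0 det_metric_pos. Qed.

Lemma Ck_vol k : Ck k U vol.
Proof. by apply: Ck_sqrt => //; [exact: det_metric_pos|exact: Ck_det]. Qed.

Lemma pd_vol k u : U u -> pd k vol u = vol u * \tr (Gam g k u).
Proof.
move=> Uu; have d0 := det_metric_pos Uu.
rewrite (pd_sqrt oU det_metric_pos k (Ck_det oU (cg 1)) Uu) (pd_det k oU (cg 1) Uu).
rewrite (compat oU gT gpos k Uu) mulmxDl linearD /=.
have -> : \tr (g u *m (Gam g k u)^T *m \adj (g u)) = \tr (Gam g k u *m g u *m \adj (g u)).
  have aT : (\adj (g u))^T = \adj (g u) by rewrite -[in RHS](gT Uu) trmx_adj.
  by rewrite -[LHS]mxtrace_tr !trmx_mul trmxK gT // aT mulmxA mxtrace_mulC !mulmxA mxtrace_mulC mulmxA.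
rewrite -mulmxA mul_mx_adj mul_mx_scalar linearZ /=.
rewrite -/(vol u) -[X in (X * _ + _) / _](sqr_sqrtr (ltW d0)) -[X in (_ + X * _) / _](sqr_sqrtr (ltW d0)) -/(vol u).
by field; rewrite gt_eqF ?vol_pos.
Qed.

(* Covariant divergence of a vector field. *)
Definition dvg (Y : 'rV[R]_n -> 'rV[R]_n) u : R := \sum_k (pdm k Y u + Y u *m Gam g k u) 0 k.

Lemma pd_vol_dvg Y u : Ckm 1 U Y -> U u ->
  \sum_k pd k (fun v => vol v * Y v 0 k) u = vol u * dvg Y u.
Proof.
move=> cY Uu; rewrite /dvg.
have -> : \sum_k (pdm k Y u + Y u *m Gam g k u) 0 k = \sum_k (pd k (fun v => Y v 0 k) u + Y u 0 k * \tr (Gam g k u)).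
  under eq_bigr => k _ do rewrite mx_addE pdmE.
  rewrite !big_split; congr (_ + _) => /=.
  under eq_bigr => k _ do rewrite mxE.
  rewrite exchange_big; apply: eq_bigr => l _; rewrite /mxtrace mulr_sumr; apply: eq_bigr => k _.
  by rewrite (Gam_sym oU gT _ _ _ Uu).
rewrite mulr_sumr; apply: eq_bigr => k _.
rewrite (pdM k (Ck_vol 1) (cY 0 k) Uu) pd_vol //; ring.
Qed.

(* Covariant derivative of a tensor field of type (1,1). *)
Definition nab k (T : 'rV[R]_n -> 'M[R]_n) u : 'M[R]_n := pdm k T u + T u *m Gam g k u - Gam g k u *m T u.

Definition dvg11 (T : 'rV[R]_n -> 'M[R]_n) u : 'rV[R]_n := \row_i \sum_k nab k T u i k.

Lemma dvg_mul Z T u : Ckm 1 U Z -> Ckm 1 U T -> U u ->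
  dvg (fun v => Z v *m T v) u = \sum_k ((pdm k Z u + Z u *m Gam g k u) *m T u) 0 k + (Z u *m (dvg11 T u)^T) 0 0.
Proof.
move=> cZ cT Uu; have -> : (Z u *m (dvg11 T u)^T) 0 0 = \sum_k (Z u *m nab k T u) 0 k.
  rewrite mxE; under eq_bigr => i _ do rewrite !mxE mulr_sumr.
  by rewrite exchange_big; apply: eq_bigr => k _; rewrite mxE.
rewrite /dvg -big_split; apply: eq_bigr => k _ /=; rewrite -mx_addE; congr (fun_of_matrix _ 0 k).
rewrite (pdmM oU k cZ cT Uu) /nab mulmxDl mulmxBr mulmxDr !mulmxA.
move: (pdm k Z u *m _) (Z u *m pdm k T u) (_ *m _ *m Gam g k u) (_ *m Gam g k u *m _) => x y z w.
by rewrite [RHS]addrACA subrr addr0 addrA.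
Qed.

Variables (A : 'rV[R]_n -> 'M[R]_n) (l : 'rV[R]_n -> 'I_n -> R).
Hypothesis cA : forall k, Ckm k U A.
Hypothesis lA : forall u, U u -> char_poly (A u) = \prod_i ('X - (l u i)%:P).
Hypothesis codz : forall i j u, U u ->
  row j (pdm i A u) + row j (A u) *m Gam g i u = row i (pdm j A u) + row i (A u) *m Gam g j u.
Local Notation S r := (fun u => esym (l u) r).
Local Notation P r := (fun u => nwt (esym (l u)) (A u) r).

Lemma nwt_comm s (B : 'M[R]_n) r : nwt s B r *m B = B *m nwt s B r.
Proof.
elim: r => [|r IH] /=; first by rewrite mul1mx mulmx1.
by rewrite mulmxBl mulmxBr mulmxA -IH scalar_mxC.
Qed.

Lemma nab_codazzi i j k u : U u -> nab i A u j k = nab j A u i k.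
Proof.
move=> Uu; rewrite /nab !mx_subE; congr (_ - _).
  by have /matrixP /(_ 0 k) := codz i j Uu; rewrite !mx_addE -!row_mul !mxE.
by rewrite !mxE; apply: eq_bigr => s _; rewrite (Gam_sym oU gT _ _ _ Uu).
Qed.

(** In the divergence of [P r.+1], the Codazzi equation turns the contraction of the derivative of
    [A] with [P r] into a trace, and [pd_esym] cancels it against the differential of [S r.+1]; the
    rest is [A] applied to the divergence of [P r]. *)
Lemma nwt_divergence_free r u : (r <= n)%N -> U u -> dvg11 (P r) u = 0.
Proof.
move=> + Uu; elim: r => [_|r IH rn].
  apply/rowP => i; rewrite !mxE big1 // => k _.
  by rewrite /nab pdm_cst mul1mx mulmx1 add0r subrr mxE.
have cP := Ckm_nwt oU cA lA r 1; have cS := Ck_esym oU cA lA r.+1 1.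
(* The product is written with [A] on the left: then, after contraction, the derivative of [P r]
   appears exactly as its divergence. *)
have PE k : pdm k (P r.+1) u = (pd k (S r.+1) u)%:M - (pdm k A u *m P r u + A u *m pdm k (P r) u).
  have cAP := CkmM oU (cA 1) cP.
  have cSM : Ckm 1 U (fun v => (S r.+1 v)%:M : 'M[R]_n).
    move=> a b; case: (eqVneq a b) => ab.
      by apply: (Ck_eq oU _ cS) => v _; rewrite ab mxE eqxx mulr1n.
    by apply: (Ck_eq oU _ (Ck_cst 1 U (0 : R))) => v _; rewrite mxE (negbTE ab).
  rewrite (@pdm_eq _ _ _ oU _ _ _ _ _ (fun v => (S r.+1 v)%:M - A v *m P r v)) //; last first.
    by move=> v _ /=; rewrite nwt_comm.
  rewrite (pdmB oU k cSM cAP Uu) (pdmM oU k (cA 1) cP Uu); congr (_ - _).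
  apply/matrixP => a b; rewrite pdmE mxE; case: (eqVneq a b) => ab /=.
    by rewrite mulr1n; apply: (pd_eq oU) => // v _; rewrite mxE ab eqxx mulr1n.
  rewrite mulr0n -[RHS](pd_cst (0 : R) k u); apply: (pd_eq oU) => // v _; by rewrite mxE (negbTE ab).
have nP k : nab k (P r.+1) u = (pd k (S r.+1) u)%:M - nab k A u *m P r u - A u *m nab k (P r) u.
  have -> : nab k (P r.+1) u = (pd k (S r.+1) u)%:M - (pdm k A u *m P r u + A u *m pdm k (P r) u) + P r.+1 u *m Gam g k u - Gam g k u *m P r.+1 u.
    by rewrite /nab PE.
  have -> : P r.+1 u = (S r.+1 u)%:M - A u *m P r u by rewrite /= nwt_comm.
  rewrite mulmxBl mulmxBr scalar_mxC /nab !mulmxBl !mulmxBr !mulmxDl !mulmxDr !mulmxA.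
  move: ((pd k _ u)%:M) (pdm k A u *m _) (A u *m pdm k _ u) (_%:M *m Gam g k u) => a b d e.
  move: (_ *m _ *m Gam g k u) (Gam g k u *m _ *m _) (_ *m Gam g k u *m _) => x y z.
  by apply/matrixP => p q; rewrite !mxE; ring.
apply/rowP => i; rewrite mxE [RHS]mxE.
under eq_bigr => k _ do rewrite nP !mx_subE.
rewrite !sumrB.
have -> : \sum_k (A u *m nab k (P r) u) i k = (A u *m (dvg11 (P r) u)^T) i 0.
  rewrite [RHS]mxE; under [RHS]eq_bigr => s _ do rewrite !mxE mulr_sumr.
  by rewrite exchange_big; apply: eq_bigr => k _; rewrite mxE.
rewrite (IH (ltnW rn)) trmx0 mulmx0 mxE subr0.
have -> : \sum_k (pd k (S r.+1) u)%:M i k = pd i (S r.+1) u.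
  rewrite (bigD1 i) //= mxE eqxx mulr1n big1 ?addr0 // => k ki; by rewrite mxE eq_sym (negbTE ki).
have -> : \sum_k (nab k A u *m P r u) i k = \tr (nab i A u *m P r u).
  rewrite /mxtrace; apply: eq_bigr => k _; rewrite !mxE; apply: eq_bigr => s _.
  by rewrite (nab_codazzi i k s Uu).
rewrite (pd_esym oU cA lA i rn Uu) mxtrace_mulC /nab !(mulmxBl, mulmxDl).
have lin (X Y Z : 'M[R]_n) : \tr X - \tr (X + Y - Z) = \tr Z - \tr Y.
  by rewrite (linearB (mxtrace (n := n))) (linearD (mxtrace (n := n))) /=; ring.
rewrite lin.
have -> : \tr (Gam g i u *m A u *m P r u) = \tr (A u *m Gam g i u *m P r u).
  by rewrite -mulmxA -nwt_comm mulmxA mxtrace_mulC mulmxA.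
by rewrite subrr.
Qed.

End Divergence.

(** * The rescaled gradient field *)

Section Flux.
Variables (R : realType) (n : nat) (U : set 'rV[R]_n).
Hypothesis oU : open U.
Variable g : 'rV[R]_n -> 'M[R]_n.
Hypothesis cg : forall k, Ckm k U g.
Hypothesis gT : forall u, U u -> (g u)^T = g u.
Hypothesis gpos : forall u v, U u -> v != 0 -> 0 < inner g u v v.
Variables (A : 'rV[R]_n -> 'M[R]_n) (l : 'rV[R]_n -> 'I_n -> R).
Hypothesis cA : forall k, Ckm k U A.
Hypothesis lA : forall u, U u -> char_poly (A u) = \prod_i ('X - (l u i)%:P).
Hypothesis codz : forall i j u, U u ->
  row j (pdm i A u) + row j (A u) *m Gam g i u = row i (pdm j A u) + row i (A u) *m Gam g j u.
Hypothesis AgT : forall u, U u -> (A u *m g u)^T = A u *m g u.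
Variables (c : R) (phi nu : 'rV[R]_n -> R).
Hypothesis cphi : forall k, Ck k U phi.
Hypothesis hess : forall j u, U u -> pdm j (grd phi) u =
  (- (c * phi u)) *: row j (g u) + grd phi u *m (Gam g j u)^T + nu u *: row j (A u *m g u).
Variable r : nat.
Hypothesis rn : (r < n)%N.
Hypothesis Sr0 : forall u, U u -> esym (l u) r.+1 = 0.
Local Notation P := (fun u => nwt (esym (l u)) (A u) r).
Hypothesis Ppsd : forall u (v : 'rV[R]_n), U u -> 0 <= (v *m (nwt (esym (l u)) (A u) r *m g u) *m v^T) 0 0.
Hypothesis c0 : c <= 0.
Hypothesis grad_le : forall u, U u -> (grd phi u *m invmx (g u) *m (grd phi u)^T) 0 0 <= 1 - c * phi u ^+ 2.

Let ug u : U u -> g u \in unitmx. Proof. exact: metric_unit. Qed.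
Let giT u : U u -> (invmx (g u))^T = invmx (g u). Proof. by move=> Uu; rewrite trmx_inv gT. Qed.

Lemma nwt_sym s (u : 'rV[R]_n) k : U u -> (nwt s (A u) k *m g u)^T = nwt s (A u) k *m g u.
Proof.
move=> Uu; elim: k => [|k IH] /=; first by rewrite mul1mx gT.
rewrite mulmxBl trmx_sub mul_scalar_mx trmx_scale gT //; congr (_ - _).
have gP : g u *m (nwt s (A u) k)^T = nwt s (A u) k *m g u by rewrite -{1}(gT Uu) -trmx_mul IH.
by rewrite -[in LHS]mulmxA trmx_mul AgT // -mulmxA gP mulmxA -nwt_comm.
Qed.

Definition gradv u := grd phi u *m invmx (g u).
Definition rho u := (1 + phi u ^+ 2) * (1 - c * phi u ^+ 2).
Definition wt u := phi u / Num.sqrt (rho u).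
(* [phi] restricts an ambient solution of [Hess h = - c h g] with [|grad h|^2 + c h^2 = 1];
   the field [P grad (phi^2 / 2)] is rescaled so that its norm is at most [tr P]. *)
Definition vfield u := wt u *: (gradv u *m P u).
Definition flux u := (gradv u *m P u *m (grd phi u)^T) 0 0.
Definition trP u := (n - r)%:R * esym (l u) r.
(** The divergence of [vfield]: the factor of [flux] is the derivative of t / sqrt ((1 + t^2) (1 - c
    t^2)) at [phi], the last term is the weight times the divergence in [dvg_gradP]. *)
Definition dens u := (1 + c * phi u ^+ 4) / Num.sqrt (rho u) ^+ 3 * flux u - c * phi u ^+ 2 / Num.sqrt (rho u) * trP u.

Lemma gradv_ge1 u : 1 <= 1 - c * phi u ^+ 2.
Proof. by rewrite lerDl oppr_ge0 mulr_le0_ge0 // sqr_ge0. Qed.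

Lemma rho_pos u : 0 < rho u.
Proof.
by rewrite mulr_gt0 //; [rewrite ltr_wpDr ?sqr_ge0|exact: lt_le_trans (gradv_ge1 u)].
Qed.

Lemma Ck_rho k : Ck k U rho.
Proof.
have c2 : Ck k U (fun u => phi u ^+ 2) by exact: (CkM oU (cphi k) (cphi k)).
apply: CkM => //; first by apply: CkD => //; exact: Ck_cst.
by apply: CkB => //; [exact: Ck_cst|apply: CkM => //; exact: Ck_cst].
Qed.

Let sq_neq0 u : Num.sqrt (rho u) != 0.
Proof. by rewrite sqrtr_eq0 -ltNge rho_pos. Qed.

Lemma Ck_wt k : Ck k U wt.
Proof.
have n0 : forall v, U v -> Num.sqrt (rho v) != 0 by move=> v _; exact: sq_neq0.
exact: (CkM oU (cphi k) (CkV oU n0 (Ck_sqrt oU (fun u _ => rho_pos u) (Ck_rho k)))).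
Qed.

Lemma pd_wt j u : U u -> pd j wt u = (1 + c * phi u ^+ 4) / Num.sqrt (rho u) ^+ 3 * pd j phi u.
Proof.
move=> Uu; have cs := Ck_sqrt oU (fun u _ => rho_pos u) (Ck_rho 1).
have n0 : forall v, U v -> Num.sqrt (rho v) != 0 by move=> v _; exact: sq_neq0.
rewrite (pdM j (cphi 1) (CkV oU n0 cs) Uu) (pdV j n0 cs Uu).
rewrite (pd_sqrt oU (fun u _ => rho_pos u) j (Ck_rho 1) Uu).
have c2 : Ck 1 U (fun u => phi u * phi u) by exact: (CkM oU (cphi 1) (cphi 1)).
have cc := Ck_cst 1 U (1 : R); have cm := Ck_cst 1 U c.
have p2 : pd j (fun v => phi v * phi v) u = 2 * phi u * pd j phi u.
  by rewrite (pdM j (cphi 1) (cphi 1) Uu); ring.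
have p1 : pd j (fun v => 1 + phi v * phi v) u = 2 * phi u * pd j phi u.
  by rewrite (pdD j cc c2 Uu) pd_cst p2 add0r.
have p3 : pd j (fun v => 1 - c * (phi v * phi v)) u = - (c * (2 * phi u * pd j phi u)).
  by rewrite (pdB oU j cc (CkM oU cm c2) Uu) (pdM j cm c2 Uu) !pd_cst p2 mul0r !add0r.
have pr : pd j rho u = 2 * phi u * pd j phi u * (1 - c * phi u ^+ 2) - (1 + phi u ^+ 2) * (c * (2 * phi u * pd j phi u)).
  rewrite (pdM j (CkD oU cc c2) (CkB oU cc (CkM oU cm c2)) Uu) p1 p3 !expr2; ring.
rewrite pr; have E := sqr_sqrtr (ltW (rho_pos u)); have s0 := sq_neq0 u.
move: E s0; set q := Num.sqrt _ => E s0.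
have D : rho u = (1 + phi u ^+ 2) * (1 - c * phi u ^+ 2) by [].
(* Written with [q ^+ 2] in place of [rho u], the numerator makes the identity one of rational
   functions in [q]. *)
have -> : (1 + c * phi u ^+ 4) = q ^+ 2 - phi u ^+ 2 * (1 - c * phi u ^+ 2) + c * phi u ^+ 2 * (1 + phi u ^+ 2).
  by rewrite E D; ring.
by field.
Qed.

Lemma pd_gradv j u : U u -> pdm j gradv u + gradv u *m Gam g j u = (- (c * phi u)) *: ebase R j + nu u *: row j (A u).
Proof.
move=> Uu; have cgr := Ckm_grd oU (cphi 2).
rewrite (pdmM oU j cgr (Ckm_ginv oU cg gpos 1) Uu) (pdm_ginv oU cg gT gpos j Uu) (hess j Uu) /gradv.
rewrite !mulmxDl -!scalemxAl -!row_mul mulmxV ?ug // mulmxK ?ug // row1 mulmxN mulmxDr !mulmxA.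
move: (_ *: 'e_j) (_ *: row j _) (_ *m _ *m invmx (g u)) (_ *m invmx (g u) *m _) => x y z w.
have -> : x + z + y - (w + z) + w = x + y by apply/matrixP => a b; rewrite !mxE; ring.
by [].
Qed.

Lemma Ckm_gradv k : Ckm k U gradv.
Proof. by apply: CkmM => //; [exact: Ckm_grd (cphi k.+1)|exact: Ckm_ginv]. Qed.

(** As [P] is divergence free, only traces remain: that of [P], with factor - c phi, and that of
    [P *m A], with factor [nu]. The latter is a multiple of [S r.+1], which is assumed to vanish. *)
Lemma dvg_gradP u : U u -> dvg g (fun v => gradv v *m P v) u = - (c * phi u) * trP u.
Proof.
move=> Uu; rewrite (dvg_mul oU g (Ckm_gradv 1) (Ckm_nwt oU cA lA r 1) Uu).
rewrite (nwt_divergence_free oU gT cA lA codz (ltnW rn) Uu) trmx0 mulmx0 mxE addr0.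
under eq_bigr => k _ do rewrite pd_gradv // mulmxDl -!scalemxAl mx_addE !mx_scaleE /ebase -rowE -row_mul.
rewrite big_split -!mulr_sumr /=.
have -> : \sum_k (row k (P u)) 0 k = \tr (P u) by apply: eq_bigr => k _; rewrite mxE.
have -> : \sum_k (row k (A u *m P u)) 0 k = \tr (P u *m A u) by rewrite nwt_comm; apply: eq_bigr => k _; rewrite mxE.
by rewrite -(esym_trace (lA Uu) rn) Sr0 // !mulr0 addr0 (trace_nwt (lA Uu) (ltnW rn)).
Qed.

Lemma Ckm_field k : Ckm k U vfield.
Proof. by apply: CkmZ => //; [exact: Ck_wt|apply: CkmM => //; [exact: Ckm_gradv|exact: (Ckm_nwt oU cA lA)]]. Qed.

Lemma dvg_field u : U u -> dvg g vfield u = dens u.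
Proof.
move=> Uu; have cX := CkmM oU (Ckm_gradv 1) (Ckm_nwt oU cA lA r 1).
rewrite /dvg; under eq_bigr => k _ do rewrite (pdmZ oU k (Ck_wt 1) cX Uu) -scalemxAl -addrA -scalerDr mx_addE !mx_scaleE pd_wt //.
rewrite big_split -mulr_sumr -/(dvg g (fun v => gradv v *m P v) u) dvg_gradP // /dens; congr (_ + _); last first.
  by rewrite /wt; ring.
rewrite /flux mxE mulr_sumr; apply: eq_bigr => k _; rewrite mx_trE grd_entry; ring.
Qed.

Lemma pd_vol_field u : U u -> \sum_k pd k (fun v => vol g v * vfield v 0 k) u = vol g u * dens u.
Proof. by move=> Uu; rewrite (pd_vol_dvg oU cg gT gpos (Ckm_field 1) Uu) dvg_field. Qed.

Lemma quad_le u (w : 'rV[R]_n) : U u -> (w *m (P u *m g u) *m w^T) 0 0 <= trP u * (w *m g u *m w^T) 0 0.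
Proof.
move=> Uu; have := psd_le_trace w (gT Uu) (nwt_sym (esym (l u)) r Uu) (fun v => @gpos u v Uu) (fun v => @Ppsd u v Uu).
by rewrite mulmxK ?ug // (trace_nwt (lA Uu) (ltnW rn)).
Qed.

Lemma flux_quad u : U u -> flux u = (gradv u *m (P u *m g u) *m (gradv u)^T) 0 0.
Proof. by move=> Uu; rewrite /flux /gradv trmx_mul giT // !mulmxA mulmxK ?ug. Qed.

Lemma flux_ge0 u : U u -> 0 <= flux u.
Proof. by move=> Uu; rewrite flux_quad //; exact: Ppsd. Qed.

Lemma trP_ge0 u : U u -> 0 <= trP u.
Proof.
move=> Uu; pose v := ebase R (Ordinal rn).
have v0 : v != 0.
  by apply/eqP => /matrixP /(_ 0 (Ordinal rn)); rewrite !mxE !eqxx => /eqP; rewrite oner_eq0.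
by rewrite -(pmulr_lge0 _ (gpos Uu v0)); apply: le_trans (quad_le v Uu); exact: Ppsd.
Qed.

Lemma gradv_norm u : U u -> (gradv u *m g u *m (gradv u)^T) 0 0 <= 1 - c * phi u ^+ 2.
Proof. by move=> Uu; rewrite /gradv trmx_mul giT // mulmxKV ?ug // mulmxA; exact: grad_le. Qed.

Lemma flux_le u : U u -> flux u <= trP u * (1 - c * phi u ^+ 2).
Proof.
move=> Uu; rewrite flux_quad //; apply: le_trans (quad_le _ Uu) _.
by apply: ler_wpM2l; [exact: trP_ge0|exact: gradv_norm].
Qed.

(** For negative [c] the factor [1 + c * phi u ^+ 4] becomes negative far out. The trace term
    compensates: by [flux_le] it supplies at least - c phi^2 (1 + phi^2) times [flux], and the sum
    of the two factors is 1 - c phi^2. *)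
Lemma dens_ge u : U u -> flux u * (1 - c * phi u ^+ 2) / Num.sqrt (rho u) ^+ 3 <= dens u.
Proof.
move=> Uu; have s0 : 0 < Num.sqrt (rho u) by rewrite sqrtr_gt0 rho_pos.
have E := sqr_sqrtr (ltW (rho_pos u)).
rewrite ler_pdivrMr ?exprn_gt0 //.
have -> : dens u * Num.sqrt (rho u) ^+ 3 = (1 + c * phi u ^+ 4) * flux u - c * phi u ^+ 2 * rho u * trP u.
  by rewrite -{2}E /dens; field; rewrite gt_eqF.
have F := flux_le Uu.
have : 0 <= - (c * phi u ^+ 2) * (1 + phi u ^+ 2) * (trP u * (1 - c * phi u ^+ 2) - flux u).
  rewrite !mulr_ge0 // ?subr_ge0 //; last by rewrite addr_ge0 // sqr_ge0.
  by rewrite oppr_ge0 mulr_le0_ge0 // sqr_ge0.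
rewrite /rho; move: (flux u) (trP u) (phi u) => f t p; nra.
Qed.

Lemma dens_ge0 u : U u -> 0 <= dens u.
Proof.
move=> Uu; apply: le_trans (dens_ge Uu); rewrite divr_ge0 ?exprn_ge0 ?sqrtr_ge0 // mulr_ge0 ?flux_ge0 //.
exact: le_trans (gradv_ge1 u).
Qed.

Lemma dens_gt0 u : U u -> 0 < flux u -> 0 < dens u.
Proof.
move=> Uu f0; apply: lt_le_trans (dens_ge Uu); rewrite divr_gt0 ?exprn_gt0 ?sqrtr_gt0 ?rho_pos //.
by rewrite mulr_gt0 //; exact: lt_le_trans (gradv_ge1 u).
Qed.

(** Cauchy-Schwarz for the semidefinite form of [P], in its additive form and tested on a covector
    [w], so that no square root of the metric appears. *)
Lemma field_bound u (w : 'rV[R]_n) : U u ->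
  `|(vfield u *m w^T) 0 0| <= trP u * (1 + (w *m invmx (g u) *m w^T) 0 0) / 2.
Proof.
move=> Uu; set S := P u *m g u.
have -> : (vfield u *m w^T) 0 0 = ((wt u *: gradv u) *m S *m (w *m invmx (g u))^T) 0 0.
  by rewrite /vfield /S trmx_mul giT // -!scalemxAl !mulmxA mulmxK ?ug.
have b := psd_bilin (wt u *: gradv u) (w *m invmx (g u)) (nwt_sym (esym (l u)) r Uu) (fun v => @Ppsd u v Uu).
have q1 : ((wt u *: gradv u) *m S *m (wt u *: gradv u)^T) 0 0 <= trP u.
  apply: le_trans (quad_le _ Uu) _; rewrite -[leRHS]mulr1; apply: ler_wpM2l; first exact: trP_ge0.
  rewrite trmx_scale -!scalemxAl -scalemxAr !mx_scaleE mulrA -expr2.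
  apply: le_trans (_ : wt u ^+ 2 * (1 - c * phi u ^+ 2) <= 1).
    by apply: ler_wpM2l; [exact: sqr_ge0|exact: gradv_norm].
  rewrite /wt exprMn exprVn sqr_sqrtr ?(ltW (rho_pos u)) // mulrAC ler_pdivrMr ?rho_pos // mul1r /rho.
  by rewrite ler_wpM2r ?(le_trans ler01 (gradv_ge1 u)) // lerDr.
have q2 : ((w *m invmx (g u)) *m S *m (w *m invmx (g u))^T) 0 0 <= trP u * (w *m invmx (g u) *m w^T) 0 0.
  apply: le_trans (quad_le _ Uu) _; by rewrite mulmxKV ?ug // trmx_mul giT // mulmxA.
move: b q1 q2; rewrite -/S; move: (_ 0 0) => a; lra.
Qed.

End Flux.

Section Hypersurface.
Variables (R : realType) (n : nat) (c : R).
Variables (Q : riemannian R n.+1) (M : riemannian R n) (x : M -> Q).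
Variable eta : chart R Q n.+1 -> M -> 'rV[R]_n.+1.
Variable A : chart R M n -> 'rV[R]_n -> 'M[R]_n.
Variables (lam : M -> 'I_n -> R) (r : nat).
Hypothesis imm : isometric_immersion x.
Hypothesis sA : shape_operator x eta A.
Hypothesis plam : principal_curvatures A lam.
Hypothesis rn : (r < n)%N.
Hypothesis psd : newton_psd A lam r.

Local Notation aM := (@atlas R n M).
Local Notation aQ := (@atlas R n.+1 Q).
Implicit Types (s : chart R M n) (d : chart R Q n.+1).

Let xc : continuous x. Proof. by case: imm => -[]. Qed.

Lemma locx_open s d : open (local_dom x s d). Proof. exact: local_dom_open. Qed.
Arguments locx_open : clear implicits.

Lemma locxC s d k : aM s -> aQ d -> Ckm k (local_dom x s d) (local x s d).
Proof. by move=> as_ ad; case: imm => -[_ sm] _; exact: (Ck_entry (locx_open s d) (sm _ _ as_ ad k)). Qed.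

Lemma locx_cod s d u : local_dom x s d u -> ccod d (local x s d u).
Proof. by move=> [_ h]; exact: cmap_ccod. Qed.

Lemma locx_metric s d u : aM s -> aQ d -> local_dom x s d u ->
  metric s u = jac (local x s d) u *m metric d (local x s d u) *m (jac (local x s d) u)^T.
Proof.
move=> as_ ad Uu; case: imm => _ /(_ s d u as_ ad Uu)[_ ->].
by rewrite (jacE (locx_open s d) (fun k => locxC k as_ ad) Uu).
Qed.

Lemma locx_free s d u : aM s -> aQ d -> local_dom x s d u -> row_free (jac (local x s d) u).
Proof.
move=> as_ ad Uu; case: imm => _ /(_ s d u as_ ad Uu)[+ _].
by rewrite (jacE (locx_open s d) (fun k => locxC k as_ ad) Uu).
Qed.

Lemma newton_nwt s u k : newton A lam k s u = nwt (esym (lam (cinv s u))) (A s u) k.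
Proof. by elim: k => //= k ->. Qed.

Lemma char_poly_shape s u : aM s -> ccod s u -> char_poly (A s u) = \prod_i ('X - (lam (cinv s u) i)%:P).
Proof. exact: plam. Qed.

Lemma nwt_psd s u (v : 'rV[R]_n) : aM s -> ccod s u ->
  0 <= (v *m (nwt (esym (lam (cinv s u))) (A s u) r *m metric s u) *m v^T) 0 0.
Proof. by move=> as_ su; have := psd v as_ su; rewrite newton_nwt /inner !mulmxA. Qed.

Lemma covariant_etaE s d i u : aM s -> aQ d -> local_dom x s d u ->
  row i (covariant_eta x eta s d u) = pdm i (fun w => eta d (cinv s w)) u +
    eta d (cinv s u) *m Gt (local x s d) (metric d) i u.
Proof.
move=> as_ ad Uu; apply/rowP => a; rewrite mx_addE mxE mxE pdmE pdE; congr (_ + _).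
rewrite mxE exchange_big; apply: eq_bigr => k _; rewrite Gt_def summxE mulr_sumr; apply: eq_bigr => b _.
rewrite mx_scaleE Gam_entry (jacE (locx_open s d) (fun k => locxC k as_ ad) Uu); ring.
Qed.

Section Normal.
Hypothesis un : unit_normal x eta.

Lemma etaC s d k : aM s -> aQ d -> Ckm k (local_dom x s d) (fun u => eta d (cinv s u)).
Proof. by move=> as_ ad; exact: (Ck_entry (locx_open s d) (normal_smooth un as_ ad k)). Qed.

Lemma eta_orth s d u : aM s -> aQ d -> local_dom x s d u ->
  jac (local x s d) u *m metric d (local x s d u) *m (eta d (cinv s u))^T = 0.
Proof.
move=> as_ ad Uu; apply/matrixP => i j; rewrite ord1 [RHS]mxE.
have := normal_orth un (ebase R i) as_ ad Uu.
rewrite (jacE (locx_open s d) (fun k => locxC k as_ ad) Uu) /inner /ebase -rowE -!row_mul.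
by rewrite mxE.
Qed.

Lemma eta_unit s d u : aM s -> aQ d -> local_dom x s d u ->
  eta d (cinv s u) *m metric d (local x s d u) *m (eta d (cinv s u))^T = 1%:M.
Proof.
move=> as_ ad [su du]; rewrite [LHS]mx11_scalar; congr (_%:M).
exact: (normal_unit un ad du).
Qed.

Lemma shape_weingarten s d i u : aM s -> aQ d -> local_dom x s d u ->
  pdm i (fun w => eta d (cinv s w)) u + eta d (cinv s u) *m Gt (local x s d) (metric d) i u =
  - (row i (A s u) *m jac (local x s d) u).
Proof.
move=> as_ ad Uu; rewrite -covariant_etaE // -row_mul.
rewrite -(jacE (locx_open s d) (fun k => locxC k as_ ad) Uu) (sA as_ ad Uu).
by apply/rowP => a; rewrite !mxE opprK.
Qed.

(** [A] is given without any regularity. It is recovered from the covariant derivative of [eta] by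
    multiplying the shape equation with the ambient metric, the transposed Jacobian and the inverse
    of the induced metric. *)
Lemma shapeC s d k : aM s -> aQ d -> Ckm k (local_dom x s d) (A s).
Proof.
move=> as_ ad; have oU := locx_open s d; have ct k := locxC k as_ ad.
have cJ l : Ckm l (local_dom x s d) (jac (local x s d)) by exact: Ckm_jac.
have ch l : Ckm l (local_dom x s d) (fun u => metric d (local x s d u)).
  exact: (Ckm_comp oU (@ccod_open _ _ _ d) ct (@locx_cod s d) (metricC l ad)).
have ug u : local_dom x s d u -> metric s u \in unitmx by move=> [su _]; exact: metric_unitC.
have cg l : Ckm l (local_dom x s d) (metric s).
  by move=> i j; exact: (Ck_sub (fun u (h : local_dom x s d u) => h.1) (metricC l as_ i j)).
pose cov u : 'M[R]_(n, n.+1) := \matrix_(i, a) (pdm i (fun w => eta d (cinv s w)) u +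
    eta d (cinv s u) *m Gt (local x s d) (metric d) i u) 0 a.
have ccov : Ckm k (local_dom x s d) cov.
  move=> i a; have cGt : Ckm k (local_dom x s d) (Gt (local x s d) (metric d) i).
    apply: (@Ckm_eq _ _ _ oU _ _ _ (fun v => \sum_a jac (local x s d) v i a *: Gam (metric d) a (local x s d v))).
      by move=> v Uv; rewrite Gt_def.
    move=> b e; apply: (@Ck_eq _ _ _ _ _ (fun v => \sum_y jac (local x s d) v i y * Gam (metric d) y (local x s d v) b e)) => //.
      by move=> v _; rewrite summxE; apply: eq_bigr => y _; rewrite mxE.
    apply: Ck_sum => // y _; apply: CkM => //; first exact: cJ.
    have cG := Ckm_Gam (@ccod_open _ _ _ d) (fun l => metricC l ad) (fun u => @metric_sym _ _ _ d u ad) (fun u v => @metric_pos _ _ _ d u v ad) k y.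
    exact: (Ckm_comp oU (@ccod_open _ _ _ d) ct (@locx_cod s d) cG b e).
  apply: (Ck_eq oU _ (CkmD oU (Ckm_pdm oU i (etaC k.+1 as_ ad)) (CkmM oU (etaC k as_ ad) cGt) 0 a)).
  by move=> u _; rewrite [RHS]mxE.
apply: (@Ckm_eq _ _ _ oU _ _ _ (fun u => - cov u *m metric d (local x s d u) *m (jac (local x s d) u)^T *m invmx (metric s u))).
  move=> u Uu; have -> : - cov u = A s u *m jac (local x s d) u.
    apply/row_matrixP => i; rewrite row_mul -[RHS]opprK -(shape_weingarten i as_ ad Uu).
    by apply/rowP => a; rewrite !mxE.
  have -> : A s u *m jac (local x s d) u *m metric d (local x s d u) *m (jac (local x s d) u)^T = A s u *m metric s u.
    by rewrite (locx_metric as_ ad Uu) !mulmxA.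
  by rewrite mulmxK // ug.
apply: CkmM => //; last by apply: Ckm_inv.
apply: CkmM => //; last by apply: Ckm_tr.
by apply: CkmM => //; exact: CkmN.
Qed.

Section Potential.
Variable F : Q -> R.
Hypothesis curv : constant_curvature Q c.
Hypothesis c0 : c <= 0.
Hypothesis HF : forall d, aQ d -> hesseq (metric d) c (ccod d) (F \o cinv d).
Hypothesis EF : forall d p, aQ d -> cdom d p -> energy (metric d) c (F \o cinv d) (cmap d p) = 1.
Hypothesis S0 : forall p, Scurv lam r.+1 p = 0.

Definition pot s (u : 'rV[R]_n) : R := F (x (cinv s u)).
Definition fieldM s := vfield (metric s) (A s) (lam \o cinv s) c (pot s) r.
Definition densM s := dens (metric s) (A s) (lam \o cinv s) c (pot s) r.
Definition fluxM s := flux (metric s) (A s) (lam \o cinv s) (pot s) r.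

Lemma grd_pot s d u : aM s -> aQ d -> local_dom x s d u ->
  grd (pot s) u = grd (F \o cinv d) (local x s d u) *m (jac (local x s d) u)^T.
Proof.
move=> as_ ad Uu; have oU := locx_open s d.
rewrite -(grd_comp oU (@ccod_open _ _ _ d) (fun k => locxC k as_ ad) (@locx_cod s d) ((HF ad).1 1%N) Uu).
by apply: (grd_eq oU) => // v [_ h]; rewrite /pot /local /= cmapK.
Qed.

(** [X] is the ambient gradient and [Y] its tangential projection; the difference has nonnegative
    length, and the energy identity gives the length of [X]. *)
Lemma grad_pot_le s d u : aM s -> aQ d -> local_dom x s d u ->
  (grd (pot s) u *m invmx (metric s u) *m (grd (pot s) u)^T) 0 0 <= 1 - c * pot s u ^+ 2.
Proof.
move=> as_ ad Uu; have [su du] := Uu; rewrite (grd_pot as_ ad Uu).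
have := EF ad du; rewrite /energy /= cmapK // -/(local x s d u) -/(pot s u).
have uh : metric d (local x s d u) \in unitmx by exact: metric_unitC (locx_cod Uu).
have ug : metric s u \in unitmx by exact: metric_unitC su.
have hT : (metric d (local x s d u))^T = metric d (local x s d u) by exact: metric_sym (locx_cod Uu).
have gT : (metric s u)^T = metric s u by exact: metric_sym su.
have gE := locx_metric as_ ad Uu.
set w := grd _ _; set J := jac _ _ in gE *; set h := metric d _ in uh hT gE *; set g := metric s u in ug gT gE *.
move=> E; rewrite -E [c * _ + _]addrC addrK.
have hiT : (invmx h)^T = invmx h by rewrite trmx_inv hT.
have giT : (invmx g)^T = invmx g by rewrite trmx_inv gT.
pose X := w *m invmx h; pose Y := w *m J^T *m invmx g *m J.
have hpsd (v : 'rV[R]_n.+1) : 0 <= (v *m h *m v^T) 0 0.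
  have [->|v0] := eqVneq v 0; first by rewrite !mul0mx mxE.
  by apply/ltW; exact: (metric_pos ad (locx_cod Uu) v0).
have := hpsd (X - Y).
have XhX : X *m h *m X^T = w *m invmx h *m w^T by rewrite /X trmx_mul hiT !mulmxA mulmxKV.
have XhY : X *m h *m Y^T = w *m J^T *m invmx g *m (w *m J^T)^T.
  by rewrite /X /Y mulmxKV // !trmx_mul !trmxK giT !mulmxA.
have YhX : Y *m h *m X^T = w *m J^T *m invmx g *m (w *m J^T)^T.
  by rewrite /X /Y !trmx_mul !trmxK hiT !mulmxA mulmxK.
have YhY : Y *m h *m Y^T = w *m J^T *m invmx g *m (w *m J^T)^T.
  rewrite /Y !trmx_mul !trmxK giT !mulmxA -2!(mulmxA (w *m J^T *m invmx g)) -gE.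
  by rewrite mulmxKV.
rewrite trmx_sub !mulmxBl !mulmxBr XhX XhY YhX YhY subrr subr0 mx_subE subr_ge0.
by [].
Qed.

Lemma chart_flux s d : aM s -> aQ d -> let U := local_dom x s d in
  [/\ Ckm 1 U (fieldM s),
      forall u, U u -> \sum_k pd k (fun v => vol (metric s) v * fieldM s v 0 k) u = vol (metric s) u * densM s u,
      forall u, U u -> 0 <= densM s u,
      forall u, U u -> 0 < fluxM s u -> 0 < densM s u &
      forall u (w : 'rV[R]_n), U u -> `|(fieldM s u *m w^T) 0 0| <=
        (n - r)%:R * Scurv lam r (cinv s u) * (1 + (w *m invmx (metric s u) *m w^T) 0 0) / 2].
Proof.
move=> as_ ad U; have oU : open U := locx_open s d; have oV := @ccod_open _ _ _ d.
have ct k : Ckm k U (local x s d) := locxC k as_ ad.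
have tV u : U u -> ccod d (local x s d u) := @locx_cod s d u.
have cg k : Ckm k U (metric s).
  by move=> i j; exact: (Ck_sub (fun u (h : local_dom x s d u) => h.1) (metricC k as_ i j)).
have ch k : Ckm k (ccod d) (metric d) := metricC k ad.
have gT u : U u -> (metric s u)^T = metric s u by move=> [su _]; exact: metric_sym.
have hT u : ccod d u -> (metric d u)^T = metric d u by exact: metric_sym.
have gp u v : U u -> v != 0 -> 0 < inner (metric s) u v v by move=> [su _]; exact: metric_pos.
have hp u v : ccod d u -> v != 0 -> 0 < inner (metric d) u v v by exact: metric_pos.
have gE u (Uu : U u) := locx_metric as_ ad Uu.
have hs u v w : ccod d u -> row_free (col_mx v w) -> sectional (metric d) u v w = c by exact: curv.
have ce k : Ckm k U (fun u => eta d (cinv s u)) := etaC k as_ ad.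
have eo u (Uu : U u) := eta_orth as_ ad Uu.
have eu u (Uu : U u) := eta_unit as_ ad Uu.
have wg i u (Uu : U u) := shape_weingarten i as_ ad Uu.
have cA k : Ckm k U (A s) := shapeC k as_ ad.
have lA u : U u -> char_poly (A s u) = \prod_i ('X - ((lam \o cinv s) u i)%:P) by move=> [su _]; exact: char_poly_shape.
have cod := codazzi oU oV ct tV ch gT hT gp hp gE hs ce eo wg cA.
have AgT := sff_sym oU oV ct tV ch gT hT hp gE ce eo wg.
have cpot k : Ck k U (pot s).
  apply: (Ck_eq oU _ (Ck_comp oU oV (ct k) tV ((HF ad).1 k))) => u [_ h].
  by rewrite /pot /local /= cmapK.
pose nu u := (grd (F \o cinv d) (local x s d u) *m (eta d (cinv s u))^T) 0 0.
have hess j u : U u -> pdm j (grd (pot s)) u = (- (c * pot s u)) *: row j (metric s u) +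
   grd (pot s) u *m (Gam (metric s) j u)^T + nu u *: row j (A s u *m metric s u).
  move=> Uu; have pE v : U v -> (F \o cinv d) (local x s d v) = pot s v.
    by move=> [_ h]; rewrite /pot /local /= cmapK.
  have := hess_comp oU oV ct tV gE (HF ad) j Uu.
  rewrite (pdm_eq oU j (fun v Uv => grd_eq oU pE Uv) Uu) pE // => ->.
  rewrite (gauss oU oV ct tV ch gT hT gp hp gE ce eo eu wg j Uu) trmx_add !trmx_mul trmxK mulmxDr !mulmxA.
  rewrite -(grd_pot as_ ad Uu) -addrA; congr (_ + (_ + _)).
  by rewrite [X in X *m _]mx11_scalar mul_scalar_mx.
have Sr u : U u -> esym ((lam \o cinv s) u) r.+1 = 0 by move=> _; exact: S0.
have Pp u (v : 'rV[R]_n) : U u -> 0 <= (v *m (nwt (esym ((lam \o cinv s) u)) (A s u) r *m metric s u) *m v^T) 0 0.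
  by move=> [su _]; exact: nwt_psd.
have gl u (Uu : U u) := grad_pot_le as_ ad Uu.
split.
- exact: (Ckm_field oU cg gp cA lA cpot r c0 1).
- move=> u Uu; exact: (pd_vol_field oU cg gT gp cA lA cod cpot hess rn Sr c0 Uu).
- move=> u Uu; exact: (dens_ge0 gT gp lA AgT rn Pp c0 gl Uu).
- move=> u Uu; exact: (dens_gt0 gT gp lA AgT rn Pp c0 gl Uu).
- move=> u w Uu; exact: (field_bound gT gp lA AgT rn Pp c0 gl w Uu).
Qed.

Section ChartChange.
Variables (s t : chart R M n) (u : 'rV[R]_n).
Hypotheses (as_ : aM s) (at_ : aM t) (Uu : local_dom id s t u).
Let J := jac (local id s t) u.
Let v := local id s t u.

(** The covariant derivative of [eta] transforms like a covector in the tangent direction, and the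
    Jacobian of the immersion has independent rows, so it can be cancelled. *)
Lemma shape_change : A s u *m J = J *m A t v.
Proof.
have [d ad du] := atlas_cover (x (cinv s u)).
have Us : local_dom x s d u by split=> //; exact: Uu.1.
have vE : cinv t v = cinv s u by exact: transK.
have Ut : local_dom x t d v by split; [exact: trans_cod|rewrite vE].
have oW : open (local_dom id s t `&` local id s t @^-1` local_dom x t d).
  by apply: open_preim; [exact: trd_open|exact: locx_open|move=> w Uw; exact: (Ckm_cont (transC 0 as_ at_) Uw)].
set W := _ `&` _ in oW.
have WU : W `<=` local_dom id s t by move=> w [].
have ct k : Ckm k W (local id s t) by move=> i j; exact: Ck_sub WU (transC k as_ at_ i j).
have tV w : W w -> local_dom x t d (local id s t w) by case.
have Wu : W u by split.
have eqx w : W w -> local x t d (local id s t w) = local x s d w by move=> [Uw _]; rewrite /local -/(local id s t w) transK.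
have JJ : jac (local x s d) u = J *m jac (local x t d) v.
  apply/matrixP => i a; rewrite jac_entry (@pd_eq _ _ _ oW _ (fun w => local x t d (local id s t w) 0 a)) //; last first.
    by move=> w Ww; rewrite eqx.
  rewrite (pd_comp i oW (locx_open t d) (ct 1) (locxC 1 at_ ad 0 a) Wu (tV u Wu)) mxE.
  by apply: eq_bigr => b _; rewrite !jac_entry.
have EE : covariant_eta x eta s d u = J *m covariant_eta x eta t d v.
  apply/row_matrixP => i; rewrite covariant_etaE // row_mul (mulmx_sum_row (row i J)).
  under eq_bigr => b _ do rewrite covariant_etaE // scalerDr mxE.
  rewrite big_split; congr (_ + _) => /=.
    apply/rowP => a; rewrite pdmE summxE (@pd_eq _ _ _ oW _ (fun w => eta d (cinv t (local id s t w)) 0 a)) //; last first.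
      by move=> w [Uw _]; rewrite transK.
    rewrite (pd_comp i oW (locx_open t d) (ct 1) (etaC 1 at_ ad 0 a) Wu (tV u Wu)).
    by apply: eq_bigr => b _; rewrite mx_scaleE pdmE /J jac_entry.
  rewrite vE; under eq_bigr => b _ do rewrite scalemxAr; rewrite -mulmx_sumr; congr (_ *m _).
  rewrite Gt_def; under [RHS]eq_bigr => b _ do rewrite Gt_def scaler_sumr.
  rewrite exchange_big; apply: eq_bigr => a _; rewrite JJ mxE scaler_suml; apply: eq_bigr => b _.
  by rewrite scalerA eqx.
have := sA as_ ad Us; rewrite EE -mulmxN -(sA at_ ad Ut).
rewrite (jacE (locx_open s d) (fun k => locxC k as_ ad) Us) (jacE (locx_open t d) (fun k => locxC k at_ ad) Ut) JJ !mulmxA.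
by move/(row_free_inj (locx_free at_ ad Ut)).
Qed.

Lemma nwt_change (S : nat -> R) k : nwt S (A s u) k *m J = J *m nwt S (A t v) k.
Proof.
elim: k => [|k IH] /=; first by rewrite mul1mx mulmx1.
by rewrite mulmxBl mulmxBr scalar_mxC -mulmxA shape_change mulmxA IH mulmxA.
Qed.

Lemma grd_pot_change : grd (pot s) u = grd (pot t) v *m J^T.
Proof.
have [d ad du] := atlas_cover (x (cinv t v)).
have vE : cinv t v = cinv s u by exact: transK.
have Ut : local_dom x t d v by split=> //; exact: trans_cod.
have oW : open (local_dom id s t `&` local id s t @^-1` local_dom x t d).
  by apply: open_preim; [exact: trd_open|exact: locx_open|move=> w Uw; exact: (Ckm_cont (transC 0 as_ at_) Uw)].
set W := _ `&` _ in oW.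
have WU : W `<=` local_dom id s t by move=> w [].
have ct k : Ckm k W (local id s t) by move=> i j; exact: Ck_sub WU (transC k as_ at_ i j).
have tV w : W w -> local_dom x t d (local id s t w) by case.
have Wu : W u by split.
have cpot : Ck 1 (local_dom x t d) (pot t).
  apply: (Ck_eq (locx_open t d) _ (Ck_comp (locx_open t d) (@ccod_open _ _ _ d) (locxC 1 at_ ad) (@locx_cod t d) ((HF ad).1 1%N))) => w [_ h].
  by rewrite /pot /local /= cmapK.
rewrite -(grd_comp oW (locx_open t d) ct tV cpot Wu); apply: (grd_eq oW) => // w [Uw _].
by rewrite /pot transK.
Qed.

Lemma gradv_change : gradv (metric s) (pot s) u *m J = gradv (metric t) (pot t) v.
Proof.
have Ju : J \in unitmx by exact: jac_trans_unit.
have gu := metric_unitC as_ Uu.1; have hu := metric_unitC at_ (trans_cod Uu).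
rewrite /gradv grd_pot_change (metric_trans as_ at_ Uu) -/J -/v.
have JT : J^T \in unitmx by rewrite unitmx_tr.
set h := metric t v in hu *; set w := grd _ _.
have U3 : J *m h *m J^T \in unitmx by rewrite !unitmx_mul Ju hu JT.
have -> : invmx (J *m h *m J^T) = invmx J^T *m invmx h *m invmx J.
  apply: (can_inj (mulKmx U3)); rewrite mulmxV //.
  by rewrite !mulmxA mulmxK // mulmxK // mulmxV.
by rewrite !mulmxA mulmxK // mulmxKV.
Qed.

Lemma field_change : fieldM s u *m J = fieldM t v.
Proof.
have vE : cinv t v = cinv s u by exact: transK.
rewrite /fieldM /vfield /wt /rho /pot vE -scalemxAl -mulmxA /= vE nwt_change mulmxA gradv_change.
by [].
Qed.

Lemma flux_change : fluxM s u = fluxM t v.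
Proof.
have vE : cinv t v = cinv s u by exact: transK.
rewrite /fluxM /flux /= vE grd_pot_change trmx_mul trmxK mulmxA -(mulmxA (gradv _ _ u)) nwt_change.
by rewrite mulmxA gradv_change.
Qed.

Lemma dens_change : densM s u = densM t v.
Proof.
have vE : cinv t v = cinv s u by exact: transK.
rewrite /densM /dens -/(fluxM s u) -/(fluxM t v) flux_change /rho /pot /trP /= vE.
by [].
Qed.
End ChartChange.

End Potential.

(** If the semidefinite form of [P] vanished on every vector, it would be zero by [psd_bilin], and
    so would the trace of [P], which is a nonzero multiple of [Scurv lam r]. *)
Lemma flux_vector s u : aM s -> ccod s u -> Scurv lam r (cinv s u) != 0 ->
  exists v : 'rV[R]_n, (v *m metric s u *m v^T) 0 0 = 1 /\
    0 < (v *m (nwt (esym (lam (cinv s u))) (A s u) r *m metric s u) *m v^T) 0 0.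
Proof.
move=> as_ su S0; set P := nwt _ _ _; set g := metric s u.
have ug : g \in unitmx by exact: metric_unitC.
have [d ad du] := atlas_cover (x (cinv s u)).
have oU := locx_open s d; have Uu : local_dom x s d u by [].
have PgT : (P *m g)^T = P *m g.
  have gT v : local_dom x s d v -> (metric s v)^T = metric s v by move=> [h _]; exact: metric_sym.
  have AgT := sff_sym oU (@ccod_open _ _ _ d) (fun k => locxC k as_ ad) (@locx_cod s d) (fun k => metricC k ad) gT
    (fun u => @metric_sym _ _ _ d u ad) (fun u v => @metric_pos _ _ _ d u v ad) (fun u h => locx_metric as_ ad h)
    (fun k => etaC k as_ ad) (fun u h => eta_orth as_ ad h) (fun i u h => shape_weingarten i as_ ad h).
  exact: (nwt_sym gT AgT _ _ Uu).
have pos (v : 'rV[R]_n) : 0 <= (v *m (P *m g) *m v^T) 0 0 by exact: nwt_psd.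
have [v v0] : exists v : 'rV[R]_n, 0 < (v *m (P *m g) *m v^T) 0 0.
  apply: contrapT => /forallNP all0; case/eqP: S0.
  have z (v : 'rV[R]_n) : (v *m (P *m g) *m v^T) 0 0 = 0.
    by apply/eqP; rewrite eq_le pos andbT leNgt; apply/negP/all0.
  have Pg0 : P *m g = 0.
    apply/matrixP => i j; rewrite [RHS]mxE; apply/eqP; rewrite -normr_le0.
    have := psd_bilin (ebase R i) (ebase R j) PgT pos; rewrite !z addr0.
    by rewrite /ebase -rowE trmx_delta -colE !mxE pmulr_rle0.
  have : P = 0 by rewrite -[P](mulmxK ug) Pg0 mul0mx.
  move=> /(congr1 mxtrace); rewrite (trace_nwt (char_poly_shape as_ su) (ltnW rn)) linear0 => /eqP.
  by rewrite mulf_eq0 pnatr_eq0 subn_eq0 leqNgt rn /= => /eqP.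
have vn : v != 0 by apply/eqP => e; move: v0; rewrite e !mul0mx mxE ltxx.
have g0 : 0 < (v *m g *m v^T) 0 0 by exact: (metric_pos as_ su vn).
pose a := (Num.sqrt ((v *m g *m v^T) 0 0))^-1.
have a0 : 0 < a by rewrite invr_gt0 sqrtr_gt0.
have sc (B : 'M[R]_n) : ((a *: v) *m B *m (a *: v)^T) 0 0 = a ^+ 2 * (v *m B *m v^T) 0 0.
  by rewrite trmx_scale -!scalemxAl -scalemxAr !mx_scaleE mulrA.
exists (a *: v); rewrite !sc; split; last by rewrite mulr_gt0 ?exprn_gt0.
by rewrite /a exprVn sqr_sqrtr ?(ltW g0) // mulVf // gt_eqF.
Qed.

Theorem flux_exists q : space_form Q c -> c <= 0 -> (forall p, Scurv lam r.+1 p = 0) -> Scurv lam r q != 0 ->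
  exists (Y : chart R M n -> 'rV[R]_n -> 'rV[R]_n) (e : M -> R),
  [/\ forall s, aM s -> Ckm 1 (ccod s) (Y s),
      forall s u, aM s -> ccod s u ->
        \sum_k pd k (fun v => vol (metric s) v * Y s v 0 k) u = vol (metric s) u * e (cinv s u),
      (forall p, 0 <= e p) /\ 0 < e q,
      forall s u (w : 'rV[R]_n), aM s -> ccod s u -> `|(Y s u *m w^T) 0 0| <=
        (n - r)%:R * Scurv lam r (cinv s u) * (1 + (w *m invmx (metric s u) *m w^T) 0 0) / 2 &
      forall s t u, aM s -> aM t -> local_dom id s t u -> Y s u *m jac (local id s t) u = Y t (local id s t u)].
Proof.
move=> sf c0 S0 Sq; have [_ [pc _] curv] := sf.
have [s as_ sq] := atlas_cover q; have su := cmap_ccod sq.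
have [d ad dq] := atlas_cover (x q).
have Uu : local_dom x s d (cmap s q) by split; rewrite // cmapK.
have Sq' : Scurv lam r (cinv s (cmap s q)) != 0 by rewrite cmapK.
have [v [v1 v0]] := flux_vector as_ su Sq'.
set g := metric s _ in v1 v0.
have tq : local x s d (cmap s q) = cmap d (x q) by rewrite /local cmapK.
have gE := locx_metric as_ ad Uu; rewrite tq -/g in gE.
pose J := jac (local x s d) (cmap s q); pose h := metric d (cmap d (x q)).
have hT : h^T = h by exact: metric_sym (cmap_ccod dq).
have uh : h \in unitmx by exact: metric_unitC (cmap_ccod dq).
have ug : g \in unitmx by exact: metric_unitC.
(* The prescribed differential is dual to [v *m J], the image of the unit vector [v]: the energy at
   [x q] is then 1. Since [F] vanishes there, the density at [q] reduces to the flux, the positive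
   value of the form at [v]. *)
have [F [HF Fq Fg]] := hess_global (v *m J *m h) sf ad dq.
have EF d' p : aQ d' -> cdom d' p -> energy (metric d') c (F \o cinv d') (cmap d' p) = 1.
  move=> ad' dp; rewrite (energy_const pc HF ad' ad dp dq) /energy Fg /= cmapK // Fq expr0n mulr0 add0r.
  rewrite -/h mulmxK // !trmx_mul hT !mulmxA -(mulmxA v) -(mulmxA v) -/J.
  by rewrite -[J *m h *m J^T]gE.
pose ch p : {s : chart R M n | aM s & cdom s p} := cid2 (atlas_cover p).
(* A chart is chosen at each point; by [dens_change] the value does not depend on it. *)
pose e p := densM F (sval (ch p)) (cmap (sval (ch p)) p).
have eE t u : aM t -> ccod t u -> densM F t u = e (cinv t u).
  move=> at_ tu; rewrite /e; case: (ch (cinv t u)) => t' at' ct' /=.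
  have Utt : local_dom id t t' u by split.
  by rewrite (dens_change HF at_ at' Utt).
have CF := chart_flux curv c0 HF EF S0.
exists (fieldM F), e; split.
- move=> t at_ i j; apply: Ck_local => u tu; have [d' ad' du] := atlas_cover (x (cinv t u)).
  have [cY _ _ _ _] := CF t d' at_ ad'.
  by exists (local_dom x t d'); split; [exact: locx_open|split|exact: cY].
- move=> t u at_ tu; have [d' ad' du] := atlas_cover (x (cinv t u)).
  have [_ H _ _ _] := CF t d' at_ ad'.
  by rewrite H // eE.
- have e0 t u : aM t -> ccod t u -> 0 <= e (cinv t u).
    move=> at_ tu; have [d' ad' du] := atlas_cover (x (cinv t u)).
    have [_ _ H _ _] := CF t d' at_ ad'; rewrite -eE //; exact: H.
  split=> [p|]; first by have [t at_ tp] := atlas_cover p; rewrite -(cmapK tp); exact: (e0 _ _ at_ (cmap_ccod tp)).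
  have [_ _ _ H _] := CF s d as_ ad; have := H _ Uu; rewrite (eE _ _ as_ su) cmapK //; apply.
  have gp : grd (pot F s) (cmap s q) = v *m g.
    by rewrite (grd_pot HF as_ ad Uu) tq Fg -/J -!mulmxA (mulmxA J) -[J *m h *m J^T]gE.
  have gT : g^T = g by exact: metric_sym.
  by rewrite /fluxM /flux /gradv gp mulmxK // trmx_mul gT !mulmxA; move: v0; rewrite !mulmxA /=.
- move=> t u w at_ tu; have [d' ad' du] := atlas_cover (x (cinv t u)).
  by have [_ _ _ _ H] := CF t d' at_ ad'; exact: H.
- by move=> t t' u at_ at' Ut; exact: (field_change HF at_ at' Ut).
Qed.
End Normal.
End Hypersurface.

Lemma derive_comp_vec (R : realType) m (g : R -> 'rV[R]_m) (s : R -> R) (t ds : R) :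
  is_derive t (1 : R) s ds -> derivable g (s t) 1 ->
  is_derive t (1 : R) (fun t => g (s t)) (ds *: g^`()%classic (s t)).
Proof.
move=> [d1 e1] /derivable1_diffP dg; have /derivable1_diffP ds' := d1.
have dc : differentiable (g \o s) t := differentiable_comp ds' dg.
split; first by apply/derivable1_diffP.
rewrite -[LHS]/('D_1 (g \o s) t) (deriveE _ dc) (diff_comp ds' dg) /= (diff1E dg) /= (diff1E ds') /=.
by rewrite derive1E e1 /GRing.scale /= mul1r.
Qed.

Lemma entry_cont (R : realType) (T : topologicalType) p q (F : T -> 'M[R]_(p, q)) i j (z : T) :
  {for z, continuous F} -> {for z, continuous (fun t => F t i j)}.
Proof.
by move=> cF; apply: (@continuous_comp _ _ _ F (fun A : 'M[R]_(p, q) => A i j)) => //; exact: coord_continuous.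
Qed.

Arguments entry_cont {R T p q F} i j {z}.

Lemma sum_cont (R : realType) (T : topologicalType) (I : Type) (l : seq I) (F : I -> T -> R) (z : T) :
  (forall i, {for z, continuous (F i)}) -> {for z, continuous (fun t => \sum_(i <- l) F i t)}.
Proof.
move=> cF; elim: l => [|i l IH].
  rewrite (_ : (fun t => _) = fun _ => 0); last by apply/funext => t; rewrite big_nil.
  exact: cvg_cst.
rewrite (_ : (fun t => _) = fun t => F i t + \sum_(j <- l) F j t); last by apply/funext => t; rewrite big_cons.
exact: (cvgD (cF i) IH).
Qed.

Lemma quad_cont (R : realType) (T : topologicalType) m (G : T -> 'M[R]_m) (v : T -> 'rV[R]_m) (z : T) :
  {for z, continuous G} -> {for z, continuous v} ->
  {for z, continuous (fun t => (v t *m G t *m (v t)^T) 0 0)}.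
Proof.
move=> cG cv.
rewrite (_ : (fun t => _) = fun t => \sum_i \sum_j v t 0 i * v t 0 j * G t i j); last first.
  by apply/funext => t; rewrite quad11.
apply: sum_cont => i; apply: sum_cont => j; 
have h1 := entry_cont (0 : 'I_1) i cv; have h2 := entry_cont (0 : 'I_1) j cv; have h3 := entry_cont i j cG.
exact: (continuousM (continuousM h1 h2) h3).
Qed.

Lemma antiderivative01 (R : realType) (f : R -> R) : continuous f ->
  exists V : R -> R, forall t : R, 0 <= t <= 1 -> is_derive t (1 : R) V (f t).
Proof.
(* The integral starts at -1 so that the fundamental theorem applies also at the endpoint 0 of
   [0, 1]. *)
move=> cf; pose V (x : R) := (\int[lebesgue_measure]_(t in [set` Interval (BLeft (-1)) (BRight x)]) f t)%R.
exists V => t /andP[t0 t1].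
have H := @continuous_FTC1 R f (BLeft (-1)) t 2.
have [||||d1 d2] := H.
- by apply: le_lt_trans t1 _; lra.
- by apply: continuous_compact_integrable; [exact: segment_compact|exact: continuous_subspaceT].
- by rewrite /= lte_fin (lt_le_trans _ t0) // ltrN10.
- exact: cf.
- by apply: DeriveDef; [exact: d1|rewrite -derive1E; exact: d2].
Qed.

(** * The Riemannian distance *)

Section RDist.
Variables (R : realType) (m : nat) (N : riemannian R m).
Implicit Types (c d : chart R N m) (p q y z : N).

Definition spd c (g : R -> 'rV[R]_m) t := Num.sqrt (inner (metric c) (g t) (g^`()%classic t) (g^`()%classic t)).

Definition aff (a b t : R) : R := a + (b - a) * t.

Lemma aff_in a b t : 0 <= a <= 1 -> 0 <= b <= 1 -> 0 <= t <= 1 -> 0 <= aff a b t <= 1.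
Proof. rewrite /aff; move=> /andP[? ?] /andP[? ?] /andP[? ?]; apply/andP; split; nra. Qed.

Lemma aff_derive a b t : is_derive t (1 : R) (aff a b) (b - a).
Proof.
rewrite /aff; have : is_derive t (1 : R) (fun t : R => a + (b - a) * t) (0 + (b - a) *: (1 : R)).
  by apply: is_deriveD.
by rewrite add0r /GRing.scale /= mulr1.
Qed.

Lemma spd_cont c g : arc c g -> continuous (fun t => spd c g (clamp 0 1 t)).
Proof.
move=> [ac gc dg cg'] t.
apply: (@continuous_comp _ _ _ (fun t => inner (metric c) (g (clamp 0 1 t)) (g^`()%classic (clamp 0 1 t)) (g^`()%classic (clamp 0 1 t))) (@Num.sqrt R)); last exact: sqrt_continuous.
have cc : {for t, continuous (clamp 0 1)} by exact: (@clamp_cont R 0 1 ler01).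
apply: quad_cont.
  apply: (@continuous_comp _ _ _ (fun t => g (clamp 0 1 t)) (metric c)).
    apply: continuous_comp => //; apply: differentiable_continuous; apply/derivable1_diffP; exact: dg.
  by apply: (Ckm_cont (metricC 0 ac)); apply: gc; exact: clamp_in.
by apply: (@continuous_comp _ _ _ (clamp 0 1) (g^`()%classic : R -> 'rV[R]_m)) => //; exact: cg'.
Qed.

Lemma arc_aff c g a b : arc c g -> 0 <= a <= 1 -> 0 <= b <= 1 -> arc c (fun t => g (aff a b t)).
Proof.
move=> [ac gc dg cg'] a01 b01.
have D t : is_derive t (1 : R) (fun t => g (aff a b t)) ((b - a) *: g^`()%classic (aff a b t)).
  by apply: derive_comp_vec (dg _); exact: aff_derive.
split.
- exact: ac.
- by move=> t t01; apply: gc; exact: aff_in.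
- by move=> t; case: (D t).
- have -> : ((fun t => g (aff a b t))^`()%classic : R -> 'rV[R]_m) = fun t => (b - a) *: g^`()%classic (aff a b t).
    by apply/funext => t; rewrite derive1E; case: (D t).
  move=> t; apply: cvgZr; apply: (@continuous_comp _ _ _ (aff a b) (g^`()%classic : R -> 'rV[R]_m)); last exact: cg'.
  by apply: differentiable_continuous; apply/derivable1_diffP; case: (aff_derive a b t).
Qed.

Lemma arc_length_int01 c g : arc c g -> arc_length c g = (int01 (fun t => spd c g (clamp 0 1 t)))%:E.
Proof.
move=> ag; rewrite /arc_length /int01 /Rintegral fineK; last first.
  by apply: integrable_fin_num => //; apply: cont01_integrable; apply: cont01P => t _; exact: spd_cont.
apply: eq_integral => t; rewrite inE /= in_itv /= => t01; by rewrite clamp_id.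
Qed.

(** [V] is the arc length function; it measures every subarc, traversed in either direction, and so
    serves both for reversing and for cutting curves. *)
Lemma arc_primitive c g : arc c g -> exists V : R -> R,
  (forall t : R, 0 <= t <= 1 -> is_derive t (1 : R) V (spd c g (clamp 0 1 t))) /\
  forall a b, 0 <= a <= 1 -> 0 <= b <= 1 -> arc_length c (fun t => g (aff a b t)) = `|V b - V a|%:E.
Proof.
move=> ag; have cs := spd_cont ag; have [V HV] := antiderivative01 cs; exists V; split=> // a b a01 b01.
have aab := arc_aff ag a01 b01; rewrite (arc_length_int01 aab); congr (_%:E).
have D t : is_derive t (1 : R) (fun t => g (aff a b t)) ((b - a) *: g^`()%classic (aff a b t)).
  by case: ag => _ _ dg _; apply: derive_comp_vec (dg _); exact: aff_derive.
have sE t : 0 <= t <= 1 -> spd c (fun t => g (aff a b t)) (clamp 0 1 t) = `|b - a| * spd c g (clamp 0 1 (aff a b t)).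
  move=> t01; rewrite !clamp_id //; last exact: aff_in.
  rewrite /spd derive1E; have [_ ->] := D t.
  by rewrite /inner trmx_scale -!scalemxAl -scalemxAr !mx_scaleE mulrA -expr2 sqrtrM ?sqr_ge0 // sqrtr_sqr.
rewrite (eq_int01 sE).
have cas t : {for t, continuous (fun t => spd c g (clamp 0 1 (aff a b t)))}.
  apply: (@continuous_comp _ _ _ (aff a b) (fun t => spd c g (clamp 0 1 t))); last exact: cs.
  by apply: differentiable_continuous; apply/derivable1_diffP; case: (aff_derive a b t).
have dV (t : R) : 0 <= t <= 1 -> is_derive t (1 : R) (V \o aff a b) (spd c g (clamp 0 1 (aff a b t)) * (b - a)).
  move=> t01; apply: is_derive1_comp; last exact: aff_derive.
  exact: (HV _ (aff_in a01 b01 t01)).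
have ci : cont01 (fun t => spd c g (clamp 0 1 (aff a b t))) by apply: cont01P => t _; exact: cas.
have E : (b - a) * int01 (fun t => spd c g (clamp 0 1 (aff a b t))) = V b - V a.
{ rewrite -int01Z //; have := @int01_FTC R (V \o aff a b) (fun t => (b - a) * spd c g (clamp 0 1 (aff a b t))).
  move=> H; etransitivity; first apply: H.
  - by move=> t _; apply: cvgM; [exact: cvg_cst|exact: cas].
  - by move=> t t01; rewrite mulrC; exact: dV.
  - by rewrite /= /aff !mulr0 !mulr1 addr0; congr (V _ - _); ring. }
rewrite int01Z // -E normrM; congr (_ * _); rewrite ger0_norm // -[leLHS](int01_cst 0).
apply: le_int01; [exact: cont01_cst|exact: ci|].
by move=> t _; exact: sqrtr_ge0.
Qed.

Lemma arc_length_ge0 c g : (0 <= arc_length c g)%E.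
Proof. by apply: integral_ge0 => t _; rewrite lee_fin sqrtr_ge0. Qed.

Lemma arc_length_fin c g : arc c g -> arc_length c g \is a fin_num.
Proof. by move=> ag; rewrite arc_length_int01. Qed.

Lemma curve_ge0 p q l : curve p q l -> (0 <= l)%E.
Proof. by elim=> // c g q' l' _ _ l0; rewrite adde_ge0 // arc_length_ge0. Qed.

Lemma curve_fin p q l : curve p q l -> l \is a fin_num.
Proof. by elim=> // c g q' l' ag _ lf; rewrite fin_numD arc_length_fin. Qed.

Lemma curve_cat p q s l l' : curve p q l -> curve q s l' -> curve p s (l + l')%E.
Proof.
elim=> [{}p|c g {}q {}l ag _ IH] H; first by rewrite add0e.
by rewrite -addeA; apply: curve_cons => //; exact: IH.
Qed.

Lemma curve_arc c g : arc c g -> curve (cinv c (g 0)) (cinv c (g 1)) (arc_length c g).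
Proof. by move=> ag; rewrite -[arc_length _ _]adde0; apply: curve_cons => //; exact: curve_nil. Qed.

Lemma aff01 (g : R -> 'rV[R]_m) : (fun t => g (aff 0 1 t)) = g.
Proof. by apply/funext => t; rewrite /aff subr0 mul1r add0r. Qed.

Lemma curve_sub c g a b : arc c g -> 0 <= a <= 1 -> 0 <= b <= 1 ->
  curve (cinv c (g a)) (cinv c (g b)) (arc_length c (fun t => g (aff a b t))).
Proof.
move=> ag a01 b01; have := curve_arc (arc_aff ag a01 b01).
by rewrite /aff mulr0 addr0 mulr1 addrC subrK.
Qed.

Lemma curve_rev p q l : curve p q l -> curve q p l.
Proof.
elim=> [{}p|c g {}q {}l ag _ IH]; first exact: curve_nil.
have [V [_ HV]] := arc_primitive ag.
have i0 : 0 <= (0 : R) <= 1 by rewrite lexx ler01.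
have i1 : 0 <= (1 : R) <= 1 by rewrite lexx ler01.
have E : arc_length c g = arc_length c (fun t => g (aff 1 0 t)).
  by rewrite -{1}(aff01 g) !HV // distrC.
by rewrite addeC E; apply: curve_cat IH _; exact: curve_sub.
Qed.

(** Walk along the arcs until the one in which length [a] is reached, and cut it by the intermediate
    value theorem for its arc length. *)
Lemma curve_cut p q l : curve p q l -> forall a : R, 0 <= a -> (a%:E <= l)%E ->
  exists y l', [/\ curve p y a%:E, curve y q l' & l = (a%:E + l')%E].
Proof.
elim=> [{}p a a0 al|c g {}q {}l ag C IH a a0 al].
  have -> : a = 0 by apply/eqP; rewrite eq_le a0 andbT -lee_fin.
  by exists p, 0%E; split; rewrite ?add0e; try exact: curve_nil.
have [V [dV HV]] := arc_primitive ag.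
have i0 : 0 <= (0 : R) <= 1 by rewrite lexx ler01.
have i1 : 0 <= (1 : R) <= 1 by rewrite lexx ler01.
have LV : arc_length c g = `|V 1 - V 0|%:E by rewrite -{1}(aff01 g) HV.
have mono (s t : R) : 0 <= s -> s <= t -> t <= 1 -> V s <= V t.
{ move=> s0 st t1; rewrite -subr_ge0.
  have [| |z zs ->] := @MVT_segment R V (fun t => spd c g (clamp 0 1 t)) s t st.
  - by move=> x; rewrite in_itv /= => /andP[sx xt]; apply: dV; rewrite (le_trans s0 (ltW sx)) (le_trans (ltW xt) t1).
  - apply: derivable_within_continuous => x; rewrite in_itv /= => /andP[sx xt].
    by have [] := dV x; rewrite ?(le_trans s0 sx) ?(le_trans xt t1).
  - by rewrite mulr_ge0 ?sqrtr_ge0 // subr_ge0. }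
have V01 : 0 <= V 1 - V 0 by rewrite subr_ge0 mono.
rewrite ger0_norm // in LV.
have [aL|La] := leP a (V 1 - V 0).
{   have [s s01 Vs] : exists2 s, s \in `[0 : R, 1] & V s = V 0 + a.
  { apply: IVT.
  - exact: ler01.
  - by apply: derivable_within_continuous => x; rewrite in_itv /= => x01; have [] := dV x x01.
  - by rewrite (min_idPl _) ?mono // (max_idPr _) ?mono // lerDl a0 /= addrC -lerBrDr. }
  rewrite in_itv /= in s01.
  have Vsa : V s - V 0 = a by rewrite Vs addrC addKr.
  have As : arc_length c (fun t => g (aff 0 s t)) = a%:E by rewrite HV // Vsa ger0_norm.
  have As' : arc_length c (fun t => g (aff s 1 t)) = (V 1 - V s)%:E.
    by rewrite HV // ger0_norm // subr_ge0; case/andP: s01 => ? ?; exact: mono.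
  exists (cinv c (g s)), ((V 1 - V s)%:E + l)%E; split.
  - by rewrite -As; exact: curve_sub.
  - by rewrite -As'; apply: curve_cat C; exact: curve_sub.
  - by rewrite LV addeA -EFinD; congr (_%:E + _)%E; move: Vsa; lra. }
have a'0 : 0 <= a - (V 1 - V 0) by rewrite subr_ge0 ltW.
have [|y [l' [C1 C2 ->]]] := IH (a - (V 1 - V 0)) a'0.
  by rewrite EFinB leeBlDl // -LV.
exists y, l'; split=> //.
  have := curve_cons ag C1; rewrite LV -EFinD addrC subrK; by [].
by rewrite addeA LV -EFinD; congr (_%:E + _)%E; ring.
Qed.

Lemma rdist_ge0 p q : (0 <= rdist p q)%E.
Proof. by apply: le_ereal_inf_tmp => l; exact: curve_ge0. Qed.

Lemma rdist_le p q l : curve p q l -> (rdist p q <= l)%E.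
Proof. by move=> C; exact: ereal_inf_lbound. Qed.

Lemma rdistxx p : rdist p p = 0%E.
Proof. by apply/eqP; rewrite eq_le rdist_ge0 andbT; apply: rdist_le; exact: curve_nil. Qed.

Lemma rdist_lt p q (e : \bar R) : (rdist p q < e)%E -> exists2 l, curve p q l & (l < e)%E.
Proof. by move=> /ereal_inf_lt[l C le]; exists l. Qed.

Lemma rdist_sym p q : rdist p q = rdist q p.
Proof. by congr ereal_inf; apply/seteqP; split=> l /=; exact: curve_rev. Qed.

Lemma rdist_triangle p q s : (rdist p s <= rdist p q + rdist q s)%E.
Proof.
have [->|f1] := eqVneq (rdist p q) +oo%E.
  by rewrite addye ?leey // gt_eqF // (lt_le_trans _ (rdist_ge0 _ _)).
have [->|f2] := eqVneq (rdist q s) +oo%E.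
  by rewrite addey ?leey // gt_eqF // (lt_le_trans _ (rdist_ge0 _ _)).
have g1 : rdist p q \is a fin_num by rewrite ge0_fin_numE ?rdist_ge0 // lt_neqAle f1 leey.
have g2 : rdist q s \is a fin_num by rewrite ge0_fin_numE ?rdist_ge0 // lt_neqAle f2 leey.
apply/lee_addgt0Pr => e e0.
have h1 : (rdist p q < rdist p q + (e / 2)%:E)%E by rewrite lteDl // lte_fin divr_gt0.
have h2 : (rdist q s < rdist q s + (e / 2)%:E)%E by rewrite lteDl // lte_fin divr_gt0.
have [l C1 l1] := rdist_lt h1; have [l' C2 l2] := rdist_lt h2.
apply: le_trans (rdist_le (curve_cat C1 C2)) _.
apply: le_trans (leeD (ltW l1) (ltW l2)) _.
by rewrite addeACA -EFinD -splitr.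
Qed.

Lemma rdist_cut p q (a b : R) : 0 <= a -> 0 <= b -> (rdist p q < (a + b)%:E)%E ->
  exists y, (rdist p y <= a%:E)%E /\ (rdist y q <= b%:E)%E.
Proof.
move=> a0 b0 /rdist_lt[l C lab].
have [al|la] := leP a%:E l; last first.
  by exists q; rewrite rdistxx lee_fin; split=> //; apply: le_trans (rdist_le C) (ltW la).
have [y [l' [C1 C2 E]]] := curve_cut C a0 al.
exists y; split; first exact: rdist_le.
by apply: le_trans (rdist_le C2) _; move: lab; rewrite E EFinD lteD2lE // => /ltW.
Qed.

End RDist.

Section Frames.
Variables (R : realType) (T : topologicalType) (m : nat).

(** A frame orthonormal at [z], kept constant, distorts lengths nearby by bounded factors; constancy
    later allows translating along its rows. *)
Lemma frame_near (g : T -> 'M[R]_m) z : {for z, continuous g} -> (g z)^T = g z ->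
  (forall v : 'rV[R]_m, v != 0 -> 0 < (v *m g z *m v^T) 0 0) ->
  exists2 E : 'M[R]_m, E \in unitmx & \forall t \near z, forall y : 'rV[R]_m,
    2^-1 * (\sum_i y 0 i ^+ 2) <= ((y *m E) *m g t *m (y *m E)^T) 0 0 <= 2 * \sum_i y 0 i ^+ 2.
Proof.
move=> cg gT g0; have [E HE] := frame_exists gT g0.
exists E; first by have := mulmx1_unit HE => -[]; rewrite unitmx_mul => /andP[].
pose G t := E *m g t *m E^T.
have cG i j : {for z, continuous (fun t => G t i j)}.
  rewrite (_ : (fun t => _) = fun t => (row i E *m g t *m (row j E)^T) 0 0); last first.
    by apply/funext => t; rewrite /G tr_row -row_mul mxE [RHS]mxE; apply: eq_bigr => k _; rewrite [in RHS]mxE [in X in _ = _ * X]mxE.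
  rewrite (_ : (fun t => _) = fun t => \sum_k \sum_l row i E 0 k * row j E 0 l * g t k l); last first.
    by apply/funext => t; rewrite quad11.
  apply: sum_cont => k; apply: sum_cont => l.
  by apply: continuousM; [exact: cvg_cst|exact: entry_cont].
(* An error [d] in each entry changes the quadratic form by at most [d * m] times the sum of
   squares, hence by at most half of it. *)
pose d : R := (2 * m.+1%:R)^-1.
have d0 : 0 < d by rewrite invr_gt0 mulr_gt0.
have nG i j : \forall t \near z, `|G t i j - (i == j)%:R| <= d.
  have := (@cvgrPdist_le _ _ _ _ _ _ _).1 (cG i j) d d0; rewrite [G z]HE => h.
  by near=> t; rewrite distrC; have -> : (i == j)%:R = (1%:M : 'M[R]_m) i j; [rewrite mxE|near: t; exact: h].
near=> t => y.
have yE : ((y *m E) *m g t *m (y *m E)^T) 0 0 = \sum_i \sum_j y 0 i * y 0 j * G t i j.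
  by rewrite -quad11 trmx_mul /G !mulmxA.
have near1 i j : `|G t i j - (i == j)%:R| <= d.
  move: i j; near: t; apply: filter_forall => i; apply: filter_forall => j.
  exact: nG.
have sq : \sum_i y 0 i ^+ 2 = \sum_i \sum_j y 0 i * y 0 j * (i == j)%:R.
  apply: eq_bigr => i _; rewrite (bigD1 i) //= eqxx mulr1 big1 ?addr0 // => j ji.
  by rewrite eq_sym (negPf ji) mulr0.
suff B : `|\sum_i \sum_j y 0 i * y 0 j * G t i j - \sum_i y 0 i ^+ 2| <= 2^-1 * \sum_i y 0 i ^+ 2.
  by rewrite yE; move: B; rewrite ler_norml => /andP[]; set S := \sum_i _ ^+ 2; set S' := \sum_i _; lra.
have sq0 : 0 <= \sum_i y 0 i ^+ 2 by apply: sumr_ge0 => i _; exact: sqr_ge0.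
rewrite {1}sq -sumrB (le_trans (ler_norm_sum _ _ _)) //.
apply: (@le_trans _ _ (\sum_i \sum_j d * (2^-1 * (y 0 i ^+ 2 + y 0 j ^+ 2)))).
  apply: ler_sum => i _; rewrite -sumrB (le_trans (ler_norm_sum _ _ _)) //; apply: ler_sum => j _.
  rewrite -mulrBr normrM mulrC; apply: ler_pM => //.
  by rewrite ler_norml; have := sqr_ge0 (y 0 i - y 0 j); have := sqr_ge0 (y 0 i + y 0 j); nra.
rewrite (_ : \sum_i _ = d * m%:R * \sum_i y 0 i ^+ 2); last first.
  under eq_bigr do rewrite -mulr_sumr -mulr_sumr big_split /= sumr_const card_ord.
  rewrite -mulr_sumr -mulr_sumr big_split /= sumr_const card_ord sumrMnl.
  by rewrite -mulr_natr; move: (\sum_(i < m) _) => S; field.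
rewrite ler_wpM2r // /d invfM -mulrA ler_piMr ?invr_ge0 // ler_pdivrMl // mulr1 ler_nat; exact: leqnSn.
Unshelve. all: by end_near. Qed.

(** [w] is the covector dual to row [k] of [E]. Its squared length [a] is also the [k]-th frame
    component of the vector dual to [w], whence [a ^+ 2 / 2 <= a]. *)
Lemma frame_dual (E g : 'M[R]_m) k : E \in unitmx -> g \in unitmx -> g^T = g ->
  (forall y : 'rV[R]_m, 2^-1 * (\sum_i y 0 i ^+ 2) <= ((y *m E) *m g *m (y *m E)^T) 0 0) ->
  forall w : 'rV[R]_m, w = (col k (invmx E))^T -> (w *m invmx g *m w^T) 0 0 <= 2.
Proof.
move=> uE ug gT H w wE; set a := (w *m invmx g *m w^T) 0 0.
pose z := w *m invmx g *m invmx E.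
have zE : z *m E = w *m invmx g by rewrite /z mulmxKV.
have gi : (invmx g)^T = invmx g by rewrite trmx_inv gT.
have h1 : 2^-1 * (\sum_i z 0 i ^+ 2) <= a.
  by have := H z; rewrite zE trmx_mul gi !mulmxA mulmxKV.
have h2 : z 0 k = a.
  by rewrite /a {2}wE trmxK /z mxE [RHS]mxE; apply: eq_bigr => j _; rewrite [X in _ = _ * X]mxE.
have h3 : z 0 k ^+ 2 <= \sum_i z 0 i ^+ 2.
  by rewrite (bigD1 k) //= lerDl; apply: sumr_ge0 => i _; exact: sqr_ge0.
rewrite h2 in h3; nra.
Qed.
End Frames.

Section Segments.
Variables (R : realType) (m : nat) (N : riemannian R m).

(* A reparametrization of the segment that stays in [0, 1] for every real time, as arcs are defined on the whole line. *)
Definition sway (t : R) : R := (1 - cos (pi * t)) / 2.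
Definition dsway (t : R) : R := pi / 2 * sin (pi * t).

Lemma sway_in t : 0 <= sway t <= 1.
Proof. rewrite /sway; have := cos_geN1 (pi * t); have := cos_le1 (pi * t); lra. Qed.

Lemma sway0 : sway 0 = 0. Proof. by rewrite /sway mulr0 cos0 subrr mul0r. Qed.
Lemma sway1 : sway 1 = 1. Proof. by rewrite /sway mulr1 cospi opprK divff. Qed.

Lemma dsway_le t : `|dsway t| <= 2.
Proof.
rewrite /dsway normrM -[leRHS]mulr1; apply: ler_pM => //.
  by have /andP[h1 h2] := pihalf_02 R; rewrite ger0_norm // ltW.
by rewrite ler_norml sin_geN1 sin_le1.
Qed.

Lemma sway_derive t : is_derive t (1 : R) sway (dsway t).
Proof.
have h : is_derive t (1 : R) (fun t : R => pi * t) pi.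
  by have := @is_deriveZ _ _ _ (id : R -> R) pi t 1 1 (is_derive_id _ _); rewrite /GRing.scale /= mulr1.
have hc := @is_derive1_comp _ cos (fun t : R => pi * t) t _ _ (is_derive_cos _) h.
have h1 := @is_deriveB _ _ _ (cst (1 : R)) _ t 1 _ _ (is_derive_cst _ _ _) hc.
have := @is_deriveZ _ _ _ _ (2^-1 : R) t 1 _ h1.
rewrite (_ : 2^-1 \*: _ = sway); last by apply/funext => s; rewrite /sway /= /GRing.scale /= mulrC.
by rewrite (_ : 2^-1 *: _ = dsway t) // /dsway /GRing.scale /=; ring.
Qed.

Lemma dsway_cont : continuous dsway.
Proof.
move=> t; change ({for t, continuous dsway}); apply: continuousM; first exact: cvg_cst.
apply: (@continuous_comp _ _ _ (fun t : R => pi * t) sin); last exact: continuous_sin.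
by apply: continuousM; [exact: cvg_cst|exact: cvg_id].
Qed.

Variables (d : chart R N m) (k : nat) (U : set 'rV[R]_k) (tau : 'rV[R]_k -> 'rV[R]_m) (u v : 'rV[R]_k).
Hypotheses (ad : @atlas R m N d) (oU : open U) (ct : Ckm 1 U tau).
Hypothesis seg : forall t : R, 0 <= t <= 1 -> U (u + t *: (v - u)).
Hypothesis tau_cod : forall z, U z -> ccod d (tau z).
Let w := v - u.
Let l (t : R) := u + sway t *: w.
Let Ul t : U (l t). Proof. by apply: seg; exact: sway_in. Qed.

Let dl (t : R) : is_derive t (1 : R) l (dsway t *: w).
Proof.
have D a : is_derive t (1 : R) (fun t => l t 0 a) ((dsway t *: w) 0 a).
  have h := @is_deriveZ _ _ _ sway (w 0 a) t 1 _ (sway_derive t).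
  have := @is_deriveD _ _ _ (cst (u 0 a)) _ t 1 _ _ (is_derive_cst _ _ _) h.
  rewrite (_ : _ + w 0 a \*: sway = fun t => l t 0 a); last first.
    by apply/funext => s; rewrite /l mx_addE mx_scaleE /= /GRing.scale /= mulrC.
  by rewrite (_ : 0 + w 0 a *: dsway t = (dsway t *: w) 0 a) // add0r mx_scaleE /GRing.scale /= mulrC.
have d1 : derivable l t 1.
  by apply/derivable_mxP => i a; rewrite (ord1 i); case: (D a).
apply: DeriveDef; first exact: d1.
by rewrite derive_mx //; apply/rowP => a; rewrite mxE; case: (D a) => _ <-.
Qed.

Lemma seg_derive (t : R) : is_derive t (1 : R) (fun t => tau (l t)) (dsway t *: (w *m jac tau (l t))).
Proof.
have D a : is_derive t (1 : R) (fun t => tau (l t) 0 a) ((dsway t *: (w *m jac tau (l t))) 0 a).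
  have [d1 d2] := dl t.
  have := pd_line oU (ct 0 a) (Ul t) d1; rewrite derive1E d2.
  suff -> : \sum_b (dsway t *: w) 0 b * pd b (fun z => tau z 0 a) (l t) = (dsway t *: (w *m jac tau (l t))) 0 a by [].
  by rewrite mx_scaleE mxE mulr_sumr; apply: eq_bigr => b _; rewrite mx_scaleE jac_entry mulrA.
have d1 : derivable (fun t => tau (l t)) t 1.
  by apply/derivable_mxP => i a; rewrite (ord1 i); case: (D a).
apply: DeriveDef; first exact: d1.
by rewrite derive_mx //; apply/rowP => a; rewrite mxE; case: (D a) => _ <-.
Qed.

Lemma seg_arc : arc d (fun t => tau (l t)).
Proof.
split.
- exact: ad.
- by move=> t _; apply: tau_cod; exact: Ul.
- by move=> t; case: (seg_derive t).
- rewrite (_ : (fun t => tau (l t))^`()%classic = fun t => dsway t *: (w *m jac tau (l t))); last first.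
  by apply/funext => t; rewrite derive1E; case: (seg_derive t).
have cl t : {for t, continuous l}.
  by apply: differentiable_continuous; apply/derivable1_diffP; case: (dl t).
move=> t; apply: mx_cont => i a; rewrite (ord1 i).
rewrite (_ : (fun t => _) = fun t => dsway t * \sum_b w 0 b * jac tau (l t) b a); last first.
  by apply/funext => s; rewrite mx_scaleE mxE.
apply: continuousM; first exact: dsway_cont.
apply: sum_cont => b; apply: continuousM; first exact: cvg_cst.
apply: (@continuous_comp _ _ _ l (fun z => jac tau z b a)); first exact: cl.
rewrite (_ : (fun z => _) = pd b (fun z => tau z 0 a)); last by apply/funext => z; rewrite jac_entry.
exact: (Ck_cont (Ck_pd b (ct 0 a)) (Ul t)).
Qed.

(** The factor 2 bounds the speed [dsway] of the reparametrization. *)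
Lemma segment_dist (h : R) : 0 <= h ->
  (forall t : R, 0 <= t <= 1 -> let z := u + t *: w in
     inner (metric d) (tau z) (w *m jac tau z) (w *m jac tau z) <= h ^+ 2) ->
  (rdist (cinv d (tau u)) (cinv d (tau v)) <= (2 * h)%:E)%E.
Proof.
move=> h0 H; have C := curve_arc seg_arc.
have lu : l 0 = u by rewrite /l sway0 scale0r addr0.
have lv : l 1 = v by rewrite /l sway1 scale1r /w addrC subrK.
rewrite lu lv in C; apply: le_trans (rdist_le C) _.
rewrite (arc_length_int01 seg_arc) lee_fin -(int01_cst (2 * h)); apply: le_int01.
- by apply: cont01P => t _; exact: (spd_cont seg_arc).
- exact: cont01_cst.
- move=> t t01; rewrite clamp_id // /spd derive1E; have [_ ->] := seg_derive t.
rewrite /inner trmx_scale -!scalemxAl -scalemxAr !mx_scaleE mulrA -expr2 sqrtrM ?sqr_ge0 // sqrtr_sqr.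
apply: ler_pM; [exact: normr_ge0|exact: sqrtr_ge0|exact: dsway_le|].
by rewrite -(ger0_norm h0) -sqrtr_sqr ler_wsqrtr //; exact: (H _ (sway_in t)).
Qed.
End Segments.

Lemma compact_bound (R : realType) (T : topologicalType) (K : set T) (f : T -> R) :
  compact K -> (forall u, K u -> {for u, continuous f}) -> exists2 B, 0 <= B & forall u, K u -> `|f u| <= B.
Proof.
move=> cK cf; have wf : {within K, continuous f}.
  by apply: continuous_in_subspaceT => u; rewrite inE; exact: cf.
have [B [_ HB]] := compact_bounded (continuous_compact wf cK).
exists (`|B| + 1); first by rewrite addr_ge0.
move=> u Ku; apply: (HB (`|B| + 1)); last by exists u.
by rewrite (le_lt_trans (ler_norm _)) // ltrDl.
Qed.

Lemma compact_nbhs_cover (T : ptopologicalType) (K : set T) (U : T -> set T) :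
  compact K -> (forall y, K y -> nbhs y (U y)) ->
  exists s : seq T, (forall y, y \in s -> K y) /\ forall z, K z -> exists2 y, y \in s & U y z.
Proof.
rewrite compact_cover => cK HU.
have [||D sD cov] := cK T K (fun y => interior (U y)).
- by move=> y _; exact: open_interior.
- by move=> z Kz; exists z => //; exact: HU.
- exists (finmap.enum_fset D); split; first by move=> y /sD; rewrite inE.
  by move=> z /cov[y yD /interior_subset Uyz]; exists y.
Qed.

(** * Bump functions and the topology of the distance *)

Section SmoothStep.
Variable R : realType.

(** The square of the positive part, a function of class C^1 but not C^2; this much regularity
    suffices for bump functions. *)
Definition possq (s : R) : R := Num.max 0 s ^+ 2.

Lemma possq_derive s : is_derive s (1 : R) possq (2 * Num.max 0 s).
Proof.
have key (h : R) : `|possq (s + h) - possq s - 2 * Num.max 0 s * h| <= h ^+ 2.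
  rewrite /possq ler_norml /Num.max; case: (ltP 0 s) => s0; case: (ltP 0 (s + h)) => sh;
  apply/andP; split; nra.
have cvg : h^-1 *: (possq (h *: (1 : R) + s) - possq s) @[h --> 0^'] --> 2 * Num.max 0 s.
  apply/cvgrPdist_le => e e0; near=> h.
  have h0 : h != 0 by near: h; exact: nbhs_dnbhs_neq.
  rewrite distrC {1}/GRing.scale /= {1}/GRing.scale /= mulr1 [h + s]addrC.
  have -> : h^-1 * (possq (s + h) - possq s) - 2 * Num.max 0 s =
      h^-1 * (possq (s + h) - possq s - 2 * Num.max 0 s * h).
    by field.
  rewrite normrM normfV ler_pdivrMl ?normr_gt0 // (le_trans (key h)) // -[h ^+ 2]real_normK ?num_real //.
  rewrite expr2 ler_wpM2l //; near: h; apply: dnbhs0_le; exact: e0.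
have d : derivable possq s 1 by apply/cvg_ex; exists (2 * Num.max 0 s); exact: cvg.
by apply: DeriveDef => //; exact: (cvg_lim _ cvg).
Unshelve. all: by end_near. Qed.

Lemma max0_cont : continuous (fun s : R => Num.max 0 s).
Proof.
move=> s; apply/cvgrPdist_le => e e0; near=> t.
have : `|s - t| <= e by near: t; exact: cvgr_dist_le.
apply: le_trans; rewrite /Num.max; case: (ltP 0 s) => ?; case: (ltP 0 t) => ?; rewrite !ler_norml;
  have := ler_norm (s - t); have := ler_norm (t - s); rewrite (distrC t s); lra.
Unshelve. all: by end_near. Qed.

Lemma Ck_possq m (U : set 'rV[R]_m) (f : 'rV[R]_m -> R) : open U -> Ck 1 U f -> Ck 1 U (fun u => possq (f u)).
Proof.
move=> oU cf; have D i u : U u -> is_derive u (ebase R i) (fun u => possq (f u) : R) (2 * Num.max 0 (f u) * pd i f u).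
  move=> Uu; have [df _] := Ck1_differentiable oU cf Uu.
  have [/derivable1_diffP dp pE] := possq_derive (f u).
  have dc : differentiable (fun u => possq (f u) : R) u by exact: (@differentiable_comp _ _ _ _ f possq).
  apply: DeriveDef; first exact: diff_derivable.
  rewrite deriveE // (@diff_comp _ _ _ _ f possq u df dp) /= (diff1E dp) /= derive1E pE pdE deriveE //.
  by rewrite /GRing.scale /= mulrC.
split.
  move=> u Uu; apply: (@continuous_comp _ _ _ f possq); first exact: (Ck_cont cf Uu).
  by apply: differentiable_continuous; apply/derivable1_diffP; case: (possq_derive (f u)).
move=> i; split; first by move=> u Uu; case: (D i u Uu).
split=> // u Uu.
apply: (@near_cont _ _ (fun u => 2 * Num.max 0 (f u) * pd i f u)).
  by apply: filterS (open_near oU Uu) => v Uv; case: (D i v Uv) => _ <-.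
have c1 : {for u, continuous (fun u => Num.max 0 (f u) : R)}.
  by apply: (@continuous_comp _ _ _ f (fun s : R => Num.max 0 s)); [exact: (Ck_cont cf Uu)|exact: max0_cont].
have c2 : {for u, continuous (pd i f)} by exact: (Ck_cont (Ck_pd i cf) Uu).
exact: (continuousM (continuousM (@cvg_cst _ _ _ _ _) c1) c2).
Qed.

(** A C^1 transition from 0, for [s <= 0], to 1, for [1 <= s]. *)
Definition step (s : R) : R := 1 - possq (1 - possq s).

Lemma step_in s : 0 <= step s <= 1.
Proof.
rewrite /step /possq /Num.max; case: (ltP 0 s) => ?; [case: (ltP 0 (1 - s ^+ 2)) => ?|case: (ltP 0 (1 - 0 ^+ 2)) => ?];
apply/andP; split; nra.
Qed.

Lemma step0 s : s <= 0 -> step s = 0.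
Proof. by move=> s0; rewrite /step /possq (max_idPl s0) expr0n subr0 (max_idPr _) // expr1n subrr. Qed.

Lemma step1 s : 1 <= s -> step s = 1.
Proof.
move=> s1; rewrite /step /possq [Num.max 0 s](max_idPr _) ?(le_trans _ s1) //.
by rewrite (max_idPl _) ?expr0n ?subr0 // subr_le0 expr_ge1 // (le_trans _ s1).
Qed.

Variables (m : nat) (u0 : 'rV[R]_m) (e : R).
Hypothesis e0 : 0 < e.

(** The Euclidean distance squared, because the norm of row vectors is a maximum and not
    differentiable. *)
Definition dist2 (u : 'rV[R]_m) : R := \sum_i (u 0 i - u0 0 i) ^+ 2.
(** Equal to 1 at Euclidean distance at most [e] and zero beyond [sqrt 2 * e], thus supported in the
    box of half-width [2 * e]. *)
Definition bump (u : 'rV[R]_m) : R := step (2 - dist2 u / e ^+ 2).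
Definition box (r : R) : set 'rV[R]_m := [set u | forall i, `|u 0 i - u0 0 i| <= r].

Lemma box_compact r : compact (box r).
Proof.
have := @rV_compact R m (fun i => [set` `[u0 0 i - r, u0 0 i + r]]).
rewrite (_ : [set v | _] = box r); last first.
  apply/seteqP; split=> u /= H i; have := H i; rewrite in_itv /= ler_distl;
  by rewrite (_ : ord0 = 0).
by apply => i; exact: segment_compact.
Qed.

Lemma Ck_bump : Ck 1 setT bump.
Proof.
have cd : Ck 1 setT dist2.
  apply: Ck_sum => [|i _]; first exact: openT.
  rewrite (_ : (fun u : 'rV[R]_m => _) = fun u : 'rV[R]_m => (u 0 i - u0 0 i) * (u 0 i - u0 0 i)); last by apply/funext => u; rewrite expr2.
  have h : Ck 1 setT (fun u : 'rV[R]_m => u 0 i - u0 0 i).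
    by apply: CkB; [exact: openT|exact: Ck_coord|exact: Ck_cst].
  exact: (CkM openT h h).
have h1 : Ck 1 setT (fun u : 'rV[R]_m => 2 - dist2 u / e ^+ 2).
  apply: CkB; [exact: openT|exact: Ck_cst|].
  exact: (CkM openT cd (Ck_cst _ _ _)).
have h2 : Ck 1 setT (fun u : 'rV[R]_m => 1 - possq (2 - dist2 u / e ^+ 2)).
  by apply: CkB; [exact: openT|exact: Ck_cst|exact: (Ck_possq openT h1)].
by apply: CkB; [exact: openT|exact: Ck_cst|exact: (Ck_possq openT h2)].
Qed.

Lemma bump1 u : dist2 u <= e ^+ 2 -> bump u = 1.
Proof.
move=> H; apply: step1; have : dist2 u / e ^+ 2 <= 1 by rewrite ler_pdivrMr ?exprn_gt0 // mul1r.
lra.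
Qed.

Lemma bump_center : bump u0 = 1.
Proof. by apply: bump1; rewrite /dist2 big1 ?sqr_ge0 // => i _; rewrite subrr expr0n. Qed.

Lemma bump_neq0 u : bump u != 0 -> box (2 * e) u.
Proof.
move=> H i; have : 0 < 2 - dist2 u / e ^+ 2.
  by rewrite ltNge; apply: contra_neqN H => /step0.
rewrite subr_gt0 ltr_pdivrMr ?exprn_gt0 // => H2.
have : (u 0 i - u0 0 i) ^+ 2 <= dist2 u.
  by rewrite /dist2 (bigD1 i) //= lerDl; apply: sumr_ge0 => j _; exact: sqr_ge0.
move=> H3; rewrite -ler_sqr ?nnegrE ?normr_ge0 ?mulr_ge0 ?(ltW e0) // real_normK ?num_real //.
by apply: le_trans H3 (le_trans (ltW H2) _); rewrite exprMn ler_pM2r ?exprn_gt0 // expr2; lra.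
Qed.
End SmoothStep.

Lemma ball_segment (R : realType) (V : normedModType R) (u0 u v : V) (e t : R) :
  ball u0 e u -> ball u0 e v -> 0 <= t <= 1 -> ball u0 e (u + t *: (v - u)).
Proof.
rewrite -ball_normE /ball_ /= => hu hv /andP[t0 t1].
have E1 : u + t *: (v - u) = (1 - t) *: u + t *: v by rewrite scalerBr scalerBl scale1r addrA addrAC.
have E2 : u0 = (1 - t) *: u0 + t *: u0 by rewrite -scalerDl subrK scale1r.
rewrite E1 {1}E2 opprD addrACA -!scalerBr.
apply: le_lt_trans (ler_normD _ _) _; rewrite !normrZ !ger0_norm ?subr_ge0 //.
have [->|t'] := eqVneq t 0; first by rewrite subr0 mul1r mul0r addr0.
have t2 : 0 < t by rewrite lt_neqAle eq_sym t'.
have : t * `|u0 - v| < t * e by rewrite ltr_pM2l.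
have : (1 - t) * `|u0 - u| <= (1 - t) * e by rewrite ler_wpM2l ?subr_ge0 // ltW.
by move=> ? ?; lra.
Qed.

Lemma box_ball (R : realType) m (u0 : 'rV[R]_m) (r d : R) u : 0 < d -> r < d -> box u0 r u -> ball u0 d u.
Proof.
move=> d0 rd H; rewrite -ball_normE /ball_ /=; apply: mx_norm_lt => // i j.
by rewrite (ord1 i) mx_subE distrC (le_lt_trans (H j)).
Qed.

Lemma jac_id (R : realType) m (u : 'rV[R]_m) : jac id u = 1%:M.
Proof. by apply/matrixP => i j; rewrite jac_entry pd_coord mxE. Qed.

Lemma sqsum_mulmx (R : realType) m (A : 'M[R]_m) (w : 'rV[R]_m) :
  \sum_i ((w *m A) 0 i) ^+ 2 <= (\sum_i (\sum_j `|A j i|) ^+ 2) * `|w| ^+ 2.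
Proof.
rewrite mulr_suml; apply: ler_sum => i _; rewrite -exprMn -[leLHS]real_normK ?num_real //.
rewrite ler_sqr ?nnegrE ?mulr_ge0 ?sumr_ge0 // mxE (le_trans (ler_norm_sum _ _ _)) // mulr_suml.
by apply: ler_sum => j _; rewrite normrM mulrC ler_wpM2l // mx_entry_le.
Qed.

Lemma norm_sqsum (R : realType) m (w : 'rV[R]_m) : `|w| ^+ 2 <= \sum_i w 0 i ^+ 2.
Proof.
have S0 : 0 <= \sum_i w 0 i ^+ 2 by apply: sumr_ge0 => i _; exact: sqr_ge0.
rewrite -[leRHS]sqr_sqrtr // ler_sqr ?nnegrE ?sqrtr_ge0 //; apply: mx_norm_le; first exact: sqrtr_ge0.
move=> i j; rewrite (ord1 i) -sqrtr_sqr ler_wsqrtr // (bigD1 j) //= lerDl.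
by apply: sumr_ge0 => k _; exact: sqr_ge0.
Qed.

Section MetricTopology.
Variables (R : realType) (m : nat) (N : riemannian R m).
Implicit Types (s t d : chart R N m) (p y z : N).
Local Notation aN := (@atlas R m N).

Lemma metric_frame s u : aN s -> ccod s u -> exists2 E : 'M[R]_m, E \in unitmx &
  \forall v \near u, forall y : 'rV[R]_m,
    2^-1 * (\sum_i y 0 i ^+ 2) <= inner (metric s) v (y *m E) (y *m E) <= 2 * \sum_i y 0 i ^+ 2.
Proof.
move=> as_ su; have [||v v0|E uE H] := @frame_near R _ m (metric s) u.
- exact: (Ckm_cont (metricC 0 as_) su).
- exact: metric_sym.
- exact: (metric_pos as_ su v0).
- by exists E.
Qed.

(** Straight segments in a chart are short, by comparison of the metric with a constant frame. The
    converse comparison of topologies is [rdist_small]. *)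
Lemma rdist_near y (e : R) : 0 < e -> \forall z \near y, (rdist y z <= e%:E)%E.
Proof.
move=> e0; have [d ad dy] := atlas_cover y; have du := cmap_ccod dy; set u0 := cmap d y in du.
have [E uE HE] := metric_frame ad du.
have [dl dl0 Hd] := near_ball2 (open_near (@ccod_open _ _ _ d) du) HE.
pose C := \sum_i (\sum_j `|(invmx E) j i|) ^+ 2.
have C0 : 0 <= C by apply: sumr_ge0 => i _; exact: sqr_ge0.
pose k := Num.sqrt (2 * C); have k0 : 0 <= k by exact: sqrtr_ge0.
have h1 : \forall z \near y, ball u0 dl (cmap d z).
  by apply: (cmap_continuous dy); exact: nbhsx_ballx.
have h2 : \forall z \near y, ball u0 (e / (2 * (k + 1))) (cmap d z).
  by apply: (cmap_continuous dy); apply: nbhsx_ballx; rewrite divr_gt0 // mulr_gt0 // ltr_wpDl.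
near=> z.
have zb : ball u0 dl (cmap d z) by near: z.
have zb2 : ball u0 (e / (2 * (k + 1))) (cmap d z) by near: z.
have dz : cdom d z by near: z; apply: open_near => //; exact: cdom_open.
pose w := cmap d z - u0.
have Cid : Ckm 1 (ball u0 dl) (id : 'rV[R]_m -> 'rV[R]_m) by move=> i j; rewrite (ord1 i); exact: Ck_coord.
have bb (t : R) : 0 <= t <= 1 -> ball u0 dl (u0 + t *: (cmap d z - u0)).
  by move=> t01; apply: ball_segment => //; exact: ballxx.
have kw : 0 <= k * `|w| by rewrite mulr_ge0.
have := @segment_dist R m N d m (ball u0 dl) id u0 (cmap d z) ad (ball_open _ _) Cid bb (fun v h => (Hd v h).1) (k * `|w|) kw.
rewrite !cmapK // => H; apply: le_trans (H _) _.
  move=> t t01 /=; rewrite jac_id mulmx1 -/w.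
  have /andP[_ le2] := (Hd _ (bb t t01)).2 (w *m invmx E).
  rewrite mulmxKV // in le2; apply: le_trans le2 _.
  rewrite exprMn /k sqr_sqrtr ?mulr_ge0 // -mulrA ler_pM2l //; exact: sqsum_mulmx.
rewrite lee_fin; have : `|w| <= e / (2 * (k + 1)).
  by move: zb2; rewrite -ball_normE /ball_ /= distrC => /ltW.
rewrite ler_pdivlMr ?mulr_gt0 ?ltr_wpDl // => w1.
have := normr_ge0 w; nra.
Unshelve. all: by end_near. Qed.

Lemma rdist_closed p (a : R) : closed [set z | (rdist p z <= a%:E)%E].
Proof.
move=> z Hz; apply/lee_addgt0Pr => e e0.
have [y [/= py zy]] := Hz _ (rdist_near z e0).
by apply: le_trans (rdist_triangle p y z) _; rewrite leeD // rdist_sym.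
Qed.

Definition grad_bound (F : N -> R) (L : R) := forall t u (w : 'rV[R]_m), aN t -> ccod t u ->
  `|(w *m (grd (F \o cinv t) u)^T) 0 0| <= L * Num.sqrt (inner (metric t) u w w).

Lemma grad_bound_curve (F : N -> R) (L : R) p q l : 0 <= L -> (forall t, aN t -> Ck 1 (ccod t) (F \o cinv t)) ->
  grad_bound F L -> curve p q l -> (`|F p - F q|%:E <= L%:E * l)%E.
Proof.
move=> L0 CF GF; elim=> [{}p|c g {}q {}l ag C IH].
  by rewrite subrr normr0 mule0.
have l0 := curve_ge0 C.
rewrite ge0_muleDr ?arc_length_ge0 //.
have -> : F (cinv c (g 0)) - F q = (F (cinv c (g 0)) - F (cinv c (g 1))) + (F (cinv c (g 1)) - F q).
  by rewrite addrA subrK.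
apply: (@le_trans _ _ (`|F (cinv c (g 0)) - F (cinv c (g 1))| + `|F (cinv c (g 1)) - F q|)%:E).
  by rewrite lee_fin ler_normD.
rewrite EFinD; apply: leeD IH; rewrite (arc_length_int01 ag) -EFinM lee_fin distrC.
have [ac gc dg cg'] := ag.
have cg (t : R) : {for t, continuous g} by apply: differentiable_continuous; apply/derivable1_diffP; exact: dg.
pose f (t : R) := \sum_a (g^`()%classic t) 0 a * pd a (F \o cinv c) (g t).
have cf (t : R) : 0 <= t <= 1 -> {for t, continuous f}.
  move=> t01; apply: sum_cont => a; apply: continuousM; first exact: entry_cont (cg' t).
  apply: (@continuous_comp _ _ _ g (pd a (F \o cinv c))); first exact: cg.
  exact: (Ck_cont (Ck_pd a (CF c ac)) (gc t t01)).
have -> : F (cinv c (g 1)) - F (cinv c (g 0)) = int01 f.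
  have dF (t : R) : 0 <= t <= 1 -> is_derive t (1 : R) (fun t : R => F (cinv c (g t)) : R) (f t).
    by move=> t01; exact: (pd_line (@ccod_open _ _ _ c) (CF c ac) (gc t t01) (dg t)).
  by have E := @int01_FTC R (fun t : R => F (cinv c (g t))) f cf dF; rewrite E.
have sc := spd_cont ag.
rewrite -int01Z; last by apply: cont01P => t _; exact: sc.
have fle (t : R) : 0 <= t <= 1 -> `|f t| <= L * spd c g (clamp 0 1 t).
  move=> t01; have := GF c (g t) (g^`()%classic t) ac (gc t t01).
  rewrite clamp_id //; congr (`|_| <= _); rewrite mxE; apply: eq_bigr => a _.
  by rewrite mx_trE grd_entry.
have cL : cont01 (fun t : R => L * spd c g (clamp 0 1 t)).
  by apply: cont01P => t _; apply: continuousM; [exact: cvg_cst|exact: sc].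
have cF : cont01 f by exact: cont01P.
have cF' : cont01 (fun t : R => -1 * f t).
  by apply: cont01P => t t01; apply: continuousM; [exact: cvg_cst|exact: cf].
rewrite ler_norml; apply/andP; split; last first.
  by apply: le_int01 => // t /fle; exact: le_trans (ler_norm _).
rewrite lerNl -mulN1r -int01Z //; apply: le_int01 => // t /fle; apply: le_trans.
by rewrite mulN1r -normrN; exact: ler_norm.
Qed.

Section ManifoldBump.
Variables (s : chart R N m) (u0 : 'rV[R]_m) (e : R).
Hypotheses (as_ : aN s) (e0 : 0 < e) (Ks : box u0 (2 * e) `<=` ccod s).

Definition mbump p : R := if `[< cdom s p >] then bump u0 e (cmap s p) else 0.
Definition mbox : set N := cinv s @` box u0 (2 * e).

Lemma mbump_in p : 0 <= mbump p <= 1.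
Proof. by rewrite /mbump; case: ifP => _; [exact: step_in|rewrite lexx ler01]. Qed.

Lemma mbump_supp p : mbump p != 0 -> mbox p.
Proof.
rewrite /mbump; case: asboolP => [sp /(bump_neq0 e0) H|_]; last by rewrite eqxx.
by exists (cmap s p) => //; rewrite cmapK.
Qed.

Lemma mbox_compact : compact mbox.
Proof.
apply: continuous_compact; last exact: box_compact.
by apply: continuous_in_subspaceT => u; rewrite inE => /Ks; exact: cinv_continuous.
Qed.

Lemma mbox_closed : closed mbox.
Proof. by apply: compact_closed mbox_compact; exact: manifold_hausdorff. Qed.

Lemma mbox_dom : mbox `<=` cdom s.
Proof. by move=> p [u /Ks su <-]; exact: cinv_cdom. Qed.

Lemma mbox_cmap p : mbox p -> box u0 (2 * e) (cmap s p).
Proof. by move=> [u Ku <-]; rewrite cinvK //; exact: Ks. Qed.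

Lemma mbump_near0 t u : ccod t u -> ~ mbox (cinv t u) ->
  exists W, [/\ open W, W u, W `<=` ccod t & forall v, W v -> (mbump \o cinv t) v = 0].
Proof.
move=> tu nK; exists (ccod t `&` cinv t @^-1` (~` mbox)); split=> //.
- apply: open_preim; [exact: ccod_open|by rewrite openC; exact: mbox_closed|].
  by move=> v; exact: cinv_continuous.
- by move=> v [_ /= nv]; apply/eqP; apply: contra_notT nv => /mbump_supp.
Qed.

Lemma mbump_tr t u : local_dom id t s u -> (mbump \o cinv t) u = bump u0 e (local id t s u).
Proof. by move=> [_ su]; rewrite /= /mbump asboolT. Qed.

Lemma Ck_mbump t : aN t -> Ck 1 (ccod t) (mbump \o cinv t).
Proof.
move=> at_; apply: Ck_local => u tu.
have [Ku|nK] := pselect (mbox (cinv t u)); last first.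
  have [W [oW Wu Wt W0]] := mbump_near0 tu nK; exists W; split=> //.
  by apply: (Ck_eq oW _ (Ck_cst 1 W 0)) => v Wv; rewrite W0.
exists (local_dom id t s); split; first exact: trd_open.
  by split=> //; exact: mbox_dom.
have oU := @trd_open R m N t s.
apply: (Ck_eq oU (f := fun u => bump u0 e (local id t s u))); first by move=> v /mbump_tr ->.
by apply: (Ck_comp oU openT (transC 1 at_ as_)) => //; exact: Ck_bump.
Qed.

(** Off the box the gradient is zero. On it the partial derivatives are bounded by compactness, and
    the frame compares coordinate components with lengths. *)
Lemma mbump_grad_bound (E : 'M[R]_m) : E \in unitmx ->
  (forall v, box u0 (2 * e) v -> forall y : 'rV[R]_m,
     2^-1 * (\sum_i y 0 i ^+ 2) <= inner (metric s) v (y *m E) (y *m E)) ->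
  exists2 L, 0 <= L & grad_bound mbump L.
Proof.
move=> uE HE.
have [B B0 HB] : exists2 B, 0 <= B & forall v, box u0 (2 * e) v -> forall a, `|pd a (bump u0 e) v| <= B.
  have H a := compact_bound (@box_compact R m u0 (2 * e)) (fun v _ => Ck_cont (Ck_pd a (Ck_bump u0 e)) (I : setT v)).
  pose B a := s2val (cid2 (H a)).
  exists (\sum_a B a); first by apply: sumr_ge0 => a _; exact: (s2valP (cid2 (H a))).
  move=> v Kv a; apply: le_trans (s2valP' (cid2 (H a)) v Kv) _.
  by rewrite (bigD1 a) //= lerDl; apply: sumr_ge0 => b _; exact: (s2valP (cid2 (H b))).
pose C := \sum_i (\sum_j `|E j i|) ^+ 2.
have C0 : 0 <= C by apply: sumr_ge0 => i _; exact: sqr_ge0.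
exists (B * m%:R * Num.sqrt (2 * C)); first by rewrite !mulr_ge0 ?sqrtr_ge0.
move=> t u w at_ tu.
have [Ku|nK] := pselect (mbox (cinv t u)); last first.
  have [W [oW Wu Wt W0]] := mbump_near0 tu nK.
  rewrite (_ : grd _ u = 0); first by rewrite trmx0 mulmx0 mxE normr0 !mulr_ge0 ?sqrtr_ge0.
  apply/rowP => a; rewrite grd_entry mxE -(pd_cst 0 a u); apply: (pd_eq oW) => // v Wv; exact: W0.
have Uu : local_dom id t s u by split=> //; exact: mbox_dom.
have Kv := mbox_cmap Ku.
have oU := @trd_open R m N t s.
have -> : grd (mbump \o cinv t) u = grd (bump u0 e) (local id t s u) *m (jac (local id t s) u)^T.
  rewrite -(grd_comp oU openT (fun k => transC k at_ as_) _ (Ck_bump u0 e) Uu) //.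
  apply/rowP => a; rewrite !grd_entry; apply: (pd_eq oU) => // v Uv; exact: mbump_tr.
rewrite trmx_mul trmxK mulmxA; set w' := w *m _.
have -> : inner (metric t) u w w = inner (metric s) (local id t s u) w' w'.
  by rewrite /inner (metric_trans at_ as_ Uu) trmx_mul !mulmxA.
set v := local id t s u; change (box u0 (2 * e) v) in Kv.
pose y := w' *m invmx E; have yE : y *m E = w' by rewrite mulmxKV.
have := HE v Kv y; rewrite yE; set q := inner _ _ _ _ => hq.
have S0 : 0 <= \sum_i y 0 i ^+ 2 by apply: sumr_ge0 => i _; exact: sqr_ge0.
have q0 : 0 <= q by apply: le_trans hq; rewrite mulr_ge0.
have wa a : `|w' 0 a| <= Num.sqrt (2 * C) * Num.sqrt q.
  rewrite -sqrtrM ?mulr_ge0 // -sqrtr_sqr ler_wsqrtr //.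
  apply: (@le_trans _ _ (\sum_i (w' 0 i) ^+ 2)).
    by rewrite (bigD1 a) //= lerDl; apply: sumr_ge0 => k _; exact: sqr_ge0.
  rewrite -yE; apply: le_trans (sqsum_mulmx E y) _; rewrite -/C (mulrC 2) -mulrA ler_wpM2l //.
  by apply: le_trans (norm_sqsum y) _; move: hq; lra.
rewrite mxE (le_trans (ler_norm_sum _ _ _)) //.
apply: (@le_trans _ _ (\sum_(a < m) B * (Num.sqrt (2 * C) * Num.sqrt q))).
  apply: ler_sum => a _; rewrite normrM mulrC mx_trE grd_entry.
  by apply: ler_pM; [exact: normr_ge0|exact: normr_ge0|exact: HB|exact: wa].
by rewrite sumr_const card_ord -mulr_natr le_eqVlt (_ : _ == _) //; apply/eqP; ring.
Qed.
End ManifoldBump.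

(** A bump function is 1 at [y], zero outside a compact box [K], and Lipschitz with some constant
    [L]; a curve from [y] that ends outside [K] therefore has length at least 1 / (L + 1). *)
Lemma rdist_small y (W : set N) : nbhs y W ->
  exists K (dl : R), [/\ 0 < dl, compact K, K `<=` W & forall z, (rdist y z <= dl%:E)%E -> K z].
Proof.
move=> Wy; have [s as_ sy] := atlas_cover y; have su := cmap_ccod sy; set u0 := cmap s y in su.
have [E uE HE] := metric_frame as_ su.
have h2 : \forall u \near u0, W (cinv s u) by exact: (cinv_cvg sy).
have [d1 d10 Hd1] := near_ball2 (open_near (@ccod_open _ _ _ s) su) HE.
have [d2 d20 Hd2] := near_ball2 h2 h2.
pose e := Num.min d1 d2 / 4.
have e0 : 0 < e by rewrite divr_gt0 // lt_min d10.
have em : 2 * e < Num.min d1 d2 by move: e0; rewrite /e; move: (Num.min d1 d2) => M; lra.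
have m1 : Num.min d1 d2 <= d1 by rewrite ge_min lexx.
have m2 : Num.min d1 d2 <= d2 by rewrite ge_min lexx orbT.
have B1 v : box u0 (2 * e) v -> ball u0 d1 v by apply: box_ball => //; exact: lt_le_trans em m1.
have B2 v : box u0 (2 * e) v -> ball u0 d2 v by apply: box_ball => //; exact: lt_le_trans em m2.
have Ks : box u0 (2 * e) `<=` ccod s by move=> v /B1 /Hd1[].
have [|L L0 GL] := @mbump_grad_bound s u0 e as_ e0 Ks E uE.
  by move=> v /B1 /Hd1[_ H] z; have /andP[] := H z.
have F1 : mbump s u0 e y = 1 by rewrite /mbump asboolT // bump_center.
exists (mbox s u0 e), (2 * (L + 1))^-1; split.
- by rewrite invr_gt0 mulr_gt0 // ltr_wpDl.
- exact: mbox_compact.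
- by move=> z [u Ku <-]; apply: (Hd2 u (B2 u Ku)).1.
- move=> z yz; apply: (mbump_supp e0); apply/eqP => Fz.
have : (rdist y z < ((L + 1)^-1)%:E)%E.
  apply: le_lt_trans yz _; rewrite lte_fin invfM gtr_pMl ?invr_gt0 ?ltr_wpDl // invf_lt1 // ltr1n.
  by [].
move=> /rdist_lt[l C lL].
have := grad_bound_curve L0 (Ck_mbump as_ e0 Ks) GL C; rewrite F1 Fz subr0 normr1.
have lf := curve_fin C; move: lL C; rewrite -(fineK lf) lte_fin => lL C.
rewrite -EFinM lee_fin leNgt; apply/negP; rewrite negbK.
have L1 : 0 < L + 1 by rewrite ltr_wpDl.
move: lL; rewrite -div1r ltr_pdivlMr // => lL.
have : 0 <= fine l by rewrite -lee_fin; exact: (curve_ge0 C).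
nra.
Qed.
End MetricTopology.

Lemma ultra_cover (T : Type) (I : eqType) (F : set_system T) (K : set T) (s : seq I) (A : I -> set T) :
  UltraFilter F -> F K -> (forall z, K z -> exists2 y, y \in s & A y z) -> exists2 y, y \in s & F (A y).
Proof.
move=> UF FK cov; apply: contrapT => nE.
have FC y : y \in s -> F (~` A y).
  by move=> ys; have [FA|//] := in_ultra_setVsetC (A y) UF; case: nE; exists y.
have : F [set z | forall y, y \in s -> ~ A y z].
  elim: s {cov nE} FC => [|y s IH] FC; first by apply: filterS filterT => z _ y; rewrite in_nil.
  have Fy : F (~` A y) by apply: FC; rewrite inE eqxx.
  have Fs : F [set z | forall y, y \in s -> ~ A y z] by apply: IH => y' ys; apply: FC; rewrite inE ys orbT.
  by apply: filterS2 Fy Fs => z zy zs y'; rewrite inE => /orP[/eqP->|/zs].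
move=> H; have [z [Kz Hz]] := filter_ex (filterI FK H).
by have [y ys Ayz] := cov z Kz; exact: Hz ys Ayz.
Qed.

(** * Compactness of closed geodesic balls *)

Section HopfRinow.
Variables (R : realType) (m : nat) (N : riemannian R m).
Implicit Types (p y z : N).
Local Notation B := (@geodesic_ball R m N).

Definition totally_bounded (K : set N) := forall e : R, 0 < e ->
  exists s : seq N, forall z, K z -> exists2 y, y \in s & B y e z.

Lemma compact_totally_bounded K : compact K -> totally_bounded K.
Proof.
move=> cK e e0; have [s [_ Hs]] := compact_nbhs_cover (U := fun y => B y e) cK (fun y _ => rdist_near y e0).
by exists s.
Qed.

Lemma ball_closed p (a : R) : closed (B p a).
Proof. exact: rdist_closed. Qed.

Lemma ball_le p (a b : R) : a <= b -> B p a `<=` B p b.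
Proof. by move=> ab z /le_trans; apply; rewrite lee_fin. Qed.

Lemma ball_triangle p y z (a b : R) : B p a y -> B y b z -> B p (a + b) z.
Proof. by move=> h1 h2; apply: le_trans (rdist_triangle p y z) _; rewrite EFinD leeD. Qed.

(** An ultrafilter on [K] contains balls of radius 1 / (k + 1) for all [k]; their centres form a
    Cauchy sequence, and its limit is a limit of the ultrafilter. *)
Lemma totally_bounded_compact K : complete_riemannian N -> closed K -> totally_bounded K -> compact K.
Proof.
move=> cN cK tK; rewrite compact_ultra => F UF FK.
have H k : exists y, F (B y k.+1%:R^-1).
  have k0 : 0 < (k.+1%:R^-1 : R) by rewrite invr_gt0.
  have [s cov] := tK _ k0.
  by have [y _ Fy] := ultra_cover UF FK cov; exists y.
pose a k := sval (cid (H k)); have Fa k : F (B (a k) k.+1%:R^-1) := svalP (cid (H k)).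
have dist i j : (rdist (a i) (a j) <= (i.+1%:R^-1 + j.+1%:R^-1)%:E)%E.
  have [z [zi zj]] := filter_ex (filterI (Fa i) (Fa j)).
  by apply: ball_triangle zi _; rewrite /geodesic_ball /= rdist_sym.
have inv_small (e : R) : 0 < e -> exists k, forall i, (k <= i)%N -> (i.+1%:R^-1 : R) < e.
  move=> e0; have [k _ Hk] := near_infty_natSinv_lt (PosNum e0).
  by exists k => i ki; exact: Hk.
have [|p ap] := cN a.
  move=> e e0; have [|k Hk] := inv_small (e / 2); first by rewrite divr_gt0.
  exists k => i j ki kj; apply: le_lt_trans (dist i j) _.
  by rewrite lte_fin [ltRHS]splitr ltrD ?Hk.
have Fp : F --> p.
  move=> W /rdist_small[K' [dl [dl0 _ K'W HK']]].
  have d20 : 0 < dl / 2 by rewrite divr_gt0.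
  have [k Hk] := inv_small _ d20.
  have [k' _ Hk'] := ap _ (rdist_near p d20).
  pose i := maxn k k'.
  apply: filterS (Fa i) => z az; apply: K'W; apply: HK'.
  rewrite (splitr dl); apply: (@ball_triangle p (a i)); first exact: (Hk' i (leq_maxr _ _)).
  by apply: ball_le az; rewrite ltW // Hk // leq_maxl.
exists p; split=> //; apply: cK => W Wp.
by have [z [? ?]] := filter_ex (filterI FK (Fp _ Wp)); exists z.
Qed.

(** Finitely many balls of half the radius of a compact neighbourhood cover the given ball; the
    other half leaves room for the points slightly further out, which [rdist_cut] connects to it. *)
Lemma compact_ball_extend p (a : R) : 0 <= a -> compact (B p a) -> exists2 dl : R, 0 < dl & compact (B p (a + dl)).
Proof.
move=> a0 cB.
have H y : exists Kd : set N * R, [/\ 0 < Kd.2, compact Kd.1 & B y Kd.2 `<=` Kd.1].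
  by have [K [dl [dl0 cK _ HK]]] := rdist_small (y := y) (@filterT _ _ _); exists (K, dl); split.
pose Kd y := sval (cid (H y)).
have H1 y : 0 < (Kd y).2 by have [] := svalP (cid (H y)).
have H2 y : compact (Kd y).1 by have [] := svalP (cid (H y)).
have H3 y : B y (Kd y).2 `<=` (Kd y).1 by have [] := svalP (cid (H y)).
have [|s [_ cov]] := compact_nbhs_cover (U := fun y => B y ((Kd y).2 / 2)) cB.
  by move=> y _; apply: rdist_near; rewrite divr_gt0.
have [dl dl0 Hdl] : exists2 dl : R, 0 < dl & forall y, y \in s -> dl <= (Kd y).2 / 2.
  elim: s {cov} => [|y s [dl dl0 IH]]; first by exists 1.
  exists (Num.min dl ((Kd y).2 / 2)); first by rewrite lt_min dl0 divr_gt0.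
  move=> y'; rewrite inE => /orP[/eqP->|/IH le]; first by rewrite ge_min lexx orbT.
  by rewrite ge_min le.
exists (dl / 2); first by rewrite divr_gt0.
apply: (@subclosed_compact _ _ (\big[setU/set0]_(y <- s) (Kd y).1)).
- exact: ball_closed.
- by apply: bigsetU_compact => y _.
- move=> z Bz; have lt : (rdist p z < (a + dl)%:E)%E.
  by apply: le_lt_trans Bz _; rewrite lte_fin ltrD2l ltr_pdivrMr // ltr_pMr // ltr1n.
have [y' [py yz]] := rdist_cut a0 (ltW dl0) lt.
have [y ys yy'] := cov y' py.
rewrite -bigcup_seq; exists y => //; apply: H3.
rewrite (splitr (Kd y).2); apply: ball_triangle yy' _.
by apply: (ball_le (Hdl y ys)).
Qed.

(** Let [b] be the supremum of the radii with compact ball. The ball of radius [b] is totally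
    bounded, being close to a slightly smaller compact one, hence compact; [compact_ball_extend]
    then contradicts maximality. *)
Theorem hopf_rinow p (a : R) : complete_riemannian N -> compact (B p a).
Proof.
move=> cN; pose S := [set a : R | 0 <= a /\ compact (B p a)].
have mono b b' : b <= b' -> compact (B p b') -> compact (B p b).
  by move=> bb cb; apply: subclosed_compact cb (ball_le bb); exact: ball_closed.
have [K [dl [dl0 cK _ HK]]] := rdist_small (y := p) (@filterT _ _ _).
have S0 : S 0.
  split=> //; apply: (mono _ dl (ltW dl0)).
  by apply: subclosed_compact cK _; [exact: ball_closed|exact: HK].
apply: contrapT => nca.
have ub : ubound S a.
  by move=> b [_ cb]; rewrite leNgt; apply/negP => ab; apply: nca; exact: mono (ltW ab) cb.
have hS : has_sup S by split; [exists 0|exists a].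
pose b := sup S.
have b0 : 0 <= b by exact: (ub_le_sup hS.2 S0).
have tb : totally_bounded (B p b).
  move=> e e0; have e20 : 0 < e / 2 by rewrite divr_gt0.
  have [c [c0 cc] bc] := sup_adherent e20 hS.
  have [s Hs] := compact_totally_bounded cc e20.
  exists s => z bz.
  have lt : (rdist p z < (c + e / 2)%:E)%E by apply: le_lt_trans bz _; rewrite lte_fin -ltrBlDr.
  have [y' [py yz]] := rdist_cut c0 (ltW e20) lt.
  have [y ys yy'] := Hs y' py.
  by exists y => //; rewrite (splitr e); exact: ball_triangle yy' yz.
have cb := totally_bounded_compact cN (@ball_closed p b) tb.
have [d d0 cd] := compact_ball_extend b0 cb.
have : S (b + d) by split=> //; rewrite addr_ge0 // ltW.
by move=> /(ub_le_sup hS.2); rewrite -/b gerDl leNgt d0.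
Qed.
End HopfRinow.

Import HBNNSimple.

(** * Integration in charts *)

Section Transfer.
Context d1 d2 (X : measurableType d1) (Y : measurableType d2) (R : realType).
Variables (mu : {measure set X -> \bar R}) (la : {measure set Y -> \bar R}).
Variables (psi : Y -> X) (g : Y -> R) (D : set X).
Hypotheses (mpsi : measurable_fun setT psi) (mg : measurable_fun setT g) (g0 : forall y, 0 <= g y).
Hypothesis mD : measurable D.
Hypothesis muE : forall A, measurable A -> mu (A `&` D) = (\int[la]_y (\1_A (psi y) * g y)%:E)%E.

(** Change of variables from sets to functions: linearity gives it for simple functions, and both
    sides pass to monotone limits. *)
Lemma ge0_integral_transfer (f : X -> \bar R) : measurable_fun [set: X] f -> (forall x, (0 <= f x)%E) ->
  (\int[mu]_(x in D) f x = \int[la]_y (f (psi y) * (g y)%:E))%E.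
Proof.
move=> mf f0; pose h := nnsfun_approx (@measurableT _ X) mf.
have mh n : measurable_fun setT (h n) by exact/measurable_funP.
have hE n x : h n x = \sum_(y \in range (h n)) (y * \1_(h n @^-1` [set y]) x) by exact: fimfunE.
have -> : (\int[mu]_(x in D) f x = limn (fun n => \int[mu]_(x in D) (h n x)%:E))%E.
{ rewrite -monotone_convergence //.
  - apply: eq_integral => x _; symmetry; apply: cvg_lim => //; exact: cvg_nnsfun_approx.
  - by move=> n; apply/measurable_EFinP; exact: measurable_funTS.
  - by move=> n x _; rewrite lee_fin.
  - by move=> x _ m n mn; rewrite lee_fin; exact/lefP/nd_nnsfun_approx. }
have -> : (\int[la]_y (f (psi y) * (g y)%:E) = limn (fun n => \int[la]_y (h n (psi y) * g y)%:E))%E.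
{ rewrite -monotone_convergence //.
  - apply: eq_integral => y _; symmetry; apply: cvg_lim => //.
    under eq_fun do rewrite EFinM.
    by apply: cvgeZr => //; apply: cvg_nnsfun_approx.
  - by move=> n; apply/measurable_EFinP; apply: measurable_funM => //; exact: measurableT_comp.
  - by move=> n x _; rewrite lee_fin mulr_ge0.
  - by move=> x _ m n mn; rewrite lee_fin ler_wpM2r //; exact/lefP/nd_nnsfun_approx. }
congr (limn _); apply/funext => n.
have mi k : measurable (h n @^-1` [set k]) by rewrite -[X in measurable X]setTI; exact: mh.
have mi' k : measurable_fun setT (fun y => \1_(h n @^-1` [set k]) (psi y) * g y : R).
  by apply: measurable_funM => //; apply: measurableT_comp => //; exact: measurable_indic.
transitivity (\sum_(k \in range (h n)) (k%:E * mu (h n @^-1` [set k] `&` D)))%E.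
{ under eq_integral do rewrite hE -fsumEFin //.
  rewrite ge0_integral_fsum //; last 2 first.
  - by move=> y; apply/measurable_EFinP; apply: measurable_funM => //; exact: measurable_indic.
  - by move=> y x _; rewrite nnfun_muleindic_ge0.
  - by apply: eq_fsbigr => k _; rewrite integralZl_indic_nnsfun // integral_indic. }
transitivity (\sum_(k \in range (h n)) \int[la]_y (k * (\1_(h n @^-1` [set k]) (psi y) * g y))%:E)%E.
{ apply: eq_fsbigr => k; rewrite inE => -[x _ <-]; rewrite muE //.
  rewrite -ge0_integralZl //; last 3 first.
  - by apply/measurable_EFinP.
  - by move=> y _; rewrite lee_fin mulr_ge0.
  - by rewrite lee_fin. }
rewrite -ge0_integral_fsum //; last 2 first.
- by move=> k; apply/measurable_EFinP; apply: measurable_funM.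
- move=> k y _; have := nnfun_muleindic_ge0 (h n) k (psi y).
  by rewrite !lee_fin => h0; rewrite mulrA mulr_ge0.
- apply: eq_integral => y _; rewrite hE [in RHS]fsbig_finite //=.
  rewrite fsbig_finite //= mulr_suml -sumEFin; apply: eq_bigr => k _.
  by rewrite mulrA.
Qed.
End Transfer.

Section Borel.
Variable R : realType.

Lemma borel_open (T : ptopologicalType) (U : set T) : open U -> measurable (U : set (borel T)).
Proof. by move=> oU; exact: sub_sigma_algebra. Qed.

Lemma borel_closed (T : ptopologicalType) (U : set T) : closed U -> measurable (U : set (borel T)).
Proof.
by move=> cU; rewrite -[U]setCK; apply: measurableC; apply: borel_open; rewrite openC.
Qed.

Lemma continuous_borel (T : ptopologicalType) (D : set T) (f : T -> R) : open D ->
  (forall u, D u -> {for u, continuous f}) -> measurable_fun (D : set (borel T)) f.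
Proof.
move=> oD cf; apply: (@measurability _ _ (borel T) (measurableTypeR R) D f _ (RGenOpens.measurableE R)).
move=> _ [_ [a [b ->] <-]]; apply: borel_open; apply: open_preim => //; exact: interval_open.
Qed.

Lemma continuous_borel_map (T S : ptopologicalType) (f : T -> S) : continuous f ->
  measurable_fun (setT : set (borel T)) (f : borel T -> borel S).
Proof.
move=> cf; apply: (measurability (@open S : set (set (borel S))) erefl).
move=> _ [U oU <-]; apply: borel_open; rewrite setTI; rewrite -[X in open X]setTI; apply: open_preim => //; [exact: openT|move=> u _; exact: cf].
Qed.

Definition obox m (q : 'rV[R]_m) (r : R) : set 'rV[R]_m := [set u | forall i, `|u 0 i - q 0 i| < r].

(** Countably many rational boxes suffice. A box is a product of a box and an interval, so preimages
    of open sets under [glue] lie in the product sigma-algebra. *)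
Lemma open_obox m (U : set 'rV[R]_m) : open U ->
  U = \bigcup_(i in [set i : 'rV[rat]_m * nat | obox (map_mx ratr i.1) i.2.+1%:R^-1 `<=` U])
        obox (map_mx ratr i.1) i.2.+1%:R^-1.
Proof.
move=> oU; apply/seteqP; split => [u Uu|u [i /= sub]]; last exact: sub.
have /nbhs_ballP[e /= e0 eU] : nbhs u U by exact: open_nbhs_nbhs.
have [k _ Hk] := near_infty_natSinv_lt (PosNum (divr_gt0 e0 (ltr0n R 2))).
have k2 : (k.+1%:R^-1 : R) < e / 2 by exact: (Hk k (leqnn k)).
have k0 : 0 < (k.+1%:R^-1 : R) by rewrite invr_gt0.
have H i : exists a : rat, `|u 0 i - ratr a| < k.+1%:R^-1.
  have [|a] := @rat_in_itvoo R (u 0 i - k.+1%:R^-1) (u 0 i + k.+1%:R^-1).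
    by rewrite ltrD2l gtrN.
  by rewrite in_itv /= => ha; exists a; rewrite distrC ltr_distl.
pose q : 'rV[rat]_m := \row_i sval (cid (H i)).
have qu i : `|u 0 i - map_mx ratr q 0 i| < k.+1%:R^-1 by rewrite !mxE; exact: (svalP (cid (H i))).
exists (q, k) => //= v Hv; apply: eU; rewrite -ball_normE /ball_ /=; apply: mx_norm_lt => // i j.
rewrite (ord1 i) mx_subE (splitr e).
have -> : u 0 j - v 0 j = (u 0 j - map_mx ratr q 0 j) - (v 0 j - map_mx ratr q 0 j).
  by rewrite opprB addrA subrK.
by apply: le_lt_trans (ler_normB _ _) _; apply: ltrD; apply: lt_trans k2; [exact: qu|exact: Hv].
Qed.

Lemma box_closed m (q : 'rV[R]_m) (r : R) : closed (box q r).
Proof. by apply: compact_closed; [exact: norm_hausdorff|exact: box_compact]. Qed.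

Definition glue m (p : measurableTypeR R * borel 'rV[R]_m) : borel 'rV[R]_m.+1 := row_mx (p.1%:M : 'M[R]_1) p.2.

Lemma glue0 m (t : R) (v : 'rV[R]_m) : (row_mx (t%:M : 'M[R]_1) v : 'rV[R]_m.+1) 0 ord0 = t.
Proof.
have -> : (ord0 : 'I_m.+1) = lshift m (ord0 : 'I_1) by apply: val_inj.
by rewrite (@row_mxEl _ 1 1 m) mxE.
Qed.

Lemma glueS m (t : R) (v : 'rV[R]_m) i : (row_mx (t%:M : 'M[R]_1) v : 'rV[R]_m.+1) 0 (lift ord0 i) = v 0 i.
Proof.
have -> : lift ord0 i = rshift 1 i by apply: val_inj.
by rewrite (@row_mxEr _ 1 1 m).
Qed.

Lemma forall_ordS m (P : 'I_m.+1 -> Prop) : (forall i, P i) <-> P ord0 /\ forall i, P (lift ord0 i).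
Proof.
split=> [H|[H0 H] i]; first by split=> [|i]; exact: H.
by case: (unliftP ord0 i) => [j ->|->]; [exact: H|exact: H0].
Qed.

Lemma obox_ball m (q : 'rV[R]_m) (r : R) : 0 < r -> obox q r = ball q r.
Proof.
move=> r0; apply/seteqP; split=> u; rewrite -ball_normE /ball_ /=.
  by move=> H; apply: mx_norm_lt => // i j; rewrite (ord1 i) mx_subE distrC; exact: H.
by move=> H i; apply: le_lt_trans H; have := mx_entry_le (q - u) 0 i; rewrite mx_subE distrC.
Qed.

Lemma measurable_glue m : measurable_fun setT (@glue m).
Proof.
apply: (measurability (@open 'rV[R]_m.+1 : set (set (borel 'rV[R]_m.+1))) erefl).
move=> _ [U oU <-]; rewrite setTI (open_obox oU) preimage_bigcup bigcup_mkcond.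
apply: countable_bigcupT_measurable; first exact: countableP.
move=> [q k]; case: ifP => // _; set r := k.+1%:R^-1; pose q' := map_mx ratr q : 'rV[R]_m.+1.
have r0 : 0 < r :> R by rewrite invr_gt0.
rewrite (_ : _ @^-1` _ = [set t : R | `|t - q' 0 ord0| < r] `*` obox (\row_i q' 0 (lift ord0 i)) r).
  apply: measurableX.
    apply: open_measurable; rewrite (_ : [set t | _] = ball (q' 0 ord0) r); first exact: ball_open.
    by rewrite -ball_normE; apply/seteqP; split=> t; rewrite /ball_ /= distrC.
  by apply: borel_open; rewrite obox_ball //; exact: ball_open.
apply/seteqP; split=> -[t v] /=.
  move=> /forall_ordS[]; rewrite glue0 => h0 hS; split=> //= i.
  by have := hS i; rewrite glueS mxE.
move=> [h0 hS]; apply/forall_ordS; rewrite glue0; split=> // i.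
by have := hS i; rewrite glueS mxE.
Qed.

(** The iterated integral is the integral against a measure, the image of a product measure under
    [glue]; the convergence theorems thereby become available. The bounds on boxes express local
    finiteness and positivity on open sets. *)
Lemma iint_measure m : exists la : {sigma_finite_measure set (borel 'rV[R]_m) -> \bar R},
  (forall f : 'rV[R]_m -> \bar R, measurable_fun [set: borel 'rV[R]_m] f -> (forall u, (0 <= f u)%E) ->
     iint f = (\int[la]_u f u)%E) /\
  forall u0 r, (la (box u0 r) < +oo)%E /\ (0 < r -> (0 < la (box u0 r))%E).
Proof.
elim: m => [|m [la [laE laf]]].
  exists (dirac (0 : borel 'rV[R]_0) : {sigma_finite_measure set (borel 'rV[R]_0) -> \bar R}); split.
    by move=> f mf f0 /=; rewrite integral_dirac // diracT mul1e.
  move=> u0 r; have h : dirac (0 : borel 'rV[R]_0) (box u0 r) = 1%E :> \bar R by rewrite diracE mem_set // => -[].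
  split=> [|_]; [move: (ltry (1 : R))|move: (@lte01 R)]; by rewrite -h.
have mglue := @measurable_glue m.
pose P := measure_function_pushforward__canonical__measure_function_Measure (@lebesgue_measure R \x la)%E mglue.
have PE A : P A = (@lebesgue_measure R \x la)%E (@glue m @^-1` A) by [].
have Pbox u0 r : (P (box u0 r) < +oo)%E /\ (0 < r -> (0 < P (box u0 r))%E).
  rewrite PE (_ : _ @^-1` _ = `[u0 0 ord0 - r, u0 0 ord0 + r] `*` box (\row_i u0 0 (lift ord0 i)) r); last first.
    apply/seteqP; split=> -[t v] /=.
      move=> /forall_ordS[]; rewrite glue0 ler_distl => h0 hS; split; first by rewrite /= in_itv.
      by move=> i /=; have := hS i; rewrite glueS mxE.
    rewrite in_itv /= => -[h0 hS]; apply/forall_ordS; rewrite glue0 ler_distl; split=> // i.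
    by have := hS i; rewrite glueS mxE.
  rewrite product_measure1E //; last by apply: borel_closed; exact: box_closed.
  have [l1 l2] := laf (\row_i u0 0 (lift ord0 i)) r; split.
    apply: lte_mul_pinfty; [exact: measure_ge0| |exact: l1].
    change (@lebesgue_measure R `[u0 0 ord0 - r, u0 0 ord0 + r]%classic \is a fin_num).
    by rewrite lebesgue_measure_itv /=; case: ifP.
  move=> r0; apply: mule_gt0; last exact: l2.
  change (0 < @lebesgue_measure R `[(u0 0 ord0 - r)%R, (u0 0 ord0 + r)%R]%classic)%E.
  rewrite lebesgue_measure_itv /= lte_fin; have h : u0 0 ord0 - r < u0 0 ord0 + r by rewrite ltrD2l gtrN.
  by rewrite h -EFinB lte_fin subr_gt0.
have sfP : sigma_finite [set: borel 'rV[R]_m.+1] P.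
  exists (fun k => box 0 k%:R).
    symmetry; apply/seteqP; split=> // u _.
    exists (Num.truncn `|u|).+1 => // i; rewrite mxE subr0 (le_trans (mx_entry_le _ _ _)) // ltW //.
    exact: truncnS_gt.
  by move=> k; split; [apply: borel_closed; exact: box_closed|by case: (Pbox 0 k%:R)].
pose SP : {sigma_finite_measure set (borel 'rV[R]_m.+1) -> \bar R} :=
  HB.pack (P : set _ -> \bar R) (Measure.on P) (Measure_isSigmaFinite.Build _ _ _ (P : set _ -> \bar R) sfP).
exists SP; split=> // f mf f0; rewrite [RHS](_ : _ = (\int[P]_u f u)%E) //.
rewrite [RHS](@ge0_integral_pushforward _ _ _ _ _ _ mglue _ setT f) //.
rewrite preimage_setT (@fubini_tonelli1 _ _ _ _ _ _ _ (f \o @glue m)); last 2 first.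
- exact: measurableT_comp.
- by move=> p; exact: f0.
- change (iint f) with (\int[@lebesgue_measure R]_t iint (fun v : 'rV[R]_m => f (row_mx (t%:M : 'M[R]_1) v)))%E.
  apply: eq_integral => t _; rewrite laE //.
  have : measurable_fun setT ((f \o @glue m) \o (pair t)) by apply: measurableT_comp; [exact: measurableT_comp|exact: measurable_pair1].
  exact.
Qed.
End Borel.

(** * Translation invariance and integration by parts *)

Section Translation.
Variable R : realType.

(** The image of Lebesgue measure under a translation has the same values on half-open intervals,
    hence equals it by uniqueness. *)
Lemma lebesgue_translate (a : R) (G : R -> \bar R) : measurable_fun setT G -> (forall t, (0 <= G t)%E) ->
  (\int[@lebesgue_measure R]_t G (t + a)%R = \int[@lebesgue_measure R]_t G t)%E.
Proof.
move=> mG G0.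
pose tau : measurableTypeR R -> measurableTypeR R := fun t => (t : R) + a.
have mt : measurable_fun setT tau.
  by apply: measurable_funD => //; exact: measurable_cst.
have E A : measurable A -> pushforward (@lebesgue_measure R) tau A = lebesgue_measure A.
  move=> mA; symmetry.
  apply: (@lebesgue_measure_unique R (measure_function_pushforward__canonical__measure_function_Measure lebesgue_measure mt)) => // _ [[b c] _ <-].
  rewrite /= /pushforward (_ : _ @^-1` _ = `]b - a, c - a]%classic); last first.
    by apply/seteqP; split=> t; rewrite /= !in_itv /= ltrBlDr lerBrDr.
  by rewrite !lebesgue_measure_itv /= !lte_fin ltrD2r -!EFinB opprB addrA subrK.
transitivity (\int[pushforward (@lebesgue_measure R) tau]_t G t)%E.
  by rewrite (@ge0_integral_pushforward _ _ _ _ _ _ mt _ setT G).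
by apply: eq_measure_integral => A mA _; exact: E.
Qed.

Lemma addr_row_mx m (t : R) (v : 'rV[R]_m) (h : 'rV[R]_m.+1) :
  (row_mx (t%:M : 'M[R]_1) v : 'rV[R]_m.+1) + h =
  row_mx ((t + h 0 ord0)%:M : 'M[R]_1) (v + \row_i h 0 (lift ord0 i)).
Proof.
apply/rowP; apply/forall_ordS; split=> [|i]; rewrite mx_addE.
  by rewrite (glue0 t v) (glue0 _ (v + _)).
by rewrite (glueS t v) (glueS _ (v + _)) mx_addE mxE.
Qed.

Lemma iint_translate m (f : 'rV[R]_m -> \bar R) h : measurable_fun [set: borel 'rV[R]_m] f ->
  (forall u, (0 <= f u)%E) -> iint (fun u => f (u + h)) = iint f.
Proof.
elim: m f h => [|m IH] f h mf f0; first by congr iint; apply/funext => u; rewrite (thinmx0 (u + h)) (thinmx0 u).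
have [la [laE _]] := iint_measure R m.
have mglue := @measurable_glue R m.
have ms t : measurable_fun [set: borel 'rV[R]_m] (fun v : borel 'rV[R]_m => f (row_mx (t%:M : 'M[R]_1) v)).
  have : measurable_fun setT ((f \o @glue R m) \o (pair t)).
    by apply: measurableT_comp; [exact: measurableT_comp|exact: measurable_pair1].
  exact.
pose G t := iint (fun v : 'rV[R]_m => f (row_mx (t%:M : 'M[R]_1) v)).
have GE t : G t = fubini_F la (f \o @glue R m) t by rewrite /G laE.
have mG : measurable_fun setT (G : measurableTypeR R -> \bar R).
  apply: (eq_measurable_fun (fubini_F la (f \o @glue R m))); first by move=> t _; rewrite GE.
  by apply: measurable_fun_fubini_tonelli_F => [|p]; [exact: measurableT_comp|exact: f0].
have G0 t : (0 <= G t)%E by rewrite GE; apply: integral_ge0 => v _; exact: f0.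
have := @lebesgue_translate (h 0 ord0) G mG G0.
rewrite -[RHS]/(iint f) => <-.
change (iint (fun u => f (u + h))) with (\int[@lebesgue_measure R]_t iint (fun v : 'rV[R]_m => f ((row_mx (t%:M : 'M[R]_1) v : 'rV[R]_m.+1) + h)%R))%E.
apply: eq_integral => t _; rewrite /G -(IH _ (\row_i h 0 (lift ord0 i)) (ms _)) //.
by congr iint; apply/funext => v; rewrite addr_row_mx.
Qed.
End Translation.

Section InvariantMeasure.
Variables (R : realType) (m : nat) (la : {sigma_finite_measure set (borel 'rV[R]_m) -> \bar R}).
Hypothesis laE : forall f : 'rV[R]_m -> \bar R, measurable_fun [set: borel 'rV[R]_m] f ->
  (forall u, (0 <= f u)%E) -> iint f = (\int[la]_u f u)%E.
Hypothesis laf : forall u0 r, (la (box u0 r) < +oo)%E.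

Lemma measurable_translate h : measurable_fun [set: borel 'rV[R]_m] (fun u : borel 'rV[R]_m => u + h : borel 'rV[R]_m).
Proof.
apply: (@continuous_borel_map 'rV[R]_m 'rV[R]_m (fun u => u + h)) => u.
by apply: (@cvgD _ _ _ (nbhs u) _ idfun (cst h) u h); [exact: cvg_id|exact: cvg_cst].
Qed.

Lemma integral_translate h (f : 'rV[R]_m -> \bar R) : measurable_fun [set: borel 'rV[R]_m] f ->
  (\int[la]_u f (u + h)%R = \int[la]_u f u)%E.
Proof.
move=> mf; have pos (k : 'rV[R]_m -> \bar R) : measurable_fun [set: borel 'rV[R]_m] k -> (forall u, (0 <= k u)%E) ->
    (\int[la]_u k (u + h)%R = \int[la]_u k u)%E.
  move=> mk k0; rewrite -(laE mk k0) -(@laE (fun u => k (u + h)) (measurableT_comp mk (measurable_translate h))) //.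
  exact: iint_translate.
rewrite integralE [RHS]integralE; congr (_ - _)%E.
  have H := pos (f^\+)%E (measurable_funepos mf) (fun u => funepos_ge0 f u).
  by rewrite -H; apply: eq_integral => u _; rewrite !funeposE.
have H := pos (f^\-)%E (measurable_funeneg mf) (fun u => funeneg_ge0 f u).
by rewrite -H; apply: eq_integral => u _; rewrite !funenegE.
Qed.

Lemma bounded_box_integrable (f : 'rV[R]_m -> R) u0 r B : measurable_fun [set: borel 'rV[R]_m] f ->
  (forall u, `|f u| <= B) -> (forall u, f u != 0 -> box u0 r u) -> la.-integrable setT (EFin \o f).
Proof.
move=> mf fB fs.
have mbox : measurable (box u0 r : set (borel 'rV[R]_m)) by apply: borel_closed; exact: box_closed.
have B0 : 0 <= B by apply: le_trans (fB u0); exact: normr_ge0.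
have : la.-integrable setT (EFin \o (fun u => B * \1_(box u0 r) u) : borel 'rV[R]_m -> \bar R).
  apply/integrableP; split; first by apply/measurable_EFinP; apply: measurable_funM => //; exact: measurable_indic.
  under eq_integral do rewrite /= ger0_norm ?mulr_ge0 // EFinM.
  rewrite ge0_integralZl //; last by apply/measurable_EFinP; exact: measurable_indic.
  by rewrite integral_indic // setIT; apply: lte_mul_pinfty; [rewrite lee_fin| |exact: laf].
apply: le_integrable => //; first exact/measurable_EFinP.
move=> u _ /=; rewrite lee_fin [leRHS]ger0_norm ?mulr_ge0 //.
have [->|fu] := eqVneq (f u) 0; first by rewrite normr0 mulr_ge0.
by rewrite indicE mem_set ?mulr1; [exact: fB|exact: fs].
Qed.

Section IntegrationByParts.
Variables (y phi k : 'rV[R]_m -> R) (u0 v : 'rV[R]_m) (r h0 : R).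
Hypotheses (cy : Ck 1 setT y) (ys : forall u, y u != 0 -> box u0 r u).
Hypotheses (mphi : measurable_fun [set: borel 'rV[R]_m] phi) (phi1 : forall u, `|phi u| <= 1).
Hypotheses (mk : measurable_fun [set: borel 'rV[R]_m] k) (k0 : forall u, 0 <= k u).
Hypothesis h00 : 0 < h0.
Hypothesis phik : forall h u, 0 < h < h0 -> y u != 0 -> `|phi (u - h *: v) - phi u| <= h * k u.

Let Dy u := \sum_i v 0 i * pd i y u.

Let yc : continuous y. Proof. by move=> u; apply: (Ck_cont cy I). Qed.
Let Dc : continuous Dy.
Proof.
move=> u; rewrite /Dy.
apply: (@sum_cont R 'rV[R]_m _ _ (fun i t => v 0 i * pd i y t) u) => i.
have h : {for u, continuous (pd i y)} by apply: (Ck_cont (Ck_pd i cy)).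
have h' : {for u, continuous (fun _ : 'rV[R]_m => v 0 i)} by exact: cst_continuous.
exact: (continuousM h' h).
Qed.

Let derE u : derivable y u v /\ 'D_v y u = Dy u.
Proof. by have [d dE] := Ck1_differentiable openT cy (I : setT u); split; [exact: diff_derivable|rewrite deriveE // dE]. Qed.

Let MVT u (h : R) : exists2 s, `|s| <= `|h| & y (u + h *: v) - y u = h * Dy (u + s *: v).
Proof.
have [s _|s sh E] := @MVT_line R m y u v h; first by case: (derE (u + s *: v)).
by exists s => //; rewrite E; case: (derE (u + s *: v)) => _ ->.
Qed.

Let out u : ~ box u0 r u -> \forall w \near u, y w = 0.
Proof.
move=> nu; have : \forall w \near u, ~ box u0 r w.
  by apply: (open_near (U := ~` box u0 r)) => //; rewrite openC; exact: box_closed.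
by apply: filterS => w nw; apply/eqP; apply: contra_notT nw => /ys.
Qed.

Let Ds u : Dy u != 0 -> box u0 r u.
Proof.
apply: contra_neqP => nu; have [Z [oZ Zu Z0]] := near_open (out nu).
rewrite /Dy big1 // => i _; rewrite (_ : pd i y u = 0) ?mulr0 // -(pd_cst 0 i u).
exact: (pd_eq oZ).
Qed.

Let DB : exists2 B, 0 <= B & forall u, `|Dy u| <= B.
Proof.
have [B B0 HB] := compact_bound (@box_compact R m u0 r) (fun u _ => @Dc u).
exists B => // u; have [->|/Ds] := eqVneq (Dy u) 0; [by rewrite normr0|exact: HB].
Qed.

Lemma integrable_by_parts : la.-integrable setT (fun u => (phi u * Dy u)%:E : \bar R).
Proof.
have [B B0 HB] := DB; apply: (@bounded_box_integrable (fun u => phi u * Dy u) u0 r B).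
- by apply: measurable_funM => //; apply: continuous_borel; [exact: openT|move=> u _; exact: Dc].
- by move=> u; rewrite normrM -[leRHS]mul1r ler_pM.
- by move=> u H; apply: Ds; apply: contra_neq H => ->; rewrite mulr0.
Qed.

(** The difference quotients of [y] converge to [Dy] under a common bound, so dominated convergence
    applies; for each quotient, invariance moves the shift onto [phi], where [phik] is the only
    regularity required. *)
Lemma integration_by_parts : (`| \int[la]_u (phi u * Dy u)%:E | <= \int[la]_u (`|y u| * k u)%:E)%E.
Proof.
(* The step lengths stay below [h0], where [phik] holds, and below 1, which keeps all supports in
   the box of half-width [r + |v|]. *)
have [B B0 HB] := DB; pose hj j : R := (Num.min h0 1) / j.+2%:R.
have m0 : 0 < Num.min h0 1 by rewrite lt_min h00 ltr01.
have hj0 j : 0 < hj j by rewrite divr_gt0.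
have hjm j : hj j < Num.min h0 1 by rewrite /hj ltr_pdivrMr // ltr_pMr // ltr1n.
have hjh j : 0 < hj j < h0 by rewrite hj0 (lt_le_trans (hjm j)) // ge_min lexx.
have hj1 j : hj j <= 1 by rewrite (le_trans (ltW (hjm j))) // ge_min lexx orbT.
pose q j u := phi u * ((hj j)^-1 * (y (u + hj j *: v) - y u)).
have yb : exists2 By, 0 <= By & forall u, `|y u| <= By.
  have [By By0 HBy] := compact_bound (@box_compact R m u0 r) (fun u _ => @yc u).
  by exists By => // u; have [->|/ys] := eqVneq (y u) 0; [rewrite normr0|exact: HBy].
have [By By0 HBy] := yb.
have my : measurable_fun [set: borel 'rV[R]_m] y by apply: continuous_borel; [exact: openT|move=> u _; exact: yc].
have mD : measurable_fun [set: borel 'rV[R]_m] Dy by apply: continuous_borel; [exact: openT|move=> u _; exact: Dc].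
have myt h : measurable_fun [set: borel 'rV[R]_m] (fun u => y (u + h)).
  exact: (measurableT_comp my (measurable_translate h)).
have mpt h : measurable_fun [set: borel 'rV[R]_m] (fun u => phi (u + h)).
  exact: (measurableT_comp mphi (measurable_translate h)).
pose r' := r + `|v|.
have qB j u : `|q j u| <= B.
  have [s _ E] := MVT u (hj j); rewrite /q E mulKf ?(gt_eqF (hj0 j)) // normrM.
  by rewrite -[leRHS]mul1r ler_pM.
have qs j u : q j u != 0 -> box u0 r' u.
  have [s sh E] := MVT u (hj j); rewrite /q E mulKf ?(gt_eqF (hj0 j)) // => H i.
  have /Ds/(_ i) : Dy (u + s *: v) != 0 by apply: contra_neq H => ->; rewrite mulr0.
  rewrite mx_addE mx_scaleE => H2.
  have -> : u 0 i - u0 0 i = (u 0 i + s * v 0 i - u0 0 i) - s * v 0 i by ring.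
  apply: le_trans (ler_normB _ _) _; apply: lerD => //.
  rewrite normrM -[leRHS]mul1r; apply: ler_pM => //; last exact: mx_entry_le.
  by apply: le_trans sh _; rewrite gtr0_norm.
have mq j : measurable_fun [set: borel 'rV[R]_m] (q j).
  by apply: measurable_funM => //; apply: measurable_funM; [exact: measurable_cst|apply: measurable_funB].
have hcvg : hj j @[j --> \oo] --> (0 : R).
  rewrite -(mulr0 (Num.min h0 1)); apply: cvgM; first exact: cvg_cst.
  by have := @cvg_harmonic R; rewrite -(cvg_shiftS (fun n : nat => n.+1%:R^-1 : R)).
have qcv u : (EFin \o q ^~ u) j @[j --> \oo] --> (phi u * Dy u)%:E.
  apply/cvg_EFin; first exact: nearW.
  rewrite /comp /=; apply: cvgM; first exact: cvg_cst.
  apply/cvgrPdist_le => e e0.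
  have /cvgrPdist_le/(_ e e0)[d /= d0 Hd] : (fun s : R => Dy (u + s *: v)) s @[s --> (0 : R)] --> Dy u.
    have -> : Dy u = Dy (u + 0 *: v) by rewrite scale0r addr0.
    apply: (@continuous_comp _ _ _ (fun s : R => u + s *: v) Dy); last exact: Dc.
    by apply: cvgD; [exact: cvg_cst|apply: cvgZl; exact: cvg_id].
  have /cvgrPdist_lt/(_ d d0) := hcvg; apply: filterS => j; rewrite sub0r normrN => hd.
  have [s sh E] := MVT u (hj j); rewrite E mulKf ?(gt_eqF (hj0 j)) //.
  by apply: Hd; rewrite /ball_ /= sub0r normrN (le_lt_trans sh).
have qint j : la.-integrable setT (EFin \o q j) := bounded_box_integrable (mq j) (qB j) (qs j).
have dint : la.-integrable setT (EFin \o (fun u => B * \1_(box u0 r') u) : borel 'rV[R]_m -> \bar R).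
{ apply: (@bounded_box_integrable _ u0 r' B).
  - apply: measurable_funM; first exact: measurable_cst.
    by apply: measurable_indic; apply: borel_closed; exact: box_closed.
  - move=> u; rewrite indicE; case: (_ \in _); rewrite ?mulr1 ?mulr0 ?normr0 //.
    by rewrite ger0_norm.
  - by move=> u; rewrite indicE; case: (boolP (u \in _)); rewrite ?inE // mulr0 eqxx. }
have key j : (`| \int[la]_u (q j u)%:E | <= \int[la]_u (`|y u| * k u)%:E)%E.
{ have i1 : la.-integrable setT (EFin \o (fun u => phi u * y (u + hj j *: v))).
  { apply: (@bounded_box_integrable _ u0 r' By).
    - exact: measurable_funM.
    - by move=> u; rewrite normrM -[leRHS]mul1r ler_pM.
    - move=> u H i; have /ys/(_ i) : y (u + hj j *: v) != 0 by apply: contra_neq H => ->; rewrite mulr0.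
      rewrite mx_addE mx_scaleE => H2.
      have -> : u 0 i - u0 0 i = (u 0 i + hj j * v 0 i - u0 0 i) - hj j * v 0 i by ring.
      apply: le_trans (ler_normB _ _) _; apply: lerD => //.
      rewrite normrM -[leRHS]mul1r; apply: ler_pM => //; last exact: mx_entry_le.
      by rewrite gtr0_norm. }
  have i2 : la.-integrable setT (EFin \o (fun u => phi u * y u)).
  { apply: (@bounded_box_integrable _ u0 r By).
    - exact: measurable_funM.
    - by move=> u; rewrite normrM -[leRHS]mul1r ler_pM.
    - by move=> u H; apply: ys; apply: contra_neq H => ->; rewrite mulr0. }
  have i3 : la.-integrable setT (EFin \o (fun u => phi (u - hj j *: v) * y u)).
  { apply: (@bounded_box_integrable _ u0 r By).
    - exact: measurable_funM.
    - by move=> u; rewrite normrM -[leRHS]mul1r ler_pM.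
    - by move=> u H; apply: ys; apply: contra_neq H => ->; rewrite mulr0. }
  have -> : (\int[la]_u (q j u)%:E = (hj j)^-1%:E * \int[la]_u ((phi (u - hj j *: v) - phi u) * y u)%:E)%E.
    transitivity ((hj j)^-1%:E * (\int[la]_u (phi u * y (u + hj j *: v))%:E - \int[la]_u (phi u * y u)%:E))%E.
      rewrite -integralB // -integralZl //; last exact: integrableB.
      by apply: eq_integral => u _; rewrite -EFinB -EFinM /q; congr _%:E; ring.
    congr (_ * _)%E; rewrite -(integral_translate (- (hj j *: v))); last exact/measurable_EFinP/measurable_funM.
    under eq_integral do rewrite subrK.
    rewrite -integralB //.
    by apply: eq_integral => u _; rewrite -EFinB; congr _%:E; ring.
  rewrite abseM gee0_abs ?lee_fin ?invr_ge0 ?(ltW (hj0 j)) //.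
  rewrite -lee_pdivlMl ?invr_gt0 // invrK.
  have mI : measurable_fun [set: borel 'rV[R]_m] (fun u => (phi (u - hj j *: v) - phi u) * y u).
    by apply: measurable_funM => //; exact: measurable_funB.
  apply: le_trans (le_abse_integral la measurableT _) _; first exact/measurable_EFinP.
  rewrite -ge0_integralZl //; last 3 first.
  - by apply/measurable_EFinP/measurable_funM => //; exact: measurableT_comp.
  - by move=> u _; rewrite lee_fin mulr_ge0.
  - by rewrite lee_fin ltW.
  - apply: ge0_le_integral => //.
    + by apply: measurableT_comp => //; exact/measurable_EFinP.
    + by apply: measurable_funeM; apply/measurable_EFinP/measurable_funM => //; exact: measurableT_comp.
    + move=> u _; rewrite -EFinM lee_fin normrM.
      have [->|yu] := eqVneq (y u) 0; first by rewrite normr0 !(mul0r, mulr0).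
      rewrite mulrCA mulrC ler_wpM2l //.
      by apply: phik. }
have qdom u j : (`|(q j u)%:E| <= (B * \1_(box u0 r') u)%:E)%E.
  rewrite /= lee_fin; have [->|qu] := eqVneq (q j u) 0; first by rewrite normr0 mulr_ge0.
  by rewrite indicE mem_set ?mulr1; [exact: qB|exact: qs qu].
have cv : (fun j => \int[la]_u (q j u)%:E)%E @ \oo --> (\int[la]_u (phi u * Dy u)%:E)%E.
  have h1 j : measurable_fun [set: borel 'rV[R]_m] (EFin \o q j) by exact/measurable_EFinP.
  have h2 : measurable_fun [set: borel 'rV[R]_m] (fun u => (phi u * Dy u)%:E).
    by apply/measurable_EFinP; exact: measurable_funM.
  by have [] := @dominated_convergence _ _ R la setT measurableT (fun j => EFin \o q j) _ _ h1 h2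
    (aeW la (fun u _ => qcv u)) dint (aeW la (fun u j _ => qdom u j)).
have cva : (fun j => `| \int[la]_u (q j u)%:E |)%E @ \oo --> (`| \int[la]_u (phi u * Dy u)%:E |)%E.
  exact: cvg_abse cv.
rewrite -(cvg_lim _ cva) //; apply: lime_le; first by apply/cvg_ex; eexists; exact: cva.
by apply: nearW => j; exact: key.
Qed.
End IntegrationByParts.
End InvariantMeasure.

Section ChartIntegral.
Variables (R : realType) (m : nat) (M : riemannian R m) (mu : {measure set (borel M) -> \bar R}).
Hypothesis vm : riemannian_volume mu.
Variable la : {sigma_finite_measure set (borel 'rV[R]_m) -> \bar R}.
Hypothesis laE : forall f : 'rV[R]_m -> \bar R, measurable_fun [set: borel 'rV[R]_m] f ->
  (forall u, (0 <= f u)%E) -> iint f = (\int[la]_u f u)%E.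
Hypothesis laf : forall u0 r, (la (box u0 r) < +oo)%E /\ (0 < r -> (0 < la (box u0 r))%E).
Variable s : chart R M m.
Hypothesis as_ : @atlas R m M s.

Lemma volC k : Ck k (ccod s) (vol (metric s)).
Proof.
apply: (Ck_vol (@ccod_open _ _ _ s) (fun k => metricC k as_)) => u.
- by move=> su; exact: metric_sym.
- by move=> v su; exact: metric_pos.
Qed.

Lemma volC_pos u : ccod s u -> 0 < vol (metric s) u.
Proof.
apply: (vol_pos (U := ccod s)) => w; first by move=> sw; exact: metric_sym.
by move=> v sw; exact: metric_pos.
Qed.

(** Total extension of the inverse chart, so that measurability is that of a function on the whole
    space; outside the chart the weight [cvol] is zero. *)
Definition cpoint (u : borel 'rV[R]_m) : borel M := if `[< ccod s u >] then cinv s u else point.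
Definition cvol (u : borel 'rV[R]_m) : R := if `[< ccod s u >] then vol (metric s) u else 0.

Lemma cpointE u : ccod s u -> cpoint u = cinv s u.
Proof. by move=> su; rewrite /cpoint asboolT. Qed.

Lemma cvolE u : ccod s u -> cvol u = vol (metric s) u.
Proof. by move=> su; rewrite /cvol asboolT. Qed.

Lemma cvol_out u : ~ ccod s u -> cvol u = 0.
Proof. by move=> su; rewrite /cvol asboolF. Qed.

Lemma cvol_ge0 u : 0 <= cvol u.
Proof. by rewrite /cvol; case: asboolP => // su; rewrite ltW // volC_pos. Qed.

Let mcod : measurable (ccod s : set (borel 'rV[R]_m)).
Proof. by apply: borel_open; exact: ccod_open. Qed.

Let preim (A : set (borel M)) : measurable A -> measurable (ccod s `&` cinv s @^-1` A : set (borel 'rV[R]_m)).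
Proof.
move=> mA; have : measurable_fun (ccod s : set (borel 'rV[R]_m)) (cinv s : borel 'rV[R]_m -> borel M).
  apply: (measurability (@open M : set (set (borel M))) erefl) => _ [U oU <-].
  by apply: borel_open; apply: open_preim => //; [exact: ccod_open|move=> u; exact: cinv_continuous].
by move=> H; exact: H.
Qed.

Lemma measurable_cpoint : measurable_fun setT cpoint.
Proof.
move=> _ A mA; rewrite setTI.
rewrite (_ : cpoint @^-1` A = (ccod s `&` cinv s @^-1` A) `|` (~` ccod s `&` [set _ | A point])).
  apply: measurableU; first exact: preim.
  apply: measurableI; first exact: measurableC.
  have [h|h] := pselect (A point).
    by rewrite (_ : [set _ | _] = setT) //; apply/seteqP; split.
  by rewrite (_ : [set _ | _] = set0) //; apply/seteqP; split.
apply/seteqP; split=> u /=; rewrite /cpoint; case: asboolP => su; try tauto.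
Qed.

Lemma measurable_cvol : measurable_fun setT cvol.
Proof.
have -> : cvol = vol (metric s) \_ (ccod s).
  by apply/funext => u; rewrite /cvol patchE; case: asboolP => su; [rewrite mem_set|rewrite memNset].
apply/(measurable_restrict _ mcod measurableT); rewrite setTI.
by apply: continuous_borel; [exact: ccod_open|move=> u su; exact: (Ck_cont (volC 0) su)].
Qed.

Let mdom : measurable (cdom s : set (borel M)).
Proof. by apply: borel_open; exact: cdom_open. Qed.

(** The defining property of the Riemannian volume, turned into the form expected by
    [ge0_integral_transfer]. *)
Lemma chart_volume (A : set (borel M)) : measurable A ->
  mu (A `&` cdom s) = (\int[la]_u (\1_A (cpoint u) * cvol u)%:E)%E.
Proof.
move=> mA; pose E : set 'rV[R]_m := ccod s `&` cinv s @^-1` A.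
have -> : A `&` cdom s = cinv s @` E.
  apply/seteqP; split=> [p [Ap sp]|p [u [su Au] <-]]; last by split=> //; exact: cinv_cdom.
  by exists (cmap s p); [split; [exact: cmap_ccod|rewrite /= cmapK]|rewrite cmapK].
rewrite (vm as_ (preim mA)); last by move=> u [].
rewrite -laE; last 2 first.
- apply/measurable_EFinP; apply: measurable_funM; last exact: measurable_cvol.
  by apply: (measurableT_comp _ measurable_cpoint); exact: measurable_indic.
- by move=> u; rewrite lee_fin mulr_ge0 // cvol_ge0.
- congr iint; apply/funext => u; congr (_%:E); rewrite !indicE.
  have [su|su] := pselect (ccod s u); last first.
    by rewrite cvol_out // mulr0 memNset ?mul0r // => -[].
  rewrite cpointE // cvolE //; congr (_%:R * _).
  have [h|h] := pselect (A (cinv s u)); first by rewrite !mem_set.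
  by rewrite !memNset // => -[].
Qed.

Lemma chart_integral_ge0 (f : borel M -> \bar R) : measurable_fun setT f -> (forall p, (0 <= f p)%E) ->
  (\int[mu]_(p in cdom s) f p = \int[la]_u (f (cpoint u) * (cvol u)%:E))%E.
Proof.
move=> mf f0; apply: ge0_integral_transfer => //.
- exact: measurable_cpoint.
- exact: measurable_cvol.
- exact: cvol_ge0.
- exact: chart_volume.
Qed.

Lemma chart_integral (f : borel M -> R) : measurable_fun setT f ->
  (\int[mu]_(p in cdom s) (f p)%:E = \int[la]_u (f (cpoint u) * cvol u)%:E)%E.
Proof.
move=> mf; have mE : measurable_fun setT (EFin \o f) by exact/measurable_EFinP.
rewrite integralE [RHS]integralE; congr (_ - _)%E.
  rewrite chart_integral_ge0 //; last exact: measurable_funepos.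
  apply: eq_integral => u _; rewrite !funeposE /= EFinM.
  by rewrite maxe_pMl ?lee_fin ?cvol_ge0 // mul0e.
rewrite chart_integral_ge0 //; last exact: measurable_funeneg.
apply: eq_integral => u _; rewrite !funenegE.
by rewrite maxe_pMl ?lee_fin ?cvol_ge0 // mul0e mulNe -EFinM.
Qed.

Lemma mbox_finite u0 r : box u0 r `<=` ccod s -> (mu (cinv s @` box u0 r) < +oo)%E.
Proof.
move=> bs; have [B B0 HB] := compact_bound (@box_compact R m u0 r) (fun u bu => Ck_cont (volC 0) (bs u bu)).
have mb : measurable (box u0 r : set (borel 'rV[R]_m)) by apply: borel_closed; exact: box_closed.
rewrite (vm as_ mb bs).
have -> : (fun u => (\1_(box u0 r) u * Num.sqrt (\det (metric s u)))%:E) = (fun u => (\1_(box u0 r) u * cvol u)%:E).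
  apply/funext => u; congr (_%:E); rewrite !indicE; case: (boolP (u \in _)); rewrite ?inE ?mul0r //.
  by move=> bu; rewrite cvolE //; exact: bs.
have mi : measurable_fun [set: borel 'rV[R]_m] (fun u => (\1_(box u0 r) u * cvol u)%:E).
  by apply/measurable_EFinP; apply: measurable_funM; [exact: measurable_indic|exact: measurable_cvol].
rewrite laE //; last by move=> u; rewrite lee_fin mulr_ge0 // cvol_ge0.
apply: (@le_lt_trans _ _ (\int[la]_u (B%:E * (\1_(box u0 r) u)%:E))%E).
{ apply: ge0_le_integral => //.
  - by move=> u _; rewrite lee_fin mulr_ge0 // cvol_ge0.
  - by apply: measurable_funeM; apply/measurable_EFinP; exact: measurable_indic.
  - move=> u _; rewrite -EFinM lee_fin indicE; case: (boolP (u \in _)); rewrite ?inE ?mul0r ?mulr0 //.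
    by move=> bu; rewrite mul1r mulr1 (cvolE (bs u bu)); exact: le_trans (ler_norm _) (HB u bu). }
rewrite ge0_integralZl //; last by apply/measurable_EFinP; exact: measurable_indic.
rewrite integral_indic // setIT; apply: lte_mul_pinfty; [rewrite lee_fin //| by []|by case: (laf u0 r)].
Qed.

Lemma mbox_positive u0 r : 0 < r -> box u0 r `<=` ccod s -> (0 < mu (cinv s @` box u0 r))%E.
Proof.
move=> r0 bs; have mb : measurable (box u0 r : set (borel 'rV[R]_m)) by apply: borel_closed; exact: box_closed.
have [B B0 HB] : exists2 B, 0 < B & forall u, box u0 r u -> B <= vol (metric s) u.
  have [B B0 HB] := compact_bound (@box_compact R m u0 r)
    (fun u bu => Ck_cont (CkV (@ccod_open _ _ _ s) (fun v sv => lt0r_neq0 (volC_pos sv)) (volC 0)) (bs u bu)).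
  exists (B + 1)^-1; first by rewrite invr_gt0 ltr_wpDl.
  move=> u bu; have v0 := volC_pos (bs u bu).
  rewrite -[leRHS]invrK lef_pV2 ?posrE ?invr_gt0 ?ltr_wpDl //.
  by apply: le_trans (ler_norm _) (le_trans (HB u bu) _); rewrite lerDl.
rewrite (vm as_ mb bs).
have -> : (fun u => (\1_(box u0 r) u * Num.sqrt (\det (metric s u)))%:E) = (fun u => (\1_(box u0 r) u * cvol u)%:E).
  apply/funext => u; congr (_%:E); rewrite !indicE; case: (boolP (u \in _)); rewrite ?inE ?mul0r //.
  by move=> bu; rewrite cvolE //; exact: bs.
have mi : measurable_fun [set: borel 'rV[R]_m] (fun u => (\1_(box u0 r) u * cvol u)%:E).
  by apply/measurable_EFinP; apply: measurable_funM; [exact: measurable_indic|exact: measurable_cvol].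
rewrite laE //; last by move=> u; rewrite lee_fin mulr_ge0 // cvol_ge0.
apply: (@lt_le_trans _ _ (\int[la]_u (B%:E * (\1_(box u0 r) u)%:E))%E).
  rewrite ge0_integralZl //; [|by apply/measurable_EFinP; exact: measurable_indic|by rewrite lee_fin ltW].
  by rewrite integral_indic // setIT; apply: mule_gt0; [rewrite lte_fin|case: (laf u0 r) => _; exact].
apply: ge0_le_integral => //.
- by move=> u _; rewrite mule_ge0 ?lee_fin // ltW.
- by apply: measurable_funeM; apply/measurable_EFinP; exact: measurable_indic.
- move=> u _; rewrite -EFinM lee_fin indicE; case: (boolP (u \in _)); rewrite ?inE ?mul0r ?mulr0 //.
  by move=> bu; rewrite mul1r mulr1 (cvolE (bs u bu)); exact: HB.
Qed.
End ChartIntegral.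

Lemma continuous_chart (R : realType) m (M : riemannian R m) (f : M -> R) :
  (forall s u, @atlas R m M s -> ccod s u -> {for u, continuous (f \o cinv s)}) -> continuous f.
Proof.
move=> cf p; have [s as_ sp] := atlas_cover p.
apply: (@near_cont _ _ ((f \o cinv s) \o cmap s)).
  by apply: filterS (open_near (@cdom_open _ _ _ s) sp) => z sz; rewrite /= cmapK.
by apply: continuous_comp; [exact: cmap_continuous|apply: cf => //; exact: cmap_ccod].
Qed.

(** [f] is at least half of [f q] on a small coordinate box inside [W], whose measure is positive
    and finite; the bound does not depend on [B]. *)
Lemma integral_positive (R : realType) m (M : riemannian R m) (mu : {measure set (borel M) -> \bar R})
    (f : M -> R) q (W : set M) : riemannian_volume mu -> continuous f -> (forall p, 0 <= f p) -> 0 < f q ->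
  nbhs q W -> exists2 dl : R, 0 < dl & forall B : set (borel M), measurable B -> W `<=` B ->
    (dl%:E <= \int[mu]_(p in B) (f p)%:E)%E.
Proof.
move=> vm cf f0 fq Wq; have [la [laE laf]] := iint_measure R m.
have [s as_ sq] := atlas_cover q; have sv := cmap_ccod sq; set u0 := cmap s q in sv.
have h1 : \forall p \near q, f q / 2 <= f p.
  have fq2 : 0 < f q / 2 by rewrite divr_gt0.
  have h := (@cvgrPdist_le _ _ _ _ _ _ _).1 (cf q) _ fq2; near=> p.
  have : `|f q - f p| <= f q / 2 by near: p; exact: h.
  by move=> /(le_trans (ler_norm _)); lra.
have h2 : \forall u \near u0, f q / 2 <= f (cinv s u) by exact: (cinv_cvg sq h1).
have h3 : \forall u \near u0, W (cinv s u) by exact: (cinv_cvg sq Wq).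
have [d1 d10 H1] := near_ball2 h2 h3.
have [d2 d20 H2] := near_ball2 (open_near (@ccod_open _ _ _ s) sv) h3.
pose r := Num.min d1 d2 / 2.
have m0 : 0 < Num.min d1 d2 by rewrite lt_min d10.
have r0 : 0 < r by rewrite divr_gt0.
have rm : r < Num.min d1 d2 by rewrite /r; lra.
have B1 u : box u0 r u -> ball u0 d1 u by apply: box_ball => //; rewrite (lt_le_trans rm) // ge_min lexx.
have B2 u : box u0 r u -> ball u0 d2 u by apply: box_ball => //; rewrite (lt_le_trans rm) // ge_min lexx orbT.
have bs : box u0 r `<=` ccod s by move=> u /B2 /H2[].
pose D : set (borel M) := cinv s @` box u0 r.
have mD : measurable D.
  apply: borel_closed; apply: compact_closed; first exact: manifold_hausdorff.
  apply: continuous_compact; last exact: box_compact.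
  by apply: continuous_in_subspaceT => u; rewrite inE => /bs; exact: cinv_continuous.
have Dpos : (0 < mu D)%E by exact: (mbox_positive vm laE laf as_ r0 bs).
have Dfin : (mu D < +oo)%E by exact: (mbox_finite vm laE laf as_ bs).
have Df : mu D \is a fin_num by rewrite ge0_fin_numE.
have mf : measurable_fun [set: borel M] f by apply: continuous_borel; [exact: openT|move=> p _; exact: cf].
exists (f q / 2 * fine (mu D)); first by rewrite mulr_gt0 ?divr_gt0 // fine_gt0 // Dpos.
move=> B mB WB; apply: (@le_trans _ _ (\int[mu]_(p in D) (f p)%:E)%E); last first.
{ apply: ge0_subset_integral => //.
  - by apply/measurable_EFinP; exact: measurable_funTS.
  - by move=> p _; rewrite lee_fin.
  - by move=> p [u bu <-]; apply: WB; case: (H1 u (B1 u bu)). }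
rewrite EFinM fineK // -integral_cst //; apply: ge0_le_integral => //.
- by move=> p _; rewrite lee_fin ltW // divr_gt0.
- by apply/measurable_EFinP; exact: measurable_funTS.
- by move=> p [u bu <-]; rewrite lee_fin; case: (H1 u (B1 u bu)).
Unshelve. all: by end_near. Qed.

Lemma distance_cutoff (R : realType) m (N : riemannian R m) (p : N) (a b : R) : 0 <= a -> a < b ->
  exists phi : N -> R, [/\ forall y, 0 <= phi y <= 1, forall y, geodesic_ball p a y -> phi y = 1,
    forall y, phi y != 0 -> geodesic_ball p b y &
    forall y z (l : R), (rdist y z <= l%:E)%E -> `|phi y - phi z| <= (b - a)^-1 * l].
Proof.
move=> a0 ab; have ba : 0 < b - a by rewrite subr_gt0.
(* The distance may be infinite, so it is truncated at [b] before being read as a real number. *)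
pose rho y := fine (Order.min (rdist p y) b%:E).
have rhoE y : ((rho y)%:E = Order.min (rdist p y) b%:E)%E.
  rewrite /rho fineK //; case: (leP (rdist p y) b%:E) => // h.
  by rewrite ge0_fin_numE ?rdist_ge0 // (le_lt_trans h) // ltry.
pose phi y := clamp 0 1 ((b - rho y) / (b - a)).
have lip y z (l : R) : (rdist y z <= l%:E)%E -> rho z - rho y <= l.
  move=> yz; have l0 : 0 <= l by rewrite -lee_fin (le_trans (rdist_ge0 y z)).
  rewrite lerBlDr -lee_fin EFinD !rhoE; case: (leP (rdist p y) b%:E) => h.
    by rewrite ge_min addeC (le_trans (rdist_triangle p y z)) // leeD2l.
  by rewrite ge_min -EFinD lee_fin lerDr l0 orbT.
exists phi; split.
- by move=> y; exact: clamp_in.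
- move=> y yb; have : rho y <= a by rewrite -lee_fin rhoE ge_min yb.
  move=> h; have h1 : 1 <= (b - rho y) / (b - a) by rewrite ler_pdivlMr // mul1r lerD2l lerN2.
  by rewrite /phi /clamp leNgt (lt_le_trans ltr01 h1) /= h1.
- move=> y; apply: contra_neqP => /negP; rewrite -ltNge => h.
  have E : rho y = b by apply: EFin_inj; rewrite rhoE; apply/min_idPr; exact: ltW.
  by rewrite /phi E subrr mul0r /clamp lexx.
- move=> y z l yz; apply: le_trans (clamp_lip ler01 _ _) _.
  rewrite -mulrBl normrM [X in _ * X]ger0_norm ?invr_ge0 ?(ltW ba) // mulrC ler_wpM2l ?invr_ge0 ?(ltW ba) //.
  rewrite opprB addrC addrA subrK; have h1 := lip y z l yz.
  by have := lip z y l; rewrite rdist_sym => /(_ yz) h2; rewrite ler_norml; lra.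
Qed.

(** * Transport along a vector field *)

Section Patches.
Variables (R : realType) (n m : nat) (Q : riemannian R m) (M : riemannian R n) (x : M -> Q).
Hypothesis xc : continuous x.
Hypothesis locC : forall s d, @atlas R n M s -> @atlas R m Q d -> Ckm 1 (local_dom x s d) (local x s d).
Hypothesis locg : forall s d u, @atlas R n M s -> @atlas R m Q d -> local_dom x s d u ->
  metric s u = jac (local x s d) u *m metric d (local x s d u) *m (jac (local x s d) u)^T.

(* A coordinate box together with a constant frame [E] which is almost orthonormal on it. *)
Record patch := Patch {
  pch : chart R M n; pcen : 'rV[R]_n; prad : R; pframe : 'M[R]_n; pstep : R;
  patch_atlas : @atlas R n M pch;
  patch_rad : 0 < prad;
  patch_box : box pcen (2 * prad) `<=` ccod pch;
  patch_unit : pframe \in unitmx;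
  patch_frame : forall u, box pcen (2 * prad) u -> forall y : 'rV[R]_n,
    2^-1 * (\sum_i y 0 i ^+ 2) <= inner (metric pch) u (y *m pframe) (y *m pframe);
  patch_step : 0 < pstep;
  patch_dist : forall u k (h : R), box pcen (2 * prad) u -> 0 < h < pstep ->
    ccod pch (u - h *: row k pframe) /\
    (rdist (x (cinv pch u)) (x (cinv pch (u - h *: row k pframe))) <= (3 * h)%:E)%E
}.

Definition pbump P := mbump (pch P) (pcen P) (prad P).

Lemma patch_exists (p : M) : exists P : patch, \forall z \near p, pbump P z = 1.
Proof.
have [s as_ sp] := atlas_cover p; have su := cmap_ccod sp; set u0 := cmap s p in su.
have [d ad dp] := atlas_cover (x p).
have oU : open (local_dom x s d) by exact: local_dom_open.
have U0 : local_dom x s d u0 by split; rewrite // cmapK.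
have [E uE HE] := metric_frame as_ su.
have [dl dl0 Hd] := near_ball2 (open_near oU U0) HE.
pose e := dl / 8; have e0 : 0 < e by rewrite divr_gt0.
(* A step [h < h0] along a row of [E] moves a point by less than [dl / 8], so from the ball of
   radius [dl / 2] it stays in the ball of radius [dl]. *)
pose h0 := dl / (8 * (1 + \sum_k `|row k E|)).
have S0 : 0 < 1 + \sum_k `|row k E| by rewrite ltr_pwDl // sumr_ge0.
have h00 : 0 < h0 by rewrite divr_gt0 // mulr_gt0.
have bb u : box u0 (2 * e) u -> ball u0 (dl / 2) u.
  by apply: box_ball; [rewrite divr_gt0|rewrite /e; lra].
have b2 u : ball u0 (dl / 2) u -> ball u0 dl u by apply: le_ball; lra.
have step u k (h : R) : box u0 (2 * e) u -> 0 < h < h0 -> ball u0 dl (u - h *: row k E).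
  move=> /bb; rewrite -ball_normE /ball_ /= => bu /andP[hp hh].
  have -> : u0 - (u - h *: row k E) = (u0 - u) + h *: row k E by rewrite opprB addrCA [LHS]addrC.
  apply: le_lt_trans (ler_normD _ _) _; rewrite normrZ gtr0_norm //.
  have : h * `|row k E| <= dl / 8.
    have : `|row k E| <= 1 + \sum_k `|row k E|.
      by rewrite (bigD1 k) //= addrCA lerDl addr_ge0 // sumr_ge0.
    move: hh; rewrite /h0 ltr_pdivlMr ?mulr_gt0 // => hh le.
    have := ler_wpM2l (ltW hp) le; lra.
  by move: bu; lra.
have h1 : box u0 (2 * e) `<=` ccod s by move=> u /bb/b2/Hd[[]].
have h2 u : box u0 (2 * e) u -> forall y : 'rV[R]_n,
    2^-1 * (\sum_i y 0 i ^+ 2) <= inner (metric s) u (y *m E) (y *m E).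
  by move=> /bb/b2/Hd[_ H] y; have /andP[] := H y.
have h3 u k (h : R) : box u0 (2 * e) u -> 0 < h < h0 -> ccod s (u - h *: row k E) /\
    (rdist (x (cinv s u)) (x (cinv s (u - h *: row k E))) <= (3 * h)%:E)%E.
  move=> bu hh; have bv := step u k h bu hh; have bu' := b2 _ (bb _ bu); split; first by case: (Hd _ bv) => -[].
  have /andP[hp _] := hh.
  have seg (t : R) : 0 <= t <= 1 -> ball u0 dl (u + t *: (u - h *: row k E - u)) by move=> t01; exact: ball_segment.
  have ct : Ckm 1 (ball u0 dl) (local x s d) by move=> i j; apply: Ck_sub (locC as_ ad i j) => z /Hd[].
  have tc z : ball u0 dl z -> ccod d (local x s d z) by move=> /Hd[[_ dz] _]; exact: cmap_ccod.
  (* Rows of the frame have squared length at most 2, hence length at most 3/2; [segment_dist]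
     doubles this to the constant 3 of [patch_dist]. *)
  have h32 : 0 <= 3 / 2 * h by rewrite mulr_ge0 // ltW.
  have := @segment_dist R m Q d n (ball u0 dl) (local x s d) u (u - h *: row k E) ad (ball_open _ _) ct seg tc _ h32.
  rewrite !cmapK; [|by case: (Hd _ bv) => -[]|by case: (Hd _ bu') => -[]].
  rewrite (_ : 2 * (3 / 2 * h) = 3 * h); last by field.
  apply=> t t01 /=; have zb := seg t t01; set z := u + _ in zb *; set w := u - h *: row k E - u in z zb *.
  have [Uz Hz] := Hd z zb.
  have -> : inner (metric d) (local x s d z) (w *m jac (local x s d) z) (w *m jac (local x s d) z) = inner (metric s) z w w.
    by rewrite /inner (locg as_ ad Uz) trmx_mul !mulmxA.
  have wE : w = (- h *: ebase R k) *m E by rewrite /w addrAC subrr add0r -scalemxAl -rowE scaleNr.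
  have /andP[_ le] := Hz (- h *: ebase R k); rewrite -wE in le; apply: le_trans le _.
  rewrite (bigD1 k) //= big1 => [|j jk]; last by rewrite mx_scaleE mxE eqxx (negPf jk) mulr0 expr0n.
  by rewrite mx_scaleE mxE !eqxx mulr1 addr0 sqrrN exprMn ler_wpM2r ?sqr_ge0 // expr2; lra.
exists (@Patch s u0 e E h0 as_ e0 h1 uE h2 h00 h3); rewrite /pbump /=.
(* The bump is 1 at Euclidean distance [e], and [n] coordinates of size [r] have a sum of squares at
   most [e ^+ 2]. *)
pose r := e / n.+1%:R; have r0 : 0 < r by rewrite divr_gt0.
have n1 : \forall z \near p, ball u0 r (cmap s z) by apply: (cmap_continuous sp); exact: nbhsx_ballx.
have n2 : \forall z \near p, cdom s z by apply: open_near => //; exact: cdom_open.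
apply: filterS2 n1 n2 => z; rewrite -ball_normE /ball_ /= => zr sz.
rewrite /mbump asboolT //; apply: bump1 => //.
apply: (@le_trans _ _ (\sum_(i < n) r ^+ 2)).
  apply: ler_sum => i _; rewrite -[leLHS]real_normK ?num_real // ler_sqr ?nnegrE ?(ltW r0) //.
  by rewrite distrC -mx_subE (le_trans (mx_entry_le _ _ _)) // ltW.
rewrite sumr_const card_ord -mulr_natr /r expr_div_n -mulrA ler_piMr ?sqr_ge0 //.
rewrite mulrC ler_pdivrMr ?exprn_gt0 // mul1r -natrX ler_nat; nia.
Qed.

Section Transport.
Variables (mu : {measure set (borel M) -> \bar R}) (vm : riemannian_volume mu).
Variables (Y : chart R M n -> 'rV[R]_n -> 'rV[R]_n) (e S : M -> R) (kap : R).
Local Notation aM := (@atlas R n M).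
Hypothesis cY : forall s, aM s -> Ckm 1 (ccod s) (Y s).
Hypothesis divY : forall s u, aM s -> ccod s u ->
  \sum_k pd k (fun v => vol (metric s) v * Y s v 0 k) u = vol (metric s) u * e (cinv s u).
Hypothesis e0 : forall p, 0 <= e p.
Hypothesis kap0 : 0 <= kap.
Hypothesis S0 : forall p, 0 <= S p.
Hypothesis cS : continuous S.
Hypothesis Yb : forall s u (w : 'rV[R]_n), aM s -> ccod s u -> `|(Y s u *m w^T) 0 0| <=
  kap * S (cinv s u) * (1 + (w *m invmx (metric s u) *m w^T) 0 0) / 2.
Hypothesis Ych : forall s t u, aM s -> aM t -> local_dom id s t u ->
  Y s u *m jac (local id s t) u = Y t (local id s t u).

Definition C1fun (f : M -> R) := forall s, aM s -> Ck 1 (ccod s) (f \o cinv s).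

Lemma C1fun_cst (a : R) : C1fun (fun _ => a).
Proof. by move=> s _; exact: Ck_cst. Qed.

Lemma C1funD f g : C1fun f -> C1fun g -> C1fun (fun p => f p + g p).
Proof. by move=> cf cg s as_; exact: (CkD (@ccod_open _ _ _ s) (cf s as_) (cg s as_)). Qed.

Lemma C1funB f g : C1fun f -> C1fun g -> C1fun (fun p => f p - g p).
Proof. by move=> cf cg s as_; exact: (CkB (@ccod_open _ _ _ s) (cf s as_) (cg s as_)). Qed.

Lemma C1funM f g : C1fun f -> C1fun g -> C1fun (fun p => f p * g p).
Proof. by move=> cf cg s as_; exact: (CkM (@ccod_open _ _ _ s) (cf s as_) (cg s as_)). Qed.

Lemma C1fun_cont f : C1fun f -> continuous f.
Proof. by move=> cf; apply: continuous_chart => s u as_ su; exact: (Ck_cont (cf s as_) su). Qed.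

Definition ownch p : chart R M n := s2val (cid2 (atlas_cover p)).

(* The derivative of [f] along the field [Y], computed in an arbitrary chart at [p]. *)
Definition along (f : M -> R) p := let s := ownch p in
  (Y s (cmap s p) *m (grd (f \o cinv s) (cmap s p))^T) 0 0.

Lemma along_chart f s u : C1fun f -> aM s -> ccod s u ->
  along f (cinv s u) = (Y s u *m (grd (f \o cinv s) u)^T) 0 0.
Proof.
move=> cf as_ su; rewrite /along; set t := ownch _.
have at_ : aM t by exact: s2valP (cid2 (atlas_cover (cinv s u))).
have ts : cdom t (cinv s u) by exact: s2valP' (cid2 (atlas_cover (cinv s u))).
have Uu : local_dom id s t u by split.
have oU := @trd_open R n M s t.
have -> : grd (f \o cinv s) u = grd (f \o cinv t) (local id s t u) *m (jac (local id s t) u)^T.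
  rewrite -(grd_comp oU (@ccod_open _ _ _ t) (fun k => transC k as_ at_) (@trans_cod _ _ _ s t) (cf t at_) Uu).
  by apply: (grd_eq oU) => // v Uv; rewrite /= transK.
by rewrite trmx_mul trmxK mulmxA (Ych as_ at_ Uu).
Qed.

Lemma grdD (U : set 'rV[R]_n) f g u : open U -> Ck 1 U f -> Ck 1 U g -> U u ->
  grd (fun v => f v + g v) u = grd f u + grd g u.
Proof. by move=> oU cf cg Uu; apply/rowP => i; rewrite mx_addE !grd_entry (pdD i cf cg Uu). Qed.

Lemma alongD f g p : C1fun f -> C1fun g -> along (fun p => f p + g p) p = along f p + along g p.
Proof.
move=> cf cg; have [s as_ sp] := atlas_cover p; rewrite -(cmapK sp); have su := cmap_ccod sp.
rewrite (along_chart (C1funD cf cg) as_ su) (along_chart cf as_ su) (along_chart cg as_ su).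
rewrite (grdD (@ccod_open _ _ _ s) (cf s as_) (cg s as_) su) trmx_add mulmxDr.
by rewrite mx_addE.
Qed.

Lemma along_near_cst f (a : R) p : C1fun f -> (\forall z \near p, f z = a) -> along f p = 0.
Proof.
move=> cf fa; have [s as_ sp] := atlas_cover p; have su := cmap_ccod sp.
have H : \forall u \near cmap s p, f (cinv s u) = a by exact: (cinv_cvg sp fa).
have [Z [oZ Zu Za]] := near_open H.
rewrite -{1}(cmapK sp) along_chart // (_ : grd _ _ = 0) ?trmx0 ?mulmx0 ?mxE //.
apply/rowP => i; rewrite grd_entry mxE -(pd_cst a i (cmap s p)).
exact: (pd_eq oZ).
Qed.

Lemma along_cont f : C1fun f -> continuous (along f).
Proof.
move=> cf; apply: continuous_chart => s u as_ su.
apply: (@near_cont _ _ (fun u => \sum_i Y s u 0 i * pd i (f \o cinv s) u)).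
  apply: filterS (open_near (@ccod_open _ _ _ s) su) => v sv; rewrite /= along_chart // mxE.
  by apply: eq_bigr => i _; rewrite mx_trE grd_entry.
apply: sum_cont => i; apply: continuousM; first exact: (Ck_cont (cY as_ 0 i) su).
exact: (Ck_cont (Ck_pd i (cf s as_)) su).
Qed.

Lemma e_cont : continuous e.
Proof.
apply: continuous_chart => s u as_ su.
have vC k : Ck k (ccod s) (vol (metric s)) by exact: volC.
apply: (@near_cont _ _ (fun u => (vol (metric s) u)^-1 * \sum_k pd k (fun v => vol (metric s) v * Y s v 0 k) u)).
  apply: filterS (open_near (@ccod_open _ _ _ s) su) => v sv; rewrite divY // mulKf //.
  by rewrite gt_eqF // volC_pos.
apply: continuousM.
  exact: (Ck_cont (CkV (@ccod_open _ _ _ s) (fun v sv => lt0r_neq0 (volC_pos as_ sv)) (vC 0)) su).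
apply: sum_cont => k.
exact: (Ck_cont (Ck_pd k (CkM (@ccod_open _ _ _ s) (vC 1) (cY as_ 0 k))) su).
Qed.

Variables (phi : M -> R) (L gap : R) (B : set M).
Hypothesis cphi : continuous phi.
Hypothesis phi01 : forall p, 0 <= phi p <= 1.
Hypothesis L0 : 0 <= L.
Hypothesis phiL : forall p p' (l : R), (rdist (x p) (x p') <= l%:E)%E -> `|phi p - phi p'| <= L * l.
Hypothesis gap0 : 0 < gap.
Hypothesis phiB : forall p p', phi p != 0 -> (rdist (x p) (x p') <= gap%:E)%E -> B p'.
Hypothesis mB : measurable (B : set (borel M)).

Let mcont (f : M -> R) : continuous f -> measurable_fun [set: borel M] f.
Proof. by move=> cf; apply: continuous_borel; [exact: openT|move=> p _; exact: cf]. Qed.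

(** The cutoff [phi] times the divergence of the field [f Y]. *)
Definition transport (f : M -> R) p := phi p * (f p * e p + along f p).
Definition mass (f : M -> R) := (\int[mu]_p (f p * \1_B p * S p)%:E)%E.
(** The bound is additive in [f], so it can be proved patch by patch. In the constant, [n] counts
    the directions of a frame, 3 comes from [patch_dist], and 3/2 is the bound of [Yb] for covectors
    of squared length at most 2. *)
Definition controlled (f : M -> R) := [/\ C1fun f, forall p, 0 <= f p,
  mu.-integrable [set: borel M] (EFin \o transport f) &
  (`| \int[mu]_p (transport f p)%:E | <= (n%:R * (9 / 2 * L * kap))%:E * mass f)%E].

Lemma measurable_mass (f : M -> R) : continuous f -> measurable_fun [set: borel M] (fun p => f p * \1_B p * S p).
Proof.
move=> cf; apply: measurable_funM; last exact: mcont.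
by apply: measurable_funM; [exact: mcont|exact: measurable_indic].
Qed.

Lemma measurable_transport f : C1fun f -> measurable_fun [set: borel M] (transport f).
Proof.
move=> cf; apply: measurable_funM; first exact: mcont.
apply: measurable_funD; last by apply: mcont; exact: along_cont.
by apply: measurable_funM; apply: mcont; [exact: C1fun_cont|exact: e_cont].
Qed.

Lemma mass_ge0 f : (forall p, 0 <= f p) -> (0 <= mass f)%E.
Proof. by move=> f0; apply: integral_ge0 => p _; rewrite lee_fin !mulr_ge0. Qed.

Lemma controlledD f g : controlled f -> controlled g -> controlled (fun p => f p + g p).
Proof.
move=> [cf f0 fi fb] [cg g0 gi gb].
have E p : transport (fun p => f p + g p) p = transport f p + transport g p.
  by rewrite /transport alongD //; ring.
have k0 : 0 <= n%:R * (9 / 2 * L * kap) by rewrite !mulr_ge0.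
split.
- exact: C1funD.
- by move=> p; rewrite addr_ge0.
- by apply: eq_integrable (integrableD _ fi gi) => // p _; rewrite /= E.
- have -> : (\int[mu]_p (transport (fun p => f p + g p) p)%:E = \int[mu]_p (transport f p)%:E + \int[mu]_p (transport g p)%:E)%E.
    by rewrite -integralD //; apply: eq_integral => p _; rewrite E.
  have -> : (mass (fun p => f p + g p)%R = mass f + mass g)%E.
  { rewrite /mass -ge0_integralD //; last 4 first.
    + by move=> p _; rewrite lee_fin !mulr_ge0.
    + by apply/measurable_EFinP; apply: measurable_mass; exact: C1fun_cont.
    + by move=> p _; rewrite lee_fin !mulr_ge0.
    + by apply/measurable_EFinP; apply: measurable_mass; exact: C1fun_cont.
    + by apply: eq_integral => p _; rewrite -EFinD; congr (_%:E); ring. }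
  rewrite ge0_muleDr ?mass_ge0 //; apply: le_trans (lee_abs_add _ _) _.
  exact: leeD.
Qed.

(** In the frame [E] of the patch the divergence is a sum of derivatives along constant vectors, the
    rows of [E], so [integration_by_parts] applies to each frame component of the field. *)
Lemma controlled_patch P f : C1fun f -> (forall p, 0 <= f p <= 1) ->
  (forall p, f p != 0 -> mbox (pch P) (pcen P) (prad P) p) -> controlled f.
Proof.
case: P => s u0 r E h0 as_ r0 bs uE HE h00 Hd /= cf f01 fs.
have [la [laE laf]] := iint_measure R n.
have f0 p : 0 <= f p by have /andP[] := f01 p.
have oc := @ccod_open _ _ _ s.
have boxc := @box_closed R n u0 (2 * r).
have fbox u : ccod s u -> f (cinv s u) != 0 -> box u0 (2 * r) u.
  by move=> su /fs[v bv E']; rewrite -(cinvK su) -E' cinvK //; exact: bs.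
pose V (j : 'I_n) u := if `[< ccod s u >] then vol (metric s) u * f (cinv s u) * Y s u 0 j else 0.
have VE j u : ccod s u -> V j u = vol (metric s) u * f (cinv s u) * Y s u 0 j by move=> su; rewrite /V asboolT.
have V0 j u : ~ box u0 (2 * r) u -> V j u = 0.
  move=> nb; rewrite /V; case: asboolP => // su.
  by have [->|/(fbox _ su)] := eqVneq (f (cinv s u)) 0; rewrite ?mulr0 ?mul0r.
have ob : open (~` box u0 (2 * r)) by rewrite openC.
have cVs j : Ck 1 (ccod s) (V j).
  apply: (Ck_eq oc (f := fun u => vol (metric s) u * f (cinv s u) * Y s u 0 j)); first by move=> u su; rewrite VE.
  exact: (CkM oc (CkM oc (volC as_ 1) (cf s as_)) (cY as_ 0 j)).
have cV j : Ck 1 setT (V j).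
  apply: Ck_local => u _; have [bu|nb] := pselect (box u0 (2 * r) u).
    by exists (ccod s); split=> //; exact: bs.
  exists (~` box u0 (2 * r)); split=> //.
  by apply: (Ck_eq ob _ (Ck_cst 1 _ 0)) => v nv; rewrite V0.
(* The component along row [k] of [E] of the field [f Y] multiplied by the volume density. *)
pose y k u := \sum_j V j u * invmx E j k.
have cy k : Ck 1 setT (y k).
  by apply: Ck_sum => [|j _]; [exact: openT|exact: (CkM openT (cV j) (Ck_cst _ _ _))].
have ys k u : y k u != 0 -> box u0 (2 * r) u.
  apply: contra_neqP => nb; rewrite /y big1 // => j _; by rewrite V0 // mul0r.
pose D k u := \sum_i row k E 0 i * pd i (y k) u.
have DE u : \sum_k D k u = \sum_j pd j (V j) u.
  have pdy k i : pd i (y k) u = \sum_j pd i (V j) u * invmx E j k.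
    rewrite /y (pd_sum openT (k := 0)) //; last by move=> j _; exact: (CkM openT (cV j) (Ck_cst _ _ _)).
    apply: eq_bigr => j _; rewrite (pdM i (cV j) (Ck_cst 1 setT (invmx E j k)) (I : setT u)).
    by rewrite pd_cst mulr0 addr0.
  rewrite /D; under eq_bigr => k _ do under eq_bigr => i _ do rewrite pdy mulr_sumr.
  transitivity (\sum_i \sum_j pd i (V j) u * (invmx E *m E) j i).
    rewrite exchange_big; apply: eq_bigr => i _; rewrite exchange_big; apply: eq_bigr => j _.
    rewrite mxE mulr_sumr; apply: eq_bigr => k _; rewrite mxE; ring.
  rewrite mulVmx //; apply: eq_bigr => i _; rewrite (bigD1 i) //= mxE eqxx mulr1 big1 ?addr0 // => j ji.
  by rewrite mxE (negPf ji) mulr0.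
have KEY u : \sum_k D k u = (f (cpoint s u) * e (cpoint s u) + along f (cpoint s u)) * cvol s u.
  rewrite DE; have [su|su] := pselect (ccod s u); last first.
    rewrite cvol_out // mulr0 big1 // => j _; rewrite -(pd_cst 0 j u); apply: (pd_eq ob) => [v|]; first exact: V0.
    by move=> /bs.
  rewrite cpointE // cvolE //.
  rewrite (_ : _ * vol _ u = f (cinv s u) * (vol (metric s) u * e (cinv s u)) + along f (cinv s u) * vol (metric s) u); last by ring.
  rewrite along_chart // -(divY as_ su) mulr_sumr.
  rewrite [X in _ = _ + X * _]mxE mulr_suml -big_split /=; apply: eq_bigr => j _.
  have eV v : ccod s v -> V j v = (f \o cinv s) v * (vol (metric s) v * Y s v 0 j) by move=> sv; rewrite VE //=; ring.
  rewrite (pd_eq oc j eV su) (pdM j (cf s as_) (CkM oc (volC as_ 1) (cY as_ 0 j)) su) mx_trE grd_entry /=; ring.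
have off p : ~ cdom s p -> transport f p = 0.
  move=> np; have nb : ~ mbox s u0 r p by move=> [u /bs su E']; apply: np; rewrite -E'; exact: cinv_cdom.
  have oM : open (~` mbox s u0 r) by rewrite openC; exact: (mbox_closed bs).
  have z q : ~ mbox s u0 r q -> f q = 0 by move=> nq; apply/eqP; apply: contra_notT nq => /fs.
  rewrite /transport z // (@along_near_cst f 0) // ?mul0r ?addr0 ?mulr0 //.
  by apply: filterS (open_near oM nb) => q; exact: z.
have mt := measurable_transport cf.
have IE : (\int[mu]_p (transport f p)%:E = \int[la]_u (\sum_k (phi (cpoint s u) * D k u))%:E)%E.
  transitivity (\int[mu]_(p in cdom s) (transport f p)%:E)%E.
    rewrite [RHS]integral_mkcond; apply: eq_integral => p _; rewrite patchE.
    by case: (boolP (p \in _)) => //; rewrite notin_setE => /off ->.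
  rewrite (chart_integral vm laE as_ mt); apply: eq_integral => u _.
  by rewrite /transport -mulr_sumr KEY mulrA.
(* A step [h < h1] moves image points by at most [3 * h < gap]; so wherever [phi] changes along the
   step, the point lies in [B], and the Lipschitz weight [K] can carry the indicator of [B]. *)
pose h1 := Num.min h0 (gap / 3).
have h10 : 0 < h1 by rewrite lt_min h00 divr_gt0.
pose ph u := phi (cpoint s u); pose K u : R := 3 * L * \1_B (cpoint s u).
have mcp := @measurable_cpoint R n M s.
have mph : measurable_fun [set: borel 'rV[R]_n] ph by exact: (measurableT_comp (mcont cphi) mcp).
have ph1 u : `|ph u| <= 1 by have /andP[? ?] := phi01 (cpoint s u); rewrite ger0_norm.
have mK : measurable_fun [set: borel 'rV[R]_n] K.
  apply: measurable_funM; first exact: measurable_cst.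
  by apply: (measurableT_comp _ mcp); exact: measurable_indic.
have K0 u : 0 <= K u by rewrite !mulr_ge0.
have phK k (h : R) u : 0 < h < h1 -> y k u != 0 -> `|ph (u - h *: row k E) - ph u| <= h * K u.
  move=> /andP[hp]; rewrite lt_min => /andP[hh hg] /ys bu.
  have [sv dv] := Hd u k h bu (introT andP (conj hp hh)).
  have su := bs u bu; rewrite /ph /K !cpointE // distrC.
  have [Bu|nB] := pselect (B (cinv s u)).
    by rewrite indicE mem_set // mulr1; apply: le_trans (phiL dv) _; rewrite le_eqVlt (_ : _ == _) //; apply/eqP; ring.
  have z1 : phi (cinv s u) = 0.
    apply/eqP; apply: contra_notT nB => /phiB; apply; rewrite rdistxx lee_fin; exact: ltW.
  have z2 : phi (cinv s (u - h *: row k E)) = 0.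
    apply/eqP; apply: contra_notT nB => /phiB; apply; rewrite rdist_sym (le_trans dv) // lee_fin.
    by move: hg; rewrite ltr_pdivlMr // mulrC => /ltW.
  by rewrite z1 z2 subrr normr0 indicE memNset // mulr0 mulr0.
have lf u1 r1 : (la (box u1 r1) < +oo)%E by case: (laf u1 r1).
have ibp k := integration_by_parts laE lf (cy k) (ys k) mph ph1 mK K0 h10 (phK k).
have int k := integrable_by_parts lf (row k E) (cy k) (ys k) mph ph1.
have massE : mass f = (\int[la]_u (f (cpoint s u) * \1_B (cpoint s u) * S (cpoint s u) * cvol s u)%:E)%E.
  rewrite -(chart_integral vm laE as_ (measurable_mass (C1fun_cont cf))).
  rewrite /mass [RHS]integral_mkcond; apply: eq_integral => p _; rewrite patchE.
  case: (boolP (p \in _)) => //; rewrite notin_setE => np.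
  suff -> : f p = 0 by rewrite !mul0r.
  by apply/eqP; apply: contra_notT np => /fs; exact: (mbox_dom bs).
have gE u : ccod s u -> metric s u \in unitmx by exact: metric_unitC.
have bound k : (\int[la]_u (`|y k u| * K u)%:E <= (9 / 2 * L * kap)%:E * mass f)%E.
{ rewrite massE -ge0_integralZl //; last 3 first.
  - apply/measurable_EFinP; apply: measurable_funM; last exact: measurable_cvol.
    exact: (measurableT_comp (measurable_mass (C1fun_cont cf)) mcp).
  - by move=> u _; rewrite lee_fin !mulr_ge0 // cvol_ge0.
  - by rewrite lee_fin !mulr_ge0.
  - apply: ge0_le_integral => //.
    + by move=> u _; rewrite lee_fin mulr_ge0.
    + apply/measurable_EFinP; apply: measurable_funM => //; apply: measurableT_comp => //.
    by apply: continuous_borel; [exact: openT|move=> u _; exact: (Ck_cont (cy k) (I : setT u))].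
    + apply: measurable_funeM; apply/measurable_EFinP; apply: measurable_funM; last exact: measurable_cvol.
    exact: (measurableT_comp (measurable_mass (C1fun_cont cf)) mcp).
    + move=> u _; rewrite -EFinM lee_fin.
    have [bu|nb] := pselect (box u0 (2 * r) u); last first.
      have -> : y k u = 0 by apply/eqP; apply: contra_notT nb => /ys.
      by rewrite normr0 mul0r !mulr_ge0 // cvol_ge0.
    have su := bs u bu; rewrite cpointE // cvolE // /K cpointE //.
    pose w := (col k (invmx E))^T.
    have yE : y k u = vol (metric s) u * f (cinv s u) * (Y s u *m w^T) 0 0.
      rewrite /y mxE mulr_sumr; apply: eq_bigr => j _; rewrite VE // /w trmxK [X in _ = _ * (_ * X)]mxE; ring.
    have wb := frame_dual uE (gE u su) (metric_sym as_ su) (HE u bu) (erefl w).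
    have Y3 : `|(Y s u *m w^T) 0 0| <= kap * S (cinv s u) * (3 / 2).
      apply: le_trans (Yb w as_ su) _; rewrite -mulrA; apply: ler_wpM2l; first by rewrite mulr_ge0.
      by lra.
    have v0 := volC_pos as_ su.
    rewrite yE normrM [`|_ * f _|]ger0_norm ?mulr_ge0 ?(ltW v0) //.
    have I0 : 0 <= \1_B (cinv s u) :> R by [].
    set I := \1_B _ in I0 *; set v := vol _ u in v0 *; set T := `|_| in Y3 *.
    rewrite (_ : v * f (cinv s u) * T * (3 * L * I) = (v * f (cinv s u) * (3 * L * I)) * T); last by ring.
    rewrite (_ : _ * kap * _ = (v * f (cinv s u) * (3 * L * I)) * (kap * S (cinv s u) * (3 / 2))); last by field.
    by apply: ler_wpM2l => //; rewrite !mulr_ge0 // ltW. }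
split=> //.
- have [Bt Bt0 HBt] := compact_bound (mbox_compact bs) (fun p _ => continuousD (continuousM (C1fun_cont cf (x:=p)) (e_cont (x:=p))) (along_cont cf (x:=p))).
  have mm : measurable (mbox s u0 r : set (borel M)) by apply: borel_closed; exact: (mbox_closed bs).
  have oM : open (~` mbox s u0 r) by rewrite openC; exact: (mbox_closed bs).
  have z q : ~ mbox s u0 r q -> f q = 0 by move=> nq; apply/eqP; apply: contra_notT nq => /fs.
  have : mu.-integrable [set: borel M] (EFin \o (fun p => Bt * \1_(mbox s u0 r) p)).
    apply/integrableP; split; first by apply/measurable_EFinP; apply: measurable_funM => //; exact: measurable_indic.
    under eq_integral do rewrite /= ger0_norm ?mulr_ge0 // EFinM.
    rewrite ge0_integralZl //; last by apply/measurable_EFinP; exact: measurable_indic.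
    rewrite integral_indic // setIT; apply: lte_mul_pinfty; [rewrite lee_fin //|by []|].
    exact: (mbox_finite vm laE laf as_ bs).
  apply: le_integrable => //; first exact/measurable_EFinP.
  move=> p _ /=; rewrite lee_fin [leRHS]ger0_norm ?mulr_ge0 //.
  have [bp|np] := pselect (mbox s u0 r p).
    rewrite indicE mem_set // mulr1 /transport normrM -[leRHS]mul1r; apply: ler_pM => //; last exact: HBt.
    by have /andP[? ?] := phi01 p; rewrite ger0_norm.
  rewrite /transport z // (@along_near_cst f 0) //; first by rewrite mul0r addr0 mulr0 normr0 mulr_ge0.
  by apply: filterS (open_near oM np) => q; exact: z.
- rewrite IE; under eq_integral do rewrite -sumEFin.
  rewrite integral_sum //.
  apply: le_trans (lee_abs_sum _ _ _) _.
  apply: (@le_trans _ _ (\sum_(k < n) (9 / 2 * L * kap)%:E * mass f)%E).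
    by apply: lee_sum => k _; apply: le_trans (ibp k) (bound k).
  have m0 := mass_ge0 f0; have c0 : (0 <= (9 / 2 * L * kap)%:E * mass f)%E by rewrite mule_ge0 // lee_fin !mulr_ge0.
  rewrite [leRHS](_ : _ = n%:R%:E * ((9 / 2 * L * kap)%:E * mass f))%E; last by rewrite muleA -EFinM.
  set z := ((9 / 2 * L * kap)%:E * mass f)%E in c0 *.
  suff H : forall N, (\sum_(k < N) z)%E = (N%:R%:E * z)%E by rewrite H.
  elim=> [|N IH]; first by rewrite big_ord0 mul0e.
  by rewrite big_ord_recr /= IH -natr1 EFinD ge0_muleDl ?lee_fin // mul1e.
Qed.

(* Removing the bumps of the patches one after the other replaces the construction of a partition of unity. *)
Lemma controlled_patches (l : seq patch) f : C1fun f -> (forall p, 0 <= f p <= 1) ->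
  exists g, [/\ C1fun g, forall p, 0 <= g p <= f p, forall P p, List.In P l -> pbump P p = 1 -> g p = 0 &
    controlled (fun p => f p - g p)].
Proof.
elim: l f => [|P l IH] f cf f01.
  have z p : transport (fun p => f p - f p) p = 0.
    rewrite /transport subrr mul0r add0r (along_near_cst (a := 0) (C1funB cf cf)) ?mulr0 //.
    by apply: nearW => z; rewrite subrr.
  exists f; split; [exact: cf|by move=> p; have /andP[-> _] := f01 p; rewrite lexx|by []|].
  split; [exact: (C1funB cf cf)|by move=> p; rewrite subrr| |].
    by apply: eq_integrable (integrable0 _ _) => // p _; rewrite /= z.
  by under eq_integral do rewrite z; rewrite integral0 abse0 mule_ge0 ?mass_ge0 ?lee_fin ?mulr_ge0 // => p; rewrite subrr.
have cb : C1fun (pbump P) by move=> s as_; exact: (Ck_mbump (patch_atlas P) (patch_rad P) (@patch_box P)).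
have b01 p : 0 <= pbump P p <= 1 by exact: mbump_in.
pose f' p := f p * (1 - pbump P p).
have cf' : C1fun f' := C1funM cf (C1funB (C1fun_cst 1) cb).
have f'le p : 0 <= f' p <= f p.
  have /andP[? ?] := f01 p; have /andP[? ?] := b01 p; rewrite /f'; apply/andP; split; nra.
have f'01 p : 0 <= f' p <= 1 by have /andP[-> h] := f'le p; have /andP[_ h'] := f01 p; rewrite (le_trans h).
have [g [cg gle gz gc]] := IH f' cf' f'01.
exists g; split.
- exact: cg.
- by move=> p; have /andP[-> h] := gle p; have /andP[_ h'] := f'le p; rewrite (le_trans h).
- move=> P' p [<-|]; last exact: gz.
  move=> b1; have := gle p; rewrite /f' b1 subrr mulr0 => /andP[? ?]; apply/eqP; by rewrite eq_le; apply/andP.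
- have c1 : controlled (fun p => f p * pbump P p).
    apply: (controlled_patch (P := P)); first exact: (C1funM cf cb).
      by move=> p; have /andP[? ?] := f01 p; have /andP[? ?] := b01 p; rewrite mulr_ge0 //= mulr_ile1.
    by move=> p H; apply: (mbump_supp (patch_rad P)); apply: contra_neq H => h; rewrite -/(pbump P p) in h; rewrite h mulr0.
  have := controlledD c1 gc; congr controlled; apply/funext => p; rewrite /f'; ring.
Qed.

(** Finitely many patches have bumps equal to 1 around points of [K]. The remainder [g] of
    [controlled_patches] vanishes near every point where [phi] does not, so there [1 - g] is locally
    1 and its transport is just [phi * e]. *)
Lemma transport_estimate (K : set M) : compact K -> (forall p, phi p != 0 -> K p) ->
  (\int[mu]_p (phi p * e p)%:E <= (n%:R * (9 / 2 * L * kap))%:E * \int[mu]_(p in B) (S p)%:E)%E.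
Proof.
move=> cK phiK.
pose P p := sval (cid (patch_exists p)).
have HP p : \forall z \near p, pbump (P p) z = 1 := svalP (cid (patch_exists p)).
pose U (p : M) : set M := [set z : M | \forall w \near z, pbump (P p) w = 1].
have [l [_ cov]] := compact_nbhs_cover (U := U) cK (fun p _ => near_near (HP p)).
have [g [cg g01 gz [_ _ _ gb]]] := controlled_patches (map P l) (C1fun_cst 1) (fun p => introT andP (conj ler01 (lexx 1))).
have inl p : p \in l -> List.In (P p) (map P l).
  elim: l {cov gz} => // a l IH; rewrite inE => /orP[/eqP->|/IH h]; [by left|by right].
have E p : transport (fun p => 1 - g p) p = phi p * e p.
  rewrite /transport; have [->|fp] := eqVneq (phi p) 0; first by rewrite !mul0r.
  have [y yl Uy] := cov p (phiK p fp).
  have g0 : \forall z \near p, g z = 0 by apply: filterS Uy => z; apply: gz; exact: inl.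
  rewrite (nbhs_singleton g0) subr0 mul1r (along_near_cst (a := 1) (C1funB (C1fun_cst 1) cg)) ?addr0 //.
  by apply: filterS g0 => z ->; rewrite subr0.
have -> : (\int[mu]_p (phi p * e p)%:E = \int[mu]_p (transport (fun p => 1 - g p) p)%:E)%E.
  by apply: eq_integral => p _; rewrite E.
apply: le_trans (lee_abs _) (le_trans gb _).
have k0 : 0 <= n%:R * (9 / 2 * L * kap) by rewrite !mulr_ge0.
apply: lee_wpmul2l; first by rewrite lee_fin.
rewrite [leRHS]integral_mkcond /mass; apply: ge0_le_integral => //.
- by move=> p _; rewrite lee_fin !mulr_ge0 // subr_ge0; case/andP: (g01 p).
- by apply/measurable_EFinP; apply: measurable_mass; exact: (C1fun_cont (C1funB (C1fun_cst 1) cg)).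
- apply/(measurable_restrict _ mB measurableT); rewrite setTI; apply/measurable_EFinP.
  by apply: measurable_funTS; exact: mcont.
- move=> p _; rewrite patchE indicE; case: (p \in B); last by rewrite mulr0 mul0r.
  by rewrite mulr1 lee_fin -[leRHS]mul1r ler_wpM2r // gerBl; case/andP: (g01 p).
Qed.
End Transport.
End Patches.

(** * Growth of the curvature integral *)

Section Scalar.
Variables (R : realType) (n : nat) (Q : riemannian R n.+1) (M : riemannian R n) (x : M -> Q).
Variable eta : chart R Q n.+1 -> M -> 'rV[R]_n.+1.
Variable A : chart R M n -> 'rV[R]_n -> 'M[R]_n.
Variables (lam : M -> 'I_n -> R) (r : nat).
Hypotheses (imm : isometric_immersion x) (un : unit_normal x eta) (sA : shape_operator x eta A).
Hypothesis plam : principal_curvatures A lam.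

Lemma Scurv_ge0 p : (r < n)%N -> newton_psd A lam r -> 0 <= Scurv lam r p.
Proof.
move=> rn psd; have [s as_ sp] := atlas_cover p; have su := cmap_ccod sp.
have [d ad dp] := atlas_cover (x p).
have Uu : local_dom x s d (cmap s p) by split; rewrite // cmapK.
have oU : open (local_dom x s d) by exact: (locx_open imm).
have gT v : local_dom x s d v -> (metric s v)^T = metric s v by move=> [h _]; exact: metric_sym.
have gp u v : local_dom x s d u -> v != 0 -> 0 < inner (metric s) u v v by move=> [h _]; exact: metric_pos.
have AgT := sff_sym oU (@ccod_open _ _ _ d) (fun k => locxC imm k as_ ad) (@locx_cod _ _ _ _ x s d) (fun k => metricC k ad) gT
    (fun u => @metric_sym _ _ _ d u ad) (fun u v => @metric_pos _ _ _ d u v ad) (fun u h => locx_metric imm as_ ad h)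
    (fun k => etaC imm un k as_ ad) (fun u h => eta_orth imm un as_ ad h) (fun i u h => shape_weingarten imm sA i as_ ad h).
have lA u : local_dom x s d u -> char_poly (A s u) = \prod_i ('X - ((lam \o cinv s) u i)%:P) by move=> [h _]; exact: char_poly_shape.
have Pp u (v : 'rV[R]_n) : local_dom x s d u ->
    0 <= (v *m (nwt (esym ((lam \o cinv s) u)) (A s u) r *m metric s u) *m v^T) 0 0.
  by move=> [h _]; exact: nwt_psd.
have := trP_ge0 gT gp lA AgT rn Pp Uu; rewrite /trP /= cmapK // pmulr_rge0 //.
by rewrite ltr0n subn_gt0.
Qed.

Lemma Scurv_cont : continuous (Scurv lam r).
Proof.
apply: continuous_chart => s u as_ su; have [d ad dp] := atlas_cover (x (cinv s u)).
have Uu : local_dom x s d u by split.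
have oU : open (local_dom x s d) by exact: (locx_open imm).
have lA v : local_dom x s d v -> char_poly (A s v) = \prod_i ('X - ((lam \o cinv s) v i)%:P) by move=> [h _]; exact: char_poly_shape.
exact: (Ck_cont (Ck_esym oU (fun k => shapeC imm sA un k as_ ad) lA r 0) Uu).
Qed.

Lemma ball_measurable p mu : measurable (x @^-1` geodesic_ball p mu : set (borel M)).
Proof.
have xc : continuous x by case: imm => -[].
by apply: borel_closed; apply: (closed_comp (fun z _ => xc z)); exact: rdist_closed.
Qed.
End Scalar.

(** Up to the factor [C] the integrand is the density of the exponential distribution, whose total
    mass is 1. *)
Lemma integral_expR_le (R : realType) (alpha a b C : R) : 0 < alpha -> 0 <= a -> 0 <= C ->
  (\int[@lebesgue_measure R]_(t in `[a, b]) (C * alpha * expR (- alpha * t))%:E <= C%:E)%E.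
Proof.
move=> al0 a0 C0.
have E : (\int[@lebesgue_measure R]_(t in `[a, b]) (C * alpha * expR (- alpha * t))%:E =
    \int[@lebesgue_measure R]_(t in `[a, b]) (C%:E * (exponential_pdf alpha t)%:E))%E.
  apply: eq_integral => t; rewrite inE /= in_itv /= => /andP[at_ _].
  by rewrite exponential_pdfE ?(le_trans a0) // -EFinM mulrA.
have mp (D : set R) : measurable D -> measurable_fun D (fun t => (exponential_pdf alpha t)%:E).
  by move=> mD; apply/measurable_EFinP; apply: measurable_funTS; exact: measurable_exponential_pdf.
have p0 t : (0 <= (exponential_pdf alpha t)%:E)%E by rewrite lee_fin exponential_pdf_ge0 // ltW.
rewrite E ge0_integralZl //; last exact: mp.
rewrite -[leRHS]mule1 -(integral_exponential_pdf al0).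
apply: lee_wpmul2l; first by rewrite lee_fin.
by apply: ge0_subset_integral => //; exact: mp.
Qed.

Lemma integral_cst_itv (R : realType) (a b C : R) : a <= b ->
  (\int[@lebesgue_measure R]_(t in `[a, b]) C%:E = (C * (b - a))%:E)%E.
Proof.
move=> ab; rewrite integral_cst //= lebesgue_measure_itv /= lte_fin.
move: ab; rewrite le_eqVlt => /orP[/eqP->|->]; last by rewrite -EFinM.
by rewrite ltxx subrr mulr0 mule0.
Qed.

Section Growth.
Variables (R : realType) (n : nat) (c : R).
Variables (Q : riemannian R n.+1) (M : riemannian R n) (x : M -> Q).
Variable eta : chart R Q n.+1 -> M -> 'rV[R]_n.+1.
Variable A : chart R M n -> 'rV[R]_n -> 'M[R]_n.
Variables (lam : M -> 'I_n -> R) (dM : {measure set (borel M) -> \bar R}) (r : nat).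
Hypotheses (imm : isometric_immersion x) (un : unit_normal x eta) (sA : shape_operator x eta A).
Hypotheses (plam : principal_curvatures A lam) (vm : riemannian_volume dM).
Hypotheses (rn : (r < n)%N) (psd : newton_psd A lam r).
Variables (q : M) (mu0 : R).
Hypotheses (Sq : Scurv lam r q != 0) (mu00 : 0 < mu0).

Let xc : continuous x. Proof. by case: imm => -[]. Qed.
Let S0 p : 0 <= Scurv lam r p. Proof. exact: (Scurv_ge0 imm un sA plam p rn psd). Qed.
Let near_ball : nbhs q (x @^-1` geodesic_ball (x q) mu0).
Proof. exact: (xc (rdist_near (x q) mu00)). Qed.

Lemma ball_integral_pos : exists2 dl : R, 0 < dl & forall mu, mu0 < mu ->
  (dl%:E <= \int[dM]_(p in x @^-1` geodesic_ball (x q) mu) (Scurv lam r p)%:E)%E.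
Proof.
have [|dl dl0 H] := integral_positive vm (Scurv_cont imm un sA plam (r := r)) S0 _ near_ball.
  by rewrite lt_def Sq S0.
exists dl => // mu mm; apply: H; first exact: ball_measurable.
by move=> p; apply: ball_le; exact: ltW.
Qed.

Lemma linear_growth : space_form Q c -> proper_map x -> c <= 0 -> (forall p, Scurv lam r.+1 p = 0) ->
  exists2 C : R, 0 < C & forall mu, mu0 < mu ->
  ((C * (mu - mu0))%:E <= \int[dM]_(p in x @^-1` geodesic_ball (x q) mu) (Scurv lam r p)%:E)%E.
Proof.
move=> sf prop c0 S10; have [comp _ _] := sf.
have [Y [e [cY divY [e0 eq] Yb Ych]]] := flux_exists imm sA plam rn psd un sf c0 S10 Sq.
have ce : continuous e := e_cont cY divY.
have [dl dl0 H] := integral_positive vm ce e0 eq near_ball.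
have k0 : 0 < (n - r)%:R :> R by rewrite ltr0n subn_gt0.
have n0 : 0 < n%:R :> R by rewrite ltr0n (leq_trans _ rn).
(* The constant of [transport_estimate] is 9/2 n (n - r) times the slope [2 / (mu - mu0)] of the
   cutoff; inverting it produces the factor [mu - mu0]. *)
exists (dl / (9 * n%:R * (n - r)%:R)); first by rewrite divr_gt0 // !mulr_gt0.
(* The cutoff falls to zero at the midpoint [b] already; the remaining width [mu - b] is the gap
   that lets displaced points stay in the ball of radius [mu]. *)
move=> mu mm; pose b := (mu0 + mu) / 2.
have ab : mu0 < b by rewrite /b; lra.
have [f [f01 f1 fb fL]] := distance_cutoff (x q) (ltW mu00) ab.
have L0 : 0 < b - mu0 by rewrite subr_gt0.
pose phi p := f (x p).
have cphi : continuous phi.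
  move=> p; apply/cvgrPdist_le => z z0.
  have h : 0 < (b - mu0) * z by rewrite mulr_gt0.
  have N : \forall p' \near p, (rdist (x p) (x p') <= ((b - mu0) * z)%:E)%E by exact: (xc (rdist_near (x p) h)).
  apply: filterS N => p' /fL; rewrite /phi => le.
  by apply: le_trans le _; rewrite mulKf // gt_eqF.
have gap0 : 0 < mu - b by rewrite /b; lra.
pose B := x @^-1` geodesic_ball (x q) mu.
have phiB p p' : phi p != 0 -> (rdist (x p) (x p') <= (mu - b)%:E)%E -> B p'.
  move=> /fb h h'; apply: le_trans (rdist_triangle _ (x p) _) _.
  by rewrite (_ : mu = b + (mu - b)) ?EFinD ?leeD // addrC subrK.
have mB : measurable (B : set (borel M)) by exact: ball_measurable imm _ _.
have cK : compact (x @^-1` geodesic_ball (x q) b) by apply: prop; exact: hopf_rinow.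
have phiK p : phi p != 0 -> (x @^-1` geodesic_ball (x q) b) p by exact: fb.
have Li0 : 0 <= (b - mu0)^-1 by rewrite invr_ge0 ltW.
have T := transport_estimate xc (fun s d => locxC imm 1) (fun s d u => @locx_metric _ _ _ _ _ imm s d u) vm cY divY (ltW k0)
  S0 (Scurv_cont imm un sA plam (r := r)) Yb Ych cphi (fun p => f01 (x p)) Li0 (fun p p' l => fL _ _ l) gap0 phiB mB cK phiK.
set K := n%:R * _ in T; have KE : K = 9 * n%:R * (n - r)%:R / (mu - mu0).
  rewrite /K (_ : b - mu0 = (mu - mu0) / 2); last by rewrite /b; field.
  by field; rewrite gt_eqF // subr_gt0.
have K0 : 0 < K by rewrite KE divr_gt0 ?subr_gt0 // !mulr_gt0.
rewrite (_ : _ * (mu - mu0) = K^-1 * dl); last by rewrite KE invf_div; ring.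
rewrite EFinM lee_pdivrMl //; apply: le_trans T.
have mB0 : measurable (x @^-1` geodesic_ball (x q) mu0 : set (borel M)) by exact: ball_measurable.
apply: le_trans (H _ mB0 (fun p h => h)) _.
rewrite integral_mkcond; apply: ge0_le_integral => //.
- by move=> p _; rewrite patchE; case: ifP => // _; rewrite lee_fin.
- apply/(measurable_restrict _ mB0 measurableT); rewrite setTI; apply/measurable_EFinP; apply: measurable_funTS.
  by apply: continuous_borel; [exact: openT|move=> p _; exact: ce].
- apply/measurable_EFinP; apply: measurable_funM; apply: continuous_borel; try exact: openT; move=> p _.
    exact: cphi.
  exact: ce.
- move=> p _; rewrite patchE; case: ifPn => [|_]; last by rewrite lee_fin mulr_ge0 //; case/andP: (f01 (x p)).
  by rewrite inE => h; rewrite /phi f1 // mul1r.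
Qed.
End Growth.

Theorem theoremA (R : realType) (n : nat) (c : R)
    (Q : riemannian R n.+1) (M : riemannian R n) (x : M -> Q)
    (eta : chart R Q n.+1 -> M -> 'rV[R]_n.+1)
    (A : chart R M n -> 'rV[R]_n -> 'M[R]_n)
    (lam : M -> 'I_n -> R)
    (dM : {measure set (borel M) -> \bar R})
    (alpha : R) (r : nat) :
  space_form Q c ->
  complete_riemannian M -> ~ compact [set: M] -> orientable M ->
  isometric_immersion x -> proper_map x ->
  unit_normal x eta -> shape_operator x eta A -> principal_curvatures A lam ->
  riemannian_volume dM ->
  0 <= alpha -> (r < n)%N ->
  (forall p : M,
     (r.+1)%:R * `|Scurv lam r.+1 p| <= (n - r)%:R * alpha * Scurv lam r p) ->
  newton_psd A lam r ->
  forall (q : M) (mu0 : R), Scurv lam r q != 0 -> 0 < mu0 ->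
  exists2 C : R, 0 < C &
    forall mu : R, mu0 < mu ->
      (forall kappa : R, 0 < kappa -> c = kappa ^+ 2 -> mu <= pi / (2 * kappa)) ->
      (\int[@lebesgue_measure R]_(tau in `[mu0, mu]) (C * expR (- alpha * tau))%:E
       <= \int[dM]_(p in x @^-1` geodesic_ball (x q) mu) (Scurv lam r p)%:E)%E.
Proof.
move=> sf _ _ _ imm prop un sA plam vm al0 rn bound psd q mu0 Sq mu00.
have [dl dl0 H] := ball_integral_pos imm un sA plam vm rn psd Sq mu00.
have [alp|aln] := ltP 0 alpha.
  (* With this constant the left side is at most [dl], whatever [mu] is. *)
  exists (dl * alpha) => [|mu mm _]; first exact: mulr_gt0.
  by apply: le_trans (integral_expR_le mu alp (ltW mu00) (ltW dl0)) (H mu mm).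
have a0 : alpha = 0 by apply: le_anti; rewrite aln.
have E C mu : mu0 < mu -> (\int[@lebesgue_measure R]_(tau in `[mu0, mu]) (C * expR (- alpha * tau))%:E = (C * (mu - mu0))%:E)%E.
  move=> mm; rewrite -integral_cst_itv ?ltW //; apply: eq_integral => t _.
  by rewrite a0 oppr0 mul0r expR0 mulr1.
have [c0|cp] := leP c 0.
  have S0 p : Scurv lam r.+1 p = 0.
    have := bound p; rewrite a0 mulr0 mul0r pmulr_rle0 // normr_le0 => /eqP //.
  have [C C0 HC] := linear_growth imm un sA plam vm rn psd Sq mu00 sf prop c0 S0.
  by exists C => // mu mm _; rewrite E //; exact: HC.
pose k := Num.sqrt c; have k0 : 0 < k by rewrite sqrtr_gt0.
have b0 : 0 < pi / (2 * k) by rewrite divr_gt0 ?pi_gt0 // mulr_gt0.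
have kE : c = k ^+ 2 by rewrite sqr_sqrtr // ltW.
(* The admissible radii make [mu - mu0] less than pi / (2 k), so the left side, linear in
   [mu - mu0], stays below [dl]. *)
exists (dl / (pi / (2 * k))) => [|mu mm /(_ k k0 kE) le]; first exact: divr_gt0.
rewrite E //; apply: le_trans (H mu mm).
rewrite lee_fin mulrAC ler_pdivrMr // ler_wpM2l ?(ltW dl0) //; lra.
Qed.
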